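(* Let $\Omega\subset\mathbb{R}^d$ ($d\ge2$) be a bounded connected open set with smooth boundary, let $p>d$, $\mathbf{B}\in L^p(\Omega,\mathbb{R}^{n\times d\times n})$ and $k\in\{0,\dots,n\}$. Then $\dim N(\nabla+\mathbf{B}\cdot)=k$ if and only if $\mathbf{B}$ is $k$-conservative (in the $L^p$ sense defined below).
   Context: $N(\nabla+\mathbf{B}\cdot)$ is the set of $\boldsymbol\mu\in L^2(\Omega,\mathbb{R}^n)$ with $\nabla\boldsymbol\mu+\mathbf{B}\cdot\boldsymbol\mu=0$ in $H^{-1}(\Omega,\mathbb{R}^{n\times d})$, where $(\nabla\boldsymbol\mu)_{ij}=\partial_j\mu_i$ and $(\mathbf{B}\cdot\boldsymbol\mu)_{ij}=\sum_k\mathbf{B}_{ijk}\mu_k$. For a continuous field $\mathbf{B}'\in C^0(\overline\Omega,\mathbb{R}^{n\times d\times n})$: let $\Gamma(x,y)=\{\boldsymbol\gamma\in C^1([0,1],\Omega):\boldsymbol\gamma(0)=x,\boldsymbol\gamma(1)=y\}$; for $\boldsymbol\gamma\in\Gamma(x,y)$, $R^{\boldsymbol\gamma}_{\mathbf{B}'}(\mathbf{v})=\boldsymbol\varphi(1)$ where $\varphi_i'(t)=-\sum_{j,k}\mathbf{B}'_{ijk}(\boldsymbol\gamma(t))\varphi_k(t)\gamma_j'(t)$, $\boldsymbol\varphi(0)=\mathbf{v}$; $E^x_{\mathbf{B}'}=\{\mathbf{v}\in\mathbb{R}^n:\forall y\in\Omega,\forall\boldsymbol\gamma_1,\boldsymbol\gamma_2\in\Gamma(x,y),\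 R^{\boldsymbol\gamma_1}_{\mathbf{B}'}(\mathbf{v})=R^{\boldsymbol\gamma_2}_{\mathbf{B}'}(\mathbf{v})\}$; its dimension does not depend on $x$, and $\mathbf{B}'$ is called $k'$-conservative if $\dim E^x_{\mathbf{B}'}=k'$. For $\mathbf{B}\in L^p$: $\mathbf{B}$ is at least $k$-conservative if for every $\varepsilon>0$ there exists $\mathbf{B}_\varepsilon\in C^0(\overline\Omega,\mathbb{R}^{n\times d\times n})$ which is $k'$-conservative for some $k'\ge k$ and satisfies $\|\mathbf{B}-\mathbf{B}_\varepsilon\|_{L^p}<\varepsilon$; $\mathbf{B}$ is $k$-conservative if it is at least $k$-conservative and not at least $(k+1)$-conservative. *)

(* Defs.v *)
From HB Require Import structures.
From mathcomp Require Import all_boot all_order all_algebra.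
From mathcomp Require Import all_classical all_reals all_analysis.
Set Implicit Arguments. Unset Strict Implicit. Unset Printing Implicit Defensive.
Import Order.TTheory GRing.Theory Num.Theory.
Import numFieldNormedType.Exports.
Local Open Scope classical_set_scope.
Local Open Scope ring_scope.

Section Defs.
Variable R : realType.

Notation V d := 'rV[R]_d.

(* For a nonnegative Borel function this is the integral w.r.t. d-dimensional
   Lebesgue measure (Tonelli); it is only ever applied to such functions. *)
Fixpoint lebint (m : nat) : (V m -> \bar R) -> \bar R :=
  match m return (V m -> \bar R) -> \bar R with
  | 0 => fun f => f 0
  | m'.+1 => fun f =>
      (\int[lebesgue_measure]_(x in [set: R])
          lebint (fun t : V m' => f (row_mx (\row_(_ < 1) x) t) : \bar R))%E
  end.

Definition lebint_on d (O : set (V d)) (f : V d -> \bar R) : \bar R :=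
  lebint (fun x => if `[< O x >] then f x else 0%E).

Definition lebmeas d (A : set (V d)) : \bar R := lebint_on A (fun _ => 1%E).

(* signed integral over Omega (used only for integrable integrands) *)
Definition sint_on d (O : set (V d)) (f : V d -> R) : \bar R :=
  (lebint_on O (fun x => (Num.max (f x) 0)%:E)
   - lebint_on O (fun x => (Num.max (- f x) 0)%:E))%E.

Definition borelV d (A : set (V d)) : Prop :=
  <<s [set U : set (V d) | open U] >> A.
Definition borel_on d (O : set (V d)) (f : V d -> R) : Prop :=
  forall U : set R, open U -> borelV (O `&` f @^-1` U).

Definition ae_zero_on d (O : set (V d)) (f : V d -> R) : Prop :=
  lebmeas (O `&` [set x | f x != 0]) = 0%E.

Definition evec d (i : 'I_d) : V d := \row_(j < d) (i == j)%:R.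

Fixpoint Ck d (k : nat) (f : V d -> R) : Prop :=
  continuous f /\
  match k with
  | 0 => True
  | k'.+1 => forall i : 'I_d,
      (forall x, derivable f x (evec i)) /\ Ck k' ('D_(evec i) f)
  end.
Definition smooth d (f : V d -> R) : Prop := forall k, Ck k f.

Definition bounded_set_V d (O : set (V d)) : Prop :=
  exists M : R, forall x, O x -> `|x| <= M.
Definition smooth_boundary d (O : set (V d)) : Prop :=
  forall z, (closure O `\` O) z ->
    exists r : R, 0 < r /\ exists rho : V d -> R,
      smooth rho /\ (exists i, 'D_(evec i) rho z != 0) /\
      O `&` ball z r = [set x | ball z r x /\ rho x < 0].

Definition test_fun d (O : set (V d)) (phi : V d -> R) : Prop :=
  smooth phi /\ exists K : set (V d), compact K /\ K `<=` O /\
    (forall x, ~ K x -> phi x = 0).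

Definition tfield d n := V d -> 'I_n -> 'I_d -> 'I_n -> R.

Definition tnorm2 d n (T : 'I_n -> 'I_d -> 'I_n -> R) : R :=
  \sum_i \sum_j \sum_k (T i j k) ^+ 2.

Definition in_Lp d n (O : set (V d)) (p : R) (B : tfield d n) : Prop :=
  (forall i j k, borel_on O (fun x => B x i j k)) /\
  (lebint_on O (fun x => (Num.sqrt (tnorm2 (B x)) `^ p)%:E) < +oo)%E.

Definition Lp_dist_lt d n (O : set (V d)) (p : R) (B B' : tfield d n) (eps : R) :=
  (lebint_on O (fun x =>
     (Num.sqrt (tnorm2 (fun i j k => B x i j k - B' x i j k)) `^ p)%:E)
   < (eps `^ p)%:E)%E.

Definition in_L2 d n (O : set (V d)) (mu : V d -> 'I_n -> R) : Prop :=
  (forall i, borel_on O (fun x => mu x i)) /\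
  (lebint_on O (fun x => (\sum_i (mu x i) ^+ 2)%:E) < +oo)%E.

(* grad mu + B.mu = 0 in the sense of distributions (tested against C_c^infty(Omega),
   which is dense in H^1_0(Omega), so this is the equation in H^{-1}) *)
Definition weak_kernel d n (O : set (V d)) (B : tfield d n)
    (mu : V d -> 'I_n -> R) : Prop :=
  forall phi, test_fun O phi -> forall (i : 'I_n) (j : 'I_d),
    sint_on O (fun x => - (mu x i) * ('D_(evec j) phi x)
                        + (\sum_k B x i j k * mu x k) * phi x) = 0%E.

Definition inN d n (O : set (V d)) (B : tfield d n) (mu : V d -> 'I_n -> R) :=
  in_L2 O mu /\ weak_kernel O B mu.

Definition L2_indep d n (O : set (V d)) m (f : 'I_m -> V d -> 'I_n -> R) :=
  forall c : 'I_m -> R,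
    (forall i, ae_zero_on O (fun x => \sum_l c l * f l x i)) -> forall l, c l = 0.

Definition dimN_eq d n (O : set (V d)) (B : tfield d n) (k : nat) : Prop :=
  (exists f : 'I_k -> V d -> 'I_n -> R, (forall l, inN O B (f l)) /\ L2_indep O f) /\
  ~ (exists f : 'I_k.+1 -> V d -> 'I_n -> R, (forall l, inN O B (f l)) /\ L2_indep O f).

(* C^1 curves [0,1] -> Omega from x to y (as C^1 maps R -> R^d, only their
   restriction to [0,1] matters) *)
Definition C1curve d (O : set (V d)) (x y : V d) (g : R -> V d) : Prop :=
  (forall t, derivable g t 1) /\ continuous ('D_1 g) /\
  (forall t, 0 <= t <= 1 -> O (g t)) /\ g 0 = x /\ g 1 = y.

Definition transport_sol d n (B' : tfield d n) (g : R -> V d) (v : 'rV[R]_n)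
    (phi : R -> 'rV[R]_n) : Prop :=
  {within `[0, 1]%classic, continuous phi} /\ phi 0 = v /\
  forall t, 0 < t < 1 -> derivable phi t 1 /\
    forall i, ('D_1 phi t) 0 i =
      - \sum_j \sum_k B' (g t) i j k * (phi t) 0 k * ('D_1 g t) 0 j.

Definition Eset d n (O : set (V d)) (B' : tfield d n) (x : V d) : set 'rV[R]_n :=
  [set v | forall y g1 g2, C1curve O x y g1 -> C1curve O x y g2 ->
     forall phi1 phi2, transport_sol B' g1 v phi1 -> transport_sol B' g2 v phi2 ->
       phi1 1 = phi2 1].

Definition vec_indep n (E : set 'rV[R]_n) m (v : 'I_m -> 'rV[R]_n) : Prop :=
  (forall l, E (v l)) /\ forall c : 'I_m -> R, \sum_l c l *: v l = 0 -> forall l, c l = 0.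

Definition dim_eq n (E : set 'rV[R]_n) (k : nat) : Prop :=
  (exists v : 'I_k -> 'rV[R]_n, vec_indep E v) /\
  ~ (exists v : 'I_k.+1 -> 'rV[R]_n, vec_indep E v).

Definition continuous_on_closure d n (O : set (V d)) (B' : tfield d n) : Prop :=
  forall i j k, {within closure O, continuous (fun x => B' x i j k)}.

(* B' is k'-conservative (dim E^x = k' for x in Omega; independent of x) *)
Definition conservative_C0 d n (O : set (V d)) (B' : tfield d n) (k' : nat) : Prop :=
  forall x, O x -> dim_eq (Eset O B' x) k'.

Definition at_least_conservative d n (O : set (V d)) (p : R) (B : tfield d n)
    (k : nat) : Prop :=
  forall eps : R, 0 < eps -> exists Be : tfield d n,
    continuous_on_closure O Be /\
    (exists k', (k <= k')%N /\ conservative_C0 O Be k') /\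
    Lp_dist_lt O p B Be eps.

Definition conservative d n (O : set (V d)) (p : R) (B : tfield d n) (k : nat) : Prop :=
  at_least_conservative O p B k /\ ~ at_least_conservative O p B k.+1.

End Defs.

(* Main.v *)
(** For every [k], the kernel contains [k] independent elements if and only if [B] is at least
    [k]-conservative; the theorem is this equivalence for [k] and [k + 1].

    Let [mu] solve [grad mu = - B mu] weakly. Its averages [A_h mu] have gradients [A_h (B mu)], so for
    [w = ln (1 + |mu|^2 / de) / 2] one has [|grad w| <= |B|] in the averaged sense, uniformly in [de].
    Since [p > d], Morrey's telescoping argument over the radii [2^-m] makes [w] Hoelder continuous
    inside [O], and uniform cones at the smooth boundary together with connectedness extend this
    to a bound on the oscillation of [w] over the whole of [O]. Hence [de + |mu|^2] is comparable at any
    two points, with a constant depending only on [O] and on the integral of [|B|^p], and so [mu] is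
    bounded and Hoelder continuous.

    If [B_m -> B] in [L^p] with each [B_m] continuous and at least [k]-conservative, then parallel
    transport gives [k] classical solutions for [B_m], orthonormal at a base point; by the uniform
    Hoelder bounds they converge along an ultrafilter to [k] orthonormal elements of the kernel.

    Conversely, let the rows of [M] be [k] solutions for [B], orthonormal at a base point; the comparison
    bounds the Gram matrix of [M] from below on [O]. Shifting along the cones before averaging, and
    gluing with a partition of unity, gives [M_t] of class [C^1] up to the boundary. With [B_h] an average
    of [B], [E = grad M_t + B_h M_t] and [N] the pseudo-inverse of [M_t], the continuous field [B_h - E N]
    has the rows of [M_t] as exact solutions, and it tends to [B] in [L^p] because [grad M = - B M]. *)
Require Import Defs.
From HB Require Import structures.
From mathcomp Require Import all_boot all_order all_algebra.
From mathcomp Require Import all_classical all_reals all_analysis.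
From mathcomp Require Import measurable_realfun ring lra.
Import Order.TTheory GRing.Theory Num.Theory.
Import numFieldNormedType.Exports.
Local Open Scope classical_set_scope.
Local Open Scope ring_scope.
Set Implicit Arguments.
Unset Strict Implicit.
Unset Printing Implicit Defensive.

(** * Lebesgue measure on row vectors *)

(** With [B] only in L^p there is no transport along single curves, so unique continuation cannot
    come from an ordinary differential equation. The logarithm replaces it: |grad mu| <= |B| |mu|
    becomes a bound on grad w by |B| alone, to which Morrey's estimate applies before [mu] is known
    to be bounded. The parameter [de] only keeps the logarithm defined at the zeros of [mu]; as the
    constants do not see it, letting it tend to 0 shows that a solution which vanishes at one point
    vanishes on [O]. The dimension can therefore be read off at a base point, and orthonormality
    there survives limits, so that no dimension is lost. In the converse direction the obstacle is
    the boundary: extension by zero creates a jump, and averages across it no longer satisfy the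
    equation; the shift along the cones keeps the averaging balls inside [O]. Hoelder's and Jensen's
    inequalities are replaced throughout by a <= t + t^(1-p) a^p with a free parameter t, chosen
    anew for each use. *)

Definition rV_display : measure_display. Proof. exact: default_measure_display. Qed.

Section borel_rV.
Variables (R : realType) (d : nat).

Let borelV0 : @borelV R d set0. Proof. exact: sigma_algebra0. Qed.
Let borelVC A : @borelV R d A -> borelV (~` A).
Proof. exact: sigma_algebraC. Qed.
Let borelV_bigcup (F : (set 'rV[R]_d)^nat) :
  (forall i, borelV (F i)) -> borelV (\bigcup_i F i).
Proof. exact: sigma_algebra_bigcup. Qed.

(** The sigma-algebra is the one of [borelV], so that the Borel sets of the definitions are the
    measurable sets of the structure without any transfer. *)
HB.instance Definition _ := @isMeasurable.Build rV_display 'rV[R]_d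
  (@borelV R d) borelV0 borelVC borelV_bigcup.

End borel_rV.

Section measurability.
Variable R : realType.
Implicit Types d : nat.

Lemma measurable_rV_open d (U : set 'rV[R]_d) : open U -> measurable U.
Proof. by move=> oU; exact: sub_gen_smallest. Qed.

Lemma continuous_measurable_rV d (f : 'rV[R]_d -> R) : continuous f ->
  measurable_fun setT f.
Proof.
move=> cf; apply: (measurability _ (RGenOpens.measurableE R)).
move=> _ [_ [a [b ->] <-]].
rewrite setTI; apply: measurable_rV_open; apply: open_comp => //.
Qed.

(** The norm is the maximum norm, so balls are cubes. Product kernels and the volume (2 h)^d rest on
    this. *)
Lemma normr_rVlt d (x : 'rV[R]_d) (e : R) : 0 < e ->
  (`|x| < e) <-> (forall i, `|x 0 i| < e).
Proof.
move=> e0; have := mx_norm_ball R 1 d; move=> /(congr1 (fun f => f 0 e (- x))) H.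
split=> [xe i|xe].
  have : ball_ (fun x => `|x|) (0 : 'rV[R]_d) e (- x) by rewrite /= opprK add0r.
  rewrite -H => -[_ /(_ 0 i)].
  by rewrite /ball/= mxE mxE sub0r opprK.
suff : ball_ (fun x => `|x|) (0 : 'rV[R]_d) e (- x) by rewrite /= opprK add0r.
rewrite -H; split => // i j; rewrite (ord1 i).
by rewrite /ball/= mxE mxE sub0r opprK.
Qed.

Lemma normr_rVle d (x : 'rV[R]_d) (e : R) : 0 <= e ->
  (`|x| <= e) <-> (forall i, `|x 0 i| <= e).
Proof.
move=> e0; split=> [xe i|xe].
  apply/ler_addgt0Pr => h h0.
  apply/ltW; have := (normr_rVlt x (_ : 0 < e + h)).
  by move=> /(_ ltac:(lra)) [+ _]; apply; lra.
apply/ler_addgt0Pr => h h0; apply/ltW/normr_rVlt => [|i]; first lra.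
by have := xe i; lra.
Qed.

Lemma normr_rV_coord d (x : 'rV[R]_d) i : `|x 0 i| <= `|x|.
Proof. by have /(normr_rVle x (normr_ge0 x)) := lexx `|x|; exact. Qed.

Lemma ball_rVE d (x y : 'rV[R]_d) (e : R) : ball x e y <-> `|y - x| < e.
Proof. by rewrite -ball_normE/= distrC. Qed.

Lemma rVB d (x y : 'rV[R]_d) i : (x - y) 0 i = x 0 i - y 0 i.
Proof. by rewrite !mxE. Qed.

Lemma measurable_coord d i : measurable_fun setT (fun x : 'rV[R]_d => x 0 i).
Proof. by apply: continuous_measurable_rV; exact: coord_continuous. Qed.

(** An open set is a countable union of balls with rational centres and radii 1/(n+1), and the
    preimage of a cube is a finite intersection of preimages of intervals under the coordinates. *)
Lemma measurable_fun_rVP dT (T : measurableType dT) d (f : T -> 'rV[R]_d) :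
  measurable_fun setT f <-> forall i, measurable_fun setT (fun x => f x 0 i).
Proof.
split=> [mf i|mf].
  exact: (measurableT_comp (measurable_coord i)).
apply: (measurability [set U : set ('rV[R]_d) | open U] erefl).
move=> _ [U oU <-]; rewrite setTI.
pose q2 (q : 'rV[rat]_d) : 'rV[R]_d := map_mx ratr q.
have -> : U = \bigcup_(qn in [set qn : 'rV[rat]_d * nat |
    ball (q2 qn.1) qn.2.+1%:R^-1 `<=` U]) ball (q2 qn.1) qn.2.+1%:R^-1.
  apply/seteqP; split => [x Ux|x [qn /= + ?]]; last by apply.
  have /nbhs_ballP[e/= e0 xeU] := open_nbhs_nbhs (conj oU Ux).
  have /ltr_add_invr[n] : 0 < e / 2 by lra.
  rewrite add0r => ne.
  have : 0 < n.+1%:R^-1 :> R by rewrite invr_gt0 ltr0n.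
  move: ne; set r : R := n.+1%:R^-1 => ne r0.
  have /choice[q xq] : forall i, exists q : rat, x 0 i - r < ratr q < x 0 i + r.
    move=> i; have : x 0 i - r < x 0 i + r by lra.
    by move=> /rat_in_itvoo[q]; rewrite in_itv/=; exists q.
  have xq' : `|q2 (\row_i q i) - x| < r.
    apply/normr_rVlt => // i; rewrite !mxE ltr_norml; have := xq i; lra.
  exists (\row_i q i, n) => /=; last by apply/ball_rVE; rewrite distrC.
  move=> y /ball_rVE /= yq; apply: xeU; apply/ball_rVE.
  have := ler_distD (q2 (\row_i q i)) y x.
  move: yq; rewrite -/r; move: xq' ne; set a := `|_|; set b := `|_|; set c := `|_|; lra.
rewrite preimage_bigcup bigcup_mkcond; apply: countable_bigcupT_measurable.
  exact: countableP.
move=> [q n] /=; case: ifP => // _.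
have : 0 < n.+1%:R^-1 :> R by rewrite invr_gt0 ltr0n.
set r : R := n.+1%:R^-1 => r0.
rewrite (_ : _ @^-1` _ = \bigcap_(i in [set: 'I_d]) (fun x => f x 0 i) @^-1`
    `](q2 q) 0 i - r, (q2 q) 0 i + r[%classic); last first.
  apply/seteqP; split => x /=.
    move=> /ball_rVE/normr_rVlt - /(_ r0) h i _ /=; rewrite in_itv/=.
    by have := h i; rewrite !mxE ltr_norml; lra.
  move=> h; apply/ball_rVE/normr_rVlt => // i.
  by have := h i Logic.I; rewrite /= in_itv/= !mxE ltr_norml; lra.
apply: fin_bigcap_measurable => //.
by move=> i _; rewrite -[X in measurable X]setTI; exact: mf.
Qed.

Lemma measurable_funD_rV dT (T : measurableType dT) d (f g : T -> 'rV[R]_d) :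
  measurable_fun setT f -> measurable_fun setT g ->
  measurable_fun setT (fun x => f x + g x).
Proof.
move=> /measurable_fun_rVP mf /measurable_fun_rVP mg.
apply/measurable_fun_rVP => i; under eq_fun do rewrite mxE.
exact: measurable_funD.
Qed.

Lemma measurable_funB_rV dT (T : measurableType dT) d (f g : T -> 'rV[R]_d) :
  measurable_fun setT f -> measurable_fun setT g ->
  measurable_fun setT (fun x => f x - g x).
Proof.
move=> /measurable_fun_rVP mf /measurable_fun_rVP mg.
apply/measurable_fun_rVP => i; under eq_fun do rewrite !mxE.
exact: measurable_funB.
Qed.

Definition consV m (p : R * 'rV[R]_m) : 'rV[R]_m.+1 := row_mx (\row_(_ < 1) p.1) p.2.

Lemma consV0 m (p : R * 'rV[R]_m) : consV p 0 ord0 = p.1.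
Proof.
have -> : (ord0 : 'I_m.+1) = lshift m (ord0 : 'I_1) by exact/val_inj.
by apply: (etrans (row_mxEl (\row__ p.1) p.2 0 ord0)); rewrite mxE.
Qed.

Lemma consVS m (p : R * 'rV[R]_m) (j : 'I_m) : consV p 0 (lift ord0 j) = p.2 0 j.
Proof.
have -> : lift ord0 j = rshift 1 j by exact/val_inj.
exact: (row_mxEr (\row__ p.1) p.2 0 j).
Qed.

Lemma measurable_consV m :
  measurable_fun [set: (measurableTypeR R * 'rV[R]_m)%type] (@consV m).
Proof.
apply/measurable_fun_rVP => i; case: (unliftP ord0 i) => [j|] ->.
  under eq_fun do rewrite consVS.
  by apply: (measurableT_comp (measurable_coord j)); exact: measurable_snd.
under eq_fun do rewrite consV0.
exact: (@measurable_fst _ _ (measurableTypeR R) 'rV[R]_m).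
Qed.

End measurability.

Lemma continuous_rVP (R : realType) d (W : normedModType R) (f : 'rV[R]_d -> W) (x : 'rV[R]_d) :
  {for x, continuous f} <->
  (forall e, 0 < e -> exists2 r, 0 < r & forall y, `|y - x| < r -> `|f y - f x| < e).
Proof.
split=> [h e e0|h].
  have H : nbhs x (fun y => `|f x - f y| < e) by exact: (@cvgr_dist_lt _ _ _ (nbhs x) _ f (f x) h e e0).
  have [r /= r0 hr] := (@nbhs_ballP R 'rV[R]_d x _).1 H.
  exists r => // y yr; rewrite distrC; apply: hr; rewrite -ball_normE /ball_ /= distrC.
  exact: yr.
apply/(@cvgrPdist_lt _ _ _ (nbhs x)) => e e0; have [r r0 hr] := h e e0.
apply: (@filterS _ (nbhs x) _ (ball x r)); last exact: nbhsx_ballx.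
move=> y; rewrite -ball_normE /ball_ /= distrC => /hr.
by rewrite distrC.
Qed.

Section leb.
Variable R : realType.
Local Open Scope ereal_scope.

Section succ.
Variables (m : nat) (mu : {sigma_finite_measure set 'rV[R]_m -> \bar R}).

(** The product of the line with dimension [m], carried over by the same gluing of coordinates as in
    [lebint]. Iterated, it gives a sigma-finite measure whose integral is [lebint] by Tonelli. *)
Definition lebS : set 'rV[R]_m.+1 -> \bar R :=
  pushforward ((@lebesgue_measure R) \x mu) (@consV R m).

Let lebS0 : lebS set0 = 0.
Proof. by rewrite /lebS /pushforward preimage_set0 measure0. Qed.

Let lebS_ge0 A : 0 <= lebS A.
Proof. by rewrite /lebS /pushforward measure_ge0. Qed.

Let lebS_sigma_additive : semi_sigma_additive lebS.
Proof.
move=> F mF tF mUF; rewrite /lebS /pushforward preimage_bigcup.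
apply: measure_semi_sigma_additive.
- by move=> n; rewrite -[X in measurable X]setTI; exact: measurable_consV.
- apply/trivIsetP => /= i j _ _ ij; rewrite -preimage_setI.
  by move/trivIsetP : tF => /(_ _ _ _ _ ij) ->//; rewrite preimage_set0.
- by rewrite -preimage_bigcup -[X in measurable X]setTI; exact: measurable_consV.
Qed.

HB.instance Definition _ := isMeasure.Build _ _ _ lebS
  lebS0 lebS_ge0 lebS_sigma_additive.

Definition unconsV (x : 'rV[R]_m.+1) : measurableTypeR R * 'rV[R]_m :=
  (x 0%R ord0, (\row_j x 0 (lift ord0 j))%R).

Lemma measurable_unconsV : measurable_fun setT unconsV.
Proof.
apply/measurable_fun_pairP; split; first exact: measurable_coord.
apply/measurable_fun_rVP => i; rewrite /comp/=; under eq_fun do rewrite mxE.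
exact: measurable_coord.
Qed.

Lemma consVK : cancel (@consV R m) unconsV.
Proof.
move=> [a t]; rewrite /unconsV consV0; congr pair => /=.
by apply/rowP => j; rewrite mxE consVS.
Qed.

Let lebS_sigma_finite : sigma_finite setT lebS.
Proof.
have /sigma_finiteP[F [TF ndF Foo]] := sigma_finiteT (@lebesgue_measure R).
have /sigma_finiteP[G [TG ndG Goo]] := sigma_finiteT mu.
exists (fun n => unconsV @^-1` (F n `*` G n)).
  rewrite -preimage_bigcup [X in _ @^-1` X](_ : _ = setT) ?preimage_setT//.
  rewrite -setXTT TF TG predeqE => -[x y]; split; last first.
    move=> [/= [n _ Fnx] [k _ Gky]]; exists (maxn n k) => //; split.
    - by move: x Fnx; exact/subsetPset/ndF/leq_maxl.
    - by move: y Gky; exact/subsetPset/ndG/leq_maxr.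
  by move=> [n _ []/= ? ?]; split; exists n.
move=> k; have [? ?] := Foo k; have [? ?] := Goo k; split.
  by rewrite -[X in measurable X]setTI; apply: measurable_unconsV => //; exact: measurableX.
rewrite /lebS /pushforward -comp_preimage (_ : _ \o _ = id); last first.
  by apply/funext => x /=; rewrite consVK.
by rewrite preimage_id product_measure1E// lte_mul_pinfty// ge0_fin_numE.
Qed.

HB.instance Definition _ := Measure_isSigmaFinite.Build _ _ _ lebS
  lebS_sigma_finite.

Lemma ge0_integral_lebS (f : 'rV[R]_m.+1 -> \bar R) :
  measurable_fun setT f -> (forall x, 0 <= f x) ->
  \int[lebS]_x f x = \int[lebesgue_measure]_x \int[mu]_t f (consV (x, t)).
Proof.
move=> mf f0.
rewrite /lebS (ge0_integral_pushforward (@measurable_consV R m))//.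
rewrite preimage_setT fubini_tonelli1//; last by move=> x; exact: f0.
by apply: measurableT_comp => //; exact: measurable_consV.
Qed.

End succ.

Fixpoint leb m : {sigma_finite_measure set 'rV[R]_m -> \bar R} :=
  match m return {sigma_finite_measure set 'rV[R]_m -> \bar R} with
  | 0 => \d_(0%R : 'rV[R]_0)
  | m'.+1 => lebS (leb m')
  end.

Lemma lebint_integral m (f : 'rV[R]_m -> \bar R) :
  measurable_fun setT f -> (forall x, 0 <= f x) ->
  lebint f = \int[leb m]_x f x.
Proof.
elim: m f => [|m IH] f mf f0 /=.
  by rewrite integral_dirac// diracT mul1e.
rewrite ge0_integral_lebS//; apply: eq_integral => x _.
rewrite IH//.
have := measurableT_comp mf (measurableT_comp (@measurable_consV R m)
  (@pair1_measurable _ _ (measurableTypeR R) 'rV[R]_m x)).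
exact.
Qed.

Lemma integral_leb_consV m (f : 'rV[R]_m.+1 -> \bar R) :
  measurable_fun setT f -> (forall x, 0 <= f x) ->
  \int[leb m.+1]_x f x = \int[lebesgue_measure]_x \int[leb m]_t f (consV (x, t)).
Proof. by move=> mf f0; rewrite [LHS]ge0_integral_lebS. Qed.

Lemma measurable_fun_consV1 m (f : 'rV[R]_m.+1 -> \bar R) x :
  measurable_fun setT f -> measurable_fun setT (fun t => f (consV (x, t))).
Proof.
move=> mf; apply: (measurableT_comp mf (measurableT_comp (@measurable_consV R m)
  (@pair1_measurable _ _ (measurableTypeR R) 'rV[R]_m x))).
Qed.

(** Uniqueness of Lebesgue measure reduces this to half-open intervals, whose preimages under the
    shift have the same length. *)
Lemma lebesgue_measureDr (a : R) (A : set R) : measurable A ->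
  pushforward (@lebesgue_measure R) ((+%R^~ a) : measurableTypeR R -> measurableTypeR R) A
    = lebesgue_measure A.
Proof.
have ma : measurable_fun setT ((+%R^~ a) : measurableTypeR R -> measurableTypeR R).
  exact: (@measurable_funD _ _ R setT id (cst a)).
move=> mA; apply/esym/(@lebesgue_measure_unique _ (measure_function_pushforward__canonical__measure_function_Measure lebesgue_measure ma)) => //= _ [[b c]] _ <-.
rewrite /pushforward (_ : _ @^-1` _ = [set` `](b - a)%R, (c - a)%R]]).
  rewrite !lebesgue_measure_itv/= !lte_fin ltrD2r; case: ifPn => // _.
  by rewrite -!EFinB; congr EFin; ring.
by apply/seteqP; split => x /=; rewrite !in_itv/=; lra.
Qed.

Lemma ge0_integral_lebesgueD (a : R) (f : R -> \bar R) :
  measurable_fun setT f -> (forall x, 0 <= f x) ->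
  \int[lebesgue_measure]_x f (x + a)%R = \int[lebesgue_measure]_x f x.
Proof.
move=> mf f0.
have ma : measurable_fun setT ((+%R^~ a) : measurableTypeR R -> measurableTypeR R).
  exact: (@measurable_funD _ _ R setT id (cst a)).
transitivity (\int[pushforward lebesgue_measure ((+%R^~ a) : measurableTypeR R -> measurableTypeR R)]_x f x).
  by rewrite (ge0_integral_pushforward ma).
by apply: eq_measure_integral => //= A mA _; exact: lebesgue_measureDr.
Qed.

Lemma ge0_integral_lebD m (a : 'rV[R]_m) (f : 'rV[R]_m -> \bar R) :
  measurable_fun setT f -> (forall x, 0 <= f x) ->
  \int[leb m]_x f (x + a)%R = \int[leb m]_x f x.
Proof.
elim: m a f => [|m IH] a f mf f0.
  by apply: eq_integral => x _; rewrite !thinmx0.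
have mfa : measurable_fun setT (fun x : 'rV[R]_m.+1 => f (x + a)%R).
  by apply: measurableT_comp => //; apply: measurable_funD_rV.
rewrite !integral_leb_consV//.
pose g x := \int[leb m]_t f (consV (x, t)).
have mg : measurable_fun [set: measurableTypeR R] g.
  apply: (@measurable_fun_fubini_tonelli_F _ _ (measurableTypeR R) _ _ _ (f \o @consV R m)).
  - by apply: measurableT_comp => //; exact: measurable_consV.
  - by move=> x; exact: f0.
rewrite -[RHS](@ge0_integral_lebesgueD (a 0%R ord0) g)//; last first.
  by move=> x; exact: integral_ge0.
apply: eq_integral => x _; rewrite /g.
rewrite -[RHS](IH (unconsV a).2)//; last exact: measurable_fun_consV1.
apply: eq_integral => t _; congr f.
apply/rowP => i; case: (unliftP ord0 i) => [j|] ->; rewrite mxE.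
  by rewrite !consVS/= !mxE.
by rewrite !consV0.
Qed.

End leb.

Section leb_ball.
Variable R : realType.

Lemma leb_ball m (x : 'rV[R]_m) (h : R) : 0 < h ->
  leb R m (ball x h) = ((2 * h) ^+ m)%:E.
Proof.
elim: m x => [|m IH] x h0.
  rewrite expr0 /= diracE mem_set//; apply/ball_rVE.
  by apply/normr_rVlt => // -[].
have mb : measurable (ball x h) by apply: measurable_rV_open; exact: ball_open.
transitivity (\int[leb R m.+1]_y (\1_(ball x h) y)%:E)%E.
  by rewrite integral_indic// setIT.
rewrite integral_leb_consV//; last by apply/measurable_EFinP; exact: measurable_indic.
have E y t : \1_(ball x h) (consV (y, t)) =
    \1_`](x 0 ord0 - h), (x 0 ord0 + h)[%classic y * \1_(ball (unconsV x).2 h) t :> R.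
  rewrite !indicE -natrM mulnb; congr ((nat_of_bool _)%:R); apply/idP/andP => [|[]].
    rewrite inE => /ball_rVE/(normr_rVlt _ h0) H; split.
      rewrite inE/= in_itv/=; have := H ord0; rewrite rVB consV0 ltr_norml/=; lra.
    rewrite inE; apply/ball_rVE/normr_rVlt => // i; have := H (lift ord0 i).
    by rewrite rVB consVS/= rVB mxE.
  rewrite !inE/= in_itv/= => yx /ball_rVE/(normr_rVlt _ h0) H.
  apply/ball_rVE/normr_rVlt => // i; case: (unliftP ord0 i) => [j|] ->.
    by have := H j; rewrite !rVB consVS/= mxE.
  by rewrite rVB consV0 ltr_norml/=; lra.
under eq_integral do under eq_integral do rewrite E.
have mbm : measurable (ball (unconsV x).2 h).
  by apply: measurable_rV_open; exact: ball_open.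
transitivity (\int[lebesgue_measure]_y ((\1_`](x 0 ord0 - h), (x 0 ord0 + h)[%classic y)%:E * ((2 * h) ^+ m)%:E))%E.
  apply: eq_integral => y _.
  under eq_integral do rewrite EFinM.
  rewrite ge0_integralZl//.
    by rewrite integral_indic// setIT; congr (_ * _)%E; exact: IH.
  by apply/measurable_EFinP; exact: measurable_indic.
rewrite ge0_integralZr//.
- rewrite integral_indic// setIT exprS EFinM; congr (_ * _)%E.
  apply: etrans (lebesgue_measure_itv _) _; rewrite /= lte_fin.
  rewrite (_ : _ < _); last lra.
  by rewrite -EFinB; congr _%:E; ring.
- by apply/measurable_EFinP; exact: measurable_indic.
- by rewrite lee_fin exprn_ge0//; lra.
Qed.

End leb_ball.

(** * Integrable functions and translations *)

Section L1.
Context dT (T : measurableType dT) (R : realType).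
Variable mu : {measure set T -> \bar R}.
Implicit Types f g : T -> R.

Definition L1 f := mu.-integrable setT (EFin \o f).

Lemma L1_meas f : L1 f -> measurable_fun setT f.
Proof. by move=> /integrableP[/measurable_EFinP]. Qed.

Lemma L1D f g : L1 f -> L1 g -> L1 (fun x => f x + g x).
Proof.
move=> hf hg; rewrite /L1; have := integrableD measurableT hf hg.
by apply: eq_integrable.
Qed.

Lemma L1Z c f : L1 f -> L1 (fun x => c * f x).
Proof.
move=> hf; rewrite /L1; have := integrableZl measurableT c hf.
by apply: eq_integrable.
Qed.

Lemma L1N f : L1 f -> L1 (fun x => - f x).
Proof.
by move=> /(L1Z (-1)); apply: eq_integrable => // x _ /=; rewrite mulN1r.
Qed.

Lemma L1B f g : L1 f -> L1 g -> L1 (fun x => f x - g x).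
Proof. by move=> hf /L1N; exact: L1D. Qed.

Lemma L1_le f g : measurable_fun setT f -> (forall x, `|f x| <= g x) ->
  L1 g -> L1 f.
Proof.
move=> mf fg; apply: le_integrable => //; first exact/measurable_EFinP.
by move=> x _ /=; rewrite lee_fin (le_trans (fg x))// ler_norm.
Qed.

Lemma L1_abs f : L1 f -> L1 (fun x => `|f x|).
Proof.
move=> hf; have : L1 (fun x => Num.norm (f x)); last by [].
have := integrable_norm hf; by apply: eq_integrable.
Qed.

Lemma L1_abs_inv f : measurable_fun setT f -> L1 (fun x => `|f x|) -> L1 f.
Proof. by move=> mf; exact: L1_le. Qed.

Lemma L1M f g c : L1 f -> measurable_fun setT g -> (forall x, `|g x| <= c) ->
  L1 (fun x => f x * g x).
Proof.
move=> hf mg gc; apply: (@L1_le _ (fun x => `|c| * `|f x|)).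
- by apply: measurable_funM => //; exact: L1_meas.
- move=> x; rewrite normrM mulrC ler_wpM2r//.
  by rewrite (le_trans (gc x))// ler_norm.
- exact/L1Z/L1_abs.
Qed.

Lemma L1_sum (I : Type) (s : seq I) (F : I -> T -> R) :
  (forall i, L1 (F i)) -> L1 (fun x => \sum_(i <- s) F i x).
Proof.
move=> h; elim: s => [|a s IH].
  rewrite /L1; under eq_fun do rewrite /= big_nil.
  exact: integrable0.
under eq_fun do rewrite big_cons.
exact: L1D.
Qed.

Lemma L1_indic A : measurable A -> (mu A < +oo)%E -> L1 (\1_A : T -> R).
Proof.
move=> mA Aoo; apply/integrableP; split; first exact/measurable_EFinP/measurable_indic.
rewrite (eq_integral (fun x => (\1_A x)%:E)) ?integral_indic ?setIT//.
by move=> x _ /=; rewrite ger0_norm.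
Qed.

Lemma L1_ge0 f : measurable_fun setT f -> (forall x, 0 <= f x) ->
  (\int[mu]_x (f x)%:E < +oo)%E -> L1 f.
Proof.
move=> mf f0 h; apply/integrableP; split; first exact/measurable_EFinP.
by under eq_integral do rewrite /= ger0_norm//.
Qed.

Lemma EFin_Rintegral f : L1 f -> (\int[mu]_x f x)%:E = (\int[mu]_x (f x)%:E)%E.
Proof. by move=> hf; rewrite /Rintegral fineK//; exact: integrable_fin_num. Qed.

Lemma Int0 : \int[mu]_x (0 : R) = 0.
Proof. by rewrite /Rintegral integral0. Qed.

Lemma IntD f g : L1 f -> L1 g ->
  \int[mu]_x (f x + g x) = \int[mu]_x f x + \int[mu]_x g x.
Proof. by move=> *; rewrite RintegralD. Qed.

Lemma IntB f g : L1 f -> L1 g ->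
  \int[mu]_x (f x - g x) = \int[mu]_x f x - \int[mu]_x g x.
Proof. by move=> *; rewrite RintegralB. Qed.

Lemma IntZ c f : L1 f -> \int[mu]_x (c * f x) = c * \int[mu]_x f x.
Proof. by move=> *; rewrite RintegralZl. Qed.

Lemma IntN f : L1 f -> \int[mu]_x (- f x) = - \int[mu]_x f x.
Proof.
move=> hf; rewrite -mulN1r -IntZ//.
by apply: eq_Rintegral => x _; rewrite mulN1r.
Qed.

Lemma Int_sum (I : Type) (s : seq I) (F : I -> T -> R) :
  (forall i, L1 (F i)) ->
  \int[mu]_x (\sum_(i <- s) F i x) = \sum_(i <- s) \int[mu]_x F i x.
Proof.
move=> h; elim: s => [|a s IH].
  rewrite big_nil; under eq_Rintegral do rewrite big_nil.
  by rewrite /Rintegral integral0.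
under eq_Rintegral do rewrite big_cons.
by rewrite IntD// ?IH ?big_cons//; exact: L1_sum.
Qed.

Lemma Int_le f g : L1 f -> L1 g -> (forall x, f x <= g x) ->
  \int[mu]_x f x <= \int[mu]_x g x.
Proof. by move=> hf hg fg; apply: le_Rintegral. Qed.

Lemma Int_ge0 f : (forall x, 0 <= f x) -> 0 <= \int[mu]_x f x.
Proof. by move=> f0; apply: Rintegral_ge0. Qed.

Lemma Int_abs f : L1 f -> `|\int[mu]_x f x| <= \int[mu]_x `|f x|.
Proof. by move=> hf; apply: le_normr_Rintegral. Qed.

Lemma Int_abs_le f g : L1 f -> L1 g -> (forall x, `|f x| <= g x) ->
  `|\int[mu]_x f x| <= \int[mu]_x g x.
Proof.
move=> hf hg fg; apply: (le_trans (Int_abs hf)); apply: Int_le => //.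
exact: L1_abs.
Qed.

Lemma Int_dct (f_ : nat -> T -> R) f g :
  (forall n, measurable_fun setT (f_ n)) -> (forall n x, `|f_ n x| <= g x) ->
  (forall x, f_ n x @[n --> \oo] --> f x) -> L1 g ->
  \int[mu]_x f_ n x @[n --> \oo] --> \int[mu]_x f x.
Proof.
move=> mf fg ff hg.
have mf0 : measurable_fun setT f.
  by apply: (measurable_fun_cvg (h := f_)) => // x _; exact: ff.
apply: fine_cvg.
have fi : L1 f.
  apply: (L1_le mf0 _ hg) => x; have fx : `|f_ n x| @[n --> \oo] --> `|f x| by apply: cvg_norm; exact: ff.
  rewrite -(cvg_lim (@Rhausdorff R) fx); apply: limr_le; last exact: nearW.
  by apply/cvg_ex; eexists; exact: fx.
rewrite fineK; last exact: integrable_fin_num.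
have [||||_ _ h] := @dominated_convergence _ _ _ mu setT measurableT
   (fun n x => (f_ n x)%:E) (EFin \o f) (EFin \o g) _ _ _ hg _; last exact: h.
- by move=> n; apply/measurable_EFinP.
- exact/measurable_EFinP.
- by apply: aeW => x _ /=; apply: cvg_EFin; [exact: nearW|exact: ff].
- by apply: aeW => x n _ /=; rewrite lee_fin.
Qed.

End L1.

Section Fubini.
Context d1 d2 (T1 : measurableType d1) (T2 : measurableType d2) (R : realType).
Variable m1 : {sigma_finite_measure set T1 -> \bar R}.
Variable m2 : {sigma_finite_measure set T2 -> \bar R}.
Variable f : T1 -> T2 -> R.

Lemma Int_swap : measurable_fun setT (fun z => f z.1 z.2) ->
  (\int[m1]_x \int[m2]_y `|f x y|%:E < +oo)%E ->
  (forall x, L1 m2 (f x)) -> (forall y, L1 m1 (f ^~ y)) ->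
  \int[m1]_x \int[m2]_y f x y = \int[m2]_y \int[m1]_x f x y.
Proof.
move=> mf foo f1 f2.
have mfe : measurable_fun setT (EFin \o (fun z => f z.1 z.2)) by exact/measurable_EFinP.
have := (integrable12ltyP m1 m2 mfe).2 foo => /Fubini/= H.
rewrite {1 3}/Rintegral; congr fine.
transitivity (\int[m1]_x \int[m2]_y (f x y)%:E)%E.
  by apply: eq_integral => x _; rewrite EFin_Rintegral.
rewrite H; apply: eq_integral => x _; rewrite EFin_Rintegral//.
Qed.

End Fubini.

Section translation.
Variables (R : realType) (d : nat).
Local Notation V := 'rV[R]_d.
Local Notation mu := (leb R d).
Implicit Types (f g F : V -> R).

Lemma measurable_shift_rV (a : V) : measurable_fun setT (fun x : V => x + a).
Proof. exact: measurable_funD_rV. Qed.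

Lemma L1_shift (a : V) F : L1 mu F -> L1 mu (fun x => F (x + a)).
Proof.
move=> hF; have mF := L1_meas hF; apply: L1_abs_inv.
  exact: (measurableT_comp mF (measurable_shift_rV a)).
apply: L1_ge0 => //.
  by apply: measurableT_comp => //; exact: (measurableT_comp mF (measurable_shift_rV a)).
rewrite (@ge0_integral_lebD _ _ a (fun x => `|F x|%:E))//.
- by move: hF => /integrableP[].
- by apply/measurable_EFinP; exact: measurableT_comp.
Qed.

Lemma Int_shift_ge0 (a : V) F : measurable_fun setT F -> (forall x, 0 <= F x) ->
  \int[mu]_x F (x + a) = \int[mu]_x F x.
Proof.
move=> mF F0; congr fine; apply: (@ge0_integral_lebD _ _ a (fun x => (F x)%:E)).
- exact/measurable_EFinP.
- by move=> x; rewrite lee_fin.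
Qed.

(** Tonelli gives the invariance for non-negative functions, and [F] is the difference of |F| and
    |F| - F. *)
Lemma Int_shift (a : V) F : L1 mu F -> \int[mu]_x F (x + a) = \int[mu]_x F x.
Proof.
move=> hF; have mF := L1_meas hF.
have E x : F x = `|F x| - (`|F x| - F x) by ring.
have h1 := L1_abs hF; have h2 := L1B h1 hF.
have Fge x : 0 <= `|F x| - F x by rewrite subr_ge0 ler_norm.
transitivity (\int[mu]_x `|F x| - \int[mu]_x (`|F x| - F x)); last first.
  by rewrite -IntB//; apply: eq_Rintegral => x _; rewrite -E.
rewrite -(@Int_shift_ge0 a (fun x => `|F x|) (L1_meas h1))//.
rewrite -(@Int_shift_ge0 a (fun x => `|F x| - F x) (L1_meas h2) Fge).
rewrite -(IntB (L1_shift a h1) (L1_shift a h2)).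
by apply: eq_Rintegral => x _; rewrite -E.
Qed.

(** Continuity of translations in L^1, phrased along sequences because dominated convergence is a
    statement on sequences. *)
Definition transl F := forall w : nat -> V, w n @[n --> \oo] --> (0 : V) ->
  (\int[mu]_x `|F (x + w n) - F x|) @[n --> \oo] --> (0 : R).

Let L1_transl F a : L1 mu F -> L1 mu (fun x => `|F (x + a) - F x|).
Proof. by move=> hF; apply/L1_abs/L1B => //; exact: L1_shift. Qed.

Lemma transl_approx F : L1 mu F ->
  (forall e, 0 < e -> exists G, [/\ L1 mu G, transl G & \int[mu]_x `|F x - G x| < e]) ->
  transl F.
Proof.
move=> hF h w w0; apply/cvgrPdist_lt => e e0.
have [|G [hG tG FG]] := h (e / 3); first by lra.
have := tG w w0 => /cvgrPdist_lt/(_ (e / 3)) - /(_ ltac:(lra)).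
apply: filterS => n; rewrite !sub0r !normrN => nG.
have hFG := L1B hF hG.
rewrite ger0_norm ?Int_ge0//.
apply: (@le_lt_trans _ _ (\int[mu]_x ((`|F (x + w n) - G (x + w n)| + `|F x - G x|)
  + `|G (x + w n) - G x|))).
  apply: Int_le.
  - exact: L1_transl.
  - apply: L1D; last exact: L1_transl.
    by apply: L1D; apply: L1_abs => //; exact: (L1_shift _ hFG).
  - move=> x; have := ler_normD (F (x + w n) - G (x + w n)) (G x - F x).
    rewrite (distrC (G x)).
    have := ler_normD (F (x + w n) - G (x + w n) + (G x - F x)) (G (x + w n) - G x).
    rewrite (_ : _ + (G (x + w n) - G x) = F (x + w n) - F x); last by ring.
    lra.
rewrite IntD; [|by apply: L1D; apply: L1_abs => //; exact: (L1_shift _ hFG)|exact: L1_transl].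
rewrite IntD; [|by apply: L1_abs; exact: (L1_shift _ hFG)|by apply: L1_abs].
rewrite (@Int_shift _ (fun x => `|F x - G x|)); last exact: L1_abs.
by move: nG; rewrite ger0_norm ?Int_ge0//; lra.
Qed.

Lemma translD F G : L1 mu F -> L1 mu G -> transl F -> transl G ->
  transl (fun x => F x + G x).
Proof.
move=> hF hG tF tG w w0.
apply: (@squeeze_cvgr _ _ _ _ (fun=> 0)
  (fun n => \int[mu]_x `|F (x + w n) - F x| + \int[mu]_x `|G (x + w n) - G x|)).
- apply: nearW => n; rewrite Int_ge0//= -IntD; try exact: L1_transl.
  apply: Int_le.
  + by apply: (L1_transl (F := fun x => F x + G x)); exact: L1D.
  + by apply: L1D; exact: L1_transl.
  + by move=> x; rewrite opprD addrACA ler_normD.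
- exact: cvg_cst.
- by rewrite -(addr0 (0 : R)); apply: cvgD; [exact: tF|exact: tG].
Qed.

Lemma translZ c F : L1 mu F -> transl F -> transl (fun x => c * F x).
Proof.
move=> hF tF w w0.
rewrite (_ : (fun n => _) = (fun n => `|c| * \int[mu]_x `|F (x + w n) - F x|)).
  rewrite -(mulr0 `|c|); apply: cvgM; [exact: cvg_cst|exact: tF].
apply/funext => n; rewrite -IntZ; last exact: L1_transl.
by apply: eq_Rintegral => x _; rewrite -mulrBr normrM.
Qed.

Lemma transl_sum (I : Type) (s : seq I) (F : I -> V -> R) :
  (forall i, L1 mu (F i)) -> (forall i, transl (F i)) ->
  transl (fun x => \sum_(i <- s) F i x).
Proof.
move=> h t; elim: s => [|a s IH].
  rewrite (_ : (fun x : V => _) = fun=> 0); last by apply/funext => x; rewrite big_nil.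
  move=> w _; rewrite (_ : (fun n => _) = fun=> 0); first exact: cvg_cst.
  apply/funext => n; rewrite -[RHS](@Rintegral_set0 _ V R mu (cst 0)) /Rintegral.
  by rewrite integral_set0; under eq_integral do rewrite subrr normr0; rewrite integral0.
rewrite (_ : (fun x : V => _) = fun x => F a x + \sum_(j <- s) F j x); last first.
  by apply/funext => x; rewrite big_cons.
by apply: translD => //; exact: L1_sum.
Qed.

Lemma leb_bounded_lty (A : set V) (r : R) : measurable A -> A `<=` ball 0 r ->
  (mu A < +oo)%E.
Proof.
move=> mA Ar; pose s := `|r| + 1; have s0 : 0 < s by rewrite /s; have := normr_ge0 r; lra.
apply: (@le_lt_trans _ _ (mu (ball (0 : V) s))).
  apply: le_measure; rewrite ?inE//.
    by apply: measurable_rV_open; exact: ball_open.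
  by apply: (subset_trans Ar); apply: le_ball; rewrite /s; have := ler_norm r; lra.
by rewrite (_ : mu _ = ((2 * s) ^+ d)%:E) ?ltry//; exact: leb_ball.
Qed.

(** Both indicators have the same integral, so the L^1 distance is twice the integral of 1_U(x) (1 -
    1_U(x + w)). This one-sided expression tends to 0 at every point because [U] is open. *)
Lemma transl_open (U : set V) r : open U -> U `<=` ball 0 r -> transl (\1_U : V -> R).
Proof.
move=> oU Ur w w0.
have mU : measurable U by exact: measurable_rV_open.
have hU : L1 mu (\1_U : V -> R) by apply: L1_indic => //; exact: leb_bounded_lty Ur.
have mUw a : measurable_fun setT (fun x : V => (\1_U (x + a) : R)).
  by apply: (measurableT_comp _ (measurable_shift_rV a)); exact: measurable_indic.
have i01 (x : V) : 0 <= (\1_U x : R) <= 1 by rewrite indicE; case: (_ \in _); rewrite /= ?lexx ler01.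
have hUw a : L1 mu (fun x => \1_U x * (1 - \1_U (x + a)) : R).
  apply: (L1M hU (c := 1)); first exact: measurable_funB.
  by move=> x; have := i01 (x + a); rewrite ler_norml; lra.
have E a : \int[mu]_x `|\1_U (x + a) - \1_U x : R| = 2 * \int[mu]_x (\1_U x * (1 - \1_U (x + a))).
  rewrite -IntZ//; rewrite -[RHS]add0r -[X in X + _](subrr (\int[mu]_x (\1_U x : R))).
  rewrite -{1}(Int_shift a hU) -IntB//; last exact: (L1_shift a hU).
  rewrite -IntD; last 2 first.
  - by apply: L1B => //; exact: (L1_shift a hU).
  - by apply: (L1Z 2 (hUw a)).
  apply: eq_Rintegral => x _; rewrite !indicE.
  by case: (_ \in _); case: (_ \in _); rewrite /= ?(mul1r,mul0r,mulr0,mulr1,subr0,subrr,addr0,add0r,sub0r,normrN,normr0,normr1)//; ring.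
under eq_fun do rewrite E.
rewrite -(mulr0 2); apply: cvgM; first exact: cvg_cst.
rewrite -[X in _ --> X](Int0 mu).
apply: (@Int_dct _ _ _ _ _ _ (\1_U)) => //.
- by move=> n; exact: L1_meas (hUw (w n)).
- move=> n x; have := i01 x; have := i01 (x + w n) => h1 h2.
  rewrite ger0_norm; last by apply: mulr_ge0; lra.
  by rewrite ler_piMr//; lra.
- move=> x; have [Ux|nUx] := pselect (U x); last first.
    by rewrite indicE memNset//; under eq_fun do rewrite mul0r; exact: cvg_cst.
  have h : x + w n @[n --> \oo] --> x + 0 by apply: cvgD => //; exact: cvg_cst.
  rewrite addr0 in h.
  have hU' : \forall n \near \oo, U (x + w n) by exact: (h U (open_nbhs_nbhs (conj oU Ux))).
  apply: cvg_near_cst.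
  by apply: filterS hU' => n Un; rewrite !indicE !mem_set//= subrr mulr0.
Qed.

Lemma L1_approx F (G : nat -> V -> R) g : (forall n, L1 mu (G n)) ->
  (forall n x, `|G n x| <= g x) -> (forall x, G n x @[n --> \oo] --> F x) -> L1 mu g ->
  L1 mu F -> forall e, 0 < e -> exists n, \int[mu]_x `|F x - G n x| < e.
Proof.
move=> hG Gg GF hg hF e e0.
have : \int[mu]_x `|F x - G n x| @[n --> \oo] --> \int[mu]_x (0 : R).
  apply: (@Int_dct _ _ _ _ _ _ (fun x => `|F x| + g x)).
  - by move=> n; apply: L1_meas (L1_abs (L1B hF (hG n))).
  - move=> n x; rewrite normr_id (le_trans (ler_normB _ _))//.
    by rewrite lerD.
  - move=> x; rewrite -[X in _ --> X](normr0 R) -(subrr (F x)).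
    by apply: cvg_norm; apply: cvgB; [exact: cvg_cst|exact: GF].
  - by apply: L1D => //; exact: L1_abs.
rewrite Int0.
move=> /cvgrPdist_lt/(_ _ e0)[N _ /(_ N (leqnn _))] /=.
rewrite sub0r normrN ger0_norm ?Int_ge0// => h; by exists N.
Qed.

Lemma indic_le (A B : set V) x : A `<=` B -> `|\1_A x| <= (\1_B x : R).
Proof.
move=> AB; rewrite !indicE; case: (boolP (x \in A)) => [|_]; last by rewrite normr0 ler0n.
by rewrite inE => /AB xB; rewrite mem_set// normr1.
Qed.

(** The sets with this property form a Dynkin class that contains the open sets. The intersection
    with a ball keeps complements of finite measure. *)
Lemma transl_ball (A : set V) r : measurable A -> transl (\1_(A `&` ball 0 r) : V -> R).
Proof.
move=> mA; have mB : measurable (ball (0 : V) r).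
  by apply: measurable_rV_open; exact: ball_open.
have hL (B : set V) : measurable B -> L1 mu (\1_(B `&` ball 0 r) : V -> R).
  move=> mB'; apply: L1_indic; first exact: measurableI.
  by apply: leb_bounded_lty; [exact: measurableI|exact: subIsetr].
move: A mA.
apply: (@dynkin_induction _ V [set U | open U] (fun A : set V => transl (\1_(A `&` ball 0 r) : V -> R))) => //.
- by move=> A B /= oA oB; exact: openI.
- by rewrite setTI; apply: (@transl_open _ r) => //; exact: ball_open.
- move=> U /= oU; apply: (@transl_open _ r); last exact: subIsetr.
  by apply: openI => //; exact: ball_open.
- move=> S mS tS.
  rewrite (_ : \1__ = fun x => \1_(setT `&` ball 0 r) x + (-1) * (\1_(S `&` ball 0 r) x : R)).
    apply: translD; first exact: hL.
    - by apply: L1Z; exact: hL.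
    - by rewrite setTI; apply: (@transl_open _ r) => //; exact: ball_open.
    - by apply: translZ => //; exact: hL.
  apply/funext => x; rewrite setTI !indicE !in_setI in_setC.
  by case: (x \in S); case: (_ \in _) => /=; ring.
- move=> F mF tF hF.
  have mU : measurable (\bigcup_k F k) by exact: bigcupT_measurable.
  apply: transl_approx; first exact: hL.
  move=> e e0.
  pose G n x : R := \1_((\big[setU/set0]_(i < n) F i) `&` ball 0 r) x.
  have mUn n : measurable (\big[setU/set0]_(i < n) F i) by exact: bigsetU_measurable.
  have [|||||n hn] := @L1_approx (\1_(\bigcup_k F k `&` ball 0 r)) G (\1_(ball 0 r)) _ _ _ _ _ e e0.
  + by move=> n; exact: hL.
  + by move=> n x; apply: indic_le; exact: subIsetr.
  + move=> x; have [[[k _ Fkx] xr]|nF] := pselect ((\bigcup_k F k `&` ball 0 r) x).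
      apply: cvg_near_cst; exists k.+1 => // n /= kn.
      rewrite /G !indicE !mem_set//; split => //; first by exists k.
      by rewrite -bigcup_mkord; exists k.
    rewrite indicE memNset//; apply: cvg_near_cst; apply: nearW => n.
    rewrite /G indicE memNset// => -[]; rewrite -bigcup_mkord => -[k _ Fk] xr.
    by apply: nF; split => //; exists k.
  + by have := hL setT measurableT; rewrite setTI.
  + exact: hL.
  exists (G n); split => //; first exact: hL.
  rewrite (_ : G n = fun x => \sum_(i <- index_iota 0 n) (\1_(F i `&` ball 0 r) x : R)).
    by apply: transl_sum => // i; exact: hL.
  apply/funext => x; rewrite /G.
  elim: n {hn mUn} => [|n IH].
    by rewrite big_ord0 set0I indic0 big_geq.
  rewrite big_ord_recr/= big_nat_recr//=.
  rewrite setIUl -IH !indicE in_setU -natrD; congr (_%:R).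
  case: (boolP (x \in F n `&` ball 0 r)) => [|_]; last by rewrite orbF addn0.
  rewrite inE => -[Fn xr]; rewrite orbT memNset// => -[+ _].
  rewrite -bigcup_mkord => -[k /= kn Fk].
  have /trivIsetP/(_ k n Logic.I Logic.I) := tF.
  by rewrite neq_ltn kn => /(_ isT) /seteqP[/(_ x) + _]; apply.
Qed.

Lemma transl_indic (A : set V) : measurable A -> (mu A < +oo)%E -> transl (\1_A : V -> R).
Proof.
move=> mA Aoo.
have hA : L1 mu (\1_A : V -> R) by exact: L1_indic.
apply: transl_approx => // e e0.
have mB r : measurable (ball (0 : V) r).
  by apply: measurable_rV_open; exact: ball_open.
have hn n : L1 mu (\1_(A `&` ball 0 n%:R) : V -> R).
  apply: L1_indic; first exact: measurableI.
  by apply: leb_bounded_lty; [exact: measurableI|exact: subIsetr].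
have [|||||n h] := @L1_approx (\1_A) (fun n => \1_(A `&` ball 0 n%:R)) (\1_A) _ _ _ _ _ e e0 => //.
- by move=> n x; apply: indic_le; exact: subIsetl.
- move=> x; have [Ax|nA] := pselect (A x); last first.
    rewrite indicE memNset//; apply: cvg_near_cst; apply: nearW => n.
    by rewrite indicE memNset// => -[].
  apply: cvg_near_cst; exists (Num.truncn `|x|).+1 => // n /= xn.
  rewrite !indicE !mem_set//; split => //; apply/ball_rVE; rewrite subr0.
  by rewrite (lt_le_trans (truncnS_gt _))// ler_nat.
by exists (\1_(A `&` ball 0 n%:R)); split => //; exact: transl_ball.
Qed.

Import HBSimple.

Lemma transl_L1 F : L1 mu F -> transl F.
Proof.
move=> hF; apply: transl_approx => // e e0.
have [g_ [ig _ hg]] := approximation_sfun_integrable measurableT hF.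
have [N _ /(_ N (leqnn _)) /= hN] : \forall n \near \oo, (\int[mu]_z `|(F z)%:E - (g_ n z)%:E| < e%:E)%E.
  have := hg (fun y => (y < e%:E)%E); apply.
  by apply: open_ereal_lt'; rewrite lte_fin.
have igN : L1 mu (g_ N) by exact: ig.
exists (g_ N); split => //; last first.
  rewrite -lte_fin EFin_Rintegral//; exact/L1_abs/L1B.
rewrite (_ : (g_ N : V -> R) = fun x => \sum_(y <- finmap.enum_fset (fset_set (range (g_ N)))) y * (\1_(g_ N @^-1` [set y]) x)); last first.
  by apply/funext => x; rewrite {1}fimfunE fsbig_finite.
have m1 y : measurable (g_ N @^-1` [set y]) by exact: measurable_sfunP.
(* Chebyshev: on the level set of y the indicator is |g| / |y|. The level set of 0 may be infinite,
   which is why y = 0 is split off below. *)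
have fin y : y != 0 -> (mu (g_ N @^-1` [set y]) < +oo)%E.
  move=> y0; have : L1 mu (\1_(g_ N @^-1` [set y]) : V -> R).
    apply: (L1_le (g := fun x => `|y|^-1 * `|g_ N x|)).
    - exact: measurable_indic.
    - move=> x; rewrite indicE; case: (boolP (x \in _)) => [|_].
        by rewrite inE /= => ->; rewrite normr1 mulVf// normr_eq0.
      by rewrite normr0 mulr_ge0// invr_ge0.
    - exact/L1Z/L1_abs.
  move=> /integrableP[_]; rewrite (eq_integral (fun x => (\1_(g_ N @^-1` [set y]) x)%:E)).
    by rewrite integral_indic// setIT.
  by move=> x _ /=; rewrite ger0_norm.
apply: transl_sum => y.
  have [->|y0] := eqVneq y 0.
    by under eq_fun do rewrite mul0r; apply: integrable0.
  by apply: L1Z; apply: L1_indic => //; exact: fin.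
have [->|y0] := eqVneq y 0.
  have h : L1 mu (fun=> 0 : R) by exact: integrable0.
  rewrite (_ : (fun _ => _) = fun x => 0 * (0 : R)); last by apply/funext => x; rewrite !mul0r.
  move=> w _; rewrite (_ : (fun n => _) = fun=> 0); first exact: cvg_cst.
  apply/funext => n; rewrite /Rintegral.
  by under eq_integral do rewrite subrr normr0; rewrite integral0.
by apply: translZ; [apply: L1_indic => //; exact: fin|apply: transl_indic => //; exact: fin].
Qed.

End translation.

(** * Power inequalities and continuity of translations in L^p *)

Section powR_facts.
Variable R : realType.
Implicit Types a b c p x : R.

(** Each term is replaced by the largest one; no convexity is involved, since the size of the
    constant is immaterial. *)
Lemma powR_add3 p a b c : 0 <= p -> 0 <= a -> 0 <= b -> 0 <= c ->
  (a + b + c) `^ p <= 3 `^ p * (a `^ p + b `^ p + c `^ p).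
Proof.
move=> p0 a0 b0 c0.
have ap := powR_ge0 a p; have bp := powR_ge0 b p; have cp := powR_ge0 c p.
have H m : 0 <= m -> a <= m -> b <= m -> c <= m ->
    (a + b + c) `^ p <= 3 `^ p * m `^ p.
  move=> m0 am bm cm; rewrite -powRM//; apply: ge0_ler_powR => //.
  - by rewrite nnegrE; lra.
  - by rewrite nnegrE; lra.
  - by lra.
have L m s : m <= s -> 3 `^ p * m <= 3 `^ p * s by move=> ?; rewrite ler_wpM2l// powR_ge0.
have [ab|ba] := leP a b.
  have [bc|cb] := leP b c.
    by apply: (le_trans (H c _ _ _ _)) => //; [lra|apply: L; lra].
  by apply: (le_trans (H b _ _ _ _)) => //; [lra|apply: L; lra].
have [ac|ca] := leP a c.
  by apply: (le_trans (H c _ _ _ _)) => //; [lra|apply: L; lra].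
by apply: (le_trans (H a _ _ _ _)) => //; [lra|lra|apply: L; lra].
Qed.

Lemma powR_le_linear p a c : 1 <= p -> 0 <= a -> a <= c -> a `^ p <= c `^ (p - 1) * a.
Proof.
move=> p1 a0 ac; have [->|an0] := eqVneq a 0.
  by rewrite powR0 ?mulr0//; apply/eqP; lra.
rewrite -{1}(subrK 1 p) (@powRD _ a (p - 1) 1); last by rewrite an0 implybT.
rewrite powRr1// ler_wpM2r//; apply: ge0_ler_powR => //; rewrite ?nnegrE; lra.
Qed.

(* Young's inequality in the degenerate form that replaces Hoelder and Jensen. *)
Lemma le_young p a t : 1 <= p -> 0 <= a -> 0 < t -> a <= t + t `^ (1 - p) * a `^ p.
Proof.
move=> p1 a0 t0; have [at_|ta] := leP a t.
  by rewrite ler_wpDr// mulr_ge0// powR_ge0.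
have a1 : 0 < a by lra.
apply: (@le_trans _ _ (t `^ (1 - p) * a `^ p)); last lra.
have -> : a `^ p = a `^ (p - 1) * a.
  rewrite -{1}(subrK 1 p) (@powRD _ a (p - 1) 1) ?powRr1//.
  by rewrite (gt_eqF a1) implybT.
rewrite -[leLHS]mul1r mulrA ler_wpM2r//.
rewrite -(opprB p 1) powRN mulrC ler_pdivlMr ?powR_gt0// mul1r.
by apply: ge0_ler_powR => //; rewrite ?nnegrE; lra.
Qed.

End powR_facts.

Section translation_Lp.
Variables (R : realType) (d : nat).
Local Notation V := 'rV[R]_d.
Local Notation mu := (leb R d).
Implicit Types (f g F G k : V -> R).

Lemma measurable_powRl dT (T : measurableType dT) (p : R) (F : T -> R) :
  measurable_fun setT F -> measurable_fun setT (fun x => F x `^ p).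
Proof. by move=> mF; exact: (measurableT_comp (measurable_powR p)). Qed.

Lemma near0_seq (P : V -> R -> Prop) (Q : V -> R) :
  (forall w : nat -> V, w n @[n --> \oo] --> (0 : V) -> Q (w n) @[n --> \oo] --> (0 : R)) ->
  forall e, 0 < e -> exists2 r, 0 < r & forall w, `|w| < r -> `|Q w| < e.
Proof.
move=> h e e0; apply: contrapT => H.
have /choice[w hw] : forall n : nat, exists w : V, `|w| < n.+1%:R^-1 /\ ~ (`|Q w| < e).
  move=> n; apply: contrapT => H2; apply: H; exists n.+1%:R^-1.
    by rewrite invr_gt0 ltr0n.
  by move=> w wn; apply: contrapT => nw; apply: H2; exists w.
have w0 : w n @[n --> \oo] --> (0 : V).
  apply/cvgr0Pnorm_lt => r r0.
  have [N _ hN] : \forall n \near \oo, (n.+1%:R^-1 : R) < r.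
    exact: (near_infty_natSinv_lt (PosNum r0)).
  by exists N => // n /hN /=; apply: lt_trans; exact: (hw n).1.
have /cvgr0Pnorm_lt/(_ _ e0)[N _ /(_ N (leqnn _))] := h w w0.
exact: (hw N).2.
Qed.

Lemma transl_delta F : L1 mu F -> forall e, 0 < e ->
  exists2 r, 0 < r & forall w, `|w| < r -> \int[mu]_x `|F (x + w) - F x| < e.
Proof.
move=> hF e e0.
have [r r0 hr] := @near0_seq (fun _ _ => True) (fun w => \int[mu]_x `|F (x + w) - F x|)
  (transl_L1 hF) e e0.
by exists r => // w /hr; rewrite ger0_norm// Int_ge0.
Qed.

Lemma L1_powR_shiftB (p : R) G a b : 0 <= p -> measurable_fun setT G ->
  L1 mu (fun x => `|G x| `^ p) -> L1 mu (fun x => `|G (x + a) - G (x + b)| `^ p).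
Proof.
move=> p0 mG hG.
have mGs c : measurable_fun setT (fun x : V => G (x + c)).
  exact: (measurableT_comp mG (measurable_shift_rV c)).
refine (@L1_le _ V R mu _ (fun x : V => 3 `^ p * (`|G (x + a)| `^ p + `|G (x + b)| `^ p)) _ _ _).
- by apply: measurable_powRl; apply: measurableT_comp => //; exact: measurable_funB.
- move=> x; rewrite ger0_norm ?powR_ge0//.
  have h := @powR_add3 _ p `|G (x + a)| `|G (x + b)| 0 p0 (normr_ge0 _) (normr_ge0 _) (lexx _).
  apply: (@le_trans _ _ ((`|G (x + a)| + `|G (x + b)| + 0) `^ p)).
    by apply: ge0_ler_powR => //; rewrite ?nnegrE ?addr0 ?addr_ge0 ?ler_normB//.
  have [p00|pn] := eqVneq p 0; last by move: h; rewrite powR0// [X in _ <= _ * X]addr0.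
  rewrite p00 !powRr0; lra.
- by apply: L1Z; apply: L1D; [exact: (L1_shift a hG)|exact: (L1_shift b hG)].
Qed.

Definition clamp (c y : R) := Num.max (- c) (Num.min c y).

Lemma clampP c y : 0 <= c ->
  [\/ y < - c /\ clamp c y = - c, - c <= y <= c /\ clamp c y = y | c < y /\ clamp c y = c].
Proof.
move=> c0; rewrite /clamp; have [h1|h1] := ltP c y.
  apply: Or33; split => //; have [|] := leP (- c) c => //; lra.
have [h2|h2] := leP (- c) y; first by apply: Or32; split => //; lra.
by apply: Or31.
Qed.

Lemma clamp_lip c y z : 0 <= c -> `|clamp c y - clamp c z| <= `|y - z|.
Proof.
move=> c0; rewrite ler_norml; have := ler_norm (y - z); have := ler_norm (z - y).
rewrite distrC.
by have [[? ->]|[? ->]|[? ->]] := clampP y c0;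
  have [[? ->]|[? ->]|[? ->]] := clampP z c0; lra.
Qed.

Lemma clamp_le c y : 0 <= c -> `|clamp c y| <= c.
Proof.
by move=> c0; rewrite ler_norml; have [[? ->]|[? ->]|[? ->]] := clampP y c0; lra.
Qed.

Lemma clamp_id c y : `|y| <= c -> clamp c y = y.
Proof.
move=> yc; have c0 : 0 <= c by apply: le_trans yc.
by move: yc; rewrite ler_norml; have [[? ->]|[? ->]|[? ->]] := clampP y c0; lra.
Qed.

Lemma clampB_le c y : 0 <= c -> `|y - clamp c y| <= `|y|.
Proof.
move=> c0; rewrite ler_norml; have := ler_norm y; have := ler_norm (- y); rewrite normrN.
by have [[? ->]|[? ->]|[? ->]] := clampP y c0; lra.
Qed.

Lemma measurable_clamp c : measurable_fun setT (clamp c).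
Proof.
by apply: measurable_maxr; [exact: measurable_cst|apply: measurable_minr; [exact: measurable_cst|exact: measurable_id]].
Qed.

(** [G] is truncated at a level N: the remainder is small in L^p by dominated convergence, and for
    the bounded part the p-th power is controlled by the L^1 distance, where translation is already
    continuous. *)
Lemma transl_Lp (p : R) G : 1 <= p -> L1 mu G -> L1 mu (fun x => `|G x| `^ p) ->
  forall e, 0 < e -> exists2 r, 0 < r & forall w, `|w| < r ->
    \int[mu]_x `|G (x + w) - G x| `^ p < e.
Proof.
move=> p1 hG hGp e e0; have mG := L1_meas hG.
have p0 : 0 <= p by lra.
have P3 : 0 < 3 `^ p :> R by rewrite powR_gt0.
pose D n x := `|G x - clamp n%:R (G x)| `^ p.
have mD n : measurable_fun setT (D n).
  apply: measurable_powRl; apply: measurableT_comp => //; apply: measurable_funB => //.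
  exact: (measurableT_comp (measurable_clamp _)).
have D_le n x : `|D n x| <= `|G x| `^ p.
  rewrite ger0_norm ?powR_ge0//; apply: ge0_ler_powR => //; rewrite ?nnegrE//.
  exact: clampB_le.
have LD n : L1 mu (D n) by exact: (L1_le (mD n) (D_le n) hGp).
have : \int[mu]_x D n x @[n --> \oo] --> \int[mu]_x (0 : R).
  apply: (Int_dct mD D_le _ hGp) => x; apply: cvg_near_cst.
  exists (Num.truncn `|G x|).+1 => // n /= xn.
  rewrite /D clamp_id ?subrr ?normr0 ?powR0//; first by apply/eqP; lra.
  by apply/ltW; rewrite (lt_le_trans (truncnS_gt _))// ler_nat.
(* Three error terms, each multiplied by 3^p through [powR_add3], will contribute at most e / 4
   apiece. *)
have e1 : 0 < e / (4 * 3 `^ p) by rewrite divr_gt0// mulr_gt0.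
rewrite Int0 => /cvgr0Pnorm_lt/(_ _ e1)[N _ /(_ N (leqnn _))] /=.
rewrite ger0_norm; last by apply: Int_ge0 => x; exact: powR_ge0.
(* Two values truncated at N differ by at most 2 N, so [powR_le_linear] applies with this factor. *)
move=> hN; pose c : R := (2 * N%:R) `^ (p - 1).
have c0 : 0 <= c by exact: powR_ge0.
have e2 : 0 < e / (4 * 3 `^ p * (1 + c)) by rewrite divr_gt0// mulr_gt0// ?mulr_gt0//; lra.
have [r r0 hr] := transl_delta hG e2; exists r => // w /hr wr.
have LT : L1 mu (fun x => `|G (x + w) - G x|) by apply/L1_abs/L1B => //; exact: L1_shift.
have LDw : L1 mu (fun x => D N (x + w)) by exact: L1_shift.
apply: (@le_lt_trans _ _ (\int[mu]_x (3 `^ p * (D N (x + w) + D N x + c * `|G (x + w) - G x|)))).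
  apply: Int_le.
  - have := @L1_powR_shiftB p G w 0 p0 mG hGp.
    by apply: eq_integrable => // x _ /=; rewrite addr0.
  - by apply/L1Z/L1D; [exact: L1D|exact: L1Z].
  - move=> x; set y := G (x + w); set z := G x.
    apply: (@le_trans _ _ ((`|y - clamp N%:R y| + `|z - clamp N%:R z| + `|clamp N%:R y - clamp N%:R z|) `^ p)).
      apply: ge0_ler_powR => //; rewrite ?nnegrE ?addr_ge0//.
      have := ler_normD (y - clamp N%:R y + (clamp N%:R y - clamp N%:R z)) (clamp N%:R z - z).
      rewrite (_ : _ + (_ - z) = y - z); last by ring.
      have := ler_normD (y - clamp N%:R y) (clamp N%:R y - clamp N%:R z).
      rewrite (distrC z); lra.
    apply: le_trans (powR_add3 _ _ _ _) _ => //.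
    rewrite ler_wpM2l ?powR_ge0// lerD2l.
    apply: (@le_trans _ _ (c * `|clamp N%:R y - clamp N%:R z|)).
      apply: powR_le_linear => //.
      have := clamp_le y (ler0n R N); have := clamp_le z (ler0n R N).
      have := ler_normB (clamp N%:R y) (clamp N%:R z); lra.
    by rewrite ler_wpM2l// clamp_lip.
rewrite IntZ; last by apply/L1D; [exact: L1D|exact: L1Z].
rewrite IntD; [|exact: L1D|exact: L1Z].
rewrite IntD// IntZ// (Int_shift w (LD N)).
have h1 : c * \int[mu]_x `|G (x + w) - G x| <= e / (4 * 3 `^ p).
  have := ltW wr; rewrite invfM mulrA => h.
  have c1 : 0 < 1 + c by lra.
  rewrite ler_pdivlMr// in h.
  by apply: le_trans h; rewrite [leLHS]mulrC; apply: ler_wpM2l; [exact: Int_ge0|lra].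
have : 3 `^ p * (e / (4 * 3 `^ p)) = e / 4 by field; rewrite gt_eqF.
have hN' := ltW hN.
have : 3 `^ p * (\int[mu]_x D N x) < 3 `^ p * (e / (4 * 3 `^ p)) by rewrite ltr_pM2l.
have : 3 `^ p * (c * \int[mu]_x `|G (x + w) - G x|) <= 3 `^ p * (e / (4 * 3 `^ p)).
  by rewrite ler_pM2l.
rewrite !mulrDr; lra.
Qed.

End translation_Lp.

(** * Averages against a kernel *)

Section swap.
Context d1 d2 (T1 : measurableType d1) (T2 : measurableType d2) (R : realType).
Variable m1 : {sigma_finite_measure set T1 -> \bar R}.
Variable m2 : {sigma_finite_measure set T2 -> \bar R}.
Variables (f : T1 -> T2 -> R) (g : T2 -> R).

(** The bound [g] shows that the absolute double integral is finite in one order, and Tonelli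
    carries this to the other. The integrability of the inner integral is kept because averages need
    it. *)
Lemma Int_swap_dom : measurable_fun setT (fun z => f z.1 z.2) ->
  (forall x, L1 m2 (f x)) -> (forall y, L1 m1 (f ^~ y)) -> L1 m2 g ->
  (forall y, \int[m1]_x `|f x y| <= g y) ->
  \int[m1]_x \int[m2]_y f x y = \int[m2]_y \int[m1]_x f x y /\
  L1 m1 (fun x => \int[m2]_y f x y).
Proof.
move=> mf f1 f2 hg fg.
have mfa : measurable_fun setT (fun z : T1 * T2 => `|f z.1 z.2|%:E).
  by apply/measurable_EFinP; exact: measurableT_comp.
have mg : measurable_fun setT (EFin \o g) by apply/measurable_EFinP; exact: L1_meas hg.
have g0 y : 0 <= g y by rewrite (le_trans _ (fg y))// Int_ge0.
have fin : (\int[m2]_y \int[m1]_x `|f x y|%:E < +oo)%E.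
  apply: (@le_lt_trans _ _ (\int[m2]_y (g y)%:E)%E); last first.
    by rewrite -EFin_Rintegral// ltry.
  apply: ge0_le_integral => //.
  - by move=> y _; exact: integral_ge0.
  - exact: (measurable_fun_fubini_tonelli_G (fun z => `|f z.1 z.2|%:E)).
  - by move=> y _; rewrite -EFin_Rintegral ?lee_fin//; exact: L1_abs.
have fin2 : (\int[m1]_x \int[m2]_y `|f x y|%:E < +oo)%E.
  by rewrite (fubini_tonelli (fun z => `|f z.1 z.2|%:E)).
split; first exact: Int_swap.
have mfe : measurable_fun setT (EFin \o (fun z => f z.1 z.2)) by exact/measurable_EFinP.
have := (integrable12ltyP m1 m2 mfe).2 fin2 => /(@integrable_fubini_F _ _ _ _ _ _ _ _)/=.
apply: eq_integrable => // x _ /=.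
by rewrite EFin_Rintegral.
Qed.

End swap.

Section wavg.
Variables (R : realType) (d : nat).
Local Notation V := 'rV[R]_d.
Local Notation mu := (leb R d).
Implicit Types (f g F G k : V -> R).

(** [h] is the radius of the support and [K] a bound for the height; both enter the estimates. *)
Definition is_kernel k (h K : R) := [/\ measurable_fun setT k,
  forall z, 0 <= k z <= K, forall z, h <= `|z| -> k z = 0, 0 < h & \int[mu]_z k z = 1].

Definition wavg F k x := \int[mu]_z (F (x + z) * k z).

Lemma measurable_shiftl (a : V) F : measurable_fun setT F ->
  measurable_fun setT (fun z => F (a + z)).
Proof.
move=> mF; have := measurableT_comp mF (measurable_shift_rV a).
by apply: eq_measurable_fun => x _ /=; rewrite addrC.
Qed.

Lemma L1_shiftl (a : V) F : L1 mu F -> L1 mu (fun z => F (a + z)).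
Proof.
by move=> /(L1_shift a); apply: eq_integrable => // x _ /=; rewrite addrC.
Qed.

Lemma Int_shiftl (a : V) F : L1 mu F -> \int[mu]_z F (a + z) = \int[mu]_z F z.
Proof.
move=> hF; rewrite -(Int_shift a hF); apply: eq_Rintegral => x _.
by rewrite addrC.
Qed.

Lemma measurable_ball0 (x : V) (h : R) : measurable (ball x h).
Proof. by apply: measurable_rV_open; exact: ball_open. Qed.

Lemma L1_ball (x : V) (h : R) : 0 < h -> L1 mu (\1_(ball x h) : V -> R).
Proof.
move=> h0; apply: L1_indic; first exact: measurable_ball0.
apply: (@le_lt_trans _ _ ((2 * h) ^+ d)%:E); last exact: ltry.
by rewrite le_eqVlt; apply/orP; left; apply/eqP; exact: leb_ball.
Qed.

Lemma Int_ball (x : V) (h : R) : 0 < h -> \int[mu]_z (\1_(ball x h) z : R) = (2 * h) ^+ d.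
Proof.
move=> h0; apply: EFin_inj; rewrite EFin_Rintegral; last exact: L1_ball.
rewrite integral_indic ?setIT//; last exact: measurable_ball0.
exact: leb_ball.
Qed.

Lemma kernel_le k h K z : is_kernel k h K -> k z <= K * \1_(ball 0 h) z.
Proof.
move=> [mk kK k0 h0 _]; rewrite indicE; case: (boolP (z \in _)) => [_|].
  by rewrite mulr1; have := kK z; lra.
rewrite mulr0 notin_setE => nb; rewrite k0// leNgt; apply/negP => zh; apply: nb.
by apply/ball_rVE; rewrite subr0.
Qed.

Lemma kernel_norm k h K z : is_kernel k h K -> `|k z| <= K.
Proof. by move=> [_ /(_ z) ? _ _ _]; rewrite ler_norml; lra. Qed.

Lemma kernel_L1 k h K : is_kernel k h K -> L1 mu k.
Proof.
move=> hk; have [mk kK k0 h0 _] := hk.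
apply: (L1_le mk _ (L1Z K (L1_ball 0 h0))) => z.
by rewrite ger0_norm ?(kernel_le z hk)//; have := kK z; lra.
Qed.

Lemma wavg_L1 F k h K x : L1 mu F -> is_kernel k h K -> L1 mu (fun z => F (x + z) * k z).
Proof.
move=> hF hk; have [mk _ _ _ _] := hk; apply: (L1M (L1_shiftl x hF) mk (c := K)) => z.
exact: (kernel_norm z hk).
Qed.

Lemma wavg_abs F k h K x : L1 mu F -> is_kernel k h K ->
  `|wavg F k x| <= wavg (fun y => `|F y|) k x.
Proof.
move=> hF hk; apply: Int_abs_le.
- exact: wavg_L1 hk.
- exact: wavg_L1 (L1_abs hF) hk.
- by move=> z; rewrite normrM [X in _ * X]ger0_norm//; case: hk => _ /(_ z)/andP[].
Qed.

Lemma wavg_le F G k h K x : L1 mu F -> L1 mu G -> is_kernel k h K ->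
  (forall z, `|z| < h -> F (x + z) <= G (x + z)) -> wavg F k x <= wavg G k x.
Proof.
move=> hF hG hk FG; apply: Int_le; [exact: wavg_L1 hk|exact: wavg_L1 hk|].
move=> z; have [_ kK k0 _ _] := hk; have [zh|hz] := ltP `|z| h.
  by rewrite ler_wpM2r ?FG//; have := kK z; lra.
by rewrite k0// !mulr0.
Qed.

Lemma wavgD F G k h K x : L1 mu F -> L1 mu G -> is_kernel k h K ->
  wavg (fun y => F y + G y) k x = wavg F k x + wavg G k x.
Proof.
move=> hF hG hk; rewrite /wavg -IntD; [|exact: wavg_L1 hk|exact: wavg_L1 hk].
by apply: eq_Rintegral => z _; rewrite mulrDl.
Qed.

Lemma wavgB F G k h K x : L1 mu F -> L1 mu G -> is_kernel k h K ->
  wavg (fun y => F y - G y) k x = wavg F k x - wavg G k x.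
Proof.
move=> hF hG hk; rewrite /wavg -IntB; [|exact: wavg_L1 hk|exact: wavg_L1 hk].
by apply: eq_Rintegral => z _; rewrite mulrBl.
Qed.

Lemma wavg_near F k h K x c e : L1 mu F -> is_kernel k h K ->
  (forall z, `|z| < h -> `|F (x + z) - c| <= e) -> `|wavg F k x - c| <= e.
Proof.
move=> hF hk Fe; have [mk kK k0 h0 k1] := hk; have hkL := kernel_L1 hk.
have -> : wavg F k x - c = \int[mu]_z (F (x + z) * k z - c * k z).
  rewrite IntB; [|exact: wavg_L1 hk|exact: L1Z].
  by rewrite IntZ// k1 mulr1.
have -> : e = \int[mu]_z (e * k z) by rewrite IntZ// k1 mulr1.
apply: Int_abs_le; [apply: L1B; [exact: wavg_L1 hk|exact: L1Z]|exact: L1Z|].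
move=> z; rewrite -mulrBl normrM (ger0_norm (_ : 0 <= k z)); last by have := kK z; lra.
have [zh|hz] := ltP `|z| h; last by rewrite k0// !mulr0.
by rewrite ler_wpM2r ?Fe//; have := kK z; lra.
Qed.

(** Only the bound on the kernel is used, not its regularity: the difference falls on [F], and
    continuity of averages follows from continuity of translations. *)
Lemma wavg_lip F k h K x y : L1 mu F -> is_kernel k h K ->
  `|wavg F k x - wavg F k y| <= K * \int[mu]_z `|F (z + (x - y)) - F z|.
Proof.
move=> hF hk; have [mk kK _ _ _] := hk.
have hD : L1 mu (fun z => `|F (z + (x - y)) - F z|).
  by apply/L1_abs/L1B => //; exact: L1_shift.
rewrite -(Int_shiftl y hD) -IntZ; last exact: (L1_shiftl y hD).
rewrite -IntB; [|exact: wavg_L1 hk|exact: wavg_L1 hk].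
apply: Int_abs_le.
- by apply: L1B; exact: wavg_L1 hk.
- exact: (L1Z K (L1_shiftl y hD)).
- move=> z; rewrite -mulrBl normrM mulrC (_ : y + z + (x - y) = x + z).
    by rewrite ler_wpM2r// (kernel_norm z hk).
  by rewrite [y + z]addrC -addrA [y + _]addrC subrK addrC.
Qed.

Lemma wavg_continuous F k h K : L1 mu F -> is_kernel k h K -> continuous (wavg F k).
Proof.
move=> hF hk x; apply/continuous_rVP => e e0; have [mk kK _ _ _] := hk.
have K0 : 0 <= K by have := kK 0; lra.
have e1 : 0 < e / (K + 1) by rewrite divr_gt0//; lra.
have [r r0 hr] := transl_delta hF e1.
exists r => // y; rewrite distrC => yr; rewrite distrC.
apply: le_lt_trans (wavg_lip _ _ hF hk) _.
have := hr _ yr; rewrite ltr_pdivlMr; last lra.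
have : 0 <= \int[mu]_z `|F (z + (x - y)) - F z| by exact: Int_ge0.
set I := Rintegral _ _ _; nra.
Qed.

Lemma wavg_measurable F k h K : L1 mu F -> is_kernel k h K ->
  measurable_fun setT (wavg F k).
Proof. by move=> hF hk; apply: continuous_measurable_rV; exact: wavg_continuous hk. Qed.

Lemma measurable_add_pair : measurable_fun setT (fun z : V * V => z.1 + z.2).
Proof. by apply: measurable_funD_rV; [exact: measurable_fst|exact: measurable_snd]. Qed.

Lemma L1_wavg F k h K : L1 mu F -> is_kernel k h K -> L1 mu (wavg F k).
Proof.
move=> hF hk; have [mk kK _ _ _] := hk; have mF := L1_meas hF.
have mF2 : measurable_fun setT (fun z : V * V => F (z.1 + z.2)).
  exact: (measurableT_comp mF measurable_add_pair).
have [] := @Int_swap_dom _ _ _ _ _ mu mu (fun x z => F (x + z) * k z)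
  (fun z => (\int[mu]_x `|F x|) * k z) => //.
- apply: measurable_funM => //.
  by apply: (measurableT_comp mk); exact: measurable_snd.
- by move=> x; exact: wavg_L1 hk.
- move=> z; under eq_fun do rewrite mulrC; apply: L1Z; exact: (L1_shift z hF).
- exact/L1Z/(kernel_L1 hk).
- move=> z; under eq_Rintegral do rewrite normrM mulrC.
  rewrite IntZ; last exact: (L1_abs (L1_shift z hF)).
  rewrite (Int_shift z (L1_abs hF)) mulrC ger0_norm//.
  by have := kK z; lra.
Qed.

(** This is what allows averages at two different scales to be compared: both are close to the
    common double average. *)
Lemma wavg_comm F k1 h1 K1 k2 h2 K2 x : L1 mu F -> is_kernel k1 h1 K1 -> is_kernel k2 h2 K2 ->
  wavg (wavg F k1) k2 x = wavg (wavg F k2) k1 x.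
Proof.
move=> hF hk1 hk2; have [mk1 kK1 _ _ _] := hk1; have [mk2 kK2 _ _ _] := hk2.
have mF := L1_meas hF.
have mF2 : measurable_fun setT (fun z : V * V => F (x + z.1 + z.2)).
  under eq_fun do rewrite -addrA.
  exact: (measurableT_comp (measurable_shiftl x mF) measurable_add_pair).
have [] := @Int_swap_dom _ _ _ _ _ mu mu (fun z1 z2 => F (x + z1 + z2) * k2 z2 * k1 z1)
  (fun z => (K1 * \int[mu]_x `|F x|) * k2 z).
- apply: measurable_funM; first apply: measurable_funM => //.
  + by apply: (measurableT_comp mk2); exact: measurable_snd.
  + by apply: (measurableT_comp mk1); exact: measurable_fst.
- move=> z1; under eq_fun do rewrite mulrC; apply: L1Z; exact: wavg_L1 hk2.
- move=> z2; apply: (L1M _ mk1 (c := K1)) => [|z]; last exact: kernel_norm hk1.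
  under eq_fun do rewrite mulrC; apply: L1Z.
  under eq_fun do rewrite -addrA (addrC _ z2) addrA.
  exact: (L1_shiftl (x + z2) hF).
- exact/L1Z/(kernel_L1 hk2).
- move=> z2.
  have hL : L1 mu (fun z1 => `|F (x + z1 + z2)|).
    apply: L1_abs; under eq_fun do rewrite -addrA (addrC _ z2) addrA.
    exact: (L1_shiftl (x + z2) hF).
  apply: (@le_trans _ _ (\int[mu]_z1 (K1 * k2 z2 * `|F (x + z1 + z2)|))).
    apply: Int_le.
    + apply: L1_abs; apply: (L1M _ mk1 (c := K1)) => [|z]; last exact: kernel_norm hk1.
      under eq_fun do rewrite mulrC; apply: L1Z.
      by apply: L1_abs_inv => //; exact: (measurableT_comp mF2 (pair2_measurable z2)).
    + exact: L1Z.
    + move=> z1; have k20 : 0 <= k2 z2 by have := kK2 z2; lra.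
      rewrite !normrM (ger0_norm k20) (_ : K1 * _ * _ = `|F (x + z1 + z2)| * k2 z2 * K1); last by ring.
      by rewrite ler_wpM2l ?mulr_ge0// (kernel_norm _ hk1).
  rewrite IntZ// mulrAC le_eqVlt; apply/orP; left; apply/eqP; congr (_ * _ * _).
  under eq_Rintegral do rewrite -addrA (addrC _ z2) addrA.
  exact: (Int_shiftl (x + z2) (L1_abs hF)).
move=> H _; rewrite /wavg.
transitivity (\int[mu]_z2 \int[mu]_z1 (F (x + z1 + z2) * k2 z2 * k1 z1)).
  apply: eq_Rintegral => z2 _; rewrite mulrC -IntZ; last exact: wavg_L1 hk1.
  by apply: eq_Rintegral => z1 _; rewrite mulrA (mulrC (k2 z2)) -(addrA x) (addrC z2) addrA.
rewrite -H; apply: eq_Rintegral => z1 _; rewrite mulrC -IntZ; last exact: wavg_L1 hk2.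
by apply: eq_Rintegral => z2 _; rewrite mulrC.
Qed.

End wavg.

Section wavg_estimates.
Variables (R : realType) (d : nat).
Local Notation V := 'rV[R]_d.
Local Notation mu := (leb R d).
Implicit Types (f g F G H k : V -> R).

(** A substitute for Hoelder's inequality: [le_young] is integrated over the support of the kernel,
    of volume (2 h)^d, and [t] is left free. *)
Lemma wavg_bound G k h K p t x : 1 <= p -> L1 mu G -> L1 mu (fun y => `|G y| `^ p) ->
  is_kernel k h K -> 0 < t ->
  wavg (fun y => `|G y|) k x <= K * (t * (2 * h) ^+ d + t `^ (1 - p) * \int[mu]_y `|G y| `^ p).
Proof.
move=> p1 hG hGp hk t0; have [mk kK _ h0 _] := hk; have K0 : 0 <= K by have := kK 0; lra.
have hB : L1 mu (\1_(ball 0 h) : V -> R) by exact: L1_ball.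
have hGs : L1 mu (fun z => `|G (x + z)| `^ p) by exact: (L1_shiftl x hGp).
rewrite -(Int_ball 0 h0) -(Int_shiftl x hGp) -IntZ// -IntZ// -IntD; [|exact: L1Z|exact: L1Z].
rewrite -IntZ; last by apply: L1D; exact: L1Z.
apply: Int_le; [exact: wavg_L1 (L1_abs hG) hk|by apply/L1Z/L1D; exact: L1Z|].
move=> z; have k1 := kernel_le z hk; have k0 := kK z.
have y1 := le_young p1 (normr_ge0 (G (x + z))) t0.
have P0 : 0 <= t `^ (1 - p) * `|G (x + z)| `^ p by rewrite mulr_ge0 ?powR_ge0.
have G0 := normr_ge0 (G (x + z)).
move: k1; rewrite indicE; case: (_ \in _) => /=; rewrite ?mulr1 ?mulr0 => k1.
  rewrite mulrC; apply: ler_pM => //; lra.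
have -> : k z = 0 by lra.
by rewrite mulr0 add0r mulr_ge0.
Qed.

(** Jensen's inequality up to the factor 2^p. As the kernel has mass 1, [le_young] integrates to a
    <= t + t^(1-p) J for every t > 0. *)
Lemma young_Int H k h K p : 1 <= p -> is_kernel k h K ->
  L1 mu (fun z => `|H z| * k z) -> L1 mu (fun z => `|H z| `^ p * k z) ->
  (\int[mu]_z (`|H z| * k z)) `^ p <= 2 `^ p * \int[mu]_z (`|H z| `^ p * k z).
Proof.
move=> p1 hk h1 hp; set a := Rintegral _ _ _; set J := Rintegral _ _ _.
have [mk kK _ h0 k1] := hk; have hkL := kernel_L1 hk.
have a0 : 0 <= a by apply: Int_ge0 => z; rewrite mulr_ge0//; have := kK z; lra.
have J0 : 0 <= J by apply: Int_ge0 => z; rewrite mulr_ge0 ?powR_ge0//; have := kK z; lra.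
have aT t : 0 < t -> a <= t + t `^ (1 - p) * J.
  move=> t0; rewrite /J -IntZ// -[X in X + _]mulr1 -{1}k1 -IntZ// -IntD; [|exact: L1Z|exact: L1Z].
  apply: Int_le => //; first by apply: L1D; exact: L1Z.
  move=> z; rewrite mulrA -mulrDl ler_wpM2r//; first by have := kK z; lra.
  exact: le_young.
have [J00|Jn] := eqVneq J 0.
  have -> : a = 0.
    apply/eqP; rewrite eq_le a0 andbT; apply/ler_addgt0Pr => e e0.
    by have := aT e e0; rewrite J00 mulr0 addr0 add0r.
  by rewrite powR0 ?mulr_ge0 ?powR_ge0//; apply/eqP; lra.
have Jp : 0 < J by rewrite lt_neqAle eq_sym Jn.
(* For t = J^(1/p) the two terms of the bound are equal. *)
have := aT (J `^ p^-1) (powR_gt0 _ Jp).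
rewrite -powRrM -[X in _ * X]powRr1// -powRD; last by rewrite Jn implybT.
rewrite (_ : p^-1 * (1 - p) + 1 = p^-1); last by field; apply/eqP; lra.
move=> ale; apply: (@le_trans _ _ ((2 * J `^ p^-1) `^ p)).
  by apply: ge0_ler_powR; rewrite ?nnegrE ?mulr_ge0 ?powR_ge0//; lra.
by rewrite powRM ?powR_ge0// -powRrM mulVf ?powRr1//; apply/eqP; lra.
Qed.

(** The p-th power is moved inside the average by [young_Int] and the integrals are exchanged. The
    displacement [v] is carried along for the averages shifted into the cones. *)
Lemma wavg_Lp F k h K p v e : 1 <= p -> L1 mu F -> L1 mu (fun y => `|F y| `^ p) ->
  is_kernel k h K -> 
  (forall z, `|z| < h -> \int[mu]_x `|F (x + (v + z)) - F x| `^ p <= e) ->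
  L1 mu (fun x => `|wavg F k (x + v) - F x| `^ p) /\
  \int[mu]_x `|wavg F k (x + v) - F x| `^ p <= 2 `^ p * e.
Proof.
move=> p1 hF hFp hk Fe; have [mk kK k0 h0 k1] := hk; have hkL := kernel_L1 hk.
have mF := L1_meas hF; have p0 : 0 <= p by lra.
have e0 : 0 <= e.
  have := Fe 0; rewrite normr0 => /(_ h0); apply: le_trans.
  by apply: Int_ge0 => x; exact: powR_ge0.
pose H x z := F (x + (v + z)) - F x.
have LH x : L1 mu (fun z => `|H x z| `^ p * k z).
  have h3 : L1 mu (fun z => 3 `^ p * (`|F (x + v + z)| `^ p * k z) + 3 `^ p * ((`|F x| `^ p) * k z)).
    by apply: L1D; apply: L1Z; [exact: (wavg_L1 (x + v) hFp hk)|exact: L1Z].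
  apply: (L1_le _ _ h3).
    apply: measurable_funM => //; apply: measurable_powRl; apply: measurableT_comp => //.
    apply: measurable_funB => //; under eq_fun do rewrite addrA; exact: measurable_shiftl.
  move=> z; have kz : 0 <= k z by have := kK z; lra.
  rewrite normrM (ger0_norm kz) ger0_norm ?powR_ge0// !mulrA -mulrDl ler_wpM2r// -mulrDr.
  apply: (@le_trans _ _ ((`|F (x + v + z)| + `|F x| + 0) `^ p)).
    by apply: ge0_ler_powR => //; rewrite ?nnegrE ?addr0 ?addr_ge0// /H addrA ler_normB.
  have := powR_add3 p0 (normr_ge0 (F (x + v + z))) (normr_ge0 (F x)) (lexx 0).
  by rewrite powR0 ?addr0//; apply/eqP; lra.
have LH1 x : L1 mu (fun z => `|H x z| * k z).
  have h3 : L1 mu (fun z => `|F (x + v + z)| * k z + `|F x| * k z).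
    by apply: L1D; [exact: (wavg_L1 (x + v) (L1_abs hF) hk)|exact: L1Z].
  apply: (L1_le _ _ h3).
    apply: measurable_funM => //; apply: measurableT_comp => //.
    apply: measurable_funB => //; under eq_fun do rewrite addrA; exact: measurable_shiftl.
  move=> z; have kz : 0 <= k z by have := kK z; lra.
  by rewrite normrM normr_id (ger0_norm kz) -mulrDl ler_wpM2r// /H addrA ler_normB.
have pt x : `|wavg F k (x + v) - F x| `^ p <= 2 `^ p * \int[mu]_z (`|H x z| `^ p * k z).
  apply: le_trans (young_Int p1 hk (LH1 x) (LH x)).
  apply: ge0_ler_powR; rewrite ?nnegrE//.
    by apply: Int_ge0 => z; rewrite mulr_ge0//; have := kK z; lra.
  have -> : wavg F k (x + v) - F x = \int[mu]_z (F (x + v + z) * k z - F x * k z).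
    rewrite IntB; [|exact: wavg_L1 hk|exact: L1Z].
    by rewrite IntZ// k1 mulr1.
  apply: Int_abs_le => //; first by apply: L1B; [exact: wavg_L1 hk|exact: L1Z].
  move=> z; rewrite -mulrBl normrM (ger0_norm (_ : 0 <= k z)); last by have := kK z; lra.
  by rewrite /H addrA.
have Lx z : L1 mu (fun x => `|H x z| `^ p).
  have := @L1_powR_shiftB _ _ p F (v + z) 0 p0 mF hFp.
  by apply: eq_integrable => // x _ /=; rewrite addr0.
have [sw LI] : \int[mu]_x \int[mu]_z (`|H x z| `^ p * k z) =
    \int[mu]_z \int[mu]_x (`|H x z| `^ p * k z) /\
    L1 mu (fun x => \int[mu]_z (`|H x z| `^ p * k z)).
  apply: (@Int_swap_dom _ _ _ _ _ mu mu (fun x z => `|H x z| `^ p * k z) (fun z => e * k z)) => //.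
  - apply: measurable_funM; last by apply: (measurableT_comp mk); exact: measurable_snd.
    apply: measurable_powRl; apply: measurableT_comp => //; apply: measurable_funB.
      apply: (measurableT_comp mF); apply: measurable_funD_rV; first exact: measurable_fst.
      by apply: measurable_funD_rV => //; exact: measurable_snd.
    by apply: (measurableT_comp mF); exact: measurable_fst.
  - by move=> z; under eq_fun do rewrite mulrC; exact: L1Z.
  - exact: L1Z.
  - move=> z; have kz : 0 <= k z by have := kK z; lra.
    under eq_Rintegral do rewrite ger0_norm ?mulr_ge0 ?powR_ge0// mulrC.
    rewrite IntZ// mulrC; have [zh|hz] := ltP `|z| h; last by rewrite k0// !mulr0.
    by rewrite ler_wpM2r ?Fe.
have LC : L1 mu (fun x => `|wavg F k (x + v) - F x| `^ p).
  apply: (L1_le _ _ (L1Z (2 `^ p) LI)).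
    apply: measurable_powRl; apply: measurableT_comp => //; apply: measurable_funB => //.
    exact: (measurableT_comp (wavg_measurable hF hk) (measurable_shift_rV v)).
  by move=> x; rewrite (ger0_norm (powR_ge0 _ _)); exact: pt.
split => //; apply: (@le_trans _ _ (2 `^ p * \int[mu]_x \int[mu]_z (`|H x z| `^ p * k z))).
  by rewrite -(IntZ _ LI); apply: (Int_le LC (L1Z _ LI)) => x; exact: pt.
rewrite ler_wpM2l ?powR_ge0// sw.
rewrite -[leRHS]mulr1 -k1 -IntZ//.
have LI2 : L1 mu (fun z => \int[mu]_x (`|H x z| `^ p * k z)).
  have [] // := @Int_swap_dom _ _ _ _ _ mu mu (fun z x => `|H x z| `^ p * k z) (fun x => \int[mu]_z (`|H x z| `^ p * k z)).
  - apply: measurable_funM; last by apply: (measurableT_comp mk); exact: measurable_fst.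
    apply: measurable_powRl; apply: measurableT_comp => //; apply: measurable_funB.
      apply: (measurableT_comp mF); apply: measurable_funD_rV; first exact: measurable_snd.
      by apply: measurable_funD_rV => //; exact: measurable_fst.
    by apply: (measurableT_comp mF); exact: measurable_snd.
  - by move=> z; under eq_fun do rewrite mulrC; exact: L1Z.
  - move=> x; apply: Int_le => //; first exact: L1_abs.
    move=> z; rewrite ger0_norm// mulr_ge0 ?powR_ge0//; have := kK z; lra.
apply: Int_le => //; first exact: L1Z.
move=> z; have kz : 0 <= k z by have := kK z; lra.
under eq_Rintegral do rewrite mulrC.
rewrite IntZ// mulrC; have [zh|hz] := ltP `|z| h; last by rewrite k0// !mulr0.
by rewrite ler_wpM2r ?Fe.
Qed.

Lemma wavg_cvg_Lp F p e : 1 <= p -> L1 mu F -> L1 mu (fun y => `|F y| `^ p) -> 0 < e ->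
  exists2 r, 0 < r & forall k h K v, is_kernel k h K -> `|v| + h < r ->
  L1 mu (fun x => `|wavg F k (x + v) - F x| `^ p) /\
  \int[mu]_x `|wavg F k (x + v) - F x| `^ p < e.
Proof.
move=> p1 hF hFp e0; have P2 : 0 < 2 `^ p :> R by rewrite powR_gt0.
have e1 : 0 < e / (2 * 2 `^ p) by rewrite divr_gt0// mulr_gt0.
have [r r0 hr] := transl_Lp p1 hF hFp e1; exists r => // k h K v hk vh.
have [|h1 h2] := @wavg_Lp F k h K p v (e / (2 * 2 `^ p)) p1 hF hFp hk.
  move=> z zh; apply/ltW/hr; apply: le_lt_trans (ler_normD v z) _; apply: lt_trans vh.
  by rewrite ltrD2l.
split => //; apply: le_lt_trans h2 _.
have -> : 2 `^ p * (e / (2 * 2 `^ p)) = e / 2 by field; rewrite gt_eqF.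
by rewrite ltr_pdivrMr// ltr_pMr// ltr1n.
Qed.

Lemma wavg_cvg_L1 F e : L1 mu F -> 0 < e ->
  exists2 r, 0 < r & forall k h K, is_kernel k h K -> h < r ->
  \int[mu]_x `|wavg F k x - F x| < e.
Proof.
move=> hF e0.
have hF1 : L1 mu (fun y => `|F y| `^ 1).
  by under eq_fun do rewrite powRr1//; exact: L1_abs.
have [r r0 hr] := wavg_cvg_Lp (lexx 1) hF hF1 e0; exists r => // k h K hk hr'.
have [_] := hr k h K 0 hk ltac:(by rewrite normr0 add0r).
by under eq_Rintegral do rewrite addr0 powRr1//.
Qed.

End wavg_estimates.

(** * Smooth kernels and weak gradients *)

Section derive_helpers.
Variable R : realType.

(** Directional derivatives become derivatives in one real variable, to which the mean value theorem
    and differentiation under the integral apply. *)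
Lemma is_derive_lineP (V W : normedModType R) (f : V -> W) x v l (t : R) :
  is_derive (x + t *: v) v f l <-> is_derive t 1 (fun s : R => f (x + s *: v)) l.
Proof.
have E (h : R) : f (h *: v + (x + t *: v)) = f (x + (h *: (1 : R) + t) *: v).
  by rewrite [h%:A]mulr1 scalerDl addrCA.
have E2 : (fun h : R => h^-1 *: ((f \o shift (x + t *: v)) (h *: v) - f (x + t *: v))) =
   (fun h : R => h^-1 *: (((fun s : R => f (x + s *: v)) \o shift t) (h *: 1) - f (x + t *: v))).
  by apply/funext => h /=; rewrite -E.
have D1 : derivable f (x + t *: v) v <-> derivable (fun s : R => f (x + s *: v)) t 1.
  by rewrite /derivable E2.
have D2 : 'D_v f (x + t *: v) = 'D_1 (fun s : R => f (x + s *: v)) t.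
  by rewrite /derive E2.
by split=> -[d1 d2]; split; first [exact/D1|rewrite ?D2// -?D2].
Qed.

Lemma is_derive_line (V W : normedModType R) (f : V -> W) x v l :
  is_derive x v f l <-> is_derive (0 : R) 1 (fun s : R => f (x + s *: v)) l.
Proof. by rewrite -is_derive_lineP scale0r addr0. Qed.

Section lambda_forms.
Variable V : normedModType R.
Implicit Types (f g : V -> R) (x v : V) (a b c : R).

Lemma dfD f g x v a b : is_derive x v f a -> is_derive x v g b ->
  is_derive x v (fun y => f y + g y) (a + b).
Proof. by move=> hf hg; exact: is_deriveD. Qed.

Lemma dfB f g x v a b : is_derive x v f a -> is_derive x v g b ->
  is_derive x v (fun y => f y - g y) (a - b).
Proof. by move=> hf hg; exact: is_deriveB. Qed.

Lemma dfN f x v a : is_derive x v f a -> is_derive x v (fun y => - f y) (- a).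
Proof. by move=> hf; exact: is_deriveN. Qed.

Lemma dfZ c f x v a : is_derive x v f a -> is_derive x v (fun y => c * f y) (c * a).
Proof. by move=> hf; exact: is_deriveZ. Qed.

Lemma dfM f g x v a b : is_derive x v f a -> is_derive x v g b ->
  is_derive x v (fun y => f y * g y) (a * g x + f x * b).
Proof.
move=> hf hg; apply: (is_derive_eq (is_deriveM hf hg)).
by rewrite addrC [g x *: a]mulrC.
Qed.

Lemma dfX n f x v a : is_derive x v f a ->
  is_derive x v (fun y => f y ^+ n) (n%:R * f x ^+ n.-1 * a).
Proof. by move=> hf; have := is_deriveX n hf; rewrite exprfctE. Qed.

Lemma dfV f x v a : f x != 0 -> is_derive x v f a ->
  is_derive x v (fun y => (f y)^-1) (- (f x) ^- 2 * a).
Proof.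
by move=> fx [h <-]; split; [exact: derivableV|rewrite deriveV].
Qed.

Lemma df_sum (I : Type) (s : seq I) (F : I -> V -> R) (D : I -> R) x v :
  (forall i, is_derive x v (F i) (D i)) ->
  is_derive x v (fun y => \sum_(i <- s) F i y) (\sum_(i <- s) D i).
Proof.
move=> h; elim: s => [|i s IH].
  rewrite big_nil (_ : (fun y => _) = cst 0); first exact: is_derive_cst.
  by apply/funext => y; rewrite big_nil.
rewrite big_cons (_ : (fun y => _) = fun y => F i y + \sum_(i <- s) F i y).
  exact: dfD.
by apply/funext => y; rewrite big_cons.
Qed.

End lambda_forms.

Lemma is_derive_affine (f : R -> R) (a b t l : R) : is_derive (a * t + b) 1 f l ->
  is_derive t 1 (fun s => f (a * s + b)) (a * l).
Proof.
move=> h; rewrite mulrC.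
have hg : is_derive t 1 (fun s : R => a * s + b) a.
  have h1 : is_derive t 1 (fun s : R => a * s) (a * 1).
    exact: (@is_deriveZ _ _ _ id a t 1 1 (is_derive_id _ _)).
  have := @is_deriveD _ _ _ _ _ _ _ _ _ h1 (is_derive_cst b t 1).
  by rewrite mulr1 addr0.
exact: (@is_derive1_comp R f (fun s => a * s + b) t l a h hg).
Qed.

Lemma is_derive_continuous (f : R -> R) (x l : R) : is_derive x 1 f l -> {for x, continuous f}.
Proof. by move=> [h _]; apply/differentiable_continuous/derivable1_diffP. Qed.

Lemma is_derive0_sq (f : R -> R) (c : R) : f 0 = 0 -> (forall t, `|t| <= 1 -> `|f t| <= c * t ^+ 2) ->
  is_derive (0 : R) 1 f 0.
Proof.
move=> f0 fc; have c0 : 0 <= c.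
  have := fc 1; rewrite normr1 expr1n mulr1 => /(_ (lexx _)); exact: le_trans.
have h : h^-1 *: ((f \o shift 0) (h *: 1) - f 0) @[h --> 0^'] --> (0 : R).
  apply/cvgrPdist_lt => e e0; near=> t.
  rewrite sub0r normrN f0 subr0 /= addr0 [t *: _]mulr1 normrZ normfV.
  have t0 : 0 < `|t| by rewrite normr_gt0; near: t; exact: nbhs_dnbhs_neq.
  have te : `|t| < e / (c + 1).
    by near: t; apply: dnbhs0_lt; rewrite divr_gt0//; lra.
  have t1 : `|t| <= 1 by near: t; apply: dnbhs0_le.
  rewrite mulrC ltr_pdivrMr//; apply: le_lt_trans (fc t t1) _.
  rewrite -real_normK ?num_real// expr2 mulrA ltr_pM2r//.
  have : (c + 1) * `|t| < e by rewrite mulrC -ltr_pdivlMr//; lra.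
  nra.
by split; [apply/cvg_ex; exists 0|exact: cvg_lim].
Unshelve. all: by end_near. Qed.

End derive_helpers.

Section bump1.
Variable R : realType.
Implicit Types (t x : R) (k : nat).

(** The functions x^-k exp(-1/x), extended by 0. The derivative of one is a combination of two
    others, so the family is stable under differentiation. *)
Definition exp_inv k x : R := if 0 < x then x^-1 ^+ k * expR (- x^-1) else 0.

Lemma exp_inv_ge0 k x : 0 <= exp_inv k x.
Proof.
rewrite /exp_inv; case: ifP => // x0.
by rewrite mulr_ge0 ?expR_ge0// exprn_ge0// invr_ge0 ltW.
Qed.

(** The exponential of y = 1/x is at least y^N / N! with N = k + m + 1. The case m = 1 gives the
    quadratic bound needed for the derivative at 0. *)
Lemma exp_inv_le k m x : 0 < x -> exp_inv k x <= (k + m).+1`!%:R * x ^+ m.+1.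
Proof.
move=> x0; rewrite /exp_inv x0 expRN.
have y0 : 0 < x^-1 by rewrite invr_gt0.
have := @expR_ge1Dxn R x^-1 (k + m) (ltW y0).
have F0 : 0 < (k + m).+1`!%:R :> R by rewrite ltr0n fact_gt0.
move=> h; have {}h : x^-1 ^+ (k + m).+1 / (k + m).+1`!%:R <= expR x^-1.
  by apply: le_trans h; rewrite lerDr.
rewrite ler_pdivrMr ?expR_gt0//.
apply: (@le_trans _ _ ((k + m).+1`!%:R * x ^+ m.+1 * (x^-1 ^+ (k + m).+1 / (k + m).+1`!%:R))).
  have -> : (k + m).+1`!%:R * x ^+ m.+1 * (x^-1 ^+ (k + m).+1 / (k + m).+1`!%:R) =
      x^-1 ^+ k * (x * x^-1) ^+ m.+1 * ((k + m).+1`!%:R / (k + m).+1`!%:R).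
    by rewrite -addnS exprD exprMn; set F := (_`!)%:R; ring.
  by rewrite !divff ?gt_eqF// expr1n !mulr1.
by rewrite ler_pM2l// mulr_gt0// exprn_gt0.
Qed.

Lemma is_derive_exp_inv k x : is_derive x 1 (exp_inv k) (exp_inv k.+2 x - k%:R * exp_inv k.+1 x).
Proof.
have [x0|x0|->] := ltgtP x 0.
- have e0 j y : y <= 0 -> exp_inv j y = 0 by rewrite /exp_inv leNgt => /negbTE ->.
  rewrite !e0 ?ltW// mulr0 subr0.
  refine (near_eq_is_derive _ (is_derive_cst (0 : R) x 1)).
  near=> y; rewrite e0// ltW//; near: y; exact: lt_nbhsl.
- have xn0 : x != 0 by rewrite gt_eqF.
  have hi : is_derive x 1 (fun y : R => y^-1) (- x ^- 2 * 1).
    exact: (dfV xn0 (is_derive_id x (1 : R))).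
  rewrite mulr1 in hi.
  have hk := dfX k hi.
  have he : is_derive x 1 (fun y : R => expR (- y^-1)) (expR (- x^-1) * - - x ^- 2).
    exact: (@is_derive1_comp R expR (fun y => - y^-1) x _ _ (is_derive_expR _) (dfN hi)).
  refine (near_eq_is_derive _ (is_derive_eq (dfM hk he) _)).
    near=> y; rewrite /exp_inv ifT//; near: y; exact: lt_nbhsr.
  rewrite /exp_inv x0 opprK -exprVn; case: k {hk} => [|k] /=; first by rewrite !mul0r !expr0; ring.
  by rewrite !exprS; ring.
- rewrite /exp_inv ltxx mulr0 subrr.
  apply: (@is_derive0_sq _ _ (k + 1).+1`!%:R); first by rewrite ltxx.
  move=> t _; case: ifPn => t0; last by rewrite normr0 mulr_ge0// sqr_ge0.
  have := @exp_inv_le k 1 t t0; have := exp_inv_ge0 k t.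
  by rewrite /exp_inv t0 => h0; rewrite ger0_norm.
Unshelve. all: by end_near. Qed.

(* Membership in a class closed under differentiation encodes infinite differentiability. *)
Definition smooth1 (f : R -> R) : Prop := exists P : (R -> R) -> Prop, P f /\
  forall g, P g -> exists2 g', P g' & forall x, is_derive x 1 g (g' x).

Inductive bump_class : (R -> R) -> Prop :=
| bump_gen c j k : bump_class (fun t => c * t ^+ j * exp_inv k (1 - t ^+ 2))
| bump_add f g : bump_class f -> bump_class g -> bump_class (fun t => f t + g t).

Definition bump t := exp_inv 0 (1 - t ^+ 2).

Lemma smooth1_bump : smooth1 bump.
Proof.
exists bump_class; split.
  have -> : bump = fun t => 1 * t ^+ 0 * exp_inv 0 (1 - t ^+ 2).
    by apply/funext => t; rewrite expr0 !mul1r.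
  exact: bump_gen.
move=> g; elim=> [c j k|f1 f2 _ [f1' P1 d1] _ [f2' P2 d2]]; last first.
  exists (fun t => f1' t + f2' t); first exact: bump_add.
  by move=> x; exact: is_deriveD.
exists (fun t => (c * j%:R * t ^+ j.-1 * exp_inv k (1 - t ^+ 2)) +
  ((-2 * c) * t ^+ j.+1 * exp_inv k.+2 (1 - t ^+ 2) +
   (2 * c * k%:R) * t ^+ j.+1 * exp_inv k.+1 (1 - t ^+ 2))).
  by apply: bump_add; [exact: bump_gen|apply: bump_add; exact: bump_gen].
move=> x.
have h0 := is_derive_id x (1 : R).
have h2 := dfB (is_derive_cst (1 : R) x 1) (dfX 2 h0).
have h3 := @is_derive1_comp R (exp_inv k) (fun t => 1 - t ^+ 2) _ _ _ (is_derive_exp_inv _ _) h2.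
apply: (is_derive_eq (dfM (dfZ c (dfX j h0)) h3)) => /=.
rewrite expr1 ![x ^+ j.+1]exprS; set E := exp_inv _ _; set E2 := exp_inv _ _; set E1 := exp_inv k.+1 _.
ring.
Qed.

Lemma smooth1_derive f : smooth1 f -> exists2 f', smooth1 f' & forall x, is_derive x 1 f (f' x).
Proof. by move=> [P [Pf h]]; have [f' Pf' d] := h f Pf; exists f' => //; exists P. Qed.

Lemma smooth1_affine f a b : smooth1 f -> smooth1 (fun t => f (a * t + b)).
Proof.
move=> [P [Pf hP]].
exists (fun g => exists2 f, P f & exists c, g = fun t => c * f (a * t + b)); split.
  by exists f => //; exists 1; apply/funext => t; rewrite mul1r.
move=> _ [g Pg [c ->]]; have [g' Pg' d] := hP g Pg.
exists (fun t => c * a * g' (a * t + b)); first by exists g' => //; exists (c * a).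
by move=> x; rewrite -mulrA; apply: is_deriveZ; exact: is_derive_affine.
Qed.

Lemma smooth1_continuous f : smooth1 f -> continuous f.
Proof. by move=> /smooth1_derive[f' _ d] x; exact: is_derive_continuous (d x). Qed.

Lemma bump_ge0 t : 0 <= bump t. Proof. exact: exp_inv_ge0. Qed.

Lemma bump_le1 t : bump t <= 1.
Proof.
rewrite /bump /exp_inv; case: ifP => // h; rewrite expr0 mul1r expR_le1 oppr_le0 invr_ge0.
exact: ltW.
Qed.

Lemma bump_gt0 t : (0 < bump t) = (`|t| < 1).
Proof.
rewrite /bump /exp_inv subr_gt0 (_ : (t ^+ 2 < 1) = (`|t| < 1)).
  by case: ifP => h; rewrite ?ltxx// expr0 mul1r expR_gt0.
by rewrite -[t ^+ 2]real_normK ?num_real// expr_lt1.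
Qed.

(** The value of [bump] at 1/2, where 1 / (1 - t^2) = 4/3. *)
Definition bump_min : R := expR (- (4 / 3)).

Lemma bump_ge_min t : `|t| <= 1 / 2 -> bump_min <= bump t.
Proof.
move=> h; rewrite /bump /exp_inv; have t2 : t ^+ 2 <= 1 / 4.
  by rewrite -[t ^+ 2]real_normK ?num_real//; have := normr_ge0 t; nra.
rewrite ifT; last lra.
rewrite expr0 mul1r ler_expR lerN2 -[leRHS]invf_div lef_pV2 ?posrE; lra.
Qed.

End bump1.

Section bump_rV.
Variables (R : realType) (d : nat).
Local Notation V := 'rV[R]_d.
Local Notation mu := (leb R d).
Local Notation e_ := (@evec R d).

Definition prodfun (f : 'I_d -> R -> R) (x : V) : R := \prod_i f i (x 0 i).

Lemma is_derive_prodfun (f : 'I_d -> R -> R) (f' : R -> R) j (x : V) : is_derive (x 0 j) 1 (f j) (f' (x 0 j)) ->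
  is_derive x (e_ j) (prodfun f)
    (prodfun (fun i => if i == j then f' else f i) x).
Proof.
move=> hf; apply/is_derive_line.
have E (s : R) : prodfun f (x + s *: e_ j) =
    (\prod_(i | i != j) f i (x 0 i)) * f j (1 * s + x 0 j).
  rewrite /prodfun (bigD1 j)//= mulrC !mxE eqxx mulr1 mul1r addrC; congr (_ * _).
  by apply: eq_bigr => i ij; rewrite !mxE eq_sym (negbTE ij) mulr0 addr0.
rewrite (_ : (fun s : R => _) = fun s => (\prod_(i | i != j) f i (x 0 i)) * f j (1 * s + x 0 j)); last first.
  by apply/funext => s; rewrite E.
have h1 : is_derive (0 : R) 1 (fun s => f j (1 * s + x 0 j)) (1 * f' (x 0 j)).
  by apply: is_derive_affine; rewrite mulr0 add0r.
apply: (is_derive_eq (dfZ (\prod_(i | i != j) f i (x 0 i)) h1)).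
rewrite /prodfun [RHS](bigD1 j)//= eqxx mul1r mulrC; congr (_ * _).
by apply: eq_bigr => i ij; rewrite (negbTE ij).
Qed.

Lemma prodfun_continuous f : (forall i, continuous (f i)) -> continuous (prodfun f).
Proof.
move=> cf x; rewrite /prodfun; elim: (index_enum _) => [|i s IH].
  rewrite (_ : (fun x : V => _) = fun=> 1); first exact: cst_continuous.
  by apply/funext => y; rewrite big_nil.
rewrite (_ : (fun x : V => _) = fun x => f i (x 0 i) * \prod_(i <- s) f i (x 0 i)); last first.
  by apply/funext => y; rewrite big_cons.
apply: continuousM => //.
by apply: (@continuous_comp _ _ _ (fun x : V => x 0 i) (f i)); [exact: coord_continuous|exact: cf].
Qed.

(** A partial derivative of a product function is again a product function, with one factor
    differentiated; hence the induction on the order. *)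
Lemma smooth_prodfun f : (forall i, smooth1 (f i)) -> smooth (prodfun f).
Proof.
move=> hf k; elim: k f hf => [|k IH] f hf /=.
  by split => //; apply: prodfun_continuous => i; exact: smooth1_continuous.
split; first by apply: prodfun_continuous => i; exact: smooth1_continuous.
move=> j; have [f' sf' d'] := smooth1_derive (hf j).
have D (x : V) := is_derive_prodfun (d' (x 0 j)).
split; first by move=> x; case: (D x).
rewrite (_ : 'D__ _ = prodfun (fun i => if i == j then f' else f i)).
  by apply: IH => i; case: ifP.
by apply/funext => x; case: (D x).
Qed.

Definition Bump (c : V) (h : R) (x : V) := \prod_i bump (h^-1 * (x 0 i - c 0 i)).

Lemma smooth_Bump c h : smooth (Bump c h).
Proof.
rewrite (_ : Bump c h = prodfun (fun i t => bump (h^-1 * t + (- h^-1 * c 0 i)))).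
  by apply: smooth_prodfun => i; apply: smooth1_affine; exact: smooth1_bump.
by apply/funext => x; apply: eq_bigr => i _; congr bump; ring.
Qed.

Lemma Bump_ge0 c h x : 0 <= Bump c h x.
Proof. by apply: prodr_ge0 => i _; exact: bump_ge0. Qed.

Lemma Bump_le1 c h x : Bump c h x <= 1.
Proof. by apply: prodr_ile1 => i _; rewrite bump_ge0 bump_le1. Qed.

Let scale_norm (h a : R) : 0 < h -> (`|h^-1 * a| < 1) = (`|a| < h).
Proof. by move=> h0; rewrite normrM gtr0_norm ?invr_gt0// mulrC ltr_pdivrMr// mul1r. Qed.

Lemma Bump_gt0 c h x : 0 < h -> `|x - c| < h -> 0 < Bump c h x.
Proof.
move=> h0 /(normr_rVlt _ h0) H; apply: prodr_gt0 => i _.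
by rewrite bump_gt0 scale_norm//; have := H i; rewrite rVB.
Qed.

Lemma Bump_eq0 c h x : 0 < h -> h <= `|x - c| -> Bump c h x = 0.
Proof.
move=> h0 hx; apply/eqP; rewrite eq_le Bump_ge0 andbT leNgt; apply/negP => B0.
have : `|x - c| < h; last by lra.
apply/normr_rVlt => // i; rewrite rVB -scale_norm// -bump_gt0 lt_neqAle bump_ge0 andbT.
apply/negP => /eqP bi; move: B0; rewrite /Bump (bigD1 i)//= -bi mul0r; lra.
Qed.

Lemma Bump_ge_min c h x : 0 < h -> `|x - c| <= h / 2 -> bump_min R ^+ d <= Bump c h x.
Proof.
move=> h0; rewrite (normr_rVle (x - c)); last lra.
move=> H; rewrite -[X in _ ^+ X]card_ord -prodr_const; apply: ler_prod => i _.
rewrite expR_ge0/= bump_ge_min//; have := H i; rewrite rVB normrM gtr0_norm ?invr_gt0//.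
by rewrite [h^-1 * _]mulrC ler_pdivrMr// => ?; lra.
Qed.

Lemma ball_closure_compact (c : V) (h : R) : compact [set x : V | `|x - c| <= h].
Proof.
apply: bounded_closed_compact.
  exists (`|h| + `|c|); split; first exact: num_real.
  move=> M hM x /= xh; apply: ltW; apply: le_lt_trans hM.
  rewrite -[x in `|x|](subrK c); apply: le_trans (ler_normD _ _) _.
  by rewrite lerD2r (le_trans xh)// ler_norm.
rewrite (_ : [set x | _] = closed_ball_ (fun x : V => `|x|) c h).
  exact: closed_closed_ball_.
by apply/seteqP; split => x; rewrite /closed_ball_ /= distrC.
Qed.

Lemma test_fun_Bump (O : set V) c h : 0 < h -> (forall x, `|x - c| <= h -> O x) ->
  test_fun O (Bump c h).
Proof.
move=> h0 hO; split; first exact: smooth_Bump.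
exists [set x : V | `|x - c| <= h]; split; first exact: ball_closure_compact.
split => // x /= /negP; rewrite -ltNge => /ltW; exact: Bump_eq0.
Qed.

Lemma smooth_is_derive phi j (x : V) : smooth phi ->
  is_derive x (e_ j) phi ('D_(e_ j) phi x).
Proof. by move=> /(_ 1%N) [_ /(_ j) [/(_ x) h _]]; exact: derivableP. Qed.

Lemma smooth_continuous phi : @smooth R d phi -> continuous phi.
Proof. by move=> /(_ 0%N) []. Qed.

Lemma smooth_derive_continuous phi j : smooth phi -> continuous ('D_(e_ j) phi).
Proof. by move=> /(_ 1%N) [_ /(_ j) [_ []]]. Qed.

Lemma derive_eq0_out (K : set V) phi j x : compact K -> (forall x, ~ K x -> phi x = 0 :> R) ->
  ~ K x -> 'D_(e_ j) phi x = 0.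
Proof.
move=> cK phi0 nKx.
have oK : open (~` K) by apply: closed_openC; apply: compact_closed => //; exact: norm_hausdorff.
have -> : 'D_(e_ j) phi x = 'D_(e_ j) (cst (0 : R)) x.
  apply: near_eq_derive.
  by apply: filterS (open_nbhs_nbhs (conj oK nKx)) => y; exact: phi0.
exact: derive_cst.
Qed.

Lemma compact_supp_bounded (K : set V) (f : V -> R) : compact K -> continuous f ->
  (forall x, ~ K x -> f x = 0) -> exists2 C, 0 <= C & forall x, `|f x| <= C.
Proof.
move=> cK cf f0.
have cfK : compact (f @` K) by apply: continuous_compact => //; exact: continuous_subspaceT.
have /pinfty_ex_gt0[C C0 hC] := compact_bounded cfK.
exists C => //; first exact: ltW.
move=> x; have [Kx|/f0 ->] := pselect (K x); last by rewrite normr0 ltW.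
by apply: hC; exists x.
Qed.

Lemma compact_in_ball (K : set V) : compact K -> exists2 r, 0 < r & forall x, K x -> `|x| < r.
Proof.
move=> cK; have /pinfty_ex_gt0[C C0 hC] := compact_bounded cK.
exists (C + 1) => [|x /hC /= xC]; lra.
Qed.

End bump_rV.

Section kernel.
Variables (R : realType) (d : nat).
Local Notation V := 'rV[R]_d.
Local Notation mu := (leb R d).
Local Notation e_ := (@evec R d).

Definition bump_mass (h : R) : R := \int[mu]_z Bump 0 h z.
Definition kern (h : R) (z : V) : R := (bump_mass h)^-1 * Bump 0 h z.
Definition kern_cst : R := (bump_min R ^+ d)^-1.

Lemma measurable_smooth phi : @smooth R d phi -> measurable_fun setT phi.
Proof. by move=> /smooth_continuous; exact: continuous_measurable_rV. Qed.

Lemma measurable_Bump (c : V) h : measurable_fun setT (Bump c h).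
Proof. by apply: measurable_smooth; exact: smooth_Bump. Qed.

Lemma L1_Bump c h : 0 < h -> L1 mu (Bump c h).
Proof.
move=> h0; apply: (L1_le _ _ (L1_ball c h0)).
  exact: measurable_Bump.
move=> x; rewrite ger0_norm ?Bump_ge0// indicE; case: (boolP (x \in _)) => [_|].
  exact: Bump_le1.
rewrite notin_setE => nb; rewrite Bump_eq0//= leNgt; apply/negP => xc; apply: nb.
exact/ball_rVE.
Qed.

(** The cube of radius h / 2 has volume h^d, and each of the [d] factors is at least [bump_min] on
    it. This bounds the height of [kern] by [kern_cst] h^-d. *)
Lemma bump_mass_ge h : 0 < h -> bump_min R ^+ d * h ^+ d <= bump_mass h.
Proof.
move=> h0; have h2 : 0 < h / 2 by lra.
rewrite (_ : h ^+ d = (2 * (h / 2)) ^+ d); last by congr (_ ^+ _); field.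
rewrite -(Int_ball 0 h2) -IntZ; last exact: L1_ball.
apply: Int_le; [exact/L1Z/L1_ball|exact: L1_Bump|] => x; rewrite indicE.
case: (boolP (x \in _)) => [|_]; last by rewrite mulr0 Bump_ge0.
rewrite inE mulr1 => /ball_rVE xh; apply: Bump_ge_min => //; exact: ltW.
Qed.

Lemma kern_cst_gt0 : 0 < kern_cst.
Proof. by rewrite invr_gt0 exprn_gt0// expR_gt0. Qed.

Lemma bump_mass_gt0 h : 0 < h -> 0 < bump_mass h.
Proof.
by move=> h0; apply: lt_le_trans (bump_mass_ge h0); rewrite mulr_gt0 ?exprn_gt0 ?expR_gt0.
Qed.

Lemma kern_kernel h : 0 < h -> is_kernel (kern h) h (kern_cst * h ^- d).
Proof.
move=> h0; have c0 := bump_mass_gt0 h0; split => //.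
- by apply: measurable_funM => //; exact: measurable_Bump.
- move=> z; rewrite mulr_ge0 ?invr_ge0 ?Bump_ge0 ?(ltW c0)//=.
  apply: (@le_trans _ _ (bump_mass h)^-1).
    by rewrite ler_piMr ?invr_ge0 ?(ltW c0) ?Bump_le1.
  by rewrite /kern_cst -invfM lef_pV2 ?posrE ?mulr_gt0 ?exprn_gt0 ?expR_gt0// bump_mass_ge.
- by move=> z hz; rewrite /kern Bump_eq0 ?mulr0 ?subr0.
- by rewrite IntZ ?mulVf ?gt_eqF//; exact: L1_Bump.
Qed.

Lemma wavgE u h x : L1 mu u -> 0 < h ->
  wavg u (kern h) x = (bump_mass h)^-1 * \int[mu]_y (u y * Bump x h y).
Proof.
move=> hu h0; rewrite -(Int_shiftl x); last first.
  by apply: (L1M hu (c := 1)) => [|y]; [exact: measurable_Bump|rewrite ger0_norm ?Bump_ge0 ?Bump_le1].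
rewrite -IntZ; last first.
  apply: (L1_shiftl x (F := fun y => u y * Bump x h y)).
  by apply: (L1M hu (c := 1)) => [|y]; [exact: measurable_Bump|rewrite ger0_norm ?Bump_ge0 ?Bump_le1].
apply: eq_Rintegral => z _; rewrite mulrCA; congr (_ * _).
congr (_ * _); apply: eq_bigr => i _; congr (bump (_ * _)).
by rewrite !mxE; ring.
Qed.

Lemma derive_under_integral (f f' : R -> V -> R) (G : V -> R) : 
  (forall t : R, -1 < t < 1 -> L1 mu (f t)) ->
  (forall (t : R) (y : V), -1 < t < 1 -> is_derive t 1 (f^~ y) (f' t y)) ->
  (forall (t : R) (y : V), -1 < t < 1 -> `|f' t y| <= G y) -> L1 mu G ->
  is_derive (0 : R) 1 (fun t => \int[mu]_y f t y) (\int[mu]_y f' 0 y).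
Proof.
move=> hf hd hG LG.
have I0 : `](-1 : R), 1[%classic 0 by rewrite /= in_itv/= ltrN10 ltr01.
have E (t : R) (y : V) : -1 < t < 1 -> partial1of2 f t y = f' t y.
  by move=> ht; rewrite partial1of2E; case: (hd t y ht).
have IE (t : R) : `](-1 : R), 1[%classic t -> -1 < t < 1 by rewrite /= in_itv.
have G0 y : 0 <= G y by apply: le_trans (hG 0 y (IE _ I0)).
have i1 (x : R) : `](-1 : R), 1[%classic x -> mu.-integrable setT (EFin \o f x) by move=> /IE /hf.
have i2 (x : R) (y : V) : `](-1 : R), 1[%classic x -> [set: V] y -> derivable (f^~ y) x 1.
  by move=> /IE hx _; case: (hd x y hx).
have i3 (x : R) (y : V) : `](-1 : R), 1[%classic x -> [set: V] y -> `|partial1of2 f x y| <= G y.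
  by move=> /IE hx _; rewrite E// hG.
split.
  exact: (@derivable_under_integral R _ V mu f setT measurableT 0 _ _ I0 i1 i2 G G0 LG i3).
have := @differentiation_under_integral R _ V mu f setT measurableT 0 _ _ I0 i1 i2 G G0 LG i3.
rewrite derive1E => ->; apply: eq_Rintegral => y _; apply: E; exact: IE.
Qed.

Definition weak_grad (O : set V) (j : 'I_d) (u g : V -> R) :=
  forall phi, test_fun O phi ->
  \int[mu]_x (u x * 'D_(e_ j) phi x) = - \int[mu]_x (g x * phi x).

Lemma test_fun_bounded (O : set V) phi : test_fun O phi -> exists2 C, 0 <= C & forall x, `|phi x| <= C.
Proof.
move=> [sphi [K [cK [_ phi0]]]].
by apply: (compact_supp_bounded cK) => //; exact: smooth_continuous.
Qed.

Lemma test_fun_derive_bounded (O : set V) phi j : test_fun O phi ->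
  exists2 C, 0 <= C & forall x, `|'D_(e_ j) phi x| <= C.
Proof.
move=> [sphi [K [cK [_ phi0]]]].
apply: (compact_supp_bounded cK); first exact: smooth_derive_continuous.
by move=> x; exact: derive_eq0_out.
Qed.

(* Differentiating the kernel moves the derivative to a test function centred at [x]. *)
Lemma weak_grad_wavg (O : set V) j u g h x : L1 mu u -> L1 mu g -> weak_grad O j u g ->
  0 < h -> (forall y, `|y - x| <= h -> O y) ->
  is_derive x (e_ j) (wavg u (kern h)) (wavg g (kern h) x).
Proof.
move=> hu hg wg h0 hO.
have tB := test_fun_Bump h0 hO.
have [C C0 hC] := test_fun_derive_bounded j (test_fun_Bump h0 (fun y (_ : `|y - (0 : V)| <= h) => I)).
pose psi := 'D_(e_ j) (Bump (0 : V) h).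
have cpsi : continuous psi by apply: smooth_derive_continuous; exact: smooth_Bump.
have BumpE c y : Bump c h y = Bump 0 h (y - c).
  by apply: eq_bigr => i _; rewrite !mxE subr0.
(* The bump depends on y - c only, so moving its centre costs a sign; this sign cancels the one in
   [weak_grad]. *)
have dB (c y : V) (t : R) : is_derive t 1 (fun s : R => Bump (c + s *: e_ j) h y) (- psi (y - (c + t *: e_ j))).
  have /is_derive_lineP h1 : is_derive ((y - c) + (- t) *: e_ j) (e_ j) (Bump 0 h) (psi ((y - c) + (- t) *: e_ j)).
    exact/smooth_is_derive/smooth_Bump.
  have := @is_derive_affine R (fun s : R => Bump 0 h (y - c + s *: e_ j)) (-1) 0 t.
  rewrite addr0 mulN1r => /(_ _ h1).
  rewrite mulN1r scaleNr opprD addrA; congr (is_derive _ _ _ _).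
  by apply/funext => s; rewrite [RHS]BumpE addr0 mulN1r scaleNr opprD addrA.
apply/is_derive_line.
rewrite (_ : (fun s : R => _) = fun s : R => (bump_mass h)^-1 * \int[mu]_y (u y * Bump (x + s *: e_ j) h y)); last first.
  by apply/funext => s; rewrite wavgE.
rewrite wavgE//; apply: dfZ.
rewrite (_ : \int[mu]_y (g y * Bump x h y) = \int[mu]_y (u y * - psi (y - (x + 0 *: e_ j)))).
  apply: (@derive_under_integral (fun t y => u y * Bump (x + t *: e_ j) h y) (fun t y => u y * - psi (y - (x + t *: e_ j))) (fun y => `|u y| * C)).
  - move=> t _; apply: (L1M hu (c := 1)) => [|y]; [exact: measurable_Bump|].
    by rewrite ger0_norm ?Bump_ge0 ?Bump_le1.
  - by move=> t y _; rewrite normrM normrN ler_wpM2l//; exact: hC.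
  - by under eq_fun do rewrite mulrC; exact/L1Z/L1_abs.
apply: oppr_inj; rewrite -(wg _ tB) -IntN; last first.
  apply: (L1M hu (c := C)) => [|y]; last by rewrite normrN; exact: hC.
  apply: measurableT_comp => //.
  by apply: (measurableT_comp (continuous_measurable_rV cpsi)); exact: measurable_funB_rV.
apply: eq_Rintegral => y _; rewrite mulrN opprK scale0r addr0; congr (_ * _).
have [_ ->//] : is_derive y (e_ j) (Bump x h) (psi (y - x)).
apply/is_derive_line.
have /is_derive_line : is_derive (y - x) (e_ j) (Bump 0 h) (psi (y - x)).
  by apply: smooth_is_derive; exact: smooth_Bump.
congr (is_derive _ _ _ _); apply/funext => s.
by rewrite [RHS]BumpE addrAC.
Qed.

End kernel.

Section C1_weak.
Variables (R : realType) (d : nat).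
Local Notation V := 'rV[R]_d.
Local Notation mu := (leb R d).
Local Notation e_ := (@evec R d).
Variable O : set V.
Hypothesis oO : open O.
Implicit Types (u g psi : V -> R) (K : set V).

Lemma norm_evec j : `|e_ j| <= 1.
Proof. by apply/normr_rVle => // i; rewrite mxE; case: eqP; rewrite ?normr1 ?normr0. Qed.

Let open_out K : compact K -> open (~` K).
Proof. by move=> cK; apply: closed_openC; apply: compact_closed => //; exact: norm_hausdorff. Qed.

Lemma mul_supp_continuous K u psi : compact K -> K `<=` O -> (forall x, O x -> {for x, continuous u}) ->
  continuous psi -> (forall x, ~ K x -> psi x = 0) -> continuous (fun x => u x * psi x).
Proof.
move=> cK KO cu cpsi psi0 x; have [Ox|nO] := pselect (O x).
  by apply: continuousM; [exact: cu|exact: cpsi].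
have nK : ~ K x by move=> /KO.
have h : \forall y \near x, u y * psi y = 0.
  by apply: filterS (open_nbhs_nbhs (conj (open_out cK) nK)) => y /psi0 ->; rewrite mulr0.
by rewrite /continuous_at psi0// mulr0; exact: cvg_near_cst h.
Qed.

Lemma supp_L1 K f : compact K -> continuous f -> (forall x, ~ K x -> f x = 0) -> L1 mu f.
Proof.
move=> cK cf f0; have [C C0 hC] := compact_supp_bounded cK cf f0.
have [r r0 hr] := compact_in_ball cK.
apply: (L1_le _ _ (L1Z C (L1_ball 0 r0))); first exact: continuous_measurable_rV.
move=> x; have [Kx|/f0 ->] := pselect (K x); last by rewrite normr0 mulr_ge0// indicE ler0n.
rewrite indicE mem_set ?mulr1//; apply/ball_rVE; rewrite subr0; exact: hr.
Qed.

(** Integration by parts without boundary terms: the integral of u phi over translates y + t e_j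
    does not depend on t, and its derivative at t = 0 is the integral of g phi + u D_j phi. *)
Lemma C1_weak_grad j u g : (forall x, O x -> {for x, continuous u}) ->
  (forall x, O x -> {for x, continuous g}) ->
  (forall x, O x -> is_derive x (e_ j) u (g x)) -> weak_grad O j u g.
Proof.
move=> cu cg du phi tphi; have [sphi [K [cK [KO phi0]]]] := tphi.
have Dphi0 x : ~ K x -> 'D_(e_ j) phi x = 0 by exact: derive_eq0_out.
have cphi := smooth_continuous sphi; have cDphi := smooth_derive_continuous (j := j) sphi.
pose F x := u x * phi x; pose F1 x := g x * phi x; pose F2 x := u x * 'D_(e_ j) phi x.
have cF : continuous F by exact: (mul_supp_continuous cK KO).
have cF1 : continuous F1 by exact: (mul_supp_continuous cK KO).
have cF2 : continuous F2 by exact: (mul_supp_continuous cK KO).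
have F0 x : ~ K x -> F x = 0 by move=> /phi0 h; rewrite /F h mulr0.
have F10 x : ~ K x -> F1 x = 0 by move=> /phi0 h; rewrite /F1 h mulr0.
have F20 x : ~ K x -> F2 x = 0 by move=> /Dphi0 h; rewrite /F2 h mulr0.
have LF := supp_L1 cK cF F0; have LF1 := supp_L1 cK cF1 F10; have LF2 := supp_L1 cK cF2 F20.
have dF x : is_derive x (e_ j) F (F1 x + F2 x).
  have [Ox|nO] := pselect (O x).
    by apply: dfM; [exact: du|exact: smooth_is_derive].
  have nK : ~ K x by move=> /KO.
  rewrite F10// F20// addr0.
  refine (near_eq_is_derive _ (is_derive_cst (0 : R) x (e_ j))).
  by apply: filterS (open_nbhs_nbhs (conj (open_out cK) nK)) => y /F0 ->.
have [C1 C10 hC1] := compact_supp_bounded cK cF1 F10.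
have [C2 C20 hC2] := compact_supp_bounded cK cF2 F20.
have [r r0 hr] := compact_in_ball cK.
have r1 : 0 < r + 1 by lra.
have hd (t : R) y : is_derive t 1 (fun t : R => F (y + t *: e_ j))
    (F1 (y + t *: e_ j) + F2 (y + t *: e_ j)).
  exact: (iffLR (is_derive_lineP F y (e_ j) _ t) (dF _)).
have hb (t : R) y : -1 < t < 1 -> `|F1 (y + t *: e_ j) + F2 (y + t *: e_ j)| <=
    (C1 + C2) * \1_(ball (0 : V) (r + 1)) y.
  move=> t1; rewrite indicE; case: (boolP (y \in _)) => [_|].
    by rewrite mulr1; apply: le_trans (ler_normD _ _) _; apply: lerD.
  rewrite notin_setE => nb; have nK : ~ K (y + t *: e_ j).
    move=> /hr yr; apply: nb; apply/ball_rVE; rewrite subr0.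
    rewrite -[y](addrK (t *: e_ j)); apply: le_lt_trans (ler_normB _ _) _.
    apply: ltr_leD => //; rewrite normrZ -[leRHS]mulr1; apply: ler_pM => //; last exact: norm_evec.
    by rewrite ler_norml; lra.
  by rewrite F10// F20// addr0 normr0 mulr0.
have D := derive_under_integral (fun t _ => L1_shift (t *: e_ j) LF) (fun t y _ => hd t y) hb (L1Z _ (L1_ball 0 r1)).
have D0 : is_derive (0 : R) 1 (fun t : R => \int[mu]_y F (y + t *: e_ j)) 0.
  rewrite (_ : (fun t : R => _) = cst (\int[mu]_y F y)); first exact: is_derive_cst.
  by apply/funext => t; rewrite Int_shift.
have : \int[mu]_y (F1 (y + 0 *: e_ j) + F2 (y + 0 *: e_ j)) = 0.
  exact: (etrans (esym (@derive_val _ _ _ _ _ _ _ D)) (@derive_val _ _ _ _ _ _ _ D0)).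
under eq_Rintegral do rewrite scale0r addr0.
by rewrite IntD// => /eqP; rewrite addr_eq0 => /eqP h; rewrite h opprK.
Qed.

End C1_weak.

Section ext.
Variables (R : realType) (d : nat).
Local Notation V := 'rV[R]_d.
Local Notation mu := (leb R d).
Local Notation e_ := (@evec R d).
Variable O : set V.
Hypothesis oO : open O.
Hypothesis bO : bounded_set_V O.
Implicit Types (f g : V -> R).

Definition ext f x : R := if `[< O x >] then f x else 0.

Lemma ext_in f x : O x -> ext f x = f x.
Proof. by move=> Ox; rewrite /ext asboolT. Qed.

Lemma ext_out f x : ~ O x -> ext f x = 0.
Proof. by move=> Ox; rewrite /ext asboolF. Qed.

Lemma measurable_O : measurable O. Proof. exact: measurable_rV_open. Qed.

Lemma leb_O_lty : (mu O < +oo)%E.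
Proof.
have [M hM] := bO; apply: (@leb_bounded_lty _ _ _ (M + 1)); first exact: measurable_O.
by move=> x /hM xM; apply/ball_rVE; rewrite subr0; lra.
Qed.

Lemma L1_O : L1 mu (\1_O : V -> R).
Proof. by apply: L1_indic; [exact: measurable_O|exact: leb_O_lty]. Qed.

Lemma borel_on_measurable f : borel_on O f -> measurable_fun setT (ext f).
Proof.
move=> bf; apply: (measurability _ (RGenOpens.measurableE R)).
move=> _ [_ [a [b ->] <-]]; rewrite setTI.
have mA : measurable (O `&` f @^-1` `]a, b[) by apply: bf; exact: interval_open.
have [ab0|nab] := pselect (`]a, b[%classic (0 : R)).
  rewrite (_ : _ @^-1` _ = (O `&` f @^-1` `]a, b[) `|` ~` O).
    by apply: measurableU => //; apply: measurableC; exact: measurable_O.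
  apply/seteqP; split => x /=; have [Ox|nOx] := pselect (O x).
  - by rewrite ext_in//; left.
  - by right.
  - by rewrite ext_in// => -[[]|].
  - by rewrite ext_out.
rewrite (_ : _ @^-1` _ = (O `&` f @^-1` `]a, b[))//.
apply/seteqP; split => x /=; have [Ox|nOx] := pselect (O x).
- by rewrite ext_in.
- by rewrite ext_out.
- by rewrite ext_in// => -[].
- by move=> [].
Qed.

Lemma measurable_borel_on f : measurable_fun setT (ext f) -> borel_on O f.
Proof.
move=> mf U oU.
have -> : O `&` f @^-1` U = O `&` ext f @^-1` U.
  by apply/seteqP; split => x /= [Ox]; rewrite ext_in.
apply: (measurableI _ _ measurable_O).
by rewrite -[X in measurable X]setTI; apply: mf => //; exact: open_measurable.
Qed.

Lemma continuous_borel_on f : (forall x, O x -> {for x, continuous f}) -> borel_on O f.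
Proof.
move=> cf U oU; apply: measurable_rV_open.
rewrite openE => x [Ox Ux]; apply: filterI; first exact: open_nbhs_nbhs.
by apply: (cf x Ox); exact: open_nbhs_nbhs.
Qed.

Lemma lebint_on_ext f : measurable_fun setT (ext f) -> (forall x, O x -> 0 <= f x) ->
  lebint_on O (fun x => (f x)%:E) = (\int[mu]_x (ext f x)%:E)%E.
Proof.
move=> mf f0; rewrite /lebint_on.
have E x : (if `[< O x >] then (f x)%:E else 0%E) = (ext f x)%:E by rewrite /ext; case: ifP.
rewrite (_ : (fun x => _) = fun x => (ext f x)%:E); last by apply/funext => x; exact: E.
apply: lebint_integral; first exact/measurable_EFinP.
move=> x; rewrite lee_fin; have [Ox|nOx] := pselect (O x); first by rewrite ext_in// f0.
by rewrite ext_out.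
Qed.

Lemma ext_comp (h : R -> R) f x : h 0 = 0 -> ext (fun x => h (f x)) x = h (ext f x).
Proof. by move=> h0; rewrite /ext; case: ifP. Qed.

Lemma extD f g x : ext (fun x => f x + g x) x = ext f x + ext g x.
Proof. by rewrite /ext; case: ifP; rewrite ?addr0. Qed.

Lemma extM f g x : ext (fun x => f x * g x) x = ext f x * ext g x.
Proof. by rewrite /ext; case: ifP; rewrite ?mulr0. Qed.

Lemma extN f x : ext (fun x => - f x) x = - ext f x.
Proof. by rewrite /ext; case: ifP; rewrite ?oppr0. Qed.

Lemma ext_sum (I : Type) (s : seq I) (F : I -> V -> R) x :
  ext (fun x => \sum_(i <- s) F i x) x = \sum_(i <- s) ext (F i) x.
Proof. by rewrite /ext; case: ifP => // _; rewrite big1. Qed.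

Lemma sint_on_Int f : L1 mu (ext f) -> sint_on O f = (\int[mu]_x ext f x)%:E.
Proof.
move=> hf; have mf := L1_meas hf.
have E1 x : ext (fun y => Num.max (f y) 0) x = Num.max (ext f x) 0.
  by rewrite (@ext_comp (fun y => Num.max y 0))// maxxx.
have E2 x : ext (fun y => Num.max (- f y) 0) x = Num.max (- ext f x) 0.
  by rewrite (@ext_comp (fun y => Num.max (- y) 0))// oppr0 maxxx.
have m1 : measurable_fun setT (ext (fun y => Num.max (f y) 0)).
  by rewrite (_ : ext _ = fun x => Num.max (ext f x) 0); [exact: measurable_maxr|apply/funext].
have m2 : measurable_fun setT (ext (fun y => Num.max (- f y) 0)).
  rewrite (_ : ext _ = fun x => Num.max (- ext f x) 0); last exact/funext.
  by apply: measurable_maxr => //; exact: measurableT_comp.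
rewrite /sint_on !lebint_on_ext//; last 2 first.
- by move=> x _; rewrite le_max lexx orbT.
- by move=> x _; rewrite le_max lexx orbT.
rewrite EFin_Rintegral// [RHS]integralE; congr (_ - _)%E.
- by apply: eq_integral => x _; rewrite E1 funeposE EFin_max.
- by apply: eq_integral => x _; rewrite E2 funenegE EFin_max EFinN.
Qed.

End ext.

(** * Morrey's estimate *)

Section real_helpers.
Variable R : realType.

Lemma dist_telescope (a b c M p q r : R) : `|a - b| <= M * (p - q) -> `|b - c| <= M * (q - r) ->
  `|a - c| <= M * (p - r).
Proof.
move=> h1 h2; apply: le_trans (ler_distD b _ _) _; apply: le_trans (lerD h1 h2) _.
by rewrite -mulrDr addrA subrK.
Qed.

Lemma dist_le_add (a b p q : R) : 0 <= q -> `|a - b| <= p -> a - p <= b + q.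
Proof. by rewrite ler_norml => q0 /andP[_]; lra. Qed.

Lemma dist_ge_add (a b p q : R) : 0 <= q -> `|a - b| <= p -> b - q <= a + p.
Proof. by rewrite ler_norml => q0 /andP[+ _]; lra. Qed.

End real_helpers.

Section morrey.
Variables (R : realType) (d : nat).
Local Notation V := 'rV[R]_d.
Local Notation mu := (leb R d).
Local Notation e_ := (@evec R d).
Variable O : set V.
Variable al : R.
Hypothesis al01 : 0 < al < 1.
Implicit Types (u g : V -> R) (x y z : V) (h : R).

(** The bound that a gradient in L^p yields for averages of radius [h] when [al] = 1 - d/p. It is
    the only input of Morrey's estimate and concerns only averages taken inside [O]. *)
Definition avg_lip (C : R) u := forall x h s j, 0 < h ->
  (forall y, `|y - x| <= h + `|s| -> O y) ->
  `|wavg u (kern h) (x + s *: e_ j) - wavg u (kern h) x| <= C * `|s| * h `^ (al - 1).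

Variables (u : V -> R) (C : R).
Hypothesis hu : L1 mu u.
Hypothesis C0 : 0 <= C.
Hypothesis uC : avg_lip C u.

Local Notation S h := (wavg u (kern h)).

Definition trunc_rV (i : nat) (z : V) : V := \row_j (if (j < i)%N then z 0 j else 0).

Lemma trunc_rV_norm i z : `|trunc_rV i z| <= `|z|.
Proof.
apply/normr_rVle => // j; rewrite mxE; case: ifP => _; last by rewrite normr0.
exact: normr_rV_coord.
Qed.

Lemma trunc_rVS (i : 'I_d) z : trunc_rV i.+1 z = trunc_rV i z + z 0 i *: e_ i.
Proof.
apply/rowP => j; rewrite !mxE ltnS leq_eqVlt.
have [->|ij] := eqVneq i j; first by rewrite eqxx ltnn /= mulr1 add0r.
have -> : (j == i :> nat) = false by apply: contraNF ij => /eqP/val_inj ->.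
by rewrite /= mulr0 addr0.
Qed.

(** The path from x to x + z follows the coordinate axes through [trunc_rV]. The factor 2 covers the
    distance |z| of a corner from x and the length |z| of the next edge. *)
Lemma wavg_shift x z h : 0 < h -> (forall y, `|y - x| <= h + 2 * `|z| -> O y) ->
  `|S h (x + z) - S h x| <= d%:R * C * `|z| * h `^ (al - 1).
Proof.
move=> h0 hO.
have P i : (i <= d)%N -> `|S h (x + trunc_rV i z) - S h x| <= i%:R * C * `|z| * h `^ (al - 1).
  elim: i => [_|i IH id].
    rewrite (_ : trunc_rV 0 z = 0) ?addr0 ?subrr ?normr0 ?mul0r//.
    by apply/rowP => j; rewrite !mxE.
  have {}IH := IH (ltnW id).
  have := @uC (x + trunc_rV i z) h (z 0 (Ordinal id)) (Ordinal id) h0.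
  rewrite -addrA -(trunc_rVS (Ordinal id)) /=.
  have zi := normr_rV_coord z (Ordinal id); have ti := trunc_rV_norm i z.
  have H : forall y, `|y - (x + trunc_rV i z)| <= h + `|z 0 (Ordinal id)| -> O y.
    move=> y yh; apply: hO; rewrite -[y - x](addrK (- trunc_rV i z)) opprK.
    apply: le_trans (ler_normD _ _) _; rewrite -addrA -opprD.
    apply: le_trans (lerD yh ti) _; rewrite -addrA lerD2l mulrDl !mul1r.
    by rewrite lerD2r.
  move=> /(_ H) h1.
  have hp := powR_ge0 h (al - 1).
  have h2 : C * `|z 0 (Ordinal id)| * h `^ (al - 1) <= C * `|z| * h `^ (al - 1).
    by rewrite ler_wpM2r// ler_wpM2l.
  have := ler_distD (S h (x + trunc_rV i z)) (S h (x + trunc_rV i.+1 z)) (S h x).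
  rewrite -natr1 !mulrDl mul1r; lra.
have := P d (leqnn d); rewrite (_ : trunc_rV d z = z)//.
by apply/rowP => j; rewrite mxE ltn_ord.
Qed.

Lemma wavg_wavg x h h' : 0 < h -> 0 < h' -> (forall y, `|y - x| <= h + 2 * h' -> O y) ->
  `|wavg (S h) (kern h') x - S h x| <= d%:R * C * h' * h `^ (al - 1).
Proof.
move=> h0 h'0 hO; have hp := powR_ge0 h (al - 1).
apply: (wavg_near (L1_wavg hu (kern_kernel d h0)) (kern_kernel d h'0)) => z zh.
apply: (@le_trans _ _ (d%:R * C * `|z| * h `^ (al - 1))).
  by apply: wavg_shift => // y yx; apply: hO; lra.
by rewrite ler_wpM2r// ler_wpM2l ?mulr_ge0// ltW.
Qed.

(** Both averages are compared with the double average at radii h and h / 2, which commutes. With X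
    = d C h^al the two distances are at most X / 2 and 2 X, hence the factor 3. *)
Lemma wavg_half x h : 0 < h -> (forall y, `|y - x| <= 3 * h -> O y) ->
  `|S h x - S (h / 2) x| <= 3 * d%:R * C * h `^ al.
Proof.
move=> h0 hO; have h2 : 0 < h / 2 by lra.
have A1 := @wavg_wavg x h (h / 2) h0 h2 ltac:(by move=> y yx; apply: hO; lra).
have A2 := @wavg_wavg x (h / 2) h h2 h0 ltac:(by move=> y yx; apply: hO; lra).
rewrite (wavg_comm _ hu (kern_kernel d h2) (kern_kernel d h0)) in A2.
have hh : h * h `^ (al - 1) = h `^ al.
  by rewrite -{1}(powRr1 (ltW h0)) -powRD ?(gt_eqF h0) ?implybT//; congr (_ `^ _); ring.
have h2h : (h / 2) `^ (al - 1) <= 2 * h `^ (al - 1).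
  rewrite powRM ?invr_ge0 ?(ltW h0)// mulrC ler_wpM2r ?powR_ge0//.
  rewrite -powR_inv1// -powRrM (_ : -1 * (al - 1) = 1 - al); last by ring.
  have /andP[a0 _] := al01.
  rewrite -[leRHS](powRr1 (ler0n R 2)); apply: ler_powR; first by rewrite ler1n.
  by rewrite gerBl ltW.
have e1 : d%:R * C * (h / 2) * h `^ (al - 1) = d%:R * C * h `^ al / 2.
  by rewrite -hh; ring.
have e2 : d%:R * C * h * (h / 2) `^ (al - 1) <= 2 * (d%:R * C * h `^ al).
  apply: (@le_trans _ _ (d%:R * C * h * (2 * h `^ (al - 1)))).
    by rewrite ler_wpM2l// !mulr_ge0// ltW.
  by rewrite -hh le_eqVlt; apply/orP; left; apply/eqP; ring.
rewrite e1 distrC in A1; have {e2}A2 := le_trans A2 e2.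
have X0 : 0 <= d%:R * C * h `^ al by rewrite !mulr_ge0// powR_ge0.
rewrite -[3 * d%:R * C]mulrA -[3 * _ * _]mulrA.
apply: le_trans (ler_distD (wavg (S h) (kern (h / 2)) x) _ _) _.
apply: le_trans (lerD A1 A2) _; clear A1 A2 hh e1 h2h; move: X0; move: (d%:R * C * _) => X X0; lra.
Qed.

Definition hn (n : nat) : R := 2^-1 ^+ n.
Definition half_powR : R := 2^-1 `^ al.

Lemma hn_gt0 n : 0 < hn n. Proof. by rewrite exprn_gt0// invr_gt0. Qed.

Lemma hnS n : hn n.+1 = hn n / 2.
Proof. by rewrite /hn exprSr. Qed.

Lemma hn_le n m : (n <= m)%N -> hn m <= hn n.
Proof. by move=> nm; rewrite /hn ler_wiXn2l// ?invr_ge0// invf_le1// ler1n. Qed.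

Lemma half_powR_lt1 : 0 < half_powR < 1.
Proof.
rewrite /half_powR powR_gt0 ?invr_gt0//=.
have /andP[a0 _] := al01.
rewrite [ltRHS](_ : 1 = 1 `^ al); last by rewrite powR1.
apply: gt0_ltr_powR => //; rewrite ?nnegrE ?invr_ge0//.
by rewrite invf_lt1// ltr1n.
Qed.

Lemma hn_powR n : hn n `^ al = half_powR ^+ n.
Proof.
elim: n => [|n IH]; first by rewrite /hn !expr0 powR1.
by rewrite hnS powRM ?invr_ge0// ?(ltW (hn_gt0 n))// IH exprSr.
Qed.

(** The sum of the geometric series of the steps: 3 d C h^al equals [morreyA] C (h^al - (h/2)^al),
    so the estimates at successive radii telescope. *)
Definition morreyA : R := 3 * d%:R / (1 - half_powR).

Lemma morreyA_ge0 : 0 <= morreyA.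
Proof. by have := half_powR_lt1 => ?; rewrite divr_ge0 ?mulr_ge0//; lra. Qed.

Lemma wavg_step x n : (forall y, `|y - x| <= 3 * hn n -> O y) ->
  `|S (hn n) x - S (hn n.+1) x| <= morreyA * C * (hn n `^ al - hn n.+1 `^ al).
Proof.
move=> hO; rewrite hnS; apply: le_trans (wavg_half (hn_gt0 n) hO) _.
rewrite -hnS !hn_powR exprSr /morreyA.
have q1 := half_powR_lt1; rewrite le_eqVlt; apply/orP; left; apply/eqP.
by field; apply/eqP; lra.
Qed.

Lemma wavg_steps x n k : (forall y, `|y - x| <= 3 * hn n -> O y) ->
  `|S (hn n) x - S (hn (n + k)) x| <= morreyA * C * (hn n `^ al - hn (n + k) `^ al).
Proof.
move=> hO; elim: k => [|k IH]; first by rewrite addn0 !subrr normr0 mulr0.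
have hk : forall y, `|y - x| <= 3 * hn (n + k) -> O y.
  move=> y yx; apply: hO; apply: le_trans yx _.
  by rewrite ler_wpM2l// hn_le// leq_addr.
by rewrite addnS; exact: dist_telescope IH (wavg_step hk).
Qed.

(** The value is characterised at all admissible scales at once rather than as a limit. Where no
    cube around [x] fits into [O] the default is 0. *)
Lemma morrey_pt x : exists l : R, forall n, (forall y, `|y - x| <= 3 * hn n -> O y) ->
  `|S (hn n) x - l| <= morreyA * C * hn n `^ al.
Proof.
pose P n := forall y, `|y - x| <= 3 * hn n -> O y.
have [[N PN]|nP] := pselect (exists n, P n); last first.
  by exists 0 => n hO; exfalso; apply: nP; exists n.
(* Lower ends of intervals around the averages. Each lower end lies below each upper end, so the
   supremum belongs to all intervals. *)
pose B := [set S (hn n) x - morreyA * C * hn n `^ al | n in [set n | P n]].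
have AC0 : 0 <= morreyA * C by rewrite mulr_ge0 ?morreyA_ge0.
have key n m : P n -> P m -> S (hn n) x - morreyA * C * hn n `^ al <= S (hn m) x + morreyA * C * hn m `^ al.
  have K a k : P a -> `|S (hn a) x - S (hn (a + k)) x| <= morreyA * C * hn a `^ al.
    move=> Pa; apply: le_trans (wavg_steps _ Pa) _.
    by rewrite ler_wpM2l// gerBl powR_ge0.
  have W a : 0 <= morreyA * C * hn a `^ al by rewrite mulr_ge0 ?powR_ge0.
  move=> Pn Pm; have [nm|mn] := leqP n m.
    by apply: dist_le_add (W m) _; have := K n (m - n)%N Pn; rewrite subnKC.
  by apply: dist_ge_add (W n) _; have := K m (n - m)%N Pm; rewrite subnKC// ltnW.
have hB : has_sup B.
  split; first by exists (S (hn N) x - morreyA * C * hn N `^ al); exists N.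
  by exists (S (hn N) x + morreyA * C * hn N `^ al) => _ [n Pn <-]; exact: key.
exists (sup B) => n Pn; rewrite ler_distlC; apply/andP; split.
  by apply: sup_upper_bound => //; exists n.
by apply: sup_le_ub => [|_ [m Pm <-]]; [case: hB|exact: key].
Qed.

Lemma hn_between (r : R) : 0 < r <= 1 -> exists n, r <= hn n <= 2 * r.
Proof.
move=> /andP[r0 r1].
have [N hN] : exists n, hn n < r.
  have : (2^-1 : R) ^+ n @[n --> \oo] --> (0 : R).
    by apply: cvg_expr; rewrite gtr0_norm ?invr_gt0// invf_lt1// ltr1n.
  move=> /cvgr0Pnorm_lt/(_ _ r0)[N _ /(_ N (leqnn _)) /= h]; exists N.
  by move: h; rewrite ger0_norm// exprn_ge0.
elim: N hN => [|N IH]; first by rewrite /hn expr0; lra.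
rewrite hnS => h; have [hNr|] := ltP (hn N) r; first exact: IH.
by exists N; lra.
Qed.

(** Each of the two points contributes 2 [morreyA], because the radius used is at most twice their
    distance, and the shift between them contributes d. *)
Definition morreyC : R := 4 * morreyA + d%:R.

Lemma morreyC_ge0 : 0 <= morreyC.
Proof. by rewrite addr_ge0// mulr_ge0// morreyA_ge0. Qed.

Definition morrey_fun : V -> R := projT1 (choice morrey_pt).

Lemma morrey_funP x n : (forall y, `|y - x| <= 3 * hn n -> O y) ->
  `|S (hn n) x - morrey_fun x| <= morreyA * C * hn n `^ al.
Proof. exact: (projT2 (choice morrey_pt) x n). Qed.

(** With r = |y - x| a dyadic radius is taken between r and 2 r. The estimate at y needs the cube of
    radius 6 r around y, hence 7 r around x; r <= 1 ensures that such a dyadic radius exists. *)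
Lemma morrey_holder x y : `|y - x| <= 1 -> (forall z, `|z - x| <= 7 * `|y - x| -> O z) ->
  `|morrey_fun y - morrey_fun x| <= morreyC * C * `|y - x| `^ al.
Proof.
move=> r1 hO; have /andP[a0 a1] := al01.
have [->|xy] := eqVneq x y.
  by rewrite !subrr !normr0 mulr_ge0 ?powR_ge0// mulr_ge0// morreyC_ge0.
have r0 : 0 < `|y - x| by rewrite normr_gt0 subr_eq0 eq_sym.
move: r1 hO; set r := `|y - x| => r1 hO; rewrite -/r in r0.
have [n /andP[n1 n2]] := @hn_between r ltac:(by rewrite r0 r1).
have hx := @morrey_funP x n ltac:(by move=> z zx; apply: hO; lra).
have hy : `|S (hn n) y - morrey_fun y| <= morreyA * C * hn n `^ al.
  apply: morrey_funP => z zy; apply: hO; apply: le_trans (ler_distD y _ _) _.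
  by rewrite -/r; lra.
have hxy := @wavg_shift x (y - x) (hn n) (hn_gt0 n).
rewrite -/r [x + (y - x)]addrC subrK in hxy.
have {}hxy := hxy ltac:(by move=> z zx; apply: hO; lra).
have e1 : hn n `^ al <= 2 * r `^ al.
  apply: (@le_trans _ _ ((2 * r) `^ al)).
    have hp := hn_gt0 n; apply: ge0_ler_powR => //; rewrite ?nnegrE; lra.
  rewrite powRM ?(ltW r0)// ler_wpM2r ?powR_ge0// -[leRHS](powRr1 (ler0n R 2)).
  by apply: ler_powR; rewrite ?ler1n// ltW.
have e2 : r * hn n `^ (al - 1) <= r `^ al.
  have -> : r `^ al = r * r `^ (al - 1).
    by rewrite -{2}(powRr1 (ltW r0)) -powRD ?(gt_eqF r0) ?implybT//; congr (_ `^ _); ring.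
  rewrite ler_pM2l// -(opprB 1 al) !powRN lef_pV2 ?posrE ?powR_gt0 ?hn_gt0//.
  have hp := hn_gt0 n; apply: ge0_ler_powR => //; rewrite ?nnegrE; lra.
have A0 : 0 <= morreyA * C by rewrite mulr_ge0 ?morreyA_ge0.
have D0 : 0 <= d%:R * C by rewrite mulr_ge0.
have h1 := le_trans hx (ler_wpM2l A0 e1).
have h2 := le_trans hy (ler_wpM2l A0 e1).
have h3 : `|S (hn n) y - S (hn n) x| <= d%:R * C * r `^ al.
  by apply: le_trans hxy _; rewrite -mulrA ler_wpM2l.
apply: le_trans (ler_distD (S (hn n) y) _ _) _.
apply: le_trans (lerD (lexx _) (ler_distD (S (hn n) x) _ _)) _.
rewrite distrC; apply: le_trans (lerD h2 (lerD h3 h1)) _.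
by rewrite /morreyC le_eqVlt; apply/orP; left; apply/eqP; ring.
Qed.

Lemma hn_al_cvg0 : hn n `^ al @[n --> \oo] --> (0 : R).
Proof.
rewrite (_ : (fun n => _) = fun n => half_powR ^+ n); last by apply/funext => n; exact: hn_powR.
by apply: cvg_expr; have /andP[q0 q1] := half_powR_lt1; rewrite gtr0_norm.
Qed.

Lemma hn_cvg0 : hn n @[n --> \oo] --> (0 : R).
Proof. by apply: cvg_expr; rewrite gtr0_norm ?invr_gt0// invf_lt1// ltr1n. Qed.

Lemma morrey_eq x : open O -> O x -> {for x, continuous u} -> morrey_fun x = u x.
Proof.
move=> oO Ox cu.
have [r /= r0 hr] := (@nbhs_ballP R V x _).1 (open_nbhs_nbhs (conj oO Ox)).
apply/eqP; rewrite eq_sym -subr_eq0 -normr_le0; apply/ler_addgt0Pr => e e0; rewrite add0r.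
have e2 : 0 < e / 2 by lra.
have [s s0 hs] := (continuous_rVP _ _).1 cu _ e2.
have AC1 : 0 < morreyA * C + 1 by have := mulr_ge0 morreyA_ge0 C0; lra.
have e3 : 0 < e / 2 / (morreyA * C + 1) by rewrite divr_gt0.
near \oo => n.
have n1 : 3 * hn n < r.
  have : `|hn n| < r / 3 by near: n; apply: cvgr0_norm_lt; [exact: hn_cvg0|lra].
  by rewrite gtr0_norm ?hn_gt0//; lra.
have n2 : hn n < s.
  have : `|hn n| < s by near: n; apply: cvgr0_norm_lt; [exact: hn_cvg0|].
  by rewrite gtr0_norm ?hn_gt0.
have n3 : morreyA * C * hn n `^ al <= e / 2.
  have : `|hn n `^ al| < e / 2 / (morreyA * C + 1).
    by near: n; apply: cvgr0_norm_lt; [exact: hn_al_cvg0|].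
  rewrite ger0_norm ?powR_ge0// ltr_pdivlMr// => h.
  apply: le_trans (ltW h); rewrite mulrC ler_wpM2l ?powR_ge0//; lra.
have hx := @morrey_funP x n ltac:(by move=> z zx; apply: hr; apply/ball_rVE; lra).
have hw : `|S (hn n) x - u x| <= e / 2.
  apply: (wavg_near hu (kern_kernel d (hn_gt0 n))) => z zh; apply/ltW/hs.
  by rewrite addrC addKr; lra.
apply: le_trans (ler_distD (S (hn n) x) _ _) _; rewrite distrC.
by apply: le_trans (lerD hw (le_trans hx n3)) _; lra.
Unshelve. all: by end_near. Qed.

Lemma morrey_continuous x : open O -> O x -> {for x, continuous morrey_fun}.
Proof.
move=> oO Ox; apply/continuous_rVP => e e0; have /andP[a0 a1] := al01.
have [r /= r0 hr] := (@nbhs_ballP R V x _).1 (open_nbhs_nbhs (conj oO Ox)).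
have AC1 : 0 < morreyC * C + 1 by have := mulr_ge0 morreyC_ge0 C0; lra.
have e3 : 0 < e / (morreyC * C + 1) by rewrite divr_gt0.
pose t := Num.min 1 (Num.min (r / 8) ((e / (morreyC * C + 1)) `^ al^-1)).
exists t => [|y yt].
  by rewrite /t !lt_min ltr01/= divr_gt0//= powR_gt0.
have [t1 t2 t3] : [/\ `|y - x| < 1, `|y - x| < r / 8 & `|y - x| < (e / (morreyC * C + 1)) `^ al^-1].
  by move: yt; rewrite /t !lt_min => /and3P[].
apply: le_lt_trans (morrey_holder (ltW t1) _) _.
  by move=> z zx; apply: hr; apply/ball_rVE; lra.
have : `|y - x| `^ al < e / (morreyC * C + 1).
  move: e3 t3; set w := e / _ => w0 t3.
  have -> : w = (w `^ al^-1) `^ al.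
    by rewrite -powRrM mulVf ?gt_eqF// powRr1// ltW.
  by apply: gt0_ltr_powR => //; rewrite ?nnegrE ?powR_ge0.
rewrite ltr_pdivlMr// => h; apply: le_lt_trans h.
by rewrite mulrC ler_wpM2l ?powR_ge0//; lra.
Qed.

Let Or (r : R) := [set x : V | forall y, `|y - x| < r -> O y].

Let measurable_Or r : measurable (Or r).
Proof.
have -> : Or r = ~` (\bigcup_(y in ~` O) ball y r).
  apply/seteqP; split => x /=.
    by move=> h [y nOy /ball_rVE xy]; apply: nOy; apply: h; rewrite distrC.
  move=> h y yx; apply: contrapT => nO; apply: h; exists y => //.
  by apply/ball_rVE; rewrite distrC.
apply: measurableC; apply: measurable_rV_open; apply: bigcup_open => y _; exact: ball_open.
Qed.

(** On the points at distance at least r from the complement, the averages tend to [u] in L^1 and to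
    [morrey_fun] uniformly, so the two agree almost everywhere. The radii 1/(k+1) exhaust [O]. *)
Lemma morrey_ae : open O -> bounded_set_V O -> {ae mu, forall x, O x -> u x = morrey_fun x}.
Proof.
move=> oO bO; have /andP[a0 a1] := al01.
have mm : measurable_fun setT (ext O morrey_fun).
  apply: (borel_on_measurable oO); apply: continuous_borel_on => // x Ox.
  exact: morrey_continuous.
have mf r : measurable_fun setT (fun x => \1_(Or r) x * (ext O u x - ext O morrey_fun x)).
  apply: measurable_funM; first exact: measurable_indic.
  apply: measurable_funB => //; rewrite (_ : ext O u = fun x => \1_O x * u x).
    by apply: measurable_funM; [by apply: measurable_indic; exact: (measurable_O oO)|exact: L1_meas hu].
  apply/funext => x; have [Ox|nO] := pselect (O x).
    by rewrite ext_in// indicE mem_set// mul1r.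
  by rewrite ext_out// indicE memNset// mul0r.
have key r : 0 < r -> {ae mu, forall x, Or r x -> u x = morrey_fun x}.
  move=> r0; pose F x := \1_(Or r) x * (ext O u x - ext O morrey_fun x).
  have LF1 n : L1 mu (fun x => `|S (hn n) x - u x| + morreyA * C * hn n `^ al * (\1_O x : R)).
    apply: L1D; last exact/L1Z/(L1_O oO bO).
    apply/L1_abs/L1B => //; exact: (L1_wavg hu (kern_kernel d (hn_gt0 n))).
  have Fle n : 3 * hn n < r -> forall x, `|F x| <= `|S (hn n) x - u x| + morreyA * C * hn n `^ al * (\1_O x : R).
    move=> nr x; have B0 : 0 <= morreyA * C * hn n `^ al * (\1_O x : R).
      by apply: mulr_ge0; [apply: mulr_ge0; [exact: (mulr_ge0 morreyA_ge0 C0)|exact: powR_ge0]|rewrite indicE ler0n].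
    have [xO|nx] := pselect (Or r x); last first.
      by rewrite /F indicE memNset// mul0r normr0 addr_ge0.
    have Ox : O x by apply: xO; rewrite subrr normr0.
    rewrite /F !indicE !mem_set// mul1r mulr1 !ext_in//.
    apply: le_trans (ler_distD (S (hn n) x) _ _) _; rewrite distrC lerD2l.
    by apply: morrey_funP => y yx; apply: xO; lra.
  have [N hN] : exists N, 3 * hn N < r.
    have : 0 < r / 3 by lra.
    by move: hn_cvg0 => /cvgr0Pnorm_lt h /h [N _ /(_ N (leqnn _)) /=]; rewrite gtr0_norm ?hn_gt0// => ?; exists N; lra.
  have LF : L1 mu F by exact: (L1_le (mf r) (Fle N hN) (LF1 N)).
  have F0 : \int[mu]_x `|F x| = 0.
    apply/eqP; rewrite eq_le Int_ge0// andbT; apply/ler_addgt0Pr => e e0; rewrite add0r.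
    have e2 : 0 < e / 2 by lra.
    have [s s0 hs] := wavg_cvg_L1 hu e2.
    pose M := morreyA * C * \int[mu]_x (\1_O x : R).
    have M0 : 0 <= M by apply: mulr_ge0; [exact: (mulr_ge0 morreyA_ge0 C0)|apply: Int_ge0 => x; rewrite indicE ler0n].
    near \oo => n.
    have n1 : 3 * hn n < r.
      have : `|hn n| < r / 3 by near: n; apply: cvgr0_norm_lt; [exact: hn_cvg0|lra].
      by rewrite gtr0_norm ?hn_gt0//; lra.
    have n2 : hn n < s.
      have : `|hn n| < s by near: n; apply: cvgr0_norm_lt; [exact: hn_cvg0|].
      by rewrite gtr0_norm ?hn_gt0.
    have n3 : hn n `^ al * (M + 1) < e / 2.
      rewrite -ltr_pdivlMr; last lra.
      have : `|hn n `^ al| < e / 2 / (M + 1).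
        by near: n; apply: cvgr0_norm_lt; [exact: hn_al_cvg0|apply: divr_gt0; lra].
      by rewrite ger0_norm ?powR_ge0.
    have Lw : L1 mu (fun x => `|S (hn n) x - u x|).
      apply/L1_abs/L1B => //; exact: (L1_wavg hu (kern_kernel d (hn_gt0 n))).
    apply: le_trans (Int_le (L1_abs LF) (LF1 n) (Fle n n1)) _.
    rewrite IntD//; last exact/L1Z/(L1_O oO bO).
    rewrite IntZ; last exact: (L1_O oO bO).
    have := hs _ _ _ (kern_kernel d (hn_gt0 n)) n2.
    have -> : morreyA * C * hn n `^ al * (\int[mu]_x (\1_O x : R)) = hn n `^ al * M.
      by rewrite /M; ring.
    have := powR_ge0 (hn n) al; move: n3; rewrite mulrDr mulr1; lra.
  have mF : measurable_fun setT (EFin \o F) by apply/measurable_EFinP; exact: (mf r).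
  have E0 : (\int[mu]_x `|(EFin \o F) x| = 0)%E.
    rewrite (eq_integral (fun x => `|F x|%:E))//.
    by rewrite -(EFin_Rintegral (L1_abs LF)) F0.
  have := (ae_eq_integral_abs mu measurableT mF).1 E0.
  apply: filterS => x /(_ I) /= [] Fx xO.
  have Ox : O x by apply: xO; rewrite subrr normr0.
  move: Fx; rewrite /F indicE mem_set// mul1r !ext_in// => /eqP.
  by rewrite subr_eq0 => /eqP.
have : {ae mu, forall x (k : nat), Or k.+1%:R^-1 x -> u x = morrey_fun x}.
  by apply/ae_foralln => k; apply: key; rewrite invr_gt0 ltr0n.
apply: filterS => x h Ox.
have [r /= r0 hr] := (@nbhs_ballP R V x _).1 (open_nbhs_nbhs (conj oO Ox)).
have /ltr_add_invr[k] := r0; rewrite add0r => kr.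
by apply: (h k) => y yx; apply: hr; apply/ball_rVE; exact: lt_trans kr.
Unshelve. all: by end_near. Qed.

End morrey.

Lemma cvg_sumr (R : realType) (T I : Type) (F : set_system T) (FF : Filter F) (s : seq I)
  (f : I -> T -> R) (l : I -> R) : (forall i, f i x @[x --> F] --> l i) ->
  \sum_(i <- s) f i x @[x --> F] --> \sum_(i <- s) l i.
Proof.
move=> h; elim: s => [|i s IH].
  rewrite big_nil; under eq_fun do rewrite big_nil; exact: cvg_cst.
rewrite big_cons; under eq_fun do rewrite big_cons; exact: cvgD.
Qed.

Lemma cvg_mulr (R : realType) (T : Type) (F : set_system T) (FF : Filter F) (f g : T -> R) (a b : R) :
  f x @[x --> F] --> a -> g x @[x --> F] --> b -> f x * g x @[x --> F] --> a * b.
Proof. by move=> hf hg; exact: cvgM. Qed.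

Lemma cvg_sum_dist0 (R : realType) (T : Type) (F : set_system T) (FF : Filter F) n (L : R)
  (a : 'I_n -> T -> R) (l : 'I_n -> R) : (forall i, a i x @[x --> F] --> l i) ->
  L * \sum_k `|a k x - l k| @[x --> F] --> (0 : R).
Proof.
move=> h; rewrite -[X in _ --> X](mulr0 L); apply: cvgM; first exact: cvg_cst.
rewrite [X in _ --> X](_ : 0 = \sum_(k < n) 0 :> R); last by rewrite big1.
apply: cvg_sumr => k; rewrite -(normr0 R) -(subrr (l k)).
by apply: cvg_norm; apply: cvgB; [exact: h|exact: cvg_cst].
Qed.

Lemma mvt_bound (R : realType) (f f' : R -> R) (a b M : R) : a <= b ->
  (forall t, a <= t <= b -> is_derive t 1 f (f' t)) -> (forall t, a <= t <= b -> `|f' t| <= M) ->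
  `|f b - f a| <= (b - a) * M.
Proof.
move=> ab df bM.
have inI (t : R) : t \in `]a, b[ -> a <= t <= b.
  by rewrite in_itv/= => /andP[t1 t2]; rewrite !ltW.
have [||c cab ->] := @MVT_segment R f f' a b ab.
- by move=> t /inI; exact: df.
- apply: continuous_in_subspaceT => t; rewrite inE/= in_itv/= => tab.
  exact: is_derive_continuous (df t tab).
have h : 0 <= b - a by rewrite subr_ge0.
rewrite normrM mulrC (ger0_norm h) ler_wpM2l// bM//.
Qed.

Lemma mvt_bound0 (R : realType) (f f' : R -> R) (s M : R) :
  (forall t : R, `|t| <= `|s| -> is_derive t 1 f (f' t)) -> (forall t : R, `|t| <= `|s| -> `|f' t| <= M) ->
  `|f s - f 0| <= `|s| * M.
Proof.
move=> df bM; have [s0|s0] := leP 0 s.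
  have st (t : R) : 0 <= t <= s -> `|t| <= `|s| by case/andP=> t0 ts; rewrite !ger0_norm.
  have := mvt_bound s0 (fun t ht => df t (st t ht)) (fun t ht => bM t (st t ht)).
  by rewrite subr0 (ger0_norm s0).
have st (t : R) : s <= t <= 0 -> `|t| <= `|s|.
  by case/andP=> ts t0; rewrite !ler0_norm ?lerN2// ltW.
have := mvt_bound (ltW s0) (fun t ht => df t (st t ht)) (fun t ht => bM t (st t ht)).
by rewrite sub0r distrC (ltr0_norm s0).
Qed.

Lemma chain_arith (R : realType) (a s b H K E e : R) : s * (K * E) + 2 * a < e ->
  a + (s * (b * H + K * E) + a) <= b * s * H + e.
Proof.
move=> h; have -> : a + (s * (b * H + K * E) + a) = b * s * H + (s * (K * E) + 2 * a) by ring.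
by rewrite lerD2l ltW.
Qed.

(** * Averages of a Lipschitz function of weakly differentiable functions *)

Section chain.
Variables (R : realType) (d n : nat).
Local Notation V := 'rV[R]_d.
Local Notation mu := (leb R d).
Local Notation e_ := (@evec R d).
Implicit Types (O : set V) (f g : V -> R) (x y z : V).

Lemma compact_margin (K O : set V) : compact K -> open O -> K `<=` O ->
  exists2 r : R, 0 < r & forall x y, K x -> `|y - x| < r -> O y.
Proof.
move=> cK oO KO.
have /compact_near_coveringP cc := cK.
have P0 : \forall r \near (0^'+ : set_system R), K `<=` (fun x => forall y, `|y - x| < r -> O y).
  apply: cc; rewrite /=.
  move=> x Kx.
  have [r /= r0 hr] := (@nbhs_ballP R V x _).1 (open_nbhs_nbhs (conj oO (KO x Kx))).
  exists (ball x (r / 2), [set s | 0 < s < r / 2]).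
    split => /=; first by apply: nbhsx_ballx; rewrite divr_gt0.
    exists (r / 2); first by rewrite /= divr_gt0.
    by move=> s /=; rewrite sub0r normrN => s1 s0; rewrite s0/= -(gtr0_norm s0).
  move=> [y s] [/= /ball_rVE yx /andP[s0 sr]] z zy; apply: hr; apply/ball_rVE.
  by apply: le_lt_trans (ler_distD y _ _) _; rewrite (splitr r) ltrD// (lt_trans zy).
move: P0 => [e /= e0 he]; exists (e / 2); first by rewrite divr_gt0.
move=> x y Kx xy; apply: (he (e / 2) _ _ x Kx y xy) => /=; last by rewrite divr_gt0.
by rewrite sub0r normrN gtr0_norm ?divr_gt0// ltr_pdivrMr// ltr_pMr// ltr1n.
Qed.

Lemma wavg_bound_p (p : R) g h x : d%:R < p -> 1 <= p -> 0 < h -> L1 mu g -> L1 mu (fun y => `|g y| `^ p) ->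
  wavg (fun y => `|g y|) (kern h) x <=
  kern_cst R d * (2 ^+ d + \int[mu]_y `|g y| `^ p) * h `^ (1 - d%:R / p - 1).
Proof.
move=> dp p1 h0 hg hgp; have p0 : p != 0 by apply/eqP; lra.
(* For t = h^(-d/p) one has t^(1-p) = t h^d, so both terms of [wavg_bound] scale as t h^d; the
   height h^-d of the kernel cancels h^d and leaves the exponent [al] - 1. *)
have t0 : 0 < h `^ (- (d%:R / p)) by rewrite powR_gt0.
apply: le_trans (wavg_bound x p1 hg hgp (kern_kernel d h0) t0) _.
have hd : h ^+ d = h `^ d%:R by rewrite powR_mulrn// ltW.
have -> : (h `^ (- (d%:R / p))) `^ (1 - p) = h `^ (- (d%:R / p)) * h ^+ d.
  rewrite -powRrM hd -powRD ?(gt_eqF h0) ?implybT//; congr (_ `^ _).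
  by field.
rewrite (_ : 1 - d%:R / p - 1 = - (d%:R / p)); last by ring.
rewrite exprMn le_eqVlt; apply/orP; left; apply/eqP.
have hn : h ^+ d != 0 by rewrite expf_neq0// gt_eqF.
set t := h `^ _; set J := Rintegral _ _ _.
transitivity (kern_cst R d * (h ^- d * h ^+ d) * (t * 2 ^+ d + t * J)); first by ring.
by rewrite mulVf// mulr1; ring.
Qed.

Lemma hn_wavg_cvg f : L1 mu f ->
  (\int[mu]_x `|wavg f (kern (hn R m)) x - f x|) @[m --> \oo] --> (0 : R).
Proof.
move=> hf; apply/cvgr0Pnorm_lt => e e0; have [r r0 hr] := wavg_cvg_L1 hf e0.
near=> m; rewrite ger0_norm ?Int_ge0//; apply: hr; first exact: kern_kernel (hn_gt0 _ m).
have : `|hn R m| < r by near: m; apply: cvgr0_norm_lt; [exact: hn_cvg0|].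
by rewrite gtr0_norm ?hn_gt0.
Unshelve. all: by end_near. Qed.

Variables (O : set V) (p : R).
Hypothesis oO : open O.
Hypothesis dp : d%:R < p.
Hypothesis p1 : 1 <= p.
Variables (u : 'I_n -> V -> R) (g : 'I_n -> 'I_d -> V -> R) (b : V -> R).
Hypothesis hu : forall i, L1 mu (u i).
Hypothesis hg : forall i j, L1 mu (g i j).
Hypothesis hb : L1 mu b.
Hypothesis hbp : L1 mu (fun x => `|b x| `^ p).
Hypothesis wg : forall i j, weak_grad O j (u i) (g i j).
Variables (F : ('I_n -> R) -> R) (F_ : 'I_n -> ('I_n -> R) -> R) (L : R).
Hypothesis L0 : 0 <= L.
Hypothesis F0 : F (fun=> 0) = 0.
Hypothesis FL : forall a c, `|F a - F c| <= L * \sum_k `|a k - c k|.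
Hypothesis F_L : forall i a, `|F_ i a| <= L.
Hypothesis F_lip : forall i a c, `|F_ i a - F_ i c| <= L * \sum_k `|a k - c k|.
Hypothesis F_chain : forall (m : 'I_n -> R -> R) (m' : 'I_n -> R) (t : R),
  (forall i, is_derive t 1 (m i) (m' i)) ->
  is_derive t 1 (fun s => F (m^~ s)) (\sum_i F_ i (m^~ t) * m' i).
Hypothesis Fb : forall x j, `|\sum_i F_ i (u^~ x) * g i j x| <= b x.

Let comp_continuous (H : ('I_n -> R) -> R) (m : 'I_n -> V -> R) :
  (forall a c, `|H a - H c| <= L * \sum_k `|a k - c k|) -> (forall i, continuous (m i)) ->
  continuous (fun x => H (m^~ x)).
Proof.
move=> HL cm x; apply/continuous_rVP => e e0.
have h : L * \sum_k `|m k y - m k x| @[y --> x] --> (0 : R).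
  exact: (cvg_sum_dist0 (nbhs_filter x) L (fun i => cm i x)).
move/cvgr0Pnorm_lt: h => /(_ e e0) h.
have [r /= r0 hr] := (@nbhs_ballP R V x _).1 h.
exists r => // y yx; have /hr /= yl : ball x r y by apply/ball_rVE.
apply: le_lt_trans (HL _ _) _; apply: le_lt_trans yl; exact: ler_norm.
Qed.

Let comp_measurable (H : ('I_n -> R) -> R) (m : 'I_n -> V -> R) : (0 < n)%N -> 
  (forall a c, `|H a - H c| <= L * \sum_k `|a k - c k|) -> (forall i, measurable_fun setT (m i)) ->
  measurable_fun setT (fun x => H (m^~ x)).
Proof.
move=> n0 HL mm.
pose H' (v : 'rV[R]_n) := H (fun i => v 0 i).
have cH : continuous H'.
  move=> v; apply/continuous_rVP => e e0.
  have c0 : 0 < L * n%:R + 1 by have := mulr_ge0 L0 (ler0n R n); lra.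
  exists (e / (L * n%:R + 1)) => [|w wv]; first by rewrite divr_gt0.
  apply: le_lt_trans (HL _ _) _.
  apply: (@le_lt_trans _ _ (L * (n%:R * `|w - v|))).
    rewrite ler_wpM2l// -[n in n%:R]card_ord mulr_natl -sumr_const; apply: ler_sum => i _.
    by rewrite -rVB normr_rV_coord.
  move: wv; rewrite ltr_pdivlMr// => wv; apply: le_lt_trans wv.
  have := normr_ge0 (w - v); move: `|w - v| => t t0; rewrite mulrA mulrC ler_wpM2l//; lra.
have mv : measurable_fun setT (fun x : V => \row_i m i x : 'rV[R]_n).
  by apply/measurable_fun_rVP => i; under eq_fun do rewrite mxE; exact: mm.
have := measurableT_comp (continuous_measurable_rV cH) mv.
apply: eq_measurable_fun => x _; rewrite /H' /=; congr H.
by apply/funext => i; rewrite mxE.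
Qed.

Let measurable_comp_n (H : ('I_n -> R) -> R) (m : 'I_n -> V -> R) :
  (forall a c, `|H a - H c| <= L * \sum_k `|a k - c k|) -> (forall i, measurable_fun setT (m i)) ->
  measurable_fun setT (fun x => H (m^~ x)).
Proof.
have [n0|n0] := posnP n; last exact: comp_measurable.
move=> HL _; rewrite (_ : (fun x => _) = cst (H (fun=> 0))); first exact: measurable_cst.
apply/funext => x; congr H; apply/funext => i; exfalso.
by have := ltn_ord i; rewrite [X in (_ < X)%N]n0.
Qed.

Lemma L1_compF (m : 'I_n -> V -> R) : (forall i, L1 mu (m i)) -> L1 mu (fun x => F (m^~ x)).
Proof.
move=> hm.
have h : L1 mu (fun x => L * \sum_k `|m k x|) by apply/L1Z/L1_sum => k; exact/L1_abs.
apply: (L1_le _ _ h); first by apply: measurable_comp_n => // i; exact: L1_meas (hm i).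
move=> x; have := FL (m^~ x) (fun=> 0); rewrite F0 subr0.
by under eq_bigr do rewrite subr0.
Qed.

Let um (m : nat) i := wavg (u i) (kern (hn R m)).
Let gm (m : nat) i j := wavg (g i j) (kern (hn R m)).
Let wm m x := F ((um m)^~ x).
Let Gm m j x := \sum_i F_ i ((um m)^~ x) * gm m i j x.
Let kh m := kern_kernel d (hn_gt0 R m).

Let cum m i : continuous (um m i). Proof. exact: wavg_continuous (hu i) (kh m). Qed.
Let cgm m i j : continuous (gm m i j). Proof. exact: wavg_continuous (hg i j) (kh m). Qed.
Let cwm m : continuous (wm m). Proof. exact: comp_continuous. Qed.

Let cGm m j : continuous (Gm m j).
Proof.
move=> x; apply: (@cvg_sumr R V 'I_n (nbhs x) (nbhs_filter x)) => i.
have h1 : {for x, continuous (fun x => F_ i ((um m)^~ x))}.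
  by apply: (@comp_continuous (F_ i) (um m)); [exact: F_lip|exact: cum].
apply: (@cvg_mulr R V (nbhs x) (nbhs_filter x) (fun x => F_ i ((um m)^~ x)) (gm m i j) _ _ h1 _); exact: cgm.
Qed.

Let LGm m j : L1 mu (Gm m j).
Proof.
apply: L1_sum => i; under eq_fun do rewrite mulrC.
apply: (L1M (c := L)) => [||x]; [exact: L1_wavg (hg i j) (kh m)| |exact: F_L].
by apply: continuous_measurable_rV; apply: (@comp_continuous (F_ i) (um m)); [exact: F_lip|exact: cum].
Qed.

Let Em m j x := \sum_i (L * `|gm m i j x - g i j x| + `|F_ i ((um m)^~ x) - F_ i (u^~ x)| * `|g i j x|).

Let LEm1 m i j : L1 mu (fun x => L * `|gm m i j x - g i j x|).
Proof. by apply/L1Z/L1_abs/L1B => //; exact: L1_wavg (kh m). Qed.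

Let LEm2 m i j : L1 mu (fun x => `|F_ i ((um m)^~ x) - F_ i (u^~ x)| * `|g i j x|).
Proof.
under eq_fun do rewrite mulrC; apply: (L1M (c := 2 * L)) => [||x]; first exact/L1_abs.
  apply: measurableT_comp => //; apply: measurable_funB.
    by apply: continuous_measurable_rV; apply: (@comp_continuous (F_ i) (um m)); [exact: F_lip|exact: cum].
  by apply: (@measurable_comp_n (F_ i) u (F_lip i)) => k; exact: L1_meas (hu k).
rewrite normr_id; apply: le_trans (ler_normB _ _) _.
by apply: le_trans (lerD (F_L _ _) (F_L _ _)) _; lra.
Qed.

Let LEm m j : L1 mu (Em m j).
Proof. by apply: L1_sum => i; apply: L1D; [exact: LEm1|exact: LEm2]. Qed.

Let Gm_le m j x : `|Gm m j x| <= b x + Em m j x.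
Proof.
have -> : Gm m j x = \sum_i F_ i (u^~ x) * g i j x +
    \sum_i (F_ i ((um m)^~ x) * (gm m i j x - g i j x) + (F_ i ((um m)^~ x) - F_ i (u^~ x)) * g i j x).
  by rewrite -big_split/=; apply: eq_bigr => i _; ring.
apply: le_trans (ler_normD _ _) _; apply: lerD; first exact: Fb.
apply: le_trans (ler_norm_sum _ _ _) _; apply: ler_sum => i _.
by apply: le_trans (ler_normD _ _) _; rewrite !normrM lerD2r ler_wpM2r.
Qed.

(** The delicate term is |F_i(um) - F_i(u)| |g| with [g] merely integrable. On the truncation of [g]
    at N it is at most L N times the sum of |um - u|; on the remainder it is at most 2 L times the
    tail of [g], small in L^1. *)
Let Em_cvg j : \int[mu]_x Em m j x @[m --> \oo] --> (0 : R).
Proof.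
rewrite (_ : (fun m => _) = fun m => \sum_i (L * \int[mu]_x `|gm m i j x - g i j x| +
    \int[mu]_x (`|F_ i ((um m)^~ x) - F_ i (u^~ x)| * `|g i j x|))); last first.
  apply/funext => m; rewrite Int_sum; last by move=> i; apply: L1D; [exact: LEm1|exact: LEm2].
  apply: eq_bigr => i _; rewrite (IntD (LEm1 m i j) (LEm2 m i j)) IntZ//; apply/L1_abs/L1B => //; exact: L1_wavg (kh m).
rewrite [X in _ --> X](_ : 0 = \sum_(i < n) (L * 0 + 0) :> R); last first.
  by rewrite big1// => i _; rewrite mulr0 addr0.
apply: cvg_sumr => i; apply: cvgD.
  by apply: cvgM; [exact: cvg_cst|exact: hn_wavg_cvg].
apply/cvgr0Pnorm_le => e e0.
pose c := e / (8 * (L + 1)); have c0 : 0 < c by apply: divr_gt0 => //; apply: mulr_gt0 => //; apply: ltr_wpDl.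
have [N hN] : exists N : nat, \int[mu]_x `|g i j x - clamp N%:R (g i j x)| < c.
  apply: (L1_approx (g := fun x => `|g i j x|)) => //.
  - move=> N; apply: (L1_le _ _ (L1_abs (hg i j))).
      exact: (measurableT_comp (measurable_clamp _) (L1_meas (hg i j))).
    move=> x; have := @clampP R N%:R (g i j x) (ler0n R N).
    have := ler_norm (g i j x); have := ler_norm (- g i j x); rewrite normrN => h1 h2.
    by rewrite ler_norml; have := ler0n R N => h3; case=> -[? ->]; lra.
  - move=> N x; have := @clampP R N%:R (g i j x) (ler0n R N).
    have := ler_norm (g i j x); have := ler_norm (- g i j x); rewrite normrN => h1 h2.
    by rewrite ler_norml; have := ler0n R N => h3; case=> -[? ->]; lra.
  - move=> x; apply: cvg_near_cst; exists (Num.truncn `|g i j x|).+1 => // N /= xn.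
    by rewrite clamp_id//; apply/ltW; rewrite (lt_le_trans (truncnS_gt _))// ler_nat.
  - exact: L1_abs.
have Lc : L1 mu (fun x => `|g i j x - clamp N%:R (g i j x)|).
  apply: (L1_le _ _ (L1_abs (hg i j))).
    apply: measurableT_comp => //; apply: measurable_funB; first exact: L1_meas (hg i j).
    exact: (measurableT_comp (measurable_clamp _) (L1_meas (hg i j))).
  by move=> x; rewrite normr_id; apply: clampB_le; rewrite ler0n.
have Lu m k : L1 mu (fun x => `|um m k x - u k x|).
  by apply/L1_abs/L1B => //; exact: L1_wavg (kh m).
have hs : \sum_k \int[mu]_x `|um m k x - u k x| @[m --> \oo] --> (0 : R).
  rewrite [X in _ --> X](_ : 0 = \sum_(k < n) 0 :> R); last by rewrite big1.
  by apply: cvg_sumr => k; exact: hn_wavg_cvg.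
pose q := e / (2 * (L * N%:R + 1)).
have LN : 0 <= L * N%:R by rewrite mulr_ge0.
have q0 : 0 < q by apply: divr_gt0 => //; apply: mulr_gt0 => //; apply: ltr_wpDl.
have /cvgr0Pnorm_lt /(_ q q0) hsq := hs.
near=> m.
rewrite ger0_norm; last by apply: Int_ge0 => x; rewrite mulr_ge0.
apply: (@le_trans _ _ (\int[mu]_x (L * N%:R * \sum_k `|um m k x - u k x| + 2 * L * `|g i j x - clamp N%:R (g i j x)|))).
  apply: Int_le; [exact: LEm2|by apply: L1D; apply: L1Z => //; apply: L1_sum|].
  move=> x; apply: (@le_trans _ _ (`|F_ i ((um m)^~ x) - F_ i (u^~ x)| * (N%:R + `|g i j x - clamp N%:R (g i j x)|))).
    rewrite ler_wpM2l//; have := clamp_le (g i j x) (ler0n R N).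
    have := ler_normD (clamp N%:R (g i j x)) (g i j x - clamp N%:R (g i j x)).
    by rewrite addrC subrK; lra.
  rewrite mulrDr; apply: lerD.
    by rewrite mulrAC ler_wpM2r// F_lip.
  rewrite ler_wpM2r//; apply: le_trans (ler_normB _ _) _.
  by apply: le_trans (lerD (F_L _ _) (F_L _ _)) _; lra.
rewrite IntD; [|by apply: L1Z; apply: L1_sum|exact: L1Z].
rewrite IntZ; last by apply: L1_sum.
rewrite IntZ// Int_sum//.
have h1 : \sum_k \int[mu]_x `|um m k x - u k x| < q.
  apply: le_lt_trans (ler_norm _) _; near: m; exact: hsq.
have h2 : L * N%:R * q <= e / 2.
  have -> : e / 2 = (L * N%:R + 1) * q by rewrite /q; field; apply/eqP; lra.
  by apply: ler_wpM2r; [exact: ltW|rewrite lerDl].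
have h3 : 2 * L * c <= e / 2.
  have -> : e / 2 = 4 * (L + 1) * c by rewrite /c; field; rewrite gt_eqF//; apply: ltr_wpDl.
  by apply: ler_wpM2r; [exact: ltW|have := L0; lra].
have h4 := ler_wpM2l LN (ltW h1); have L2 : 0 <= 2 * L by rewrite mulr_ge0.
have h5 := ler_wpM2l L2 (ltW hN).
rewrite (splitr e); apply: lerD; [exact: le_trans h4 h2|exact: le_trans h5 h3].
Unshelve. all: by end_near. Qed.

(** Two averages at different scales: the inner one, at radius 2^-m, makes the components
    differentiable so that the chain rule holds; the outer one, at fixed [h], turns the integral
    bound on [b] into a pointwise one. [L] enters only error terms that vanish as m grows, so the
    constant depends on [b] alone. *)
Lemma chain_avg_lip :
  avg_lip O (1 - d%:R / p) (kern_cst R d * (2 ^+ d + \int[mu]_y `|b y| `^ p)) (fun x => F (u^~ x)).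
Proof.
move=> x h s j h0 hO.
pose K := [set y : V | `|y - x| <= h + `|s|].
have [r r0 hr] := compact_margin (@ball_closure_compact R d x (h + `|s|)) oO hO.
pose U := ball x (h + `|s| + r / 2).
have oU : open U by exact: ball_open.
have hk := kern_kernel d h0.
set bd := kern_cst R d * _; set w := fun x => F (u^~ x).
have Lw : L1 mu w by exact: L1_compF.
pose Kh := kern_cst R d * h ^- d; have Kh0 : 0 <= Kh by rewrite mulr_ge0 ?(ltW (kern_cst_gt0 R d))// invr_ge0 exprn_ge0// ltW.
have b0 y : 0 <= b y by apply: le_trans (Fb y j).
have Lwm m : L1 mu (wm m) by apply: L1_compF => i; exact: L1_wavg (kh m).
pose Dm m := \sum_k \int[mu]_y `|um m k y - u k y|.
have Dm_cvg : Dm m @[m --> \oo] --> (0 : R).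
  rewrite [X in _ --> X](_ : 0 = \sum_(k < n) 0 :> R); last by rewrite big1.
  by apply: cvg_sumr => k; exact: hn_wavg_cvg.
have wE m y : `|wavg (wm m) (kern h) y - wavg w (kern h) y| <= Kh * (L * Dm m).
  rewrite -(wavgB _ (Lwm m) Lw hk).
  apply: le_trans (wavg_abs _ (L1B (Lwm m) Lw) hk) _.
  have LS : L1 mu (fun y => \sum_k `|um m k y - u k y|).
    by apply: L1_sum => k; apply/L1_abs/L1B => //; exact: L1_wavg (kh m).
  rewrite /Dm -Int_sum; last by move=> k; apply/L1_abs/L1B => //; exact: L1_wavg (kh m).
  rewrite -IntZ// -(Int_shiftl y (L1Z L LS)) -IntZ; last exact: (L1_shiftl y (L1Z L LS)).
  apply: Int_le; [exact: (wavg_L1 y (L1_abs (L1B (Lwm m) Lw)) hk)|exact/L1Z/(L1_shiftl y (L1Z L LS))|].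
  move=> z; rewrite mulrC; have [_ kK _ _ _] := hk; have /andP[k1 k2] := kK z.
  by apply: ler_pM => //; exact: FL.
have step m : hn R m < r / 2 ->
    `|wavg (wm m) (kern h) (x + s *: e_ j) - wavg (wm m) (kern h) x| <=
    `|s| * (bd * h `^ (1 - d%:R / p - 1) + Kh * \int[mu]_y Em m j y).
  move=> mr.
  have dU y : U y -> is_derive y (e_ j) (wm m) (Gm m j y).
    move=> /ball_rVE Uy; apply/is_derive_line.
    have zO z : `|z - y| <= hn R m -> O z.
      move=> zy; have [xz|xz] := leP `|z - x| (h + `|s|); first exact: hO.
      (* A point beyond the cube of radius h + |s| is compared with its radial projection onto the
         cube, which is less than [r] away. *)
      pose t := (h + `|s|) / `|z - x|.
      have zx0 : 0 < `|z - x| by apply: le_lt_trans xz; rewrite addr_ge0// ltW.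
      have hs0 : 0 <= h + `|s| by rewrite addr_ge0// ltW.
      apply: (hr (x + t *: (z - x)) z).
        by rewrite /K /= addrC addKr normrZ ger0_norm ?divr_ge0// divfK ?gt_eqF.
      have -> : z - (x + t *: (z - x)) = (1 - t) *: (z - x) by rewrite scalerBl scale1r opprD addrA.
      have t1 : t <= 1 by rewrite ler_pdivrMr// mul1r ltW.
      rewrite normrZ ger0_norm ?subr_ge0// mulrBl mul1r divfK ?gt_eqF//.
      have := ler_distD y z x; lra.
    have D i := (@is_derive_line R V R (um m i) y (e_ j) (gm m i j y)).1
      (weak_grad_wavg (hu i) (hg i j) (wg i j) (hn_gt0 R m) zO).
    have := @F_chain (fun i s => um m i (y + s *: e_ j)) (fun i => gm m i j y) 0 D.
    by rewrite scale0r addr0.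
  have wgm : weak_grad U j (wm m) (Gm m j).
    by apply: C1_weak_grad => // y _; [exact: cwm|exact: cGm].
  have dS (t : R) : `|t| <= `|s| -> is_derive (x + t *: e_ j) (e_ j) (wavg (wm m) (kern h)) (wavg (Gm m j) (kern h) (x + t *: e_ j)).
    move=> ts; apply: (weak_grad_wavg (Lwm m) (LGm m j) wgm h0) => y yx; apply/ball_rVE.
    apply: (@le_lt_trans _ _ (h + `|s|)); last lra.
    rewrite -[y - x](addrK (- (t *: e_ j))) opprK.
    apply: le_trans (ler_normD _ _) _; apply: lerD; first by rewrite -addrA -opprD.
    rewrite normrZ -[leRHS]mulr1; apply: ler_pM => //; exact: norm_evec.
  have bnd y : `|wavg (Gm m j) (kern h) y| <= bd * h `^ (1 - d%:R / p - 1) + Kh * \int[mu]_y Em m j y.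
    apply: le_trans (wavg_abs _ (LGm m j) hk) _.
    apply: le_trans (wavg_le (L1_abs (LGm m j)) (L1D hb (LEm m j)) hk (fun z _ => Gm_le m j (y + z))) _.
    rewrite (wavgD _ hb (LEm m j) hk); apply: lerD.
      apply: le_trans (wavg_bound_p y dp p1 h0 hb hbp).
      by apply: (wavg_le hb (L1_abs hb) hk) => z _; exact: ler_norm.
    rewrite -(Int_shiftl y (LEm m j)) -IntZ; last exact: (L1_shiftl y (LEm m j)).
    apply: Int_le; [exact: (wavg_L1 y (LEm m j) hk)|exact/L1Z/(L1_shiftl y (LEm m j))|].
    move=> z; rewrite mulrC; have [_ kK _ _ _] := hk; have /andP[k1 k2] := kK z.
    apply: ler_pM => //.
    by apply: sumr_ge0 => i _; rewrite addr_ge0 ?mulr_ge0.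
  have dl (t : R) : `|t| <= `|s| -> is_derive t 1 (fun t : R => wavg (wm m) (kern h) (x + t *: e_ j))
      (wavg (Gm m j) (kern h) (x + t *: e_ j)).
    by move=> /dS /is_derive_lineP.
  have bb (t : R) : `|wavg (Gm m j) (kern h) (x + t *: e_ j)| <=
      bd * h `^ (1 - d%:R / p - 1) + Kh * \int[mu]_y Em m j y := bnd _.
  by have := mvt_bound0 dl (fun t _ => bb t); rewrite scale0r addr0.
apply/ler_addgt0Pr => e e0.
have cv : `|s| * (Kh * \int[mu]_y Em m j y) + 2 * (Kh * (L * Dm m)) @[m --> \oo] --> (0 : R).
  rewrite [X in _ --> X](_ : 0 = `|s| * (Kh * 0) + 2 * (Kh * (L * 0))); last by rewrite !mulr0 addr0.
  apply: cvgD; do !(apply: cvgM; first exact: cvg_cst); [exact: Em_cvg|exact: Dm_cvg].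
have /cvgr0Pnorm_lt /(_ e e0) cve := cv.
near \oo => m.
have m1 : hn R m < r / 2.
  have : `|hn R m| < r / 2 by near: m; apply: cvgr0_norm_lt; [exact: hn_cvg0|lra].
  by rewrite gtr0_norm ?hn_gt0.
have m2 : `|s| * (Kh * \int[mu]_y Em m j y) + 2 * (Kh * (L * Dm m)) < e.
  apply: le_lt_trans (ler_norm _) _; near: m; exact: cve.
have st := step m m1; have w1 := wE m (x + s *: e_ j); have w2 := wE m x.
apply: le_trans (ler_distD (wavg (wm m) (kern h) (x + s *: e_ j)) _ _) _.
apply: le_trans (lerD (lexx _) (ler_distD (wavg (wm m) (kern h) x) _ _)) _.
rewrite distrC in w1; apply: le_trans (lerD w1 (lerD st w2)) _.
exact: chain_arith.
Unshelve. all: by end_near. Qed.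

End chain.

(** * Cones and Hoelder bounds up to the boundary *)

Section telescope.
Variables (R : realType) (d : nat).
Local Notation V := 'rV[R]_d.
Local Notation e_ := (@evec R d).
Implicit Types (f : V -> R) (x y z w v : V).

Lemma coord_telescope f x w (K : R) :
  (forall i : 'I_d, `|f (x + trunc_rV i.+1 w) - f (x + trunc_rV i w)| <= K) ->
  `|f (x + w) - f x| <= d%:R * K.
Proof.
move=> h.
have P i : (i <= d)%N -> `|f (x + trunc_rV i w) - f x| <= i%:R * K.
  elim: i => [_|i IH id].
    have -> : trunc_rV 0 w = 0 by apply/rowP => j; rewrite !mxE.
    by rewrite addr0 subrr normr0 mul0r.
  apply: le_trans (ler_distD (f (x + trunc_rV i w)) _ _) _.
  by rewrite -natr1 mulrDl mul1r addrC; apply: lerD (IH (ltnW id)) (h (Ordinal id)).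
have := P d (leqnn d).
by have -> : trunc_rV d w = w by apply/rowP => j; rewrite !mxE ltn_ord.
Qed.

(** The mean value theorem on each edge of the path along the axes. All points of this path are
    within |w| of [x] in the maximum norm. *)
Lemma lip_coord f (f' : 'I_d -> V -> R) x w (M : R) :
  (forall j y, `|y - x| <= `|w| -> is_derive y (e_ j) f (f' j y)) ->
  (forall j y, `|y - x| <= `|w| -> `|f' j y| <= M) ->
  `|f (x + w) - f x| <= d%:R * (M * `|w|).
Proof.
move=> df bM; apply: coord_telescope => i.
rewrite trunc_rVS addrA; set X := x + _.
have nw (t : R) : `|t| <= `|w 0 i| -> `|(X + t *: e_ i) - x| <= `|w|.
  move=> tw; rewrite /X -(addrA x) [_ - x]addrC addKr; apply/normr_rVle => // j.
  rewrite !mxE; have [ji|ij|ji] := ltngtP j i.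
  - by rewrite -[i == j]val_eqE/= (gtn_eqF ji) mulr0 addr0 normr_rV_coord.
  - by rewrite -[i == j]val_eqE/= (ltn_eqF ij) mulr0 addr0 normr0.
  - rewrite -[i == j]val_eqE/= ji eqxx mulr1 add0r; apply: le_trans tw _; exact: normr_rV_coord.
have := @mvt_bound0 R (fun t => f (X + t *: e_ i)) (fun t => f' i (X + t *: e_ i)) (w 0 i) M.
rewrite scale0r addr0 => /(_ _ _)/le_trans; apply.
- by move=> t /nw /df /is_derive_lineP.
- by move=> t /nw /bM.
rewrite mulrC; apply: ler_wpM2l; last exact: normr_rV_coord.
by apply: le_trans (bM i x _); rewrite // subrr normr0.
Qed.

Lemma open_rVP (S : set V) :
  (forall x, S x -> exists2 r : R, 0 < r & forall y, `|y - x| < r -> S y) -> open S.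
Proof.
move=> h; rewrite openE => x /h [r r0 hr]; apply: (@nbhs_ballP R V x S).2.
by exists r => // y /ball_rVE; exact: hr.
Qed.

Lemma open_rV_ball (S : set V) x : open S -> S x ->
  exists2 r : R, 0 < r & forall y, `|y - x| < r -> S y.
Proof.
move=> oS Sx; have [r /= r0 hr] := (@nbhs_ballP R V x S).1 (open_nbhs_nbhs (conj oS Sx)).
by exists r => // y yx; apply: hr; apply/ball_rVE.
Qed.

Lemma closure_rVP (S : set V) x : closure S x -> forall r : R, 0 < r -> exists2 y, S y & `|y - x| < r.
Proof.
move=> cx r r0; have [|y [Sy /ball_rVE yx]] := cx (ball x r); first exact: nbhsx_ballx.
by exists y.
Qed.

Lemma compact_local_bound (K : set V) (P : V -> R -> Prop) : compact K ->
  (forall y a b, a <= b -> P y a -> P y b) ->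
  (forall z, K z -> exists r C : R, 0 < r /\ forall y, `|y - z| < r -> P y C) ->
  exists C, forall y, K y -> P y C.
Proof.
move=> /compact_near_coveringP cc mon h.
have : \forall C \near +oo, K `<=` (fun y => P y C).
  apply: cc => /= z Kz; have [r [C [r0 hr]]] := h z Kz.
  exists (ball z r, [set c | C <= c]) => /=.
    by split; [exact: nbhsx_ballx|exact: nbhs_pinfty_ge (num_real C)].
  by move=> [y c] [/= /ball_rVE yz Cc]; apply: mon Cc _; exact: hr.
move=> [C [_ hC]]; exists (C + 1) => y Ky; apply: hC Ky.
by rewrite ltrDl.
Qed.

Lemma compact_finite_balls (K : set V) (r : V -> R) : compact K -> (forall z, K z -> 0 < r z) ->
  exists s : seq V, (forall z, z \in s -> K z) /\
    forall x, K x -> exists2 z, z \in s & `|x - z| < r z.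
Proof.
rewrite compact_cover => cK r0.
have [||D DK KD] := cK V K (fun z => ball z (r z)).
- by move=> z Kz; apply: ball_open; exact: r0.
- by move=> x Kx; exists x => //; apply: ballxx; exact: r0.
exists (finmap.enum_fset D); split => [z zD|x /KD [z zD /ball_rVE xz]].
  by have := DK z zD; rewrite inE.
by exists z.
Qed.

End telescope.

Section cone.
Variables (R : realType) (d : nat).
Local Notation V := 'rV[R]_d.
Local Notation e_ := (@evec R d).
Variable O : set V.
Hypothesis oO : open O.
Hypothesis sO : smooth_boundary O.
Hypothesis bO : bounded_set_V O.
Implicit Types (x y z w v : V).

(** A uniform interior cone condition: one axis, aperture and height serve all points of [O] near
    [z]. *)
Definition cone z (r : R) v (de t0 : R) := forall y, O y -> `|y - z| < r ->
  forall (t : R) w, 0 < t <= t0 -> `|w| <= de * t -> O (y + t *: v + w).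

Lemma compact_closure : compact (closure O).
Proof.
have [M hM] := bO.
apply: (subclosed_compact _ (@ball_closure_compact R d 0 M)); first exact: closed_closure.
have -> : [set x : V | `|x - 0| <= M] = closure [set x : V | `|x - 0| <= M].
  apply/closure_id; apply: compact_closed; last exact: ball_closure_compact.
  exact: norm_hausdorff.
by apply: closureS => x /hM /=; rewrite subr0.
Qed.

Let cone_arith (rr ry ry' s c t q : R) : 0 < t -> 0 < c -> s = - t * c -> ry < 0 ->
  `|ry' - s - ry| <= t * (c / 2) -> `|rr - ry'| <= q -> q <= t * (c / 4) -> rr < 0.
Proof.
move=> t0 c0 -> ry0; rewrite !ler_norml => /andP[_ h1] /andP[_ h2] h3.
have := mulr_gt0 t0 c0; move: h1 h2 h3; rewrite mulNr !mulrA; lra.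
Qed.

(** At an interior point the axis 0 will do. At a boundary point the axis is a coordinate direction,
    with sign, in which [rho] has non-zero derivative of size c: moving by t along it lowers [rho]
    by at least c t / 2, and the transverse part changes it by at most c t / 4. *)
Lemma cone_at z : closure O z -> exists r v de t0,
  [/\ 0 < r, `|v| <= 1, 0 < de <= 1, 0 < t0 <= 1 & cone z r v de t0].
Proof.
move=> cz; have [Oz|nOz] := pselect (O z).
  have [r r0 hr] := open_rV_ball oO Oz.
  exists (r / 2), 0, 1, (Num.min 1 (r / 4)); split; rewrite ?normr0 ?divr_gt0//.
  - by rewrite ltr01 lexx.
  - by rewrite lt_min ltr01 divr_gt0//= ge_min lexx.
  move=> y Oy yz t w /andP[t0 tm] wt; rewrite scaler0 addr0; apply: hr.
  apply: le_lt_trans (_ : `|y - z| + `|w| < r); first by rewrite addrAC ler_normD.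
  by move: tm wt; rewrite le_min mul1r => /andP[_ tm] wt; lra.
have [r0 [r00 [rho [srho [[i ci] hO]]]]] := sO (conj cz nOz).
pose c := `|'D_(e_ i) rho z|; have c0 : 0 < c by rewrite normr_gt0.
pose M := 1 + \sum_j `|'D_(e_ j) rho z|.
have M0 : 0 < M by apply: ltr_wpDr; [apply: sumr_ge0 => k _; exact: normr_ge0|exact: ltr01].
have [r1 r10 hr1] : exists2 r1, 0 < r1 & forall y, `|y - z| < r1 ->
    \sum_j `|'D_(e_ j) rho y - 'D_(e_ j) rho z| < Num.min 1 (c / 2).
  have h : 1 * \sum_j `|'D_(e_ j) rho y - 'D_(e_ j) rho z| @[y --> z] --> (0 : R).
    apply: (@cvg_sum_dist0 R V (nbhs z) (nbhs_filter z) d 1 (fun j y => 'D_(e_ j) rho y)) => j.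
    exact: smooth_derive_continuous.
  have m0 : 0 < Num.min 1 (c / 2) by rewrite lt_min ltr01 divr_gt0.
  move/cvgr0Pnorm_lt: h => /(_ _ m0) h.
  have [r /= rr hr] := (@nbhs_ballP R V z _).1 h.
  exists r => // y yx; have /hr /= : ball z r y by apply/ball_rVE.
  by rewrite mul1r; apply: le_lt_trans; exact: ler_norm.
have one j y : `|y - z| < r1 -> `|'D_(e_ j) rho y - 'D_(e_ j) rho z| < Num.min 1 (c / 2).
  move=> /hr1; apply: le_lt_trans; rewrite (bigD1 j) ?mem_index_enum//= lerDl; apply: sumr_ge0 => k _; exact: normr_ge0.
have bM j y : `|y - z| < r1 -> `|'D_(e_ j) rho y| <= M.
  move=> /(one j); rewrite lt_min => /andP[h _].
  rewrite -['D_(e_ j) rho y](subrK ('D_(e_ j) rho z)); apply: le_trans (ler_normD _ _) _.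
  apply: lerD; first exact: ltW.
  rewrite (bigD1 j) ?mem_index_enum//= lerDl; apply: sumr_ge0 => k _; exact: normr_ge0.
have d0 : 0 < d%:R :> R by rewrite ltr0n (leq_trans _ (ltn_ord i)).
pose r := Num.min r0 r1 / 4; have rp : 0 < r by rewrite divr_gt0// lt_min r00.
have rr0 : 4 * r <= r0 by rewrite /r mulrCA divff ?pnatr_eq0// mulr1 ge_min lexx.
have rr1 : 4 * r <= r1 by rewrite /r mulrCA divff ?pnatr_eq0// mulr1 ge_min lexx orbT.
(* [M] bounds the partial derivatives of [rho] near z, so a displacement of size de t changes [rho]
   by at most d M de t <= c t / 4. *)
pose de := Num.min 1 (c / (4 * (d%:R * M))).
exists r, ((- Num.sg ('D_(e_ i) rho z)) *: e_ i), de, (Num.min 1 r); split => //.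
- rewrite normrZ normrN normr_sg ci mul1r; exact: norm_evec.
- by rewrite lt_min ltr01 divr_gt0 ?mulr_gt0//= ge_min lexx.
- by rewrite lt_min ltr01 rp ge_min lexx.
move=> y Oy yz t w /andP[t0]; rewrite le_min => /andP[t1 tr] wt.
have wt' : `|w| <= t.
  by apply: le_trans wt _; rewrite ler_piMl ?(ltW t0)// ge_min lexx.
set s := - Num.sg _; have ns : `|t * s| = t by rewrite normrM normrN normr_sg ci mulr1 gtr0_norm.
rewrite scalerA.
have rhoy : rho y < 0.
  have : (O `&` ball z r0) y by split => //; apply/ball_rVE; lra.
  by rewrite hO => -[].
have nst (a : R) : `|a| <= t -> `|(y + a *: e_ i) - z| < 2 * r.
  move=> ha; apply: le_lt_trans (_ : `|y - z| + `|a *: e_ i| < _); first by rewrite addrAC ler_normD.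
  have : `|a *: e_ i| <= `|a| by rewrite normrZ ler_piMr// norm_evec.
  by move: ha tr yz; lra.
set y' := y + _.
have y'z : `|y' - z| < 2 * r by apply: nst; rewrite ns.
have ball_r x : `|x - y'| <= `|w| -> `|x - z| < 3 * r.
  move=> xy; apply: le_lt_trans (ler_distD y' _ _) _; move: xy y'z wt' tr; lra.
suff rw : rho (y' + w) < 0.
  have : [set x | ball z r0 x /\ rho x < 0] (y' + w).
    split => //; apply/ball_rVE; apply: (@lt_le_trans _ _ (3 * r)); last by move: rr0 rp; lra.
    by apply: ball_r; rewrite addrC addKr.
  by rewrite -hO => -[].
have D1 := @mvt_bound0 R (fun a => rho (y + a *: e_ i) - 'D_(e_ i) rho z * a)
  (fun a => 'D_(e_ i) rho (y + a *: e_ i) - 'D_(e_ i) rho z) (t * s) (c / 2).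
have L := @lip_coord R d rho (fun j => 'D_(e_ j) rho) y' w M.
apply: (@cone_arith _ (rho y) (rho y') ('D_(e_ i) rho z * (t * s)) c t (d%:R * (M * `|w|))) => //.
- by rewrite /s /c [`|'D_(e_ i) rho z|]normrEsg; ring.
- have := D1; rewrite scale0r addr0 mulr0 subr0 ns; apply.
    move=> a at'.
    have h1 := (@is_derive_lineP R V R rho y (e_ i) _ a).1 (smooth_is_derive i (y + a *: e_ i) srho).
    have h2 := dfZ ('D_(e_ i) rho z) (is_derive_id a (1 : R)).
    by rewrite mulr1 in h2; exact: (dfB h1 h2).
  move=> a at'; have /(one i) : `|y + a *: e_ i - z| < r1.
    by apply: lt_le_trans (nst a at') _; move: rr1 rp; lra.
  by rewrite lt_min => /andP[_ /ltW].
- apply: L => [j x _|j x /ball_r xz]; first exact: smooth_is_derive.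
  by apply: bM; apply: lt_le_trans xz _; move: rr1 rp; lra.
have : `|w| <= c / (4 * (d%:R * M)) * t.
  apply: le_trans wt _; rewrite ler_wpM2r ?(ltW t0)// ge_min lexx orbT//.
move=> h; have dM : 0 < d%:R * M by rewrite mulr_gt0.
rewrite mulrA; apply: le_trans (ler_wpM2l (ltW dM) h) _.
rewrite le_eqVlt; apply/orP; left; apply/eqP; field.
by rewrite !gt_eqF.
Qed.

(** The half radii leave a margin in which the bumps of a partition of unity can decay; finiteness
    allows a common aperture and height. *)
Lemma cone_cover : exists (s : seq (V * R * V)) (de t0 : R),
  [/\ 0 < de <= 1, 0 < t0 <= 1,
   forall a, a \in s -> [/\ 0 < a.1.2, `|a.2| <= 1 & cone a.1.1 a.1.2 a.2 de t0] &
   forall x, closure O x -> exists2 a, a \in s & `|x - a.1.1| < a.1.2 / 2].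
Proof.
have /choice [q hq] : forall z, exists q : R * V * (R * R), closure O z ->
    [/\ 0 < q.1.1, `|q.1.2| <= 1, 0 < q.2.1 <= 1, 0 < q.2.2 <= 1 & cone z q.1.1 q.1.2 q.2.1 q.2.2].
  move=> z; have [cz|ncz] := pselect (closure O z); last by exists (0, 0, (0, 0)).
  by have [r [v [de [t0 H]]]] := cone_at cz; exists (r, v, (de, t0)).
have [|s [sK sc]] := @compact_finite_balls R d (closure O) (fun z => (q z).1.1 / 2) compact_closure.
  by move=> z /hq [r0 _ _ _ _]; rewrite divr_gt0.
have [de [de01 hde]] : exists de : R, 0 < de <= 1 /\ forall z, z \in s -> de <= (q z).2.1 /\ de <= (q z).2.2.
  elim: s sK {sc} => [_|z s IH sK]; first by exists 1; rewrite ltr01 lexx.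
  have [|de [/andP[de0 de1] h]] := IH; first by move=> y ys; apply: sK; rewrite inE ys orbT.
  have [_ _ /andP[a0 a1] /andP[b0 b1] _] := hq z (sK z (mem_head _ _)).
  exists (Num.min de (Num.min (q z).2.1 (q z).2.2)); split.
    by rewrite !lt_min de0 a0 b0 ge_min de1.
  move=> y; rewrite inE => /orP[/eqP ->|/h [h1 h2]]; split; rewrite !ge_min ?lexx ?orbT ?h1 ?h2//.
exists [seq (z, (q z).1.1, (q z).1.2) | z <- s], de, de; split => //.
  move=> a /mapP[z zs ->] /=; have [r0 v1 _ _ cn] := hq z (sK z zs); split => // y Oy yz t w /andP[t0 t1] wt.
  have [h1 h2] := hde z zs; apply: cn => //; first by rewrite t0 (le_trans t1).
  by apply: le_trans wt _; rewrite ler_wpM2r// ltW.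
by move=> x /sc [z zs xz]; exists (z, (q z).1.1, (q z).1.2) => //; apply/mapP; exists z.
Qed.

End cone.

Lemma powR_1l (R : realType) (a : R) : 1 `^ a = 1. Proof. by rewrite powR1. Qed.

Section holder.
Variables (R : realType) (d : nat).
Local Notation V := 'rV[R]_d.
Local Notation e_ := (@evec R d).
Variable O : set V.
Variable al : R.
Hypothesis al0 : 0 < al.
Hypothesis oO : open O.
Implicit Types (u : V -> R) (x y z w v : V).

(* Only pairs much closer to each other than to the boundary are compared. *)
Definition int_holder (C : R) u := forall x y, `|y - x| <= 1 ->
  (forall z, `|z - x| <= 7 * `|y - x| -> O z) -> `|u y - u x| <= C * `|y - x| `^ al.

Lemma int_holder_near C u x (r : R) : 0 <= C -> int_holder C u -> r <= 1 ->
  (forall y, `|y - x| < r -> O y) -> forall y, 8 * `|y - x| < r -> `|u y - u x| <= C * `|y - x| `^ al.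
Proof.
move=> C0 hu r1 hr y yx; have n0 := normr_ge0 (y - x); apply: hu.
  by move: yx r1 n0; move: `|y - x| => a; lra.
by move=> z zx; apply: hr; move: zx yx n0; move: `|y - x| `|z - x| => a b; lra.
Qed.

Lemma int_holder_near1 C u x (r : R) : 0 <= C -> int_holder C u -> r <= 1 ->
  (forall y, `|y - x| < r -> O y) -> forall y, 8 * `|y - x| < r -> `|u y - u x| <= C.
Proof.
move=> C0 hu r1 hr y yx; apply: le_trans (int_holder_near C0 hu r1 hr yx) _.
rewrite -[leRHS]mulr1 ler_wpM2l// -[leRHS](powR_1l al).
have n0 := normr_ge0 (y - x).
apply: ge0_ler_powR; rewrite ?nnegrE// ?ltW//.
by move: yx r1 n0; move: `|y - x| => a; lra.
Qed.

(** The axis is descended towards [y] through the points y + t lam^N v with lam = 1 - de/8. A step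
    has length at most de/8 times the current height s, while the cone contains the ball of radius
    de s: the factor 7 of [int_holder] fits. The steps form a geometric series of ratio lam^al, and
    the last point is close enough to [y] for the interior bound. *)
Lemma cone_holder z r v de t0 : cone O z r v de t0 -> 0 < de <= 1 -> t0 <= 1 -> `|v| <= 1 ->
  exists2 K : R, 0 <= K & forall C u, 0 <= C -> int_holder C u ->
  forall y (t : R), O y -> `|y - z| < r -> 0 < t <= t0 -> `|u (y + t *: v) - u y| <= K * C * t `^ al.
Proof.
move=> hc /andP[de0 de1] t01 v1.
pose lam := 1 - de / 8; have lam0 : 0 < lam by rewrite /lam; lra.
have lam1 : lam < 1 by rewrite /lam; lra.
pose q := lam `^ al; have q0 : 0 < q by rewrite powR_gt0.
have q1 : q < 1 by rewrite -[ltRHS](powR_1l al); apply: gt0_ltr_powR; rewrite ?nnegrE// ltW.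
exists (1 - q)^-1; first by rewrite invr_ge0 subr_ge0 ltW.
move=> C u C0 hu y t Oy yz /andP[tp tt0].
pose s N := t * lam ^+ N; pose x N := y + s N *: v.
have s0 N : 0 < s N by rewrite mulr_gt0// exprn_gt0.
have st N : s N <= t by rewrite ler_piMr ?(ltW tp)// exprn_ile1// ltW.
have sS N : s N.+1 = s N * lam by rewrite /s exprSr mulrA.
have sa N : s N `^ al = t `^ al * q ^+ N.
  elim: N => [|N IH]; first by rewrite /s !expr0 !mulr1.
  by rewrite sS (powRM _ (ltW (s0 N)) (ltW lam0)) IH exprSr mulrA.
have step N : `|u (x N) - u (x N.+1)| <= (1 - q)^-1 * C * (s N `^ al - s N.+1 `^ al).
  have xx : `|x N.+1 - x N| <= s N * (de / 8).
    rewrite /x opprD addrACA subrr add0r -scalerBl normrZ sS.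
    have -> : s N * lam - s N = - (s N * (de / 8)) by rewrite /lam; ring.
    have sd : 0 <= s N * (de / 8) by rewrite mulr_ge0 ?divr_ge0// ltW.
    by rewrite normrN (ger0_norm sd) ler_piMr.
  have xx' : `|x N.+1 - x N| <= s N.
    by apply: le_trans xx _; rewrite ler_piMr ?(ltW (s0 N))//; lra.
  rewrite distrC; apply: le_trans (hu _ _ _ _) _.
  - by apply: le_trans xx' _; apply: le_trans (st N) _; exact: le_trans tt0 t01.
  - move=> w wx; rewrite -(subrK (x N) w) addrC; apply: hc => //.
      by rewrite s0/=; exact: le_trans (st N) tt0.
    apply: le_trans wx _; have := s0 N; move: xx; rewrite mulrA; set a := s N * _.
    have : 0 < s N * de by rewrite mulr_gt0.
    by rewrite /a mulrC; move: (s N * de) `|x N.+1 - x N| => A B; rewrite [de * s N]mulrC; lra.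
  have -> : s N.+1 `^ al = s N `^ al * q by rewrite !sa exprSr mulrA.
  have -> : (1 - q)^-1 * C * (s N `^ al - s N `^ al * q) = C * s N `^ al.
    by field; rewrite subr_eq0 gt_eqF.
  rewrite ler_wpM2l//; apply: ge0_ler_powR; rewrite ?nnegrE// ?ltW//.
have steps N : `|u (x 0%N) - u (x N)| <= (1 - q)^-1 * C * (s 0%N `^ al - s N `^ al).
  elim: N => [|N IH]; first by rewrite !subrr normr0 mulr0.
  exact: dist_telescope IH (step N).
have x0 : x 0%N = y + t *: v by rewrite /x /s expr0 mulr1.
have [rho rho0 hrho] := open_rV_ball oO Oy.
have h' y' : `|y' - y| < Num.min 1 rho -> O y' by rewrite lt_min => /andP[_ /hrho].
apply/ler_addgt0Pr => e e0.
have K0 : 0 <= (1 - q)^-1 * C by rewrite mulr_ge0// invr_ge0 subr_ge0 ltW.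
have lc : t * lam ^+ N @[N --> \oo] --> (0 : R).
  by apply: cvg_geometric; rewrite gtr0_norm.
have qc : C * t `^ al * q ^+ N @[N --> \oo] --> (0 : R).
  by apply: cvg_geometric; rewrite gtr0_norm.
have rp : 0 < Num.min 1 rho / 8 by rewrite divr_gt0// lt_min ltr01.
have /cvgr0Pnorm_lt /(_ _ rp) l1 := lc.
have /cvgr0Pnorm_lt /(_ _ e0) q2 := qc.
near \oo => N.
have n1 : s N < Num.min 1 rho / 8.
  by apply: le_lt_trans (ler_norm _) _; near: N; exact: l1.
have n2 : C * t `^ al * q ^+ N < e.
  by apply: le_lt_trans (ler_norm _) _; near: N; exact: q2.
have xy : `|x N - y| <= s N by rewrite /x addrC addKr normrZ (gtr0_norm (s0 N)) ler_piMr// ltW.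
have uy : `|u (x N) - u y| <= e.
  have m1 : Num.min 1 rho <= 1 by rewrite ge_min lexx.
  apply: le_trans (int_holder_near C0 hu m1 h' (y := x N) _) _.
    by move: n1 xy; move: (s N) `|x N - y| (Num.min 1 rho) => a b c; lra.
  apply: le_trans _ (ltW n2); rewrite -mulrA -sa ler_wpM2l//.
  apply: ge0_ler_powR; rewrite ?nnegrE// ?ltW//.
rewrite -x0; apply: le_trans (ler_distD (u (x N)) _ _) _; apply: lerD uy.
apply: le_trans (steps N) _; rewrite ler_wpM2l// {1}/s expr0 mulr1 lerBlDr lerDl.
exact: powR_ge0.
Unshelve. all: by end_near. Qed.

Hypothesis cO : connected O.
Hypothesis nO : O !=set0.
Hypothesis sO : smooth_boundary O.
Hypothesis bO : bounded_set_V O.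

Let unif x0 x (K : R) := 0 <= K /\ forall C u, 0 <= C -> int_holder C u -> `|u x - u x0| <= K * C.

(** The constant may depend on the points but not on the function. The points that have such a
    constant form a non-empty subset of [O] that is open and closed in it. *)
Let unif_conn x0 x : O x0 -> O x -> exists K, unif x0 x K.
Proof.
move=> Ox0 Ox; pose S := [set y | O y /\ exists K, unif x0 y K].
suff SO : S = O by move: Ox; rewrite -SO => -[].
have nb y : O y -> exists2 r : R, 0 < r & forall y', `|y' - y| < r -> O y' /\
    forall C u, 0 <= C -> int_holder C u -> `|u y' - u y| <= C.
  move=> Oy; have [r r0 hr] := open_rV_ball oO Oy.
  have mp : 0 < Num.min 1 r by rewrite lt_min ltr01.
  have h' y' : `|y' - y| < Num.min 1 r -> O y' by rewrite lt_min => /andP[_ /hr].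
  exists (Num.min 1 r / 8); first by rewrite divr_gt0.
  move=> y' yy; have y8 : 8 * `|y' - y| < Num.min 1 r by rewrite mulrC -ltr_pdivlMr.
  split; first by apply: h'; have := normr_ge0 (y' - y); move: y8; move: `|y' - y| (Num.min 1 r) => a b; lra.
  by move=> C u C0 hu; apply: (int_holder_near1 C0 hu _ h' y8); rewrite ge_min lexx.
apply: cO.
- exists x0; split => //; exists 0; split => // C u C0 _; by rewrite subrr normr0 mul0r.
- exists S; last by apply/seteqP; split => [y [Oy Sy]|y [_ ?]].
  apply: open_rVP => y [Oy [K [K0 hK]]]; have [r r0 hr] := nb y Oy.
  exists r => // y' /hr [Oy' h]; split => //; exists (K + 1); split; first by rewrite addr_ge0.
  move=> C u C0 hu; apply: le_trans (ler_distD (u y) _ _) _.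
  by rewrite mulrDl mul1r addrC; apply: lerD; [exact: hK|exact: h].
- exists (~` (O `\` S)); last first.
    apply/seteqP; split => [y [Oy Sy]|y [Oy]]; first by split => // -[_]; apply.
    by move=> h; apply: contrapT => nS; apply: h.
  apply: open_closedC; apply: open_rVP => y [Oy nS]; have [r r0 hr] := nb y Oy.
  exists r => // y' /hr [Oy' h]; split => // -[_ [K [K0 hK]]]; apply: nS; split => //.
  exists (K + 1); split; first by rewrite addr_ge0.
  move=> C u C0 hu; apply: le_trans (ler_distD (u y') _ _) _.
  by rewrite mulrDl mul1r addrC; apply: lerD; [exact: hK|rewrite distrC; exact: h].
Qed.

(* Near the boundary the oscillation is controlled along the directions [v] of the cones, *)
(* which lead to points at a fixed distance from the boundary. *)
Lemma holder_global : exists2 K : R, 0 <= K & forall C u, 0 <= C -> int_holder C u ->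
  forall x y, O x -> O y -> `|u x - u y| <= K * C.
Proof.
have [x0 Ox0] := nO.
have [K hK] : exists K, forall y, closure O y -> O y -> unif x0 y K.
  apply: (@compact_local_bound R d (closure O) (fun y K => O y -> unif x0 y K)) => [|y a b ab ha Oy|z cz].
  - exact: compact_closure.
  - have [a0 h] := ha Oy; split; first exact: le_trans a0 ab.
    by move=> C u C0 hu; apply: le_trans (h C u C0 hu) _; rewrite ler_wpM2r.
  have [r [v [de [t0 [r0 v1 de01 /andP[t00 t01] hc]]]]] := cone_at oO sO cz.
  have [K K0 hK] := cone_holder hc de01 t01 v1.
  have /andP[de0 de1] := de01.
  have det : 0 < de * t0 by rewrite mulr_gt0.
  (* Two points within r' of z are shifted to points less than de t0 / 16 apart, and the ball of
     radius de t0 around the shift of [ys] lies in [O]; this satisfies the factor 8 of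
     [int_holder_near1]. *)
  pose r' := Num.min r (de * t0 / 32); have r'0 : 0 < r' by rewrite lt_min r0 divr_gt0.
  have [ys Oys ysz] := closure_rVP cz r'0.
  have tt : 0 < t0 <= t0 by rewrite t00 lexx.
  have rr y : `|y - z| < r' -> `|y - z| < r by rewrite lt_min => /andP[].
  have Oys1 : O (ys + t0 *: v) by rewrite -[_ + _]addr0; apply: (hc ys Oys (rr _ ysz)) => //; rewrite normr0 ltW.
  have [K1 [K10 hK1]] := unif_conn Ox0 Oys1.
  exists r', (K + 1 + K1); split => // y yz Oy; split; first by rewrite !addr_ge0.
  move=> C u C0 hu.
  have t1 : t0 `^ al <= 1.
    by rewrite -[leRHS](powR_1l al); apply: ge0_ler_powR; rewrite ?nnegrE// ltW.
  have s1 : `|u (y + t0 *: v) - u y| <= K * C.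
    apply: le_trans (hK C u C0 hu y t0 Oy (rr _ yz) tt) _.
    by rewrite ler_piMr// mulr_ge0.
  have s2 : `|u (y + t0 *: v) - u (ys + t0 *: v)| <= C.
    apply: (@int_holder_near1 C u _ (de * t0)) => //.
    - have := ler_piMr (ltW t00) de1; rewrite mulrC; move: t01; lra.
    - move=> w ww; rewrite -(subrK (ys + t0 *: v) w) addrC.
      by apply: (hc ys Oys (rr _ ysz)) => //; exact: ltW.
    rewrite opprD addrACA subrr addr0.
    have : `|y - ys| < 2 * r'.
      apply: le_lt_trans (ler_distD z _ _) _; rewrite (distrC z); move: yz ysz.
      by move=> h1 h2; rewrite mulrDl mul1r; exact: ltrD.
    have : 32 * r' <= de * t0 by rewrite -ler_pdivlMl// mulrC ge_min lexx orbT.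
    by have := r'0; lra.
  have s3 := hK1 C u C0 hu.
  apply: le_trans (ler_distD (u (y + t0 *: v)) _ _) _.
  rewrite distrC !mulrDl mul1r -addrA; apply: lerD s1 _.
  apply: le_trans (ler_distD (u (ys + t0 *: v)) _ _) _; exact: lerD s2 s3.
have K0 : 0 <= K by have [] := hK x0 (subset_closure Ox0) Ox0.
exists (2 * K); first by rewrite mulr_ge0.
move=> C u C0 hu x y Ox Oy; apply: le_trans (ler_distD (u x0) _ _) _.
have [_ h1] := hK x (subset_closure Ox) Ox; have [_ h2] := hK y (subset_closure Oy) Oy.
by rewrite -mulrA mulrDl mul1r; apply: lerD; [exact: h1|rewrite distrC; exact: h2].
Qed.

End holder.

Section C1_holder.
Variables (R : realType) (d : nat).
Local Notation V := 'rV[R]_d.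
Local Notation e_ := (@evec R d).
Variable O : set V.

Lemma C1_int_holder (f : V -> R) (f' : 'I_d -> V -> R) (M : R) :
  (forall j y, O y -> is_derive y (e_ j) f (f' j y)) -> (forall j y, O y -> `|f' j y| <= M) ->
  int_holder O 1 (d%:R * M) f.
Proof.
move=> df bM x y _ hO; rewrite powRr1// -mulrA.
have Oz z : `|z - x| <= `|y - x| -> O z.
  by move=> zx; apply: hO; apply: le_trans zx _; rewrite ler_peMl// (ler_nat _ 1).
have := @lip_coord R d f f' x (y - x) M.
rewrite [x + _]addrC subrK; apply; first by move=> j z /Oz; exact: df.
by move=> j z /Oz; exact: bM.
Qed.

End C1_holder.

(** * Regularity of weak solutions *)

Section ae.
Context dT (T : measurableType dT) (R : realType).
Variable mu : {measure set T -> \bar R}.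
Implicit Types f g : T -> R.

Lemma L1_ae f g : L1 mu f -> measurable_fun setT g -> {ae mu, forall x, f x = g x} -> L1 mu g.
Proof.
move=> hf mg fg; apply: L1_abs_inv => //; apply: L1_ge0 => //; first exact: measurableT_comp.
have mf := L1_meas hf.
have -> : (\int[mu]_x `|g x|%:E = \int[mu]_x `|f x|%:E)%E.
  apply: ae_eq_integral => //.
  - by apply/measurable_EFinP; exact: measurableT_comp.
  - by apply/measurable_EFinP; exact: measurableT_comp.
  - by apply: filterS fg => x -> _.
by have /integrableP[_ h] := hf; exact: h.
Qed.

Lemma Int_ae f g : measurable_fun setT f -> measurable_fun setT g -> {ae mu, forall x, f x = g x} ->
  \int[mu]_x f x = \int[mu]_x g x.
Proof.
move=> mf mg fg; congr fine; apply: ae_eq_integral => //.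
- exact/measurable_EFinP.
- exact/measurable_EFinP.
- by apply: filterS fg => x -> _.
Qed.

End ae.

Section log_norm.
Variables (R : realType) (n : nat).
Implicit Types (m a c : 'I_n -> R) (de : R).

Definition sqnorm m : R := \sum_i m i ^+ 2.
(* [lognorm] vanishes at [0]; its gradient along a solution of [grad u = - B u] is bounded by [|B|]
   uniformly in [de]. *)
Definition lognorm de m : R := 2^-1 * ln (1 + de^-1 * sqnorm m).
Definition dlognorm de i m : R := m i * (de + sqnorm m)^-1.
(** One crude constant bounds the gradient of [lognorm] and its Lipschitz modulus. It blows up as
    [de] tends to 0, which is harmless: it serves only the passage to the limit in
    [chain_avg_lip]. *)
Definition lognorm_lip_cst de : R := 2 * de^-1 + (1 + de^-1) ^+ 2 + (1 + de^-1).

Lemma sqnorm_ge0 m : 0 <= sqnorm m. Proof. by apply: sumr_ge0 => i _; exact: sqr_ge0. Qed.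

Lemma sqnorm_ge i m : m i ^+ 2 <= sqnorm m.
Proof. by rewrite /sqnorm (bigD1 i)//= lerDl; apply: sumr_ge0 => k _; exact: sqr_ge0. Qed.

Lemma sqnorm_ge_prod i k m : `|m i| * `|m k| <= sqnorm m.
Proof.
have hi := sqnorm_ge i m; have hk := sqnorm_ge k m.
rewrite -[m i ^+ 2]real_normK ?num_real// in hi; rewrite -[m k ^+ 2]real_normK ?num_real// in hk.
have := sqr_ge0 (`|m i| - `|m k|); move: hi hk; move: `|m i| `|m k| (sqnorm m) => x y q.
rewrite sqrrB; move: (x ^+ 2) (y ^+ 2) => X Y; rewrite -mulr_natr; move: (x * y) => Z; lra.
Qed.

Lemma norm_le_sqnorm i m : `|m i| <= 1 + sqnorm m.
Proof.
have hi := sqnorm_ge i m; rewrite -[m i ^+ 2]real_normK ?num_real// in hi.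
have := sqr_ge0 (`|m i| - 1); rewrite sqrrB expr1n mulr1 -mulr_natr.
by have := sqnorm_ge0 m; move: hi; move: `|m i| (`|m i| ^+ 2) (sqnorm m) => x y q; lra.
Qed.

Section de.
Variable de : R.
Hypothesis de0 : 0 < de.

Lemma lognorm_lip_cst_ge0 : 0 <= lognorm_lip_cst de.
Proof.
have i0 : 0 <= de^-1 by rewrite invr_ge0 ltW.
apply: addr_ge0; last exact: addr_ge0.
by apply: addr_ge0; [exact: mulr_ge0|exact: sqr_ge0].
Qed.

Lemma de_sqnorm m : 0 < de + sqnorm m. Proof. by apply: ltr_pwDl => //; exact: sqnorm_ge0. Qed.

Lemma lognorm0 : lognorm de (fun=> 0) = 0.
Proof.
rewrite /lognorm /sqnorm big1 => [|i _]; last by rewrite expr0n.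
by rewrite mulr0 addr0 ln1 mulr0.
Qed.

Let inv_de m : (de + sqnorm m)^-1 <= de^-1.
Proof. by rewrite lef_pV2 ?posrE ?de_sqnorm// lerDl sqnorm_ge0. Qed.

Let inv_ge0 m : 0 <= (de + sqnorm m)^-1. Proof. by rewrite invr_ge0 ltW// de_sqnorm. Qed.

Let norm_inv m : `|(de + sqnorm m)^-1| = (de + sqnorm m)^-1. Proof. exact: ger0_norm. Qed.

Let lgn_l i m : `|m i| * (de + sqnorm m)^-1 <= 1 + de^-1.
Proof.
rewrite ler_pdivrMr ?de_sqnorm//; apply: le_trans (norm_le_sqnorm i m) _.
rewrite mulrDl mul1r mulrDr mulVf ?gt_eqF//.
have h : 0 <= de^-1 * sqnorm m by rewrite mulr_ge0 ?invr_ge0 ?sqnorm_ge0// ltW.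
by move: h de0; move: (de^-1 * sqnorm m) (sqnorm m) => a b; lra.
Qed.

Let de_inv0 : 0 <= de^-1. Proof. by rewrite invr_ge0 ltW. Qed.

Lemma lognorm_bound i m : `|dlognorm de i m| <= lognorm_lip_cst de.
Proof.
rewrite normrM norm_inv; apply: le_trans (lgn_l i m) _.
by rewrite lerDr addr_ge0 ?sqr_ge0// mulr_ge0.
Qed.

(** This is |m i| |m k| <= |m|^2 <= de + |m|^2. Since 1 does not involve [de], the bound of the
    gradient by |B| is uniform. *)
Lemma lognorm_quad i k m : `|dlognorm de i m| * `|m k| <= 1.
Proof.
rewrite normrM norm_inv mulrAC ler_pdivrMr ?de_sqnorm// mul1r.
by apply: le_trans (sqnorm_ge_prod i k m) _; rewrite lerDr ltW.
Qed.

Lemma dlognorm_lip i a c : `|dlognorm de i a - dlognorm de i c| <= lognorm_lip_cst de * \sum_k `|a k - c k|.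
Proof.
have S0 : 0 <= \sum_k `|a k - c k| by apply: sumr_ge0 => k _; exact: normr_ge0.
have Si : `|a i - c i| <= \sum_k `|a k - c k|.
  by rewrite (bigD1 i)//= lerDl; apply: sumr_ge0 => k _; exact: normr_ge0.
have na := lt0r_neq0 (de_sqnorm a); have nc := lt0r_neq0 (de_sqnorm c).
(* The numerators are exchanged first; the difference of the inverses is then a sum of terms (c k -
   a k) (c k + a k) over both denominators. *)
have -> : dlognorm de i a - dlognorm de i c =
    (a i - c i) * (de + sqnorm a)^-1 + \sum_k (c i * (de + sqnorm c)^-1 * ((c k - a k) * ((c k + a k) * (de + sqnorm a)^-1))).
  rewrite -mulr_sumr.
  have -> : \sum_k (c k - a k) * ((c k + a k) * (de + sqnorm a)^-1) = (sqnorm c - sqnorm a) * (de + sqnorm a)^-1.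
    by rewrite /sqnorm -sumrB mulr_suml; apply: eq_bigr => k _; rewrite mulrA -subr_sqr.
  by rewrite /dlognorm; field; rewrite na nc.
apply: le_trans (ler_normD _ _) _.
apply: (@le_trans _ _ (de^-1 * (\sum_k `|a k - c k|) + (de^-1 + (1 + de^-1) ^+ 2) * \sum_k `|a k - c k|)); last first.
  rewrite -mulrDl; apply: ler_wpM2r => //; rewrite /lognorm_lip_cst.
  by move: de_inv0; move: ((1 + de^-1) ^+ 2) (de^-1) => x y; lra.
apply: lerD.
  by rewrite normrM norm_inv mulrC; apply: ler_pM.
apply: le_trans (ler_norm_sum _ _ _) _; rewrite mulr_sumr; apply: ler_sum => k _.
rewrite !normrM !norm_inv mulrCA [`|c k - a k|]distrC mulrC; apply: ler_wpM2r => //.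
rewrite mulrC -mulrA; apply: (@le_trans _ _ ((`|c k| + `|a k|) * ((de + sqnorm a)^-1 * (`|c i| * (de + sqnorm c)^-1)))).
  by apply: ler_wpM2r; [rewrite !mulr_ge0|exact: ler_normD].
rewrite mulrDl; apply: lerD.
  have h := lognorm_quad i k c; rewrite normrM norm_inv in h.
  have -> : `|c k| * ((de + sqnorm a)^-1 * (`|c i| * (de + sqnorm c)^-1)) =
     (de + sqnorm a)^-1 * (`|c i| * (de + sqnorm c)^-1 * `|c k|) by ring.
  by rewrite -[leRHS]mulr1; apply: ler_pM => //; rewrite !mulr_ge0.
by rewrite mulrA expr2; apply: ler_pM; rewrite ?mulr_ge0//; exact: lgn_l.
Qed.

Lemma lognorm_chain (m : 'I_n -> R -> R) (m' : 'I_n -> R) (t : R) :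
  (forall i, is_derive t 1 (m i) (m' i)) ->
  is_derive t 1 (fun s => lognorm de (m^~ s)) (\sum_i dlognorm de i (m^~ t) * m' i).
Proof.
move=> h.
have h1 : is_derive t 1 (fun s => sqnorm (m^~ s)) (\sum_i (2 * m i t ^+ 1 * m' i)).
  exact: (df_sum _ (fun i => dfX 2 (h i))).
have h2 := dfD (is_derive_cst (1 : R) t 1) (dfZ de^-1 h1).
have p0 : 0 < 1 + de^-1 * sqnorm (m^~ t) by rewrite ltr_pwDl// mulr_ge0// sqnorm_ge0.
have h3 := @is_derive1_comp R (@ln R) _ t _ _ (is_derive1_ln p0) h2.
have h4 := dfZ 2^-1 h3.
have -> : \sum_i dlognorm de i (m^~ t) * m' i =
    2^-1 * ((1 + de^-1 * sqnorm (m^~ t))^-1 * (0 + de^-1 * \sum_i (2 * m i t ^+ 1 * m' i))); last exact: h4.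
have -> : 1 + de^-1 * sqnorm (m^~ t) = de^-1 * (de + sqnorm (m^~ t)).
  by rewrite mulrDr mulVf// gt_eqF.
rewrite add0r !mulr_sumr; apply: eq_bigr => i _; rewrite /dlognorm expr1.
by field; rewrite !gt_eqF ?de_sqnorm.
Qed.

Lemma lognorm_lip a c : `|lognorm de a - lognorm de c| <= lognorm_lip_cst de * \sum_k `|a k - c k|.
Proof.
pose m i (t : R) := c i + (a i - c i) * t.
have dm i (t : R) : is_derive t 1 (m i) (a i - c i).
  have := dfD (is_derive_cst (c i) t 1) (dfZ (a i - c i) (is_derive_id t (1 : R))).
  by rewrite add0r mulr1.
have := @mvt_bound R (fun s => lognorm de (m^~ s)) (fun t => \sum_i dlognorm de i (m^~ t) * (a i - c i)) 0 1
  (lognorm_lip_cst de * \sum_k `|a k - c k|) ler01 (fun t _ => lognorm_chain (fun i => dm i t)).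
rewrite subr0 mul1r /m.
have -> : (fun i => c i + (a i - c i) * 1) = a by apply/funext => i; rewrite mulr1 addrC subrK.
have -> : (fun i => c i + (a i - c i) * 0) = c by apply/funext => i; rewrite mulr0 addr0.
apply=> t _; apply: le_trans (ler_norm_sum _ _ _) _; rewrite mulr_sumr; apply: ler_sum => i _.
rewrite normrM; apply: ler_wpM2r => //; exact: lognorm_bound.
Qed.

(** Exponentiation turns a bound on the oscillation of the logarithm into a multiplicative
    comparison whose factor does not contain [de]. *)
Lemma lognorm_le (L : R) m m' : lognorm de m <= lognorm de m' + L ->
  de + sqnorm m <= expR (2 * L) * (de + sqnorm m').
Proof.
move=> h.
have pos k : 0 < 1 + de^-1 * sqnorm k by rewrite ltr_pwDl// mulr_ge0// sqnorm_ge0.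
have : 1 + de^-1 * sqnorm m <= expR (2 * L) * (1 + de^-1 * sqnorm m').
  have e k : expR (ln (1 + de^-1 * sqnorm k)) = 1 + de^-1 * sqnorm k by rewrite lnK ?posrE.
  rewrite -(e m) -(e m') -expRD ler_expR.
  by move: h; rewrite /lognorm; move: (ln _) (ln _) => p q; lra.
have e k : de * (1 + de^-1 * sqnorm k) = de + sqnorm k by rewrite mulrDr mulr1 mulVKf// gt_eqF.
by move/(ler_wpM2l (ltW de0)); rewrite mulrCA !e.
Qed.

End de.
End log_norm.

Section regularity.
Variables (R : realType) (d n : nat).
Local Notation V := 'rV[R]_d.
Local Notation mu := (leb R d).
Local Notation e_ := (@evec R d).
Variables (O : set V) (p : R).
Hypothesis oO : open O.
Hypothesis bO : bounded_set_V O.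
Hypothesis nO : O !=set0.
Hypothesis dp : d%:R < p.
Hypothesis p1 : 1 <= p.
Hypothesis al01 : 0 < 1 - d%:R / p < 1.
Local Notation al := (1 - d%:R / p).
Variable K : R.
Hypothesis K0 : 0 <= K.
Hypothesis hK : forall C (u : V -> R), 0 <= C -> int_holder O al C u ->
  forall x y, O x -> O y -> `|u x - u y| <= K * C.
Implicit Types (x y z : V) (u U : 'I_n -> V -> R).

Variable B : 'I_n -> 'I_d -> 'I_n -> V -> R.
Definition grad_rhs u i j x : R := - \sum_k B i j k x * u k x.
Definition tnorm1 x : R := \sum_i \sum_j \sum_k `|B i j k x|.
Variable J : R.
Hypothesis hB : forall i j k, L1 mu (B i j k).
Hypothesis hBp : L1 mu (fun x => tnorm1 x `^ p).
Hypothesis hJ : \int[mu]_x (tnorm1 x `^ p) <= J.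

Definition weak_sol u := [/\ forall i, L1 mu (u i), forall i x, ~ O x -> u i x = 0,
  forall i j, L1 mu (grad_rhs u i j) & forall i j, weak_grad O j (u i) (grad_rhs u i j)].

Lemma tnorm1_ge0 x : 0 <= tnorm1 x.
Proof. by do 3 (apply: sumr_ge0 => ? _). Qed.

Lemma tnorm1_ge i j k x : `|B i j k x| <= tnorm1 x.
Proof.
rewrite /tnorm1 (bigD1 i)//= (bigD1 j)//= (bigD1 k)//= -!addrA lerDl.
by rewrite !addr_ge0//; do ?(apply: sumr_ge0 => ? _).
Qed.

Lemma tnorm1_ge_slice j x : \sum_i \sum_k `|B i j k x| <= tnorm1 x.
Proof.
apply: ler_sum => i _; rewrite [leRHS](bigD1 j)//= lerDl.
by do 2 (apply: sumr_ge0 => ? _).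
Qed.

Lemma L1_tnorm1 : L1 mu tnorm1.
Proof. by do 3 (apply: L1_sum => ?); exact: L1_abs. Qed.

Lemma L1_tnorm1_powR (c : R) : 0 <= c -> L1 mu (fun x => `|c * tnorm1 x| `^ p) /\
  \int[mu]_x (`|c * tnorm1 x| `^ p) <= c `^ p * J.
Proof.
move=> c0.
have e : (fun x => `|c * tnorm1 x| `^ p) = fun x => c `^ p * tnorm1 x `^ p.
  by apply/funext => x; rewrite ger0_norm ?mulr_ge0 ?tnorm1_ge0// powRM// tnorm1_ge0.
by rewrite e; split; [exact: L1Z|rewrite IntZ// ler_wpM2l// powR_ge0].
Qed.

Lemma weak_sol_ae u u' : weak_sol u -> (forall i, measurable_fun setT (u' i)) ->
  (forall i x, ~ O x -> u' i x = 0) -> (forall i, {ae mu, forall x, u i x = u' i x}) -> weak_sol u'.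
Proof.
move=> [h1 h2 h3 h4] mu' u'0 uu'.
have gm i j : measurable_fun setT (grad_rhs u' i j).
  apply: measurable_funN; apply: measurable_sum => k.
  by apply: measurable_funM => //; exact: L1_meas (hB i j k).
have gae i j : {ae mu, forall x, grad_rhs u i j x = grad_rhs u' i j x}.
  have : {ae mu, forall x, forall k, u k x = u' k x} by apply: filter_forall => k; exact: uu'.
  by apply: filterS => x h; congr (- _); apply: eq_bigr => k _; rewrite h.
split => // [i|i j|i j phi tphi]; [exact: L1_ae (h1 i) _ (uu' i)|exact: L1_ae (h3 i j) _ (gae i j)|].
have [C1 _ hC1] := test_fun_bounded tphi; have [C2 _ hC2] := test_fun_derive_bounded j tphi.
have mp : measurable_fun setT phi by apply: continuous_measurable_rV; exact: smooth_continuous tphi.1.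
have mdp : measurable_fun setT ('D_(e_ j) phi).
  by apply: continuous_measurable_rV; exact: smooth_derive_continuous tphi.1.
have m1 i' := L1_meas (h1 i').
transitivity (\int[mu]_x (u i x * 'D_(e_ j) phi x)).
  apply: Int_ae; [exact: measurable_funM|exact: measurable_funM|].
  by apply: filterS (uu' i) => x ->.
rewrite (h4 i j phi tphi); congr (- _); apply: Int_ae; [|exact: measurable_funM|].
  by apply: measurable_funM => //; exact: L1_meas (h3 i j).
by apply: filterS (gae i j) => x ->.
Qed.

(** [J] is an upper bound for the integral, not the integral itself, so that one constant serves a
    whole sequence of fields. *)
Definition Cb : R := kern_cst R d * (2 ^+ d + J).

Lemma J_ge0 : 0 <= J.
Proof. by apply: le_trans hJ; apply: Int_ge0 => x; exact: powR_ge0. Qed.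

Lemma Cb_ge0 : 0 <= Cb.
Proof. by rewrite mulr_ge0 ?(ltW (kern_cst_gt0 R d))// addr_ge0// J_ge0. Qed.

Lemma avg_lip_le (C C' : R) (w : V -> R) : C <= C' -> avg_lip O al C w -> avg_lip O al C' w.
Proof.
move=> CC h x t s j t0 hO; apply: le_trans (h x t s j t0 hO) _.
by rewrite -!mulrA; apply: ler_wpM2r => //; rewrite mulr_ge0 ?powR_ge0.
Qed.

Lemma weak_sol_log u (de : R) : 0 < de -> weak_sol u ->
  L1 mu (fun x => lognorm de (u^~ x)) /\ avg_lip O al Cb (fun x => lognorm de (u^~ x)).
Proof.
move=> de0 [h1 h2 h3 h4]; split.
  exact: (L1_compF (lognorm_lip_cst_ge0 de0) (lognorm0 n de) (lognorm_lip de0) h1).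
have [hb hbJ] := L1_tnorm1_powR ler01.
have eb : (fun x => `|tnorm1 x| `^ p) = fun x => `|1 * tnorm1 x| `^ p by apply/funext => x; rewrite mul1r.
have hb' : L1 mu (fun x => `|tnorm1 x| `^ p) by rewrite eb.
apply: (@avg_lip_le (kern_cst R d * (2 ^+ d + \int[mu]_y `|tnorm1 y| `^ p))).
  by rewrite ler_wpM2l ?(ltW (kern_cst_gt0 R d))// lerD2l eb (le_trans hbJ)// powR_1l mul1r.
apply: (chain_avg_lip oO dp p1 h1 h3 L1_tnorm1 hb' h4 (lognorm_lip_cst_ge0 de0) (lognorm0 n de) (lognorm_lip de0)
  (F_ := dlognorm de)) => //.
- by move=> i a; exact: lognorm_bound.
- by move=> i a c; exact: dlognorm_lip.
- by move=> m m' t h; exact: lognorm_chain.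
move=> x j; apply: le_trans (tnorm1_ge_slice j x); apply: le_trans (ler_norm_sum _ _ _) _.
apply: ler_sum => i _; rewrite /grad_rhs mulrN normrN mulr_sumr.
apply: le_trans (ler_norm_sum _ _ _) _; apply: ler_sum => k _.
rewrite mulrCA !normrM -[leRHS]mulr1; apply: ler_wpM2l => //.
by rewrite -normrM; exact: lognorm_quad.
Qed.

Definition regL : R := K * (morreyC d al * Cb).
Definition regE : R := expR (2 * regL).

Lemma morreyCb_ge0 : 0 <= morreyC d al * Cb.
Proof. by rewrite mulr_ge0 ?Cb_ge0// morreyC_ge0. Qed.

(** The comparison of de + |u|^2 holds for every [de] with the same factor, and [de] tends to 0. It
    contains unique continuation: a solution that vanishes at y vanishes at x. *)
Lemma weak_sol_compare u x y : weak_sol u -> (forall i z, O z -> {for z, continuous (u i)}) -> O x -> O y ->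
  sqnorm (u^~ x) <= regE * sqnorm (u^~ y).
Proof.
move=> hu cu Ox Oy; apply/ler_addgt0Pr => e e0.
pose de := e / (regE + 1); have E0 : 0 < regE := expR_gt0 _.
have de0 : 0 < de by rewrite divr_gt0// addr_gt0.
have [Lw aw] := weak_sol_log de0 hu.
have cw z : O z -> {for z, continuous (fun x => lognorm de (u^~ x))}.
  move=> Oz; have h : lognorm_lip_cst de * \sum_k `|u k y - u k z| @[y --> z] --> (0 : R).
    by apply: (@cvg_sum_dist0 R V (nbhs z) (nbhs_filter z) n (lognorm_lip_cst de) u) => k; exact: cu.
  apply/continuous_rVP => e' e'0.
  move/cvgr0Pnorm_lt: h => /(_ e' e'0) h.
  have [r /= r0 hr] := (@nbhs_ballP R V z _).1 h.
  exists r => // y' yx; have /hr /= yl : ball z r y' by apply/ball_rVE.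
  by apply: le_lt_trans (lognorm_lip de0 _ _) _; apply: le_lt_trans yl; exact: ler_norm.
have := hK morreyCb_ge0 (fun x y => @morrey_holder R d O al al01 _ Cb Lw Cb_ge0 aw x y) Ox Oy.
rewrite !(morrey_eq al01 Lw Cb_ge0 aw oO)//; try exact: cw.
move=> h; have h' : lognorm de (u^~ x) <= lognorm de (u^~ y) + regL.
  by rewrite -lerBlDl; apply: le_trans h; exact: ler_norm.
have := lognorm_le de0 h'; rewrite -/regE mulrDr => h2.
have h3 : regE * de <= e.
  by rewrite /de mulrCA ler_piMr ?(ltW e0)// ler_pdivrMr ?addr_gt0// mul1r lerDl.
by rewrite addrC; apply: le_trans (lerD h3 (lexx _)); apply: le_trans h2; rewrite lerDr ltW.
Qed.

(** [chain_avg_lip] with a single component and the identity for [F]; the sup bound makes S |B| a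
    majorant of the gradient. *)
Lemma weak_sol_avg_lip u (S : R) i : weak_sol u -> (forall i x, `|u i x| <= S) -> 0 <= S ->
  avg_lip O al (kern_cst R d * (2 ^+ d + S `^ p * J)) (u i).
Proof.
move=> [h1 h2 h3 h4] uS S0; have [hb hbJ] := L1_tnorm1_powR S0.
apply: (@avg_lip_le (kern_cst R d * (2 ^+ d + \int[mu]_y `|S * tnorm1 y| `^ p))).
  by rewrite ler_wpM2l ?(ltW (kern_cst_gt0 R d))// lerD2l.
apply: (@chain_avg_lip R d 1 O p oO dp p1 (fun=> u i) (fun _ j => grad_rhs u i j) (fun x => S * tnorm1 x)
  (fun=> h1 i) (fun _ j => h3 i j) (L1Z S L1_tnorm1) hb (fun _ j => h4 i j) (fun m => m ord0) (fun _ _ => 1) 1) => //.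
- by move=> a c; rewrite big_ord1 mul1r.
- by move=> _ a; rewrite normr1.
- by move=> _ a c; rewrite subrr normr0 mul1r sumr_ge0.
- by move=> m m' t h; rewrite big_ord1 mul1r; exact: h.
move=> x j; rewrite big_ord1 mul1r /grad_rhs normrN mulrC.
apply: le_trans (ler_norm_sum _ _ _) _.
apply: (@le_trans _ _ ((\sum_k `|B i j k x|) * S)).
  by rewrite mulr_suml; apply: ler_sum => k _; rewrite normrM ler_wpM2l.
apply: ler_wpM2r => //; apply: le_trans (tnorm1_ge_slice j x).
by rewrite [leRHS](bigD1 i)//= lerDl; do 2 (apply: sumr_ge0 => ? _).
Qed.

Definition regC (S : R) : R := morreyC d al * (kern_cst R d * (2 ^+ d + S `^ p * J)).

Lemma regC0 S : 0 <= kern_cst R d * (2 ^+ d + S `^ p * J).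
Proof. by rewrite mulr_ge0 ?(ltW (kern_cst_gt0 R d))// addr_ge0// mulr_ge0 ?powR_ge0// J_ge0. Qed.

Lemma weak_sol_holder u (S : R) i : weak_sol u -> (forall i x, `|u i x| <= S) -> 0 <= S ->
  (forall i z, O z -> {for z, continuous (u i)}) -> int_holder O al (regC S) (u i).
Proof.
move=> hu uS S0 cu x y xy hO; have [h1 _ _ _] := hu.
have aw := weak_sol_avg_lip i hu uS S0.
have Ox : O x by apply: hO; rewrite subrr normr0 mulr_ge0.
have Oy : O y by apply: hO; rewrite ler_peMl// (ler_nat _ 1).
have := @morrey_holder R d O al al01 (u i) _ (h1 i) (regC0 S) aw x y xy hO.
by rewrite !(morrey_eq al01 (h1 i) (regC0 S) aw oO)//; exact: cu.
Qed.

(** With [de] = 1 the logarithm has a Morrey representative of bounded oscillation, hence bounded by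
    its value at [x0]. Comparison with the zero vector, where [lognorm] is 0, then bounds |u|. *)
Lemma weak_sol_bounded u : weak_sol u -> exists2 S : R, 0 <= S & forall i, {ae mu, forall x, `|u i x| <= S}.
Proof.
move=> hu; have [h1 h2 _ _] := hu; have [Lw aw] := weak_sol_log ltr01 hu.
have wae := @morrey_ae R d O al al01 _ Cb Lw Cb_ge0 aw oO bO.
have wh := fun x y => @morrey_holder R d O al al01 _ Cb Lw Cb_ge0 aw x y.
move: wae wh; move: (morrey_fun _ _ _ _) => W wae wh.
have [x0 Ox0] := nO.
pose S := 1 + expR (2 * (W x0 + regL)); have S0 : 0 <= S by rewrite addr_ge0// expR_ge0.
exists S => // i; apply: filterS wae => x hx.
have [Ox|nOx] := pselect (O x); last by rewrite h2// normr0.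
have h : lognorm 1 (u^~ x) <= lognorm 1 (fun _ : 'I_n => 0) + (W x0 + regL).
  rewrite (lognorm0 n 1) add0r (hx Ox) -lerBlDl.
  by apply: le_trans (hK morreyCb_ge0 wh Ox Ox0); exact: ler_norm.
have := lognorm_le ltr01 h; have -> : sqnorm (fun _ : 'I_n => 0 : R) = 0.
  by rewrite /sqnorm big1// => k _; rewrite expr0n.
rewrite addr0 mulr1 => h3; apply: le_trans (norm_le_sqnorm i (u^~ x)) _.
by apply: le_trans h3 _; rewrite lerDr.
Qed.

(** Boundedness has to come first, since - B u is controlled in L^p by |B| only once [u] is bounded.
    The bound holds almost everywhere, so [u] is truncated to a bounded [v] before Morrey's estimate
    is applied to each component. *)
Lemma regularity u : weak_sol u -> exists U, [/\ weak_sol U,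
  forall i x, O x -> {for x, continuous (U i)},
  forall i, {ae mu, forall x, u i x = U i x} &
  exists2 S : R, 0 <= S & forall i x, `|U i x| <= S].
Proof.
move=> hu; have [h1 h2 h3 h4] := hu; have [S S0 hS] := weak_sol_bounded hu.
pose v i x := clamp S (u i x).
have vae i : {ae mu, forall x, u i x = v i x}.
  by apply: filterS (hS i) => x xS; rewrite /v clamp_id.
have v0 i x : ~ O x -> v i x = 0 by move=> /(h2 i); rewrite /v => ->; rewrite clamp_id ?normr0.
have mv i : measurable_fun setT (v i).
  exact: (measurableT_comp (measurable_clamp S) (L1_meas (h1 i))).
have gv : weak_sol v by exact: weak_sol_ae hu mv v0 vae.
have vS i x : `|v i x| <= S by exact: clamp_le.
have [g1 _ _ _] := gv.
have aw i := weak_sol_avg_lip i gv vS S0.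
pose W i := @morrey_fun R d O al al01 (v i) _ (g1 i) (regC0 S) (aw i).
have cW i x : O x -> {for x, continuous (W i)}.
  by move=> Ox; exact: (@morrey_continuous R d O al al01 (v i) _ (g1 i) (regC0 S) (aw i) x oO Ox).
have wae i : {ae mu, forall x, O x -> v i x = W i x} by exact: morrey_ae.
pose U i := ext O (W i).
have cU i x : O x -> {for x, continuous (U i)}.
  move=> Ox; have [r r0 hr] := open_rV_ball oO Ox.
  apply/continuous_rVP => e e0; have [r' r'0 hr'] := (continuous_rVP (W i) x).1 (cW i x Ox) e e0.
  exists (Num.min r r'); first by rewrite lt_min r0.
  move=> y; rewrite lt_min => /andP[/hr Oy /hr']; by rewrite /U !ext_in.
have mU i : measurable_fun setT (U i).
  by apply: borel_on_measurable => //; apply: continuous_borel_on => // x; exact: cW.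
have uU i : {ae mu, forall x, u i x = U i x}.
  apply: filterS2 (vae i) (wae i) => x -> h.
  have [Ox|nOx] := pselect (O x); first by rewrite /U ext_in// h.
  by rewrite /U ext_out// v0.
have gU : weak_sol U by apply: (weak_sol_ae hu) => // i x; exact: ext_out.
have EU : 0 <= regE by exact: expR_ge0.
have [x0 Ox0] := nO.
(* [U] agrees with the truncation only almost everywhere, so its bound at every point is taken from
   the comparison with [x0]. *)
exists U; split => //; exists (1 + regE * sqnorm (U^~ x0)).
  by rewrite addr_ge0// mulr_ge0// sqnorm_ge0.
move=> i x; have [Ox|nOx] := pselect (O x); last first.
  by rewrite /U ext_out// normr0 addr_ge0// mulr_ge0// sqnorm_ge0.
apply: le_trans (norm_le_sqnorm i (U^~ x)) _; rewrite lerD2l.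
exact: weak_sol_compare.
Qed.

End regularity.

(** * Linear differential equations and parallel transport *)

Section real_ode.
Variable R : realType.
Implicit Types (f g h : R -> R) (t s : R).

Let diff_quot (F l s : R) : s != 0 -> (l - s^-1 *: F) * s = - (F - l * s).
Proof. by move=> s0; rewrite -[s^-1 *: F]/(s^-1 * F); field. Qed.

Lemma is_deriveP f t (l : R) : is_derive t 1 f l <->
  forall e, 0 < e -> exists2 r : R, 0 < r & forall s : R, `|s| < r -> `|f (t + s) - f t - l * s| <= e * `|s|.
Proof.
split=> [D e e0|H].
  have h1 : derivable f t 1 := @ex_derive _ _ _ _ _ _ _ D.
  have h2 : 'D_1 f t = l := @derive_val _ _ _ _ _ _ _ D.
  have h3 : s^-1 *: ((f \o shift t) (s *: 1) - f t) @[s --> 0^'] --> l by rewrite -h2; exact: h1.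
  move/cvgrPdist_le : h3 => /(_ e e0)[/= r r0 hr]; exists r => // s sr.
  have [->|s0] := eqVneq s 0; first by rewrite addr0 subrr mulr0 subrr normr0 mulr0.
  have := hr s; rewrite /ball_/= sub0r normrN => /(_ sr s0); rewrite [s *: 1]mulr1 [s + t]addrC.
  by move/(ler_wpM2r (normr_ge0 s)); rewrite -normrM (diff_quot _ _ s0) normrN.
have h : s^-1 *: ((f \o shift t) (s *: 1) - f t) @[s --> 0^'] --> l.
  apply/cvgrPdist_le => e e0; have [r r0 hr] := H e e0; near=> s.
  have s0 : s != 0 by near: s; exact: nbhs_dnbhs_neq.
  have sr : `|s| < r by near: s; exact: dnbhs0_lt.
  have s1 : 0 < `|s| by rewrite normr_gt0.
  rewrite -(ler_pM2r s1) -normrM; apply: le_trans (hr s sr).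
  by rewrite /= [s *: 1]mulr1 [s + t]addrC (diff_quot _ _ s0) normrN.
by split; [apply/cvg_ex; exists l|exact: cvg_lim].
Unshelve. all: by end_near. Qed.

Lemma nondecreasing_derive f (f' : R -> R) (a b : R) : a <= b ->
  (forall t, a <= t <= b -> is_derive t 1 f (f' t)) -> (forall t, a <= t <= b -> 0 <= f' t) -> f a <= f b.
Proof.
move=> ab df f0.
have inI t : t \in `]a, b[ -> a <= t <= b by rewrite in_itv/= => /andP[t1 t2]; rewrite !ltW.
have [||c cab e] := @MVT_segment R f f' a b ab.
- by move=> t /inI; exact: df.
- apply: continuous_in_subspaceT => t; rewrite inE/= in_itv/= => tab.
  exact: is_derive_continuous (df t tab).
have h : 0 <= b - a by rewrite subr_ge0.
by rewrite -subr_ge0 e mulr_ge0// f0//; move: cab; rewrite in_itv.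
Qed.

Lemma mvt_compare f h (f' h' : R -> R) (a b : R) : a <= b ->
  (forall t, a <= t <= b -> is_derive t 1 f (f' t)) -> (forall t, a <= t <= b -> is_derive t 1 h (h' t)) ->
  (forall t, a <= t <= b -> `|f' t| <= h' t) -> `|f b - f a| <= h b - h a.
Proof.
move=> ab df dh fh.
have h1 := nondecreasing_derive ab (fun t ht => dfB (dh t ht) (df t ht)).
have h2 := nondecreasing_derive ab (fun t ht => dfD (dh t ht) (df t ht)).
have {}h1 : h a - f a <= h b - f b.
  by apply: h1 => t /fh; rewrite subr_ge0; apply: le_trans; exact: ler_norm.
have {}h2 : h a + f a <= h b + f b.
  by apply: h2 => t /fh; rewrite ler_norml => /andP[]; lra.
by rewrite ler_norml; apply/andP; split; lra.
Qed.

Lemma primitive f : continuous f -> exists F : R -> R,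
  F 0 = 0 /\ forall t, 0 <= t <= 1 -> is_derive t 1 F (f t).
Proof.
(* The integral starts at -1 and is considered up to 2, so that 0 and 1 are interior and the
   derivatives there are two-sided. *)
move=> cf; pose G x := (\int[lebesgue_measure]_(t in `[(-1 : R), x]) f t)%R.
have intf : (@lebesgue_measure R).-integrable `[(-1 : R), 2] (EFin \o f).
  apply: continuous_compact_integrable; first exact: segment_compact.
  exact: continuous_subspaceT.
exists (fun x => G x - G 0); split; first by rewrite subrr.
move=> t /andP[t0 t1].
have t2 : t < 2 by apply: le_lt_trans t1 _; rewrite ltr1n.
have tm : -1 < t by apply: lt_le_trans t0; rewrite ltrN10.
have [dG eG] := continuous_FTC1_closed t2 intf tm (cf t).
have D : is_derive t 1 G (f t) by split; [exact: dG|rewrite -derive1E; exact: eG].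
have := dfB D (is_derive_cst (G 0) t 1); rewrite subr0; exact.
Qed.

Lemma geometric_limit (x : nat -> R) (D : R) : (forall m, `|x m.+1 - x m| <= D * 2^-1 ^+ m) ->
  exists l : R, forall m, `|x m - l| <= 2 * D * 2^-1 ^+ m.
Proof.
move=> h; have D0 : 0 <= D.
  by have := h 0%N; rewrite expr0 mulr1; apply: le_trans; exact: normr_ge0.
have q0 m : 0 <= (2^-1 : R) ^+ m by rewrite exprn_ge0.
have T m k : `|x m - x (m + k)%N| <= 2 * D * (2^-1 ^+ m - 2^-1 ^+ (m + k)).
  elim: k => [|k IH]; first by rewrite addn0 !subrr normr0 mulr0.
  rewrite addnS; apply: dist_telescope IH _; rewrite distrC; apply: le_trans (h _) _.
  by rewrite exprS le_eqVlt; apply/orP; left; apply/eqP; field.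
have T' m k : x m - 2 * D * 2^-1 ^+ m <= x k + 2 * D * 2^-1 ^+ k.
  have D2 : 0 <= 2 * D by rewrite mulr_ge0.
  have W a b : `|x a - x (a + b)%N| <= 2 * D * 2^-1 ^+ a.
    by apply: le_trans (T a b) _; apply: ler_wpM2l => //; rewrite lerBlDr lerDl.
  have [mk|/ltnW mk] := leqP m k.
    by apply: dist_le_add; [rewrite mulr_ge0|have := W m (k - m)%N; rewrite subnKC].
  by apply: dist_ge_add; [rewrite mulr_ge0|have := W k (m - k)%N; rewrite subnKC].
pose A := [set y | exists m, y = x m - 2 * D * 2^-1 ^+ m].
have A0 : A !=set0 by exists (x 0%N - 2 * D * 2^-1 ^+ 0), 0%N.
have Aub k : ubound A (x k + 2 * D * 2^-1 ^+ k) by move=> y [m ->].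
exists (sup A) => m; rewrite ler_distl; apply/andP; split.
  by rewrite lerBlDr; apply: le_trans (_ : x m + 2 * D * 2^-1 ^+ m <= _) => //; rewrite ?lerBlDr; apply: ge_sup.
by rewrite -lerBlDr; apply: ub_le_sup; [exists (x 0%N + 2 * D * 2^-1 ^+ 0)|exists m].
Qed.

Definition clamp01 t := Num.max 0 (Num.min 1 t).

Lemma clamp01_in t : 0 <= clamp01 t <= 1.
Proof. by rewrite /clamp01 le_max lexx/= ge_max ler01 ge_min lexx. Qed.

Lemma clamp01_id t : 0 <= t <= 1 -> clamp01 t = t.
Proof. by move=> /andP[t0 t1]; rewrite /clamp01 (min_idPr t1) (max_idPr t0). Qed.

Lemma clamp01_continuous : continuous clamp01.
Proof.
move=> t; apply: continuous_max; first exact: cvg_cst.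
by apply: continuous_min; [exact: cvg_cst|exact: cvg_id].
Qed.

Lemma half_cvg0 (D : R) : D * 2^-1 ^+ m @[m --> \oo] --> (0 : R).
Proof. by apply: cvg_geometric; rewrite ger0_norm// invf_lt1// ltr1n. Qed.

Lemma le_half_cvg (x D : R) : (forall m, x <= D * 2^-1 ^+ m) -> x <= 0.
Proof.
move=> h; apply/ler_addgt0Pr => e e0; rewrite add0r.
have /cvgr0Pnorm_lt /(_ e e0) [m _ hm] := half_cvg0 D.
by apply: le_trans (h m) _; apply: le_trans (ler_norm _) (ltW (hm m _)) => /=.
Qed.

Section linear_ode.
Variables (n : nat) (a : 'I_n -> 'I_n -> R -> R) (K : R) (v : 'I_n -> R).
Hypothesis ca : forall i k, continuous (a i k).
Hypothesis K0 : 0 <= K.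
Hypothesis aK : forall i k t, `|a i k t| <= K.

Let Prim : {P : (R -> R) -> (R -> R) | forall f, continuous f ->
  P f 0 = 0 /\ forall t, 0 <= t <= 1 -> is_derive t 1 (P f) (f t)}.
Proof.
have /choice [P hP] : forall f : R -> R, exists F : R -> R, continuous f ->
    F 0 = 0 /\ forall t, 0 <= t <= 1 -> is_derive t 1 F (f t).
  move=> f; have [cf|ncf] := pselect (continuous f); last by exists (fun=> 0).
  by have [F hF] := primitive cf; exists F.
by exists P.
Qed.

Let P := sval Prim.
Let P0 f : continuous f -> P f 0 = 0. Proof. by move=> cf; have [] := svalP Prim f cf. Qed.
Let dP f t : continuous f -> 0 <= t <= 1 -> is_derive t 1 (P f) (f t).
Proof. by move=> cf; have [_] := svalP Prim f cf; exact. Qed.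

Let rhs (phi : 'I_n -> R -> R) i t := \sum_k a i k t * phi k (clamp01 t).
Fixpoint picard m : 'I_n -> R -> R :=
  if m is m'.+1 then fun i t => v i + P (rhs (picard m') i) t else fun i _ => v i.

Let rhs_continuous (phi : 'I_n -> R -> R) i :
  (forall k t, 0 <= t <= 1 -> {for t, continuous (phi k)}) -> continuous (rhs phi i).
Proof.
move=> cphi t; apply: cvg_sumr => k; apply: cvg_mulr; first exact: ca.
apply: (@continuous_comp _ _ _ clamp01 (phi k)); first exact: clamp01_continuous.
by apply: cphi; exact: clamp01_in.
Qed.

Let picard_continuous m k t : 0 <= t <= 1 -> {for t, continuous (picard m k)}.
Proof.
elim: m k t => [|m IH] k t t01 /=; first exact: cvg_cst.
have D := dfD (is_derive_cst (v k) t 1) (dP (@rhs_continuous (picard m) k IH) t01).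
exact: is_derive_continuous D.
Qed.

Let dpicard m i t : 0 <= t <= 1 -> is_derive t 1 (picard m.+1 i) (rhs (picard m) i t).
Proof.
move=> t01.
have := dfD (is_derive_cst (v i) t 1) (dP (@rhs_continuous (picard m) i (@picard_continuous m)) t01).
by rewrite add0r.
Qed.

Let picard0 m i : picard m i 0 = v i.
Proof. by case: m => //= m; rewrite P0 ?addr0//; apply: rhs_continuous; exact: picard_continuous. Qed.

Let W : R := n%:R * K + K + 1.
Let VV : R := \sum_i `|v i|.
Let W0 : 0 < W. Proof. by rewrite ltr_wpDl// addr_ge0// mulr_ge0. Qed.
Let VV0 : 0 <= VV. Proof. by apply: sumr_ge0 => i _; exact: normr_ge0. Qed.
(** The exponential weight makes the iteration a contraction of ratio 1/2 on all of [0, 1]: the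
    integrand of the next difference is at most W h_m = 2 W h_(m+1), which is the derivative of
    h_(m+1). *)
Let h (m : nat) t := VV * 2^-1 ^+ m * expR (2 * W * t).

Let dh m t : is_derive t 1 (h m) (2 * W * h m t).
Proof.
have h1 := @is_derive1_comp R (@expR R) (fun t => 2 * W * t) t _ _ (is_derive_expR _) (dfZ (2 * W) (is_derive_id t (1 : R))).
have := dfZ (VV * 2^-1 ^+ m) h1; rewrite mulr1 => D'.
have -> : 2 * W * h m t = VV * 2^-1 ^+ m * (expR (2 * W * t) * (2 * W)) by rewrite /h; ring.
exact: D'.
Qed.

Let h_ge0 m t : 0 <= h m t. Proof. by rewrite mulr_ge0 ?expR_ge0// mulr_ge0. Qed.

Let rhs_le (phi psi : 'I_n -> R -> R) i t (c : R) : 0 <= t <= 1 -> 0 <= c ->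
  (forall k, `|phi k t - psi k t| <= c) -> `|rhs phi i t - rhs psi i t| <= W * c.
Proof.
move=> t01 c0 hc; rewrite /rhs -sumrB clamp01_id//; apply: le_trans (ler_norm_sum _ _ _) _.
apply: (@le_trans _ _ (\sum_(k < n) K * c)).
  by apply: ler_sum => k _; rewrite -mulrBr normrM; apply: ler_pM.
rewrite sumr_const card_ord -mulr_natl mulrA; apply: ler_wpM2r => //.
by rewrite /W -addrA lerDl addr_ge0.
Qed.

Let picard_step m i t : 0 <= t <= 1 -> `|picard m.+1 i t - picard m i t| <= h m t.
Proof.
elim: m i t => [|m IH] i t /andP[t0 t1].
  have t01 s : 0 <= s <= t -> 0 <= s <= 1 by case/andP=> -> st; exact: le_trans st t1.
  have := @mvt_compare (picard 1 i) (h 0) (rhs (picard 0) i) (fun t => 2 * W * h 0 t) 0 t t0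
    (fun s hs => dpicard 0 i (t01 s hs)) (fun s _ => dh 0 s).
  rewrite picard0 => H; apply: le_trans (H _) _; last by rewrite lerBlDr lerDl.
  move=> s hs; apply: le_trans (ler_norm_sum _ _ _) _.
  apply: (@le_trans _ _ (K * VV)).
    rewrite mulr_sumr; apply: ler_sum => k _; rewrite normrM /=.
    by apply: ler_wpM2r.
  rewrite /h expr0 mulr1; apply: (@le_trans _ _ (2 * W * VV)).
    apply: ler_wpM2r => //; rewrite /W; have := mulr_ge0 (ler0n R n) K0; have := K0.
    move: (_ * K) => u; lra.
  have W2 : 0 <= 2 * W by rewrite mulr_ge0// ltW.
  have s0 : 0 <= s by case/andP: hs.
  apply: ler_wpM2l => //; rewrite ler_peMr//; apply: (@le_trans _ _ (expR 0)); first by rewrite expR0.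
  by rewrite ler_expR mulr_ge0.
have t01 s : 0 <= s <= t -> 0 <= s <= 1 by case/andP=> -> st; exact: le_trans st t1.
have := @mvt_compare (fun s => picard m.+2 i s - picard m.+1 i s) (h m.+1)
  (fun s => rhs (picard m.+1) i s - rhs (picard m) i s) (fun t => 2 * W * h m.+1 t) 0 t t0
  (fun s hs => dfB (dpicard m.+1 i (t01 s hs)) (dpicard m i (t01 s hs))) (fun s _ => dh m.+1 s).
rewrite !picard0 subrr subr0 => H; apply: le_trans (H _) _; last by rewrite lerBlDr lerDl.
move=> s /t01 hs; apply: le_trans (rhs_le i hs (h_ge0 m s) (fun k => IH k s hs)) _.
by rewrite /h exprS le_eqVlt; apply/orP; left; apply/eqP; field.
Qed.

Let D : R := VV * expR (2 * W).

Let picard_lim i t : exists l : R, forall m, `|picard m i (clamp01 t) - l| <= 2 * D * 2^-1 ^+ m.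
Proof.
apply: geometric_limit => m; have t01 := clamp01_in t.
apply: le_trans (picard_step m i t01) _; rewrite /h /D mulrAC; apply: ler_wpM2r => //.
apply: ler_wpM2l => //; rewrite ler_expR ler_piMr//; first by rewrite mulr_ge0// ltW.
by case/andP: t01.
Qed.

(** The limit [phi0] of the iterates is only known to be continuous. The function [psi], a primitive
    of its right-hand side, is differentiable and coincides with [phi0] on [0, 1], hence solves the
    equation. *)
Lemma linear_ode : exists phi : R -> 'I_n -> R, phi 0 = v /\
  forall t i, 0 <= t <= 1 -> is_derive t 1 (phi^~ i) (\sum_k a i k t * phi t k).
Proof.
have /choice [phi0 hphi] : forall i, exists f : R -> R, forall t m, `|picard m i (clamp01 t) - f t| <= 2 * D * 2^-1 ^+ m.
  by move=> i; have /choice [f hf] := picard_lim i; exists f.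
have D0 : 0 <= D by rewrite mulr_ge0// expR_ge0.
have cphi k t : {for t, continuous (phi0 k)}.
  apply/cvgrPdist_lt => e e0.
  have e3 : 0 < e / 3 by rewrite divr_gt0.
  have /cvgr0Pnorm_lt /(_ _ e3) [m _ /(_ m (leqnn m)) hm] := half_cvg0 (2 * D).
  have cm : {for t, continuous (picard m k \o clamp01)}.
    apply: continuous_comp; first exact: clamp01_continuous.
    by apply: picard_continuous; exact: clamp01_in.
  move/cvgrPdist_lt: cm => /(_ _ e3); apply: filterS => s /= hs.
  have h1 := le_lt_trans (hphi k t m) (le_lt_trans (ler_norm _) hm).
  have h2 := le_lt_trans (hphi k s m) (le_lt_trans (ler_norm _) hm).
  apply: le_lt_trans (ler_distD (picard m k (clamp01 t)) _ _) _.
  apply: le_lt_trans (lerD (lexx _) (ler_distD (picard m k (clamp01 s)) _ _)) _.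
  rewrite distrC; move: h1 h2 hs; move: `|_ - phi0 k t| `|_ - phi0 k s| `|_ - picard m k (clamp01 s)| => x y z; lra.
pose psi (t : R) i := v i + P (rhs phi0 i) t.
have crhs i : continuous (rhs phi0 i) by apply: rhs_continuous => k t _; exact: cphi.
have dpsi i t : 0 <= t <= 1 -> is_derive t 1 (psi^~ i) (rhs phi0 i t).
  move=> t01; have := dfD (is_derive_cst (v i) t 1) (dP (crhs i) t01).
  by rewrite add0r.
have psi0 : psi 0 = v by apply/funext => i; rewrite /psi P0// addr0.
have e i t : 0 <= t <= 1 -> phi0 i t = psi t i.
  move=> /andP[t0 t1]; have t01 s : 0 <= s <= t -> 0 <= s <= 1 by case/andP=> -> st; exact: le_trans st t1.
  apply/eqP; rewrite -subr_eq0 -normr_le0; apply: (@le_half_cvg _ (W * (2 * D) + 2 * D)) => m.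
  have := @mvt_bound R (fun s => psi s i - picard m.+1 i s) (fun s => rhs phi0 i s - rhs (picard m) i s) 0 t
    (W * (2 * D * 2^-1 ^+ m)) t0 (fun s hs => dfB (dpsi i s (t01 s hs)) (dpicard m i (t01 s hs))).
  rewrite psi0 picard0 subrr !subr0 => H.
  have D2 : 0 <= 2 * D * 2^-1 ^+ m by rewrite mulr_ge0// mulr_ge0.
  have H1 : `|psi t i - picard m.+1 i t| <= W * (2 * D * 2^-1 ^+ m).
    apply: le_trans (H _) _.
      move=> s /t01 hs; apply: rhs_le => // k.
      by rewrite distrC; have := hphi k s m; rewrite clamp01_id.
    by rewrite ler_piMl// mulr_ge0// ltW.
  have H2 : `|picard m.+1 i t - phi0 i t| <= 2 * D * 2^-1 ^+ m.
    have := hphi i t m.+1; rewrite clamp01_id ?t0// => hh; apply: le_trans hh _.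
    by rewrite exprS mulrCA ler_piMl// invf_le1// ler1n.
  rewrite distrC; apply: le_trans (ler_distD (picard m.+1 i t) _ _) _.
  by rewrite mulrDl -mulrA; exact: lerD H1 H2.
exists psi; split => // t i t01; have := dpsi i t t01; rewrite /rhs clamp01_id//.
by under eq_bigr do rewrite e//.
Qed.

End linear_ode.

(** |phi|^2 exp(-C t) has non-positive derivative, and one mean value theorem compares its ends.
    Derivatives are needed only inside the interval, which is all that [transport_sol] provides. *)
Lemma gronwall n (a : 'I_n -> 'I_n -> R -> R) (K : R) (phi : R -> 'I_n -> R) :
  (forall i, {within `[0, 1], continuous (phi^~ i)}) ->
  (forall t i, 0 < t < 1 -> is_derive t 1 (phi^~ i) (\sum_k a i k t * phi t k)) ->
  (forall i k t, 0 <= t <= 1 -> `|a i k t| <= K) ->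
  sqnorm (phi 1) <= expR (2 * (n%:R * n%:R * K)) * sqnorm (phi 0).
Proof.
move=> cphi dphi aK; pose C := 2 * (n%:R * n%:R * K).
pose q t := sqnorm (phi t); pose e t := q t * expR (- C * t).
have dq t : 0 < t < 1 -> is_derive t 1 q (\sum_i (2 * phi t i ^+ 1 * \sum_k a i k t * phi t k)).
  by move=> t01; exact: (df_sum _ (fun i => dfX 2 (dphi t i t01))).
have dE t : is_derive t 1 (fun t => expR (- C * t)) (expR (- C * t) * (- C)).
  have := @is_derive1_comp R (@expR R) (fun t => - C * t) t _ _ (is_derive_expR _) (dfZ (- C) (is_derive_id t (1 : R))).
  by rewrite mulr1.
have de t (t01 : 0 < t < 1) := dfM (dq t t01) (dE t).
have inI t : t \in `]0, 1[ -> 0 < t < 1 by rewrite in_itv.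
have ce : {within `[0, 1], continuous e}.
  move=> t; apply: cvg_mulr.
    have -> : q = fun t => \sum_i phi t i * phi t i.
      by apply/funext => s; apply: eq_bigr => i _; rewrite expr2.
    by apply: cvg_sumr => i; apply: cvg_mulr; exact: cphi.
  have h : {within `[0, 1], continuous (fun t => expR (- C * t))}.
    apply: continuous_subspaceT => s; apply: is_derive_continuous (dE s).
  exact: h.
have [c] := MVT ltr01 (fun t ht => de t (inI t ht)) ce.
rewrite in_itv/= => c01 E.
have q0 : 0 <= q c := sqnorm_ge0 _.
have h1 : \sum_i (2 * phi c i ^+ 1 * \sum_k a i k c * phi c k) <= C * q c.
  apply: (@le_trans _ _ (\sum_(i < n) \sum_(k < n) 2 * K * q c)); last first.
    rewrite !sumr_const !card_ord /C -[_ *+ n *+ n]mulr_natr -[2 * K * q c *+ n]mulr_natr.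
    by rewrite le_eqVlt; apply/orP; left; apply/eqP; ring.
  apply: ler_sum => i _; rewrite mulr_sumr; apply: ler_sum => k _.
  rewrite expr1; apply: le_trans (ler_norm _) _; rewrite !normrM ger0_norm// -!mulrA ler_pM2l//.
  rewrite mulrCA; apply: ler_pM => //; first by apply: aK; case/andP: c01 => c0 c1; rewrite !ltW.
  exact: sqnorm_ge_prod.
have h2 : e 1 <= e 0.
  rewrite -subr_le0 E subr0 mulr1 [X in X + _]mulrC.
  have -> : q c * (expR (- C * c) * - C) = - (expR (- C * c) * (C * q c)) by ring.
  by rewrite subr_le0 ler_wpM2l// expR_ge0.
have : expR C * e 1 <= expR C * e 0 by rewrite ler_wpM2l// expR_ge0.
rewrite /e !mulr1 mulr0 expR0 mulr1 mulrCA -expRD subrr expR0 mulr1; exact.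
Qed.

End real_ode.

Section smooth_step.
Variable R : realType.
Implicit Types t : R.

(** A smooth transition from 0 to 1. Curves reparametrised by it start and stop at rest, so that
    they can be joined with continuous velocity. *)
Definition step t : R := exp_inv 0 t * (exp_inv 0 t + exp_inv 0 (1 - t))^-1.
Definition dstep t : R := (exp_inv 2 t * exp_inv 0 (1 - t) + exp_inv 0 t * exp_inv 2 (1 - t)) *
  (exp_inv 0 t + exp_inv 0 (1 - t)) ^- 2.

Let eexp0 k t : t <= 0 -> exp_inv k t = 0.
Proof. by move=> t0; rewrite /exp_inv ltNge t0. Qed.

Let eexp_gt0 t : 0 < t -> 0 < exp_inv 0 t.
Proof. by move=> t0; rewrite /exp_inv t0 expr0 mul1r expR_gt0. Qed.

Let den t : 0 < exp_inv 0 t + exp_inv 0 (1 - t).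
Proof.
have [t0|t0] := leP t 0.
  by apply: ltr_wpDl; [exact: exp_inv_ge0|apply: eexp_gt0; lra].
by apply: ltr_pwDl; [exact: eexp_gt0|exact: exp_inv_ge0].
Qed.

Let deexp t : is_derive t 1 (@exp_inv R 0) (exp_inv 2 t).
Proof. by have := is_derive_exp_inv 0 t; rewrite mul0r subr0. Qed.

Let deexp1 t : is_derive t 1 (fun s : R => exp_inv 0 (1 - s)) (- exp_inv 2 (1 - t)).
Proof.
have := @is_derive_affine R (exp_inv 0) (-1) 1 t (exp_inv 2 (1 - t)).
rewrite mulN1r addrC => /(_ (deexp _)); rewrite mulN1r.
by under eq_fun do rewrite mulN1r addrC.
Qed.

Lemma is_derive_step t : is_derive t 1 step (dstep t).
Proof.
have := dfM (deexp t) (dfV (f := fun s : R => exp_inv 0 s + exp_inv 0 (1 - s)) (lt0r_neq0 (den t)) (dfD (deexp t) (deexp1 t))).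
have -> // : exp_inv 2 t * (exp_inv 0 t + exp_inv 0 (1 - t))^-1 + exp_inv 0 t *
    (- (exp_inv 0 t + exp_inv 0 (1 - t)) ^- 2 * (exp_inv 2 t + - exp_inv 2 (1 - t))) = dstep t.
rewrite /dstep; have := lt0r_neq0 (den t); move: (exp_inv 0 t) (exp_inv 0 _) (exp_inv 2 t) (exp_inv 2 _) => a b c e h.
by field.
Qed.

Let eexp_continuous k : continuous (@exp_inv R k).
Proof. by move=> t; exact: is_derive_continuous (is_derive_exp_inv k t). Qed.

Let eexp1_continuous k : continuous (fun t : R => exp_inv k (1 - t)).
Proof.
move=> t; apply: (@continuous_comp _ _ _ (fun t : R => 1 - t) (@exp_inv R k)); last exact: eexp_continuous.
by apply: cvgB; [exact: cvg_cst|exact: cvg_id].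
Qed.

Lemma dstep_continuous : continuous dstep.
Proof.
move=> t; apply: cvg_mulr.
  by apply: cvgD; apply: cvg_mulr; (exact: eexp_continuous || exact: eexp1_continuous).
apply: cvgV; first by rewrite expf_neq0// lt0r_neq0// den.
under eq_fun do rewrite expr2; rewrite expr2.
by apply: cvg_mulr; apply: cvgD; (exact: eexp_continuous || exact: eexp1_continuous).
Qed.

Lemma step_in t : 0 <= step t <= 1.
Proof.
rewrite /step divr_ge0 ?exp_inv_ge0 ?(ltW (den t))//=.
by rewrite ler_pdivrMr// mul1r lerDl exp_inv_ge0.
Qed.

Lemma step_le0 t : t <= 0 -> step t = 0.
Proof. by move=> t0; rewrite /step eexp0// mul0r. Qed.

Lemma step_ge1 t : 1 <= t -> step t = 1.
Proof.
move=> t1; have := den t; rewrite /step [exp_inv 0 (1 - t)]eexp0 ?subr_le0// addr0 => h.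
by rewrite divff// gt_eqF.
Qed.

Lemma dstep_le0 t : t <= 0 -> dstep t = 0.
Proof. by move=> t0; rewrite /dstep (eexp0 2 t0) (eexp0 0 t0) !mul0r addr0 mul0r. Qed.

Lemma dstep_ge1 t : 1 <= t -> dstep t = 0.
Proof.
move=> t1; have h : 1 - t <= 0 by rewrite subr_le0.
by rewrite /dstep (eexp0 2 h) (eexp0 0 h) !mulr0 addr0 mul0r.
Qed.

End smooth_step.

Section curves.
Variables (R : realType) (d : nat).
Local Notation V := 'rV[R]_d.
Local Notation e_ := (@evec R d).
Implicit Types (g h : R -> V) (t s : R).

Lemma derive_rVP g t (l : 'I_d -> R) : (forall j, is_derive t 1 (fun s => g s 0 j) (l j)) ->
  derivable g t 1 /\ forall j, ('D_1 g t) 0 j = l j.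
Proof.
move=> h; have D : derivable g t 1.
  by apply/derivable_mxP => i j; rewrite ord1; exact: (@ex_derive _ _ _ _ _ _ _ (h j)).
by split => // j; rewrite (derive_mx D) mxE; exact: (@derive_val _ _ _ _ _ _ _ (h j)).
Qed.

Lemma derivable_rV_coord g t j : derivable g t 1 -> is_derive t 1 (fun s => g s 0 j) (('D_1 g t) 0 j).
Proof.
move=> D; have h := (derivable_mxP g t 1).1 D 0 j.
by rewrite (derive_mx D) mxE; exact: derivableP h.
Qed.

Lemma continuous_to_rV (T : topologicalType) (g : T -> V) (t : T) :
  (forall j, {for t, continuous (fun s : T => g s 0 j)}) -> {for t, continuous g}.
Proof.
move=> h; apply/cvgrPdist_lt => e e0.
have : \forall s \near t, forall j, `|g t 0 j - g s 0 j| < e.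
  by apply: filter_forall => j; have /cvgrPdist_lt /(_ e e0) := h j.
by apply: filterS => s hs; apply/normr_rVlt => // j; rewrite rVB.
Qed.

Lemma continuous_rV_coord (T : topologicalType) (g : T -> V) (t : T) j :
  {for t, continuous g} -> {for t, continuous (fun s : T => g s 0 j)}.
Proof.
move=> h; apply/cvgrPdist_lt => e e0; move/cvgrPdist_lt: h => /(_ e e0).
apply: filterS => s; apply: le_lt_trans; rewrite -rVB; exact: normr_rV_coord.
Qed.

Lemma derivable_continuous_rV g t : derivable g t 1 -> {for t, continuous g}.
Proof.
move=> D; apply: continuous_to_rV => j.
exact: is_derive_continuous (derivable_rV_coord j D).
Qed.

(** Once the linear part at g t is subtracted, the remainder has small partial derivatives near that
    point; by [lip_coord] it is o(|w|), and along the curve o(s). *)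
Lemma chain_rule (O : set V) (f : V -> R) (f' : 'I_d -> V -> R) g t : open O -> O (g t) ->
  (forall j y, O y -> is_derive y (e_ j) f (f' j y)) -> (forall j, {for g t, continuous (f' j)}) ->
  derivable g t 1 -> is_derive t 1 (fun s => f (g s)) (\sum_j f' j (g t) * ('D_1 g t) 0 j).
Proof.
move=> oO Ogt df cf Dg; pose y0 := g t; pose q j := f' j y0.
pose F y := f y - \sum_j q j * y 0 j.
have hF : forall e, 0 < e -> exists2 r : R, 0 < r & forall w, `|w| < r -> `|F (y0 + w) - F y0| <= d%:R * (e * `|w|).
  move=> e e0; have [r r0 hr] := open_rV_ball oO Ogt.
  have hs : 1 * \sum_j `|f' j y - f' j y0| @[y --> y0] --> (0 : R).
    by apply: (@cvg_sum_dist0 R V (nbhs y0) (nbhs_filter y0) d 1 f') => j; exact: cf.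
  move/cvgr0Pnorm_lt: hs => /(_ e e0) hs.
  have [r' /= r'0 hr'] := (@nbhs_ballP R V y0 _).1 hs.
  exists (Num.min r r'); first by rewrite lt_min r0.
  move=> w; rewrite lt_min => /andP[wr wr'].
  apply: (@lip_coord R d F (fun j y => f' j y - q j)) => j y yw.
    apply: dfB; first by apply: df; apply: hr; exact: le_lt_trans yw wr.
    have D i : is_derive y (e_ j) (fun z : V => q i * z 0 i) (q i * (i == j)%:R).
      apply: dfZ; apply/is_derive_line.
      have := @is_derive_affine R id ((e_ j) 0 i) (y 0 i) 0 1 (is_derive_id _ _).
      rewrite mulr1 mxE eq_sym; under eq_fun do rewrite addrC mulrC.
      by under [X in _ -> is_derive _ _ X _]eq_fun do rewrite !mxE [j == i]eq_sym.
    have := df_sum (index_enum 'I_d) D; rewrite (bigD1 j)//= eqxx mulr1 big1 ?addr0// => i /negbTE ->.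
    by rewrite mulr0.
  have /hr' /= : ball y0 r' y by apply/ball_rVE; exact: le_lt_trans yw wr'.
  rewrite mul1r => h; apply/ltW; apply: le_lt_trans (le_lt_trans (ler_norm _) h).
  by rewrite (bigD1 j)//= lerDl; apply: sumr_ge0 => k _; exact: normr_ge0.
have DF : is_derive t 1 (fun s => F (g s)) 0.
  pose L := `|'D_1 g t| + 1; have L0 : 0 < L by rewrite ltr_wpDl.
  have [r1 r10 h1] : exists2 r, 0 < r & forall s : R, `|s| < r -> `|g (t + s) - g t| <= L * `|s|.
    have h3 : s^-1 *: ((g \o shift t) (s *: 1) - g t) @[s --> 0^'] --> 'D_1 g t by exact: Dg.
    move/cvgrPdist_le : h3 => /(_ 1 ltr01)[/= r r0 hr]; exists r => // s sr.
    have [->|s0] := eqVneq s 0; first by rewrite addr0 subrr normr0 mulr_ge0// ltW.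
    have := hr s; rewrite /ball_/= sub0r normrN => /(_ sr s0); rewrite [s *: 1]mulr1 [s + t]addrC => h.
    have h' : `|s^-1 *: (g (t + s) - g t)| <= L.
      rewrite -[s^-1 *: _](subrK ('D_1 g t)); apply: le_trans (ler_normD _ _) _.
      by rewrite addrC lerD2l distrC.
    by move: h'; rewrite normrZ normfV ler_pdivrMl ?normr_gt0// mulrC.
  apply/is_deriveP => e e0; pose e1 := e / (d%:R * L + 1).
  have dL : 0 < d%:R * L + 1 by rewrite ltr_wpDl// mulr_ge0// ltW.
  have e10 : 0 < e1 by rewrite divr_gt0.
  have [r2 r20 h2] := hF e1 e10.
  exists (Num.min r1 (r2 / L)); first by rewrite lt_min r10 divr_gt0.
  move=> s; rewrite lt_min ltr_pdivlMr// => /andP[sr1 sr2]; rewrite mul0r subr0.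
  have gs := h1 s sr1.
  have := h2 (g (t + s) - g t); rewrite [y0 + _]addrC subrK => /(_ _)/le_trans; apply.
    by apply: le_lt_trans gs _; rewrite mulrC.
  apply: (@le_trans _ _ (d%:R * (e1 * (L * `|s|)))).
    by rewrite ler_wpM2l// ler_wpM2l// ltW.
  have -> : d%:R * (e1 * (L * `|s|)) = e1 * (d%:R * L) * `|s| by ring.
  apply: ler_wpM2r => //; rewrite /e1 mulrAC ler_pdivrMr// ler_pM2l// lerDl//.
have D2 : is_derive t 1 (fun s => \sum_j q j * g s 0 j) (\sum_j q j * ('D_1 g t) 0 j).
  by apply: df_sum => j; apply: dfZ; exact: derivable_rV_coord.
have := dfD DF D2; rewrite add0r; under eq_fun do rewrite /F subrK.
exact.
Qed.

Lemma is_derive_near_eq (f h : R -> R) t (l r : R) : 0 < r -> (forall s, `|s| < r -> f (t + s) = h (t + s)) ->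
  is_derive t 1 f l -> is_derive t 1 h l.
Proof.
move=> r0 e /is_deriveP D; apply/is_deriveP => eps /D [r' r'0 hr'].
exists (Num.min r r'); first by rewrite lt_min r0.
move=> s; rewrite lt_min => /andP[sr sr']; rewrite -e// -[h t](_ : f t = _); first exact: hr'.
by have := e 0; rewrite addr0 normr0; exact.
Qed.

Lemma bounded01 (f : R -> R) : (forall t, 0 <= t <= 1 -> {for t, continuous f}) ->
  exists2 K, 0 <= K & forall t, 0 <= t <= 1 -> `|f t| <= K.
Proof.
move=> cf; have cf' : {within `[0, 1], continuous (fun t => `|f t|)}.
  apply: continuous_in_subspaceT => t; rewrite inE/= in_itv/= => t01.
  by apply: cvg_norm; exact: cf.
have [c c01 hc] := EVT_max ler01 cf'.
by exists `|f c| => // t t01; apply: hc; rewrite in_itv.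
Qed.

End curves.

(** * Parallel transport and classical solutions *)

Section eset.
Variables (R : realType) (d n : nat).
Local Notation V := 'rV[R]_d.
Local Notation e_ := (@evec R d).
Variables (O : set V) (B' : tfield R d n).
Hypothesis oO : open O.
Hypothesis cO : connected O.
Hypothesis cB : forall x, O x -> forall i j k, {for x, continuous (fun x => B' x i j k)}.
Implicit Types (x y z : V) (g : R -> V) (f : R -> 'I_n -> R) (t s : R) (v w : 'I_n -> R).

Definition curve_coef g (i k : 'I_n) t : R := - \sum_j B' (g t) i j k * ('D_1 g t) 0 j.
Definition curve_sol g f := forall t i, 0 <= t <= 1 -> is_derive t 1 (f^~ i) (\sum_k curve_coef g i k t * f t k).

Lemma curve_coefE g i t w : \sum_k curve_coef g i k t * w k = - \sum_j \sum_k B' (g t) i j k * w k * ('D_1 g t) 0 j.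
Proof.
rewrite exchange_big -sumrN; apply: eq_bigr => k _; rewrite /curve_coef mulNr mulr_suml.
by congr (- _); apply: eq_bigr => j _; rewrite mulrAC.
Qed.

Lemma curve_sol_transport g f : curve_sol g f -> transport_sol B' g (\row_i f 0 i) (fun t => \row_i f t i).
Proof.
move=> hf; have rE i : (fun s : R => (\row_i f s i : 'rV[R]_n) 0 i) = f^~ i by apply/funext => s; rewrite mxE.
split; [|split => // t /andP[t0 t1]].
  apply: continuous_in_subspaceT => t; rewrite inE/= in_itv/= => t01.
  by apply: continuous_to_rV => i; rewrite rE; exact: is_derive_continuous (hf t i t01).
have t01 : 0 <= t <= 1 by rewrite !ltW.
have [D e] := @derive_rVP R n (fun t => \row_i f t i) t _ (fun i => eq_rect_r (fun h => is_derive t 1 h _) (hf t i t01) (rE i)).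
split => // i; rewrite e curve_coefE; congr (- _).
by apply: eq_bigr => j _; apply: eq_bigr => k _; rewrite mxE.
Qed.

Lemma tsol_coord g (v : 'rV[R]_n) (phi : R -> 'rV[R]_n) : transport_sol B' g v phi ->
  (forall i, {within `[0, 1], continuous (fun t : R => phi t 0 i)}) /\
  forall t i, 0 < t < 1 -> is_derive t 1 (fun s : R => phi s 0 i) (\sum_k curve_coef g i k t * phi t 0 k).
Proof.
move=> [cphi [_ dphi]]; split=> [i t|t i t01].
  apply/cvgrPdist_lt => e e0; have /cvgrPdist_lt /(_ e e0) := cphi t.
  by apply: filterS => s; apply: le_lt_trans; rewrite -rVB; exact: normr_rV_coord.
have [D e] := dphi t t01; have := derivable_rV_coord i D.
by rewrite e (curve_coefE g i t (fun k => phi t 0 k)).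
Qed.

Lemma curve_coef_continuous x y g i k t : C1curve O x y g -> 0 <= t <= 1 -> {for t, continuous (curve_coef g i k)}.
Proof.
move=> [dg [cg [gO _]]] t01; apply: cvgN; apply: cvg_sumr => j; apply: cvg_mulr.
  apply: (@continuous_comp _ _ _ g (fun x => B' x i j k)); first exact: derivable_continuous_rV.
  by apply: cB; exact: gO.
exact: (@continuous_rV_coord R d R ('D_1 g) t j (cg t)).
Qed.

Lemma curve_coef_bound x y g : C1curve O x y g ->
  exists2 K, 0 <= K & forall i k t, 0 <= t <= 1 -> `|curve_coef g i k t| <= K.
Proof.
move=> hg.
have /choice [F hF] : forall q : 'I_n * 'I_n, exists K : R, 0 <= K /\ forall t, 0 <= t <= 1 -> `|curve_coef g q.1 q.2 t| <= K.
  move=> q; have [K K0 hK] := @bounded01 R (curve_coef g q.1 q.2) (fun t ht => curve_coef_continuous hg ht).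
  by exists K.
exists (\sum_q F q); first by apply: sumr_ge0 => q _; have [] := hF q.
move=> i k t t01; apply: le_trans ((hF (i, k)).2 t t01) _.
by rewrite [leRHS](bigD1 (i, k))//= lerDl; apply: sumr_ge0 => q _; have [] := hF q.
Qed.

Lemma sqnorm_eq0 w : sqnorm w <= 0 -> forall i, w i = 0.
Proof.
move=> h i; have h' := le_trans (sqnorm_ge i w) h.
by apply/eqP; rewrite -sqrf_eq0 eq_le h' sqr_ge0.
Qed.

Lemma tsol_unique x y g (v : 'rV[R]_n) (phi1 phi2 : R -> 'rV[R]_n) : C1curve O x y g ->
  transport_sol B' g v phi1 -> transport_sol B' g v phi2 -> phi1 1 = phi2 1.
Proof.
move=> hg h1 h2; have [c1 d1] := tsol_coord h1; have [c2 d2] := tsol_coord h2.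
have [K K0 hK] := curve_coef_bound hg.
pose psi t i := phi1 t 0 i - phi2 t 0 i.
have H := @gronwall R n (curve_coef g) K psi _ _ hK.
have : sqnorm (psi 1) <= 0.
  apply: le_trans (H _ _) _.
  - by move=> i t; apply: cvgB; [exact: c1|exact: c2].
  - move=> t i t01; rewrite (_ : \sum_k _ = \sum_k curve_coef g i k t * phi1 t 0 k - \sum_k curve_coef g i k t * phi2 t 0 k).
      exact: dfB (d1 t i t01) (d2 t i t01).
    by rewrite -sumrB; apply: eq_bigr => k _; rewrite mulrBr.
  have -> : sqnorm (psi 0) = 0.
    by rewrite /sqnorm big1// => i _; rewrite /psi h1.2.1 h2.2.1 subrr expr0n.
  by rewrite mulr0.
move=> /sqnorm_eq0 e; apply/rowP => i; apply/eqP; rewrite -subr_eq0; apply/eqP; exact: e.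
Qed.

Lemma curve_sol_exists x y g w : C1curve O x y g -> exists f, curve_sol g f /\ f 0 = w.
Proof.
move=> hg; have [K K0 hK] := curve_coef_bound hg.
have [|||f [f0 df]] := @linear_ode R n (fun i k t => curve_coef g i k (clamp01 t)) K w.
- move=> i k t; apply: (@continuous_comp _ _ _ (@clamp01 R) (curve_coef g i k)); first exact: clamp01_continuous.
  by apply: curve_coef_continuous hg _; exact: clamp01_in.
- exact: K0.
- by move=> i k t; apply: hK; exact: clamp01_in.
exists f; split => // t i t01; have := df t i t01.
by rewrite clamp01_id.
Qed.

Definition seg y (w : V) t : V := y + t *: w.

Lemma seg_derive y (w : V) t : derivable (seg y w) t 1 /\ 'D_1 (seg y w) t = w.
Proof.
have h j : is_derive t 1 (fun s : R => seg y w s 0 j) (w 0 j).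
  have := dfD (is_derive_cst (y 0 j) t 1) (dfZ (w 0 j) (is_derive_id t (1 : R))).
  rewrite add0r mulr1.
  have -> // : (fun s => cst (y 0 j) s + w 0 j * id s) = fun s : R => seg y w s 0 j.
  by apply/funext => s; rewrite /seg !mxE mulrC.
by have [D e] := derive_rVP h; split => //; apply/rowP => j; rewrite e.
Qed.

Lemma seg_curve y (w : V) : (forall t, 0 <= t <= 1 -> O (y + t *: w)) -> C1curve O y (y + w) (seg y w).
Proof.
move=> h; split; first by move=> t; have [] := seg_derive y w t.
split; last by split => //; rewrite /seg scale0r addr0 scale1r.
have -> : 'D_1 (seg y w) = cst w by apply/funext => t; have [] := seg_derive y w t.
by move=> t; exact: cvg_cst.
Qed.

Lemma curve_coef_seg y (w : V) i k t : curve_coef (seg y w) i k t = - \sum_j B' (y + t *: w) i j k * w 0 j.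
Proof. by rewrite /curve_coef (seg_derive y w t).2. Qed.

(** [T1] runs through the curve during [0, 1/2] and [T2] through the segment during [1/2, 1]. While
    one moves the other rests, and both have zero velocity at 1/2. The solution is the sum of the
    two reparametrised ones less the common value at the junction. *)
Lemma concat_curve x y g f (w : V) chi : C1curve O x y g -> curve_sol g f ->
  (forall t, 0 <= t <= 1 -> O (y + t *: w)) -> curve_sol (seg y w) chi -> chi 0 = f 1 ->
  exists h F, [/\ C1curve O x (y + w) h, curve_sol h F, F 0 = f 0 & F 1 = chi 1].
Proof.
move=> hg hf hO hchi chi0; have [dg [cg [gO [g0 g1]]]] := hg.
pose T1 t := step (2 * t + 0); pose T2 t := step (2 * t + -1).
have dT1 t : is_derive t 1 T1 (2 * dstep (2 * t + 0)) := is_derive_affine (is_derive_step _).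
have dT2 t : is_derive t 1 T2 (2 * dstep (2 * t + -1)) := is_derive_affine (is_derive_step _).
pose h t : V := g (T1 t) + T2 t *: w.
pose l t j := ('D_1 g (T1 t)) 0 j * (2 * dstep (2 * t + 0)) + w 0 j * (2 * dstep (2 * t + -1)).
have dh t j : is_derive t 1 (fun s : R => h s 0 j) (l t j).
  have D1 := @is_derive1_comp R (fun s => g s 0 j) T1 t _ _ (derivable_rV_coord j (dg (T1 t))) (dT1 t).
  have := dfD D1 (dfZ (w 0 j) (dT2 t)).
  have -> // : (fun s => ((fun s => g s 0 j) \o T1) s + w 0 j * T2 s) = fun s : R => h s 0 j.
  by apply/funext => s; rewrite /h !mxE/= mulrC.
have Dh t j : ('D_1 h t) 0 j = l t j by have [_ ->] := derive_rVP (dh t).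
pose F t i := f (T1 t) i + chi (T2 t) i - chi 0 i.
have lo t : t <= 2^-1 -> 2 * t + -1 <= 0 by lra.
have hi t : 2^-1 <= t -> 1 <= 2 * t + 0 by lra.
have aff (u b t : R) : 0 <= u <= 1 -> 0 <= step (2 * t + b) <= 1 by move=> _; exact: step_in.
exists h, F; split.
- split; first by move=> t; have [] := derive_rVP (dh t).
  split.
    move=> t; apply: continuous_to_rV => j.
    rewrite (_ : (fun s : R => _) = l^~ j); last by apply/funext => s; rewrite Dh.
    have cd (b : R) : {for t, continuous (fun t : R => dstep (2 * t + b))}.
      apply: (@continuous_comp _ _ _ (fun t : R => 2 * t + b) (@dstep R)); last exact: dstep_continuous.
      by apply: cvgD; [apply: cvg_mulr; [exact: cvg_cst|exact: cvg_id]|exact: cvg_cst].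
    apply: cvgD; apply: cvg_mulr.
    + apply: (@continuous_comp _ _ _ T1 (fun s : R => ('D_1 g s) 0 j)).
        exact: is_derive_continuous (dT1 t).
      exact: (@continuous_rV_coord R d R ('D_1 g) (T1 t) j (cg (T1 t))).
    + by apply: cvg_mulr; [exact: cvg_cst|exact: cd].
    + exact: cvg_cst.
    + by apply: cvg_mulr; [exact: cvg_cst|exact: cd].
  split.
    move=> t _; have [tl|tl] := leP t 2^-1.
      by rewrite /h /T2 (step_le0 (lo t tl)) scale0r addr0; apply: gO; exact: step_in.
    rewrite /h /T1 (step_ge1 (hi t (ltW tl))) g1; apply: hO; exact: step_in.
  split; rewrite /h /T1 /T2.
    by rewrite step_le0 ?mulr0 ?addr0// step_le0 ?scale0r ?addr0//; lra.
  by rewrite step_ge1 ?step_ge1 ?g1 ?scale1r//; lra.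
- move=> t i t01.
  have D1 := @is_derive1_comp R (f^~ i) T1 t _ _ (hf (T1 t) i (step_in _)) (dT1 t).
  have D2 := @is_derive1_comp R (chi^~ i) T2 t _ _ (hchi (T2 t) i (step_in _)) (dT2 t).
  have := dfB (dfD D1 D2) (is_derive_cst (chi 0 i) t 1); rewrite subr0.
  have -> // : (\sum_k curve_coef g i k (T1 t) * f (T1 t) k) * (2 * dstep (2 * t + 0)) +
     (\sum_k curve_coef (seg y w) i k (T2 t) * chi (T2 t) k) * (2 * dstep (2 * t + -1)) =
     \sum_k curve_coef h i k t * F t k.
  have [tl|tl] := leP t 2^-1.
    have T20 : T2 t = 0 by rewrite /T2 step_le0// lo.
    have hE : h t = g (T1 t) by rewrite /h T20 scale0r addr0.
    have d20 : dstep (2 * t + -1) = 0 by rewrite dstep_le0// lo.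
    rewrite d20 !mulr0 addr0 mulr_suml; apply: eq_bigr => k _.
    have -> : F t k = f (T1 t) k by rewrite /F T20 addrK.
    rewrite mulrAC; congr (_ * _); rewrite /curve_coef hE mulNr mulr_suml; congr (- _).
    have e j : l t j = ('D_1 g (T1 t)) 0 j * (2 * dstep (2 * t + 0)) by rewrite /l d20 mulr0 mulr0 [LHS]addr0.
    by apply: eq_bigr => j _; rewrite Dh e [RHS]mulrA.
  have T11 : T1 t = 1 by rewrite /T1 step_ge1// hi// ltW.
  have hE : h t = y + T2 t *: w by rewrite /h T11 g1.
  have d10 : dstep (2 * t + 0) = 0 by rewrite dstep_ge1// hi// ltW.
  rewrite d10 !mulr0 add0r mulr_suml; apply: eq_bigr => k _.
  have -> : F t k = chi (T2 t) k by rewrite /F T11 chi0 addrAC subrr add0r.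
  rewrite mulrAC; congr (_ * _); rewrite curve_coef_seg /curve_coef hE mulNr mulr_suml; congr (- _).
  have e j : l t j = w 0 j * (2 * dstep (2 * t + -1)) by rewrite /l d10 mulr0 mulr0 [LHS]add0r.
  by apply: eq_bigr => j _; rewrite Dh e [RHS]mulrA.
- apply/funext => i; rewrite /F /T1 /T2 step_le0 ?mulr0 ?addr0// step_le0; last by lra.
  by rewrite addrK.
- apply/funext => i; rewrite /F /T1 /T2 step_ge1; last lra.
  by rewrite step_ge1 ?chi0; [rewrite addrAC subrr add0r|lra].
Qed.

Definition reach x v y w := exists g f, [/\ C1curve O x y g, curve_sol g f, f 0 = v & f 1 = w].

Lemma reach_refl x v : O x -> reach x v x v.
Proof.
move=> Ox; exists (seg x 0), (fun=> v); split => //.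
  by have := @seg_curve x 0; rewrite addr0; apply => t _; rewrite scaler0 addr0.
move=> t i _; rewrite big1; first exact: is_derive_cst.
move=> k _; rewrite curve_coef_seg big1 ?oppr0 ?mul0r// => j _; by rewrite mxE mulr0.
Qed.

Lemma reach_seg x v y w (z : V) : reach x v y w -> (forall t, 0 <= t <= 1 -> O (y + t *: z)) ->
  exists w', reach x v (y + z) w'.
Proof.
move=> [g [f [hg hf f0 f1]]] hO; have [chi [hchi chi0]] := curve_sol_exists (f 1) (seg_curve hO).
have [h [F [hh hF F0 F1]]] := concat_curve hg hf hO hchi chi0.
by exists (chi 1), h, F; split => //; rewrite F0.
Qed.

(** The points that can be reached form an open and closed part of [O], because a ball in [O] is
    joined to its centre by segments. This also provides a C^1 curve between any two points. *)
Lemma reach_all x v y : O x -> O y -> exists w, reach x v y w.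
Proof.
move=> Ox Oy; pose S := [set y | O y /\ exists w, reach x v y w].
suff SO : S = O by move: Oy; rewrite -SO => -[].
have nb z : O z -> exists2 r : R, 0 < r & forall z', `|z' - z| < r -> O z' /\
    ((exists w, reach x v z w) <-> (exists w, reach x v z' w)).
  move=> Oz; have [r r0 hr] := open_rV_ball oO Oz; exists r => // z' zz; split; first exact: hr.
  have sg (a b : V) : `|a - z| < r -> `|b - z| < r -> forall t, 0 <= t <= 1 -> O (a + t *: (b - a)).
    move=> az bz t /andP[t0 t1]; apply: hr.
    have -> : a + t *: (b - a) - z = (1 - t) *: (a - z) + t *: (b - z).
      by apply/rowP => j; rewrite !mxE; ring.
    apply: le_lt_trans (ler_normD _ _) _; rewrite !normrZ (ger0_norm t0) ger0_norm ?subr_ge0//.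
    move: az bz; move: `|a - z| `|b - z| => p q ap bq.
    have [->|tn] := eqVneq t 0; first by rewrite subr0 mul1r mul0r addr0.
    have tp : 0 < t by rewrite lt_def tn.
    have : (1 - t) * p <= (1 - t) * r by rewrite ler_wpM2l ?subr_ge0// ltW.
    have : t * q < t * r by rewrite ltr_pM2l.
    by rewrite mulrBl mul1r; lra.
  have zz0 : `|z - z| < r by rewrite subrr normr0.
  by split=> -[w hw]; [have := reach_seg hw (sg z z' zz0 zz)|have := reach_seg hw (sg z' z zz zz0)]; rewrite addrC subrK.
apply: cO.
- by exists x; split => //; exists v; exact: reach_refl.
- exists S; last by apply/seteqP; split => [z [Oz Sz]|z [_ ?]].
  apply: open_rVP => z [Oz Sz]; have [r r0 hr] := nb z Oz.
  by exists r => // z' /hr [Oz' [h _]]; split => //; exact: h.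
- exists (~` (O `\` S)); last first.
    apply/seteqP; split => [z [Oz Sz]|z [Oz]]; first by split => // -[_]; apply.
    by move=> h; apply: contrapT => nS; apply: h.
  apply: open_closedC; apply: open_rVP => z [Oz nS]; have [r r0 hr] := nb z Oz.
  exists r => // z' /hr [Oz' [_ h]]; split => // -[_ Sz']; apply: nS; split => //; exact: h.
Qed.

Definition classical_sol (mu : V -> 'I_n -> R) := forall y, O y -> (forall i, {for y, continuous (mu^~ i)}) /\
  forall i j, is_derive y (e_ j) (mu^~ i) (- \sum_k B' y i j k * mu y k).

Lemma classical_sol_curve (mu : V -> 'I_n -> R) x y g : classical_sol mu -> C1curve O x y g -> curve_sol g (fun t => mu (g t)).
Proof.
move=> hm [dg [cg [gO _]]] t i t01.
have cf j : {for g t, continuous (fun y => - \sum_k B' y i j k * mu y k)}.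
  apply: (@cvgN _ _ _ (nbhs (g t)) (nbhs_filter (g t))).
  apply: (@cvg_sumr R V 'I_n (nbhs (g t)) (nbhs_filter (g t))) => k.
  by apply: (@cvg_mulr R V (nbhs (g t)) (nbhs_filter (g t)) (fun y => B' y i j k) (mu^~ k)); [apply: cB; exact: gO|apply: (hm _ _).1; exact: gO].
have := @chain_rule R d O (mu^~ i) (fun j y => - \sum_k B' y i j k * mu y k) g t oO (gO t t01)
  (fun j y Oy => (hm y Oy).2 i j) cf (dg t).
rewrite curve_coefE -sumrN; under eq_bigr do rewrite mulNr mulr_suml.
exact.
Qed.

Lemma classical_sol_Eset (mu : V -> 'I_n -> R) x : classical_sol mu -> O x -> Eset O B' x (\row_i mu x i).
Proof.
move=> hm Ox y g1 g2 h1 h2 phi1 phi2 s1 s2.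
have key g phi : C1curve O x y g -> transport_sol B' g (\row_i mu x i) phi -> phi 1 = \row_i mu y i.
  move=> hg hp; have := curve_sol_transport (classical_sol_curve hm hg).
  have [_ [_ [_ [g0 g1']]]] := hg; rewrite g0 => hq.
  by rewrite (tsol_unique hg hp hq) g1'.
by rewrite (key _ _ h1 s1) (key _ _ h2 s2).
Qed.

(** Along a curve from x to y both the solution and the zero function transport the vector 0, and
    transport is unique. *)
Lemma classical_sol0 (mu : V -> 'I_n -> R) x y : classical_sol mu -> O x -> O y -> (forall i, mu x i = 0) -> forall i, mu y i = 0.
Proof.
move=> hm Ox Oy m0 i; have [w [g [f [hg _ _ _]]]] := reach_all (fun=> 0) Ox Oy.
have [_ [_ [_ [g0 g1]]]] := hg.
have h0 : transport_sol B' g (\row_i mu x i) (fun t => \row_i (0 : R)).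
  have -> : (\row_i mu x i : 'rV[R]_n) = \row_i (0 : R) by apply/rowP => k; rewrite !mxE m0.
  apply: (@curve_sol_transport g (fun _ _ => 0)) => t k _; rewrite big1; first exact: is_derive_cst.
  by move=> k' _; rewrite mulr0.
have h1 := curve_sol_transport (classical_sol_curve hm hg); rewrite g0 in h1.
by have := tsol_unique hg h1 h0; rewrite g1 => /rowP /(_ i); rewrite !mxE.
Qed.

Lemma classical_sol_sum m (c : 'I_m -> R) (mu : 'I_m -> V -> 'I_n -> R) : (forall l, classical_sol (mu l)) ->
  classical_sol (fun x i => \sum_l c l * mu l x i).
Proof.
move=> hm y Oy; split=> [i|i j].
  apply: (@cvg_sumr R V 'I_m (nbhs y) (nbhs_filter y)) => l.
  by apply: (@cvg_mulr R V (nbhs y) (nbhs_filter y) (fun=> c l) ((mu l)^~ i)); [exact: cvg_cst|exact: (hm l y Oy).1].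
have := df_sum (index_enum 'I_m) (fun l => dfZ (c l) ((hm l y Oy).2 i j)).
have -> // : \sum_l (c l * - \sum_k B' y i j k * mu l y k) = - \sum_k B' y i j k * \sum_l c l * mu l y k.
under eq_bigr do rewrite mulrN mulr_sumr; rewrite sumrN exchange_big/=; congr (- _).
by apply: eq_bigr => k _; rewrite mulr_sumr; apply: eq_bigr => l _; rewrite mulrCA.
Qed.

(** [mu] at y is the result of transporting [v] to y along any curve. Its partial derivatives are
    found by prolonging a curve with a segment, along which [mu] is again a transport. *)
Lemma Eset_classical_sol (v : 'rV[R]_n) x : O x -> Eset O B' x v -> exists mu, classical_sol mu /\ forall i, mu x i = v 0 i.
Proof.
move=> Ox Ev; pose v0 i := v 0 i.
have vE : \row_i v0 i = v by apply/rowP => i; rewrite mxE.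
have /choice [mu hmu] : forall y, exists w, O y -> reach x v0 y w.
  move=> y; have [Oy|nOy] := pselect (O y); last by exists v0.
  by have [w hw] := reach_all v0 Ox Oy; exists w.
(* The only use of membership in [Eset]: the transported vector does not depend on the curve. *)
have U y w1 w2 : reach x v0 y w1 -> reach x v0 y w2 -> w1 = w2.
  move=> [g1 [f1 [hg1 hf1 f10 f11]]] [g2 [f2 [hg2 hf2 f20 f21]]].
  have s1 := curve_sol_transport hf1; have s2 := curve_sol_transport hf2; rewrite f10 vE in s1; rewrite f20 vE in s2.
  have /rowP e := Ev y g1 g2 hg1 hg2 _ _ s1 s2.
  by apply/funext => i; have := e i; rewrite !mxE f11 f21.
have S y (w : V) chi : O y -> (forall t, 0 <= t <= 1 -> O (y + t *: w)) -> curve_sol (seg y w) chi -> chi 0 = mu y ->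
    chi 1 = mu (y + w).
  move=> Oy hO hchi chi0; have [g [f [hg hf f0 f1]]] := hmu y Oy.
  have e0 : chi 0 = f 1 by rewrite chi0 f1.
  have [h [F [hh hF F0 F1]]] := concat_curve hg hf hO hchi e0.
  have Oyw : O (y + w) by have := hO 1; rewrite scale1r; apply; rewrite ler01 lexx.
  apply: (U (y + w)); last exact: hmu.
  by exists h, F; split => //; rewrite F0.
(* [S] treats end points only. Applied to the shortened segment, run in unit time, it identifies
   [mu] with the transport at each intermediate point. *)
have line y (w : V) chi : O y -> (forall t, 0 <= t <= 1 -> O (y + t *: w)) -> curve_sol (seg y w) chi -> chi 0 = mu y ->
    forall s, 0 <= s <= 1 -> mu (y + s *: w) = chi s.
  move=> Oy hO hchi chi0 s /andP[s0 s1].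
  have st t : 0 <= t <= 1 -> 0 <= s * t <= 1.
    by move=> /andP[t0 t1]; rewrite mulr_ge0//= -(mulr1 1); apply: ler_pM.
  rewrite -(@S y (s *: w) (fun t => chi (s * t + 0))).
  - by rewrite mulr1 addr0.
  - exact: Oy.
  - by move=> t /st /hO; rewrite scalerA mulrC.
  - move=> t i t01; have D := hchi (s * t) i (st t t01).
    rewrite -[s * t]addr0 in D; have := is_derive_affine D.
    have -> // : s * (\sum_k curve_coef (seg y w) i k (s * t + 0) * chi (s * t + 0) k) =
      \sum_k curve_coef (seg y (s *: w)) i k t * chi (s * t + 0) k.
    rewrite addr0.
    rewrite mulr_sumr; apply: eq_bigr => k _; rewrite mulrA; congr (_ * _).
    rewrite !curve_coef_seg mulrN mulr_sumr; congr (- _); apply: eq_bigr => j _.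
    by rewrite scalerA [t * s]mulrC !mxE mulrCA.
  - by rewrite mulr0 addr0.
have dmu y i j : O y -> is_derive y (e_ j) (mu^~ i) (- \sum_k B' y i j k * mu y k).
  move=> Oy; have [r r0 hr] := open_rV_ball oO Oy.
  have r2 : 0 < r / 2 by rewrite divr_gt0.
  (* The segment is centred at [y], which is passed at time 1/2, because the derivative at [y] has
     to be two-sided. *)
  pose y0 := y - (r / 2) *: e_ j; pose w := r *: e_ j.
  have pt s : y0 + s *: w = y + (s * r - r / 2) *: e_ j.
    by rewrite /y0 /w scalerA scalerBl -addrA [- _ + _]addrC.
  have hO t : 0 <= t <= 1 -> O (y0 + t *: w).
    move=> /andP[t0 t1]; apply: hr; rewrite pt addrC addKr normrZ.
    apply: le_lt_trans (_ : `|t * r - r / 2| < r); first by rewrite ler_piMr// norm_evec.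
    have := mulr_ge0 t0 (ltW r0); have : t * r <= r by rewrite ler_piMl// ltW.
    by rewrite ltr_norml; move: (t * r) => u *; apply/andP; split; lra.
  have Oy0 : O y0 by have := hO 0; rewrite scale0r addr0; apply; rewrite lexx ler01.
  have [chi [hchi chi0]] := curve_sol_exists (mu y0) (seg_curve hO).
  have L := line y0 w chi Oy0 hO hchi chi0.
  have h01 : 0 <= (2^-1 : R) <= 1 by rewrite invr_ge0 ler0n invf_le1// ler1n.
  have D := hchi 2^-1 i h01.
  have y2 : y0 + 2^-1 *: w = y by rewrite pt mulrC subrr scale0r addr0.
  apply/is_derive_line; apply: (@is_derive_near_eq R (fun t => chi (r^-1 * t + 2^-1) i) _ 0 _ (r / 2)) => //.
    move=> s sr; rewrite add0r -L.
      rewrite pt; congr (mu (y + _ *: _) _); by field; rewrite gt_eqF.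
    have : `|r^-1 * s| < 2^-1 by rewrite normrM gtr0_norm ?invr_gt0// ltr_pdivrMl.
    by rewrite ltr_norml => /andP[]; move: (r^-1 * s) => u; move=> *; apply/andP; split; lra.
  have D' : is_derive (r^-1 * 0 + 2^-1) 1 (chi^~ i) (\sum_k curve_coef (seg y0 w) i k 2^-1 * chi 2^-1 k) by rewrite mulr0 add0r.
  have := is_derive_affine D'.
  have -> // : r^-1 * (\sum_k curve_coef (seg y0 w) i k 2^-1 * chi 2^-1 k) = - \sum_k B' y i j k * mu y k.
  rewrite -(L _ h01) y2 mulr_sumr -sumrN; apply: eq_bigr => k _.
  rewrite curve_coef_seg y2 (bigD1 j)//= big1 ?addr0.
    rewrite !mxE eqxx mulr1; field; by rewrite gt_eqF.
  by move=> j' jj; rewrite !mxE eq_sym (negbTE jj) !mulr0.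
(* Existence of partial derivatives does not give continuity. [gronwall] along segments from y
   bounds [mu] near y, hence also its partial derivatives, and [lip_coord] concludes. *)
have cmu y i : O y -> {for y, continuous (mu^~ i)}.
  move=> Oy; have [r r0 hr] := open_rV_ball oO Oy.
  pose b z := \sum_i \sum_j \sum_k `|B' z i j k|.
  have cb : {for y, continuous b}.
    do 3 (apply: (@cvg_sumr R V _ (nbhs y) (nbhs_filter y)) => ?).
    by apply: (@cvg_norm _ _ _ (nbhs y) (nbhs_filter y)); exact: cB.
  have [r' r'0 hr'] := (continuous_rVP b y).1 cb 1 ltr01.
  pose Kb := b y + 1.
  have tnorm1 z i' j k : `|z - y| < r' -> `|B' z i' j k| <= Kb.
    move=> /hr' /(le_lt_trans (ler_norm _)) h; apply: (@le_trans _ _ (b z)); last by rewrite /Kb; lra.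
    rewrite /b (bigD1 i')//= (bigD1 j)//= (bigD1 k)//= -!addrA lerDl.
    by rewrite !addr_ge0//; do ?(apply: sumr_ge0 => ? _).
  pose rho := Num.min (Num.min r r') 1.
  have rho0 : 0 < rho by rewrite !lt_min r0 r'0 ltr01.
  have Kb0 : 0 <= Kb by rewrite addr_ge0//; do 3 (apply: sumr_ge0 => ? _).
  pose M0 := expR (2 * (n%:R * n%:R * (d%:R * Kb))) * sqnorm (mu y).
  have hM z k : `|z - y| < rho -> `|mu z k| <= 1 + M0.
    rewrite !lt_min => /andP[/andP[zr zr'] z1].
    have sz t : 0 <= t <= 1 -> `|(y + t *: (z - y)) - y| <= `|z - y|.
      by move=> /andP[t0 t1]; rewrite addrC addKr normrZ (ger0_norm t0) ler_piMl.
    have hO t : 0 <= t <= 1 -> O (y + t *: (z - y)) by move=> /sz h; apply: hr; exact: le_lt_trans h zr.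
    have [chi [hchi chi0]] := curve_sol_exists (mu y) (seg_curve hO).
    have e1 : mu z = chi 1.
      by have := line _ _ _ Oy hO hchi chi0 1; rewrite scale1r [y + _]addrC subrK => ->//; rewrite ler01 lexx.
    apply: le_trans (norm_le_sqnorm k (mu z)) _; rewrite lerD2l e1 /M0 -chi0.
    apply: (@gronwall R n (curve_coef (seg y (z - y))) (d%:R * Kb) chi).
    - move=> i'; apply: continuous_in_subspaceT => t; rewrite inE/= in_itv/= => t01.
      exact: is_derive_continuous (hchi t i' t01).
    - by move=> t i' /andP[t0 t1]; apply: hchi; rewrite !ltW.
    - move=> i' k' t t01; rewrite curve_coef_seg normrN; apply: le_trans (ler_norm_sum _ _ _) _.
      rewrite -[d in d%:R]card_ord mulr_natl -sumr_const; apply: ler_sum => j _.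
      rewrite normrM -[leRHS]mulr1; apply: ler_pM => //.
        by apply: tnorm1; exact: le_lt_trans (sz t t01) zr'.
      apply: le_trans (normr_rV_coord _ _) _; exact: ltW.
  have M00 : 0 <= M0 by rewrite mulr_ge0 ?expR_ge0 ?sqnorm_ge0.
  pose M := n%:R * (Kb * (1 + M0)); have M1 : 0 <= M by rewrite !mulr_ge0// addr_ge0.
  have dM : 0 < d%:R * M + 1 by rewrite ltr_wpDl// mulr_ge0.
  apply/continuous_rVP => e e0; exists (Num.min rho (e / (d%:R * M + 1))); first by rewrite lt_min rho0 divr_gt0.
  move=> z; rewrite lt_min ltr_pdivlMr// => /andP[zr ze].
  have := @lip_coord R d (mu^~ i) (fun j y => - \sum_k B' y i j k * mu y k) y (z - y) M.
  rewrite [y + _]addrC subrK => H; apply: le_lt_trans (H _ _) _.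
  - move=> j z' z'y; apply: dmu; apply: hr; apply: le_lt_trans z'y _.
    by move: zr; rewrite !lt_min => /andP[/andP[-> _] _].
  - move=> j z' z'y; have z'r := le_lt_trans z'y zr.
    rewrite normrN; apply: le_trans (ler_norm_sum _ _ _) _.
    rewrite /M -[n in n%:R]card_ord mulr_natl -sumr_const; apply: ler_sum => k _.
    rewrite normrM; apply: ler_pM => //; last exact: hM.
    by apply: tnorm1; move: z'r; rewrite !lt_min => /andP[/andP[_ ->] _].
  apply: le_lt_trans ze; rewrite mulrA [leRHS]mulrC; apply: ler_wpM2r => //; by rewrite lerDl.
exists mu; split; first by move=> y Oy; split => [i|i j]; [exact: cmu|exact: dmu].
have e := U x (mu x) v0 (hmu x Ox) (reach_refl v0 Ox).
by move=> i; rewrite e.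
Qed.

Lemma Eset_indep_transfer m x y : O x -> O y -> (exists v : 'I_m -> 'rV[R]_n, vec_indep (Eset O B' x) v) ->
  exists mu : 'I_m -> V -> 'I_n -> R, (forall l, classical_sol (mu l)) /\
    forall c : 'I_m -> R, (forall i, \sum_l c l * mu l y i = 0) -> forall l, c l = 0.
Proof.
move=> Ox Oy [v [Ev iv]].
have /choice [mu hmu] : forall l, exists mu, classical_sol mu /\ forall i, mu x i = v l 0 i.
  by move=> l; exact: Eset_classical_sol.
exists mu; split=> [l|c hc]; first by have [] := hmu l.
apply: iv; apply/rowP => i; rewrite summxE mxE.
have := @classical_sol0 (fun x i => \sum_l c l * mu l x i) y x (classical_sol_sum c (fun l => (hmu l).1)) Oy Ox hc i.
by move=> {2}<-; apply: eq_bigr => l _; rewrite mxE (hmu l).2.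
Qed.

Lemma classical_sol_indep_Eset m x (mu : 'I_m -> V -> 'I_n -> R) : O x -> (forall l, classical_sol (mu l)) ->
  (forall c : 'I_m -> R, (forall i, \sum_l c l * mu l x i = 0) -> forall l, c l = 0) ->
  vec_indep (Eset O B' x) (fun l => \row_i mu l x i).
Proof.
move=> Ox hm hi; split=> [l|c hc]; first exact: classical_sol_Eset.
apply: hi => i; move/rowP: hc => /(_ i); rewrite summxE mxE => {2}<-.
by apply: eq_bigr => l _; rewrite !mxE.
Qed.

Lemma vec_indep_le m (v : 'I_m -> 'rV[R]_n) x : vec_indep (Eset O B' x) v -> (m <= n)%N.
Proof.
move=> [_ iv]; pose A : 'M[R]_(m, n) := \matrix_l v l.
have : row_free A.
  rewrite -kermx_eq0; apply/eqP/row_matrixP => i; rewrite row0; apply/rowP => l.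
  have h : \sum_l (row i (kermx A)) 0 l *: v l = 0.
    have : row i (kermx A) *m A = 0 by rewrite -row_mul mulmx_ker row0.
    by rewrite mulmx_sum_row => h; rewrite -[RHS]h; apply: eq_bigr => l' _; rewrite rowK.
  by rewrite (iv _ h) mxE.
by rewrite /row_free => /eqP <-; exact: rank_leq_col.
Qed.

(** The largest size of an independent family at x exists because it is at most [n]. Classical
    solutions carry families from point to point without loss of independence, so the maximum is the
    same everywhere. *)
Lemma Eset_dim_const x m (v : 'I_m -> 'rV[R]_n) : O x -> vec_indep (Eset O B' x) v ->
  exists k', (m <= k')%N /\ conservative_C0 O B' k'.
Proof.
move=> Ox iv; pose P k := `[< exists v : 'I_k -> 'rV[R]_n, vec_indep (Eset O B' x) v >].
have Pm : exists k, P k by exists m; apply/asboolP; exists v.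
have Pn k : P k -> (k <= n)%N by move=> /asboolP [w] /vec_indep_le.
case: (ex_maxnP Pm Pn) => k' /asboolP Pk' maxk'.
exists k'; split; first by apply: maxk'; apply/asboolP; exists v.
move=> y Oy; split.
  have [mu [hm hi]] := Eset_indep_transfer Ox Oy Pk'.
  by exists (fun l => \row_i mu l y i); exact: classical_sol_indep_Eset.
move=> h; have [mu [hm hi]] := Eset_indep_transfer Oy Ox h.
have hP : P k'.+1 by apply/asboolP; exists (fun l => \row_i mu l x i); exact: classical_sol_indep_Eset.
by have := maxk' _ hP; rewrite ltnn.
Qed.

End eset.

(** * From conservative fields to the kernel *)

Section conversions.
Variables (R : realType) (d n : nat).
Local Notation V := 'rV[R]_d.
Local Notation mu := (leb R d).
Local Notation e_ := (@evec R d).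
Variables (O : set V) (p : R).
Hypothesis oO : open O.
Hypothesis bO : bounded_set_V O.
Hypothesis p2 : 2 <= p.
Implicit Types (T B : tfield R d n) (m : V -> 'I_n -> R) (x : V).

Definition extT T i j k : V -> R := ext O (fun x => T x i j k).
Definition extm m i : V -> R := ext O (fun x => m x i).
Definition tnormE T x : R := Num.sqrt (tnorm2 (fun i j k => extT T i j k x)).

Let p0 : 0 < p. Proof. by apply: lt_le_trans p2. Qed.
Let p1 : 1 <= p. Proof. by apply: le_trans p2; rewrite ler1n. Qed.

Lemma tnormE_ge0 T x : 0 <= tnormE T x. Proof. exact: sqrtr_ge0. Qed.

Lemma extT_le_tnormE T i j k x : `|extT T i j k x| <= tnormE T x.
Proof.
rewrite -sqrtr_sqr ler_wsqrtr// /tnorm2 (bigD1 i)//= (bigD1 j)//= (bigD1 k)//= -!addrA lerDl.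
by rewrite !addr_ge0//; do ?(apply: sumr_ge0 => ? _); exact: sqr_ge0.
Qed.

Lemma tnormE_le_tnorm1 T x : tnormE T x <= tnorm1 (extT T) x.
Proof.
have b0 := tnorm1_ge0 (extT T) x; rewrite -(ger0_norm b0) -sqrtr_sqr ler_wsqrtr// expr2 {1}/tnorm1 /tnorm2 !mulr_suml.
apply: ler_sum => i _; rewrite mulr_suml; apply: ler_sum => j _; rewrite mulr_suml; apply: ler_sum => k _.
rewrite -real_normK ?num_real// expr2; apply: ler_wpM2l => //; exact: tnorm1_ge.
Qed.

Definition tnorm_cst : R := n%:R * (d%:R * n%:R).

Lemma tnorm1_le_tnormE T x : tnorm1 (extT T) x <= tnorm_cst * tnormE T x.
Proof.
have hs (m : nat) (F : 'I_m -> R) c : (forall i, F i <= c) -> \sum_i F i <= m%:R * c.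
  by move=> h; rewrite -[m in m%:R]card_ord mulr_natl -sumr_const; apply: ler_sum.
by rewrite /tnorm_cst -!mulrA; apply: (hs) => i; apply: (hs) => j; apply: (hs) => k; exact: extT_le_tnormE.
Qed.

Lemma tnormE_out T x : ~ O x -> tnormE T x = 0.
Proof.
move=> nO; rewrite /tnormE /tnorm2 big1 ?sqrtr0// => i _; rewrite big1// => j _; rewrite big1// => k _.
by rewrite /extT ext_out// expr0n.
Qed.

Lemma measurable_tnormE T : (forall i j k, measurable_fun setT (extT T i j k)) -> measurable_fun setT (tnormE T).
Proof.
move=> mT; apply: (measurableT_comp (f := @Num.sqrt R)).
  by apply: continuous_measurable_fun; exact: sqrt_continuous.
do 3 (apply: measurable_sum => ?); exact: measurable_funX.
Qed.

Lemma lebint_tnormE T : (forall i j k, measurable_fun setT (extT T i j k)) ->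
  lebint_on O (fun x => (Num.sqrt (tnorm2 (T x)) `^ p)%:E) = (\int[mu]_x (tnormE T x `^ p)%:E)%E.
Proof.
move=> mT; have /funext e : forall x, ext O (fun x => Num.sqrt (tnorm2 (T x)) `^ p) x = tnormE T x `^ p.
  move=> x.
  have [Ox|nOx] := pselect (O x).
    rewrite ext_in// /tnormE; congr (Num.sqrt _ `^ p); do 3 (apply: eq_bigr => ? _).
    by rewrite /extT ext_in.
  by rewrite ext_out// tnormE_out// powR0// gt_eqF.
rewrite lebint_on_ext; last 2 first.
- by rewrite e; apply: measurable_powRl; exact: measurable_tnormE.
- by move=> x _; exact: powR_ge0.
by rewrite e.
Qed.

Lemma tnormE_Lp T : (forall i j k, measurable_fun setT (extT T i j k)) -> L1 mu (fun x => tnormE T x `^ p) ->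
  [/\ L1 mu (tnormE T), forall i j k, L1 mu (extT T i j k), L1 mu (fun x => tnorm1 (extT T) x `^ p) &
   \int[mu]_x (tnorm1 (extT T) x `^ p) <= tnorm_cst `^ p * \int[mu]_x (tnormE T x `^ p)].
Proof.
move=> mT h.
have LN : L1 mu (tnormE T).
  have hs := L1D (L1_O oO bO) h; apply: (L1_le (measurable_tnormE mT) _ hs) => x.
  rewrite ger0_norm ?tnormE_ge0//; have [Ox|nOx] := pselect (O x).
    rewrite indicE mem_set// (le_trans (le_young p1 (tnormE_ge0 T x) ltr01))//.
    by rewrite powR_1l mul1r.
  by rewrite (tnormE_out T nOx) addr_ge0 ?powR_ge0// indicE.
have mb : measurable_fun setT (tnorm1 (extT T)).
  by do 3 (apply: measurable_sum => ?); exact: measurableT_comp.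
have bp x : tnorm1 (extT T) x `^ p <= tnorm_cst `^ p * tnormE T x `^ p.
  rewrite -powRM ?tnormE_ge0 ?mulr_ge0//; apply: ge0_ler_powR; rewrite ?nnegrE ?tnorm1_ge0 ?mulr_ge0 ?tnormE_ge0// ?(ltW p0)//.
  exact: tnorm1_le_tnormE.
have Lb : L1 mu (fun x => tnorm1 (extT T) x `^ p).
  apply: (L1_le _ _ (L1Z (tnorm_cst `^ p) h)); first exact: measurable_powRl.
  by move=> x; rewrite ger0_norm ?powR_ge0.
split => //.
  by move=> i j k; apply: (L1_le (mT i j k) _ LN) => x; exact: extT_le_tnormE.
by rewrite -IntZ//; apply: Int_le => //; exact: L1Z.
Qed.

Lemma in_Lp_L1 B : in_Lp O p B -> (forall i j k, measurable_fun setT (extT B i j k)) /\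
  L1 mu (fun x => tnormE B x `^ p).
Proof.
move=> [tnorm1 fB]; have mB i j k : measurable_fun setT (extT B i j k) by exact: borel_on_measurable.
split => //; apply: L1_ge0.
- by apply: measurable_powRl; exact: measurable_tnormE.
- by move=> x; exact: powR_ge0.
- by rewrite -lebint_tnormE.
Qed.

Lemma Lp_dist_ltP B B' (eps : R) : (forall i j k, measurable_fun setT (extT B i j k)) ->
  (forall i j k, measurable_fun setT (extT B' i j k)) ->
  let D x i j k := B x i j k - B' x i j k in
  (forall i j k, measurable_fun setT (extT D i j k)) /\
  (Lp_dist_lt O p B B' eps <-> L1 mu (fun x => tnormE D x `^ p) /\ \int[mu]_x (tnormE D x `^ p) < eps `^ p).
Proof.
move=> mB mB' D.
have mD i j k : measurable_fun setT (extT D i j k).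
  have -> : extT D i j k = fun x => extT B i j k x - extT B' i j k x.
    by apply/funext => x; rewrite /extT extD extN.
  exact: measurable_funB.
split => //; rewrite /Lp_dist_lt (lebint_tnormE mD).
have mN : measurable_fun setT (fun x => tnormE D x `^ p) by apply: measurable_powRl; exact: measurable_tnormE.
split=> [h|[h1 h2]].
  have h1 : L1 mu (fun x => tnormE D x `^ p).
    by apply: L1_ge0 => // [x|]; [exact: powR_ge0|apply: lt_trans h _; exact: ltry].
  by split => //; rewrite -lte_fin (EFin_Rintegral h1).
by rewrite -(EFin_Rintegral h1) lte_fin.
Qed.

Lemma tnorm1_triangle B B' x : let D x i j k := B x i j k - B' x i j k in
  tnorm1 (extT B') x <= tnorm1 (extT B) x + tnorm1 (extT D) x.
Proof.
rewrite /tnorm1 -big_split/=; apply: ler_sum => i _; rewrite -big_split/=; apply: ler_sum => j _.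
rewrite -big_split/=; apply: ler_sum => k _.
rewrite /extT extD extN; set a := ext O _ x; set b := ext O _ x.
by have := ler_normB b (b - a); rewrite opprB addrCA subrr addr0.
Qed.

(** [le_young] with t = eps: its terms integrate to eps |O| and to at most eps^(1-p) eps^p = eps. *)
Lemma tnormE_dist_L1 T (eps : R) : 0 < eps -> L1 mu (tnormE T) -> L1 mu (fun x => tnormE T x `^ p) ->
  \int[mu]_x (tnormE T x `^ p) < eps `^ p -> \int[mu]_x (tnormE T x) <= eps * (\int[mu]_x (\1_O x : R) + 1).
Proof.
move=> e0 h1 h2 h3.
have hs := L1D (L1Z eps (L1_O oO bO)) (L1Z (eps `^ (1 - p)) h2).
apply: (@le_trans _ _ (\int[mu]_x (eps * \1_O x + eps `^ (1 - p) * tnormE T x `^ p))).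
  apply: Int_le => // x; have [Ox|nOx] := pselect (O x).
    by rewrite indicE mem_set// mulr1; exact: (le_young p1 (tnormE_ge0 T x) e0).
  by rewrite (tnormE_out T nOx) addr_ge0// mulr_ge0 ?powR_ge0// ?ltW// indicE.
rewrite (IntD (L1Z eps (L1_O oO bO)) (L1Z (eps `^ (1 - p)) h2)) IntZ; last exact: L1_O.
rewrite IntZ// mulrDr lerD2l.
apply: (@le_trans _ _ (eps `^ (1 - p) * eps `^ p)).
  by rewrite ler_wpM2l ?powR_ge0// ltW.
by rewrite -powRD ?(gt_eqF e0) ?implybT// subrK powRr1 ?mulr1// ltW.
Qed.

Section kernel_weak_sol.
Variable B : tfield R d n.
Hypothesis mB : forall i j k, measurable_fun setT (extT B i j k).
Hypothesis hBp : L1 mu (fun x => tnormE B x `^ p).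

(** On the bounded set [O] the square is at most 1 + |B|^p, as p >= 2. Products of [B] with
    functions in L^2 are thereby integrable. *)
Let L1Bsq i j k : L1 mu (fun x => extT B i j k x ^+ 2).
Proof.
have hs := L1D (L1_O oO bO) hBp; apply: (L1_le _ _ hs); first exact: measurable_funX.
move=> x; rewrite ger0_norm ?sqr_ge0//; have [Ox|nOx] := pselect (O x); last first.
  by rewrite /extT ext_out// expr0n addr_ge0 ?powR_ge0// indicE.
rewrite indicE mem_set// -real_normK ?num_real//.
apply: (@le_trans _ _ (tnormE B x ^+ 2)).
  by rewrite ler_sqr ?nnegrE ?tnormE_ge0//; exact: extT_le_tnormE.
have [N1|N1] := leP (tnormE B x) 1.
  by apply: (@le_trans _ _ 1); [rewrite exprn_ile1 ?tnormE_ge0|rewrite lerDl powR_ge0].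
apply: (@le_trans _ _ (tnormE B x `^ p)); last by rewrite lerDr.
by rewrite -powR_mulrn ?tnormE_ge0//; apply: ler_powR => //; exact: ltW.
Qed.

Let test_meas (phi : V -> R) j : test_fun O phi -> measurable_fun setT phi /\ measurable_fun setT ('D_(e_ j) phi).
Proof.
move=> tphi; split; first by apply: continuous_measurable_rV; exact: smooth_continuous tphi.1.
by apply: continuous_measurable_rV; exact: smooth_derive_continuous tphi.1.
Qed.

Let kernel_int m i j (phi : V -> R) : (forall i, L1 mu (extm m i)) ->
  (forall i j, L1 mu (grad_rhs (extT B) (extm m) i j)) -> test_fun O phi ->
  L1 mu (ext O (fun x => - (m x i) * ('D_(e_ j) phi x) + (\sum_k B x i j k * m x k) * phi x)) /\
  \int[mu]_x (ext O (fun x => - (m x i) * ('D_(e_ j) phi x) + (\sum_k B x i j k * m x k) * phi x) x) =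
   - (\int[mu]_x (extm m i x * 'D_(e_ j) phi x) + \int[mu]_x (grad_rhs (extT B) (extm m) i j x * phi x)).
Proof.
move=> h1 h3 tphi; have [mp mdp] := test_meas j tphi.
have [C1 C10 hC1] := test_fun_bounded tphi; have [C2 C20 hC2] := test_fun_derive_bounded j tphi.
have L1a : L1 mu (fun x => extm m i x * 'D_(e_ j) phi x) by exact: L1M (h1 i) mdp hC2.
have L1b : L1 mu (fun x => grad_rhs (extT B) (extm m) i j x * phi x) by exact: L1M (h3 i j) mp hC1.
have e : ext O (fun x => - (m x i) * ('D_(e_ j) phi x) + (\sum_k B x i j k * m x k) * phi x) =
   fun x => - (extm m i x * 'D_(e_ j) phi x + grad_rhs (extT B) (extm m) i j x * phi x).
  apply/funext => x; have [Ox|nOx] := pselect (O x).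
    rewrite ext_in// /grad_rhs /extm ext_in// mulNr opprD mulNr opprK; congr (_ + _ * _).
    by apply: eq_bigr => k _; rewrite /extT !ext_in.
  rewrite ext_out// /grad_rhs /extm ext_out// mul0r add0r big1 ?oppr0 ?mul0r ?oppr0// => k _.
  by rewrite [ext O (fun x => m x k) x]ext_out// mulr0.
rewrite e; split; first exact/L1N/L1D.
by rewrite (IntN (L1D L1a L1b)) (IntD L1a L1b).
Qed.

Lemma inN_weak_sol m : inN O B m -> weak_sol O (extT B) (extm m).
Proof.
move=> [[bm fm] wk].
have mm i : measurable_fun setT (extm m i) by exact: borel_on_measurable.
have L2m : L1 mu (fun x => \sum_i extm m i x ^+ 2).
  have /funext e : forall x, ext O (fun x => \sum_i m x i ^+ 2) x = \sum_i extm m i x ^+ 2.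
    move=> x.
    rewrite ext_sum; apply: eq_bigr => i _.
    by rewrite (@ext_comp R d O (fun y => y ^+ 2) (fun x => m x i))// expr0n.
  have mS : measurable_fun setT (fun x => \sum_i extm m i x ^+ 2).
    by apply: measurable_sum => i; exact: measurable_funX.
  apply: L1_ge0 => // [x|]; first by apply: sumr_ge0 => i _; exact: sqr_ge0.
  move: fm; rewrite lebint_on_ext.
  - by rewrite e.
  - by rewrite e.
  - by move=> x _; apply: sumr_ge0 => i _; exact: sqr_ge0.
have sq i x : extm m i x ^+ 2 <= \sum_i extm m i x ^+ 2 := sqnorm_ge i (fun i => extm m i x).
have h1 i : L1 mu (extm m i).
  apply: (L1_le (mm i) _ (L1D (L1_O oO bO) L2m)) => x.
  have [Ox|nOx] := pselect (O x); last first.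
    by rewrite {1}/extm ext_out// normr0; apply: addr_ge0; [rewrite indicE|apply: sumr_ge0 => k _; exact: sqr_ge0].
  by rewrite indicE mem_set//; exact: (norm_le_sqnorm i (fun i => extm m i x)).
have h3 i j : L1 mu (grad_rhs (extT B) (extm m) i j).
  apply: L1N; apply: L1_sum => k.
  apply: (L1_le _ _ (L1D (L1Bsq i j k) L2m)); first exact: measurable_funM.
  move=> x; rewrite normrM; have := sq k x; have := sqr_ge0 (`|extT B i j k x| - `|extm m k x|).
  rewrite sqrrB !real_normK ?num_real// -mulr_natr.
  have := sqr_ge0 (extT B i j k x); have := sqr_ge0 (extm m k x).
  have := normr_ge0 (extT B i j k x); have := normr_ge0 (extm m k x).
  move: (\sum_i _) (extT B i j k x ^+ 2) (extm m k x ^+ 2) => A C D; move: `|_| `|_| => a b a0 b0.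
  by have := mulr_ge0 b0 a0; move: (b * a) => E; lra.
split => // [i x nOx|i j phi tphi]; first exact: ext_out.
have [La e] := kernel_int i j h1 h3 tphi.
have := wk phi tphi i j; rewrite sint_on_Int// e => -[] /eqP; rewrite oppr_eq0 addr_eq0 => /eqP.
exact.
Qed.

Lemma weak_sol_inN m (S : R) : weak_sol O (extT B) (extm m) -> (forall i x, `|extm m i x| <= S) -> inN O B m.
Proof.
move=> [h1 h2 h3 h4] hS; split.
  split=> [i|]; first by apply: measurable_borel_on => //; exact: L1_meas (h1 i).
  have /funext e : forall x, ext O (fun x => \sum_i m x i ^+ 2) x = \sum_i extm m i x ^+ 2.
    move=> x.
    rewrite ext_sum; apply: eq_bigr => i _.
    by rewrite (@ext_comp R d O (fun y => y ^+ 2) (fun x => m x i))// expr0n.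
  have L2 : L1 mu (fun x => \sum_i extm m i x ^+ 2).
    apply: L1_sum => i; under eq_fun do rewrite expr2.
    by apply: (L1M (c := S) (h1 i)) => //; exact: L1_meas (h1 i).
  rewrite lebint_on_ext.
  - by rewrite e; rewrite -(EFin_Rintegral L2) ltry.
  - by rewrite e; exact: L1_meas L2.
  - by move=> x _; apply: sumr_ge0 => i _; exact: sqr_ge0.
move=> phi tphi i j; have [La e] := kernel_int i j h1 h3 tphi.
by rewrite sint_on_Int// e (h4 i j phi tphi) addNr oppr0.
Qed.

End kernel_weak_sol.

Lemma lebmeasE (A : set V) : measurable A -> lebmeas A = mu A.
Proof.
move=> mA; rewrite /lebmeas /lebint_on lebint_integral.
- rewrite -[RHS]mul1e -(integral_cst mu mA 1) [RHS]integral_mkcond; apply: eq_integral => x _.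
  rewrite /patch; have [Ax|nAx] := pselect (A x); first by rewrite (asboolT Ax) (mem_set Ax).
  by rewrite (asboolF nAx) (memNset nAx).
- apply: (@measurable_fun_ifT _ _ _ _ (fun=> 1%E) (fun=> 0%E) (fun x => `[< A x >])) => //.
  by apply: (measurable_fun_bool true); rewrite setTI (_ : _ @^-1` _ = A)//; apply/seteqP; split => x /= /asboolP.
- by move=> x; case: ifP.
Qed.

Lemma ae_zero_onP (f : V -> R) : measurable_fun setT (ext O f) ->
  ae_zero_on O f <-> {ae mu, forall x, O x -> f x = 0}.
Proof.
move=> mf; have mA : measurable (O `&` [set x | f x != 0]).
  have -> : O `&` [set x | f x != 0] = ext O f @^-1` (~` [set 0]).
    apply/seteqP; split => [x [Ox /= /eqP fx]|x /=]; first by rewrite /= ext_in.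
    by have [Ox|nOx] := pselect (O x); [rewrite ext_in// => /eqP|rewrite ext_out].
  by rewrite -[X in measurable X]setTI; apply: mf => //; apply: measurableC; exact: measurable_set1.
rewrite /ae_zero_on lebmeasE//; split=> [h|h].
  have N : mu.-negligible (O `&` [set x | f x != 0]) by apply/negligibleP.
  by apply: negligibleS N => x /= /not_implyP[Ox /eqP].
apply/negligibleP => //; apply: negligibleS h => x [Ox /= /eqP fx] /=; apply/not_implyP; split => //.
Qed.

End conversions.

(** * Limits along an ultrafilter, orthonormal frames and passage to the limit *)

Section ultra.
Variable R : realType.
Variable U : set_system nat.
Hypothesis uU : UltraFilter U.
Implicit Types (a : nat -> R) (l c : R).

Let pU : ProperFilter U := ultra_proper.

(** A bounded sequence has a cluster point by compactness, and an ultrafilter converges to its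
    cluster points. One ultrafilter serves all points of [O] at once, so no subsequence has to be
    extracted. *)
Lemma ultra_lim a c : (forall m, `|a m| <= c) -> exists l, a m @[m --> U] --> l.
Proof.
move=> ac; have [|l [_ cl]] := @segment_compact R (- c) c (a @ U) _.
  by apply: (@filterE _ U) => m /=; rewrite in_itv/= -ler_norml.
exists l => A nA; have [//|nUA] := in_ultra_setVsetC (a @^-1` A) uU.
by have [y [nAy Ay]] := cl (~` A) A nUA nA; case: (nAy Ay).
Qed.

Lemma ultra_norm_le a l c : a m @[m --> U] --> l -> (forall m, `|a m| <= c) -> `|l| <= c.
Proof.
move=> al ac; apply/ler_addgt0Pr => e e0; move/cvgrPdist_lt: al => /(_ e e0) h.
have [m hm] := filter_ex h.
have := ler_normD (l - a m) (a m); rewrite subrK => h'; apply: le_trans h' _.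
by rewrite addrC; apply: lerD => //; exact: ltW.
Qed.

End ultra.

Section frame.
Variables (R : realType) (n : nat) (E : set 'rV[R]_n).
Hypothesis E_lin : forall (a b : 'rV[R]_n) (c : R), E a -> E b -> E (a + c *: b).

Let E_sub m (W : 'M[R]_(m, n)) (v : 'rV[R]_n) (x : 'rV[R]_m) :
  E v -> (forall l, E (row l W)) -> E (v - x *m W).
Proof.
move=> Ev EW; rewrite mulmx_sum_row -sumrN; elim/big_rec : _ => [|l y _ IH]; first by rewrite addr0.
rewrite addrCA addrC -scaleNr; exact: E_lin.
Qed.

Let sq_ge0 (v : 'rV[R]_n) : v != 0 -> 0 < (v *m v^T) 0 0.
Proof.
move=> v0; rewrite mxE; have h i : 0 <= v 0 i * v^T i 0 by rewrite mxE -expr2 sqr_ge0.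
rewrite lt_def sumr_ge0// andbT; apply: contra v0 => /eqP s0; apply/eqP/rowP => i.
have := @psumr_eq0P R _ predT (fun i => v 0 i * v^T i 0) (fun i _ => h i) s0 i isT.
by rewrite !mxE -expr2 => /eqP; rewrite sqrf_eq0 => /eqP.
Qed.

(** Gram-Schmidt with a choice by rank: as long as fewer than [k] vectors are found, some row of [A]
    lies outside their span. Its orthogonal component is then non-zero and is normalised; the
    closure of [E] under a + c b keeps the result in [E]. *)
Lemma orthonormal_frame k (v : 'I_k -> 'rV[R]_n) : vec_indep E v ->
  exists W : 'M[R]_(k, n), W *m W^T = 1%:M /\ forall l, E (row l W).
Proof.
move=> [Ev iv]; pose A : 'M[R]_(k, n) := \matrix_l v l.
have rA : \rank A = k.
  apply/eqP; rewrite -/(row_free A) -kermx_eq0; apply/eqP/row_matrixP => i; rewrite row0; apply/rowP => l.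
  have h : \sum_l (row i (kermx A)) 0 l *: v l = 0.
    have : row i (kermx A) *m A = 0 by rewrite -row_mul mulmx_ker row0.
    by rewrite mulmx_sum_row => h; rewrite -[RHS]h; apply: eq_bigr => l' _; rewrite rowK.
  by rewrite (iv _ h) mxE.
suff H m : (m <= k)%N -> exists W : 'M[R]_(m, n), W *m W^T = 1%:M /\ forall l, E (row l W) by exact: H.
elim: m => [_|m IH mk].
  by exists 0; split; [apply/matrixP => -[]|case].
have [W [WW EW]] := IH (ltnW mk).
have [i nW] : exists i, ~~ (row i A <= W)%MS.
  apply/existsP; rewrite -negb_forall; apply/negP => /forallP h.
  have /mxrankS : (A <= W)%MS by apply/row_subP.
  by rewrite rA => /leq_trans /(_ (rank_leq_row W)); rewrite leqNgt mk.
pose w := row i A - (row i A *m W^T) *m W.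
have w0 : w != 0.
  by apply: contra nW; rewrite subr_eq0 => /eqP ->; exact: submxMl.
have Ew : E w by apply: E_sub => //; rewrite rowK.
have wW : w *m W^T = 0 by rewrite mulmxBl -(mulmxA _ W) WW mulmx1 subrr.
pose q := (w *m w^T) 0 0; have q0 : 0 < q := sq_ge0 w0.
pose s := (Num.sqrt q)^-1; pose w' := s *: w.
have Ew' : E w'.
  have -> : w' = w + (s - 1) *: w by rewrite scalerBl scale1r addrC subrK.
  exact: E_lin.
have w'w' : w' *m w'^T = 1%:M.
  apply/matrixP => a b; rewrite !ord1 /w' linearZ/= -scalemxAl -scalemxAr scalerA !mxE/= -/q.
  have -> : \sum_j w 0 j * w^T j 0 = q by rewrite /q mxE.
  by rewrite -expr2 /s exprVn sqr_sqrtr ?mulVf ?gt_eqF// ltW.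
have w'W : w' *m W^T = 0 by rewrite -scalemxAl wW scaler0.
have Ww' : W *m w'^T = 0 by rewrite -[LHS]trmxK trmx_mul trmxK w'W trmx0.
pose W' : 'M[R]_(1 + m, n) := col_mx w' W.
have H1 : W' *m W'^T = 1%:M by rewrite tr_col_mx mul_col_row w'w' w'W Ww' WW -scalar_mx_block.
have H2 (l : 'I_(1 + m)) : E (row l W').
  rewrite -[l]splitK; case: (fintype.split l) => l' /=; last by rewrite rowKd.
  rewrite rowKu; have -> // : row l' w' = w' by apply/rowP => j; rewrite mxE (ord1 l').
by exists W'; split; [exact: H1|exact: H2].
Qed.

End frame.

Section limit.
Variables (R : realType) (d n : nat).
Local Notation V := 'rV[R]_d.
Local Notation mu := (leb R d).
Local Notation e_ := (@evec R d).
Variables (O : set V) (al : R).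
Hypothesis oO : open O.
Hypothesis bO : bounded_set_V O.
Hypothesis al0 : 0 < al.
Implicit Types (x y z : V).

Lemma int_holder_continuous (C : R) (u : V -> R) x : 0 <= C -> int_holder O al C u -> O x -> {for x, continuous u}.
Proof.
move=> C0 hu Ox; have [r r0 hr] := open_rV_ball oO Ox.
have h' y : `|y - x| < Num.min 1 r -> O y by rewrite lt_min => /andP[_ /hr].
have m1 : Num.min 1 r <= 1 by rewrite ge_min lexx.
apply/continuous_rVP => e e0.
pose c := (e / (C + 1)) `^ al^-1.
have C1 : 0 < C + 1 by rewrite ltr_wpDl.
have c0 : 0 < c by rewrite powR_gt0// divr_gt0.
exists (Num.min (Num.min 1 r / 8) c); first by rewrite lt_min c0 divr_gt0// lt_min ltr01.
move=> y; rewrite lt_min => /andP[y1 y2].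
apply: le_lt_trans (int_holder_near C0 hu m1 h' _) _; first by rewrite mulrC -ltr_pdivlMr.
have : `|y - x| `^ al <= e / (C + 1).
  apply: (@le_trans _ _ (c `^ al)).
    by apply: ge0_ler_powR; rewrite ?nnegrE// ?ltW.
  by rewrite -powRrM mulVf ?gt_eqF// powRr1// divr_ge0// ltW.
move=> h; apply: le_lt_trans (ler_wpM2l C0 h) _.
by rewrite mulrCA gtr_pMr// ltr_pdivrMr// mul1r ltrDl.
Qed.

Variables (U : set_system nat) (uU : UltraFilter U) (ooU : \oo `<=` U).
Let pU : ProperFilter U := ultra_proper.
Variables (B : 'I_n -> 'I_d -> 'I_n -> V -> R) (Bm : nat -> 'I_n -> 'I_d -> 'I_n -> V -> R).
Variables (um : nat -> 'I_n -> V -> R) (u : 'I_n -> V -> R) (S C c : R).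
Hypothesis S0 : 0 <= S.
Hypothesis C0 : 0 <= C.
Hypothesis hB : forall i j k, L1 mu (B i j k).
Hypothesis hBm : forall m i j k, L1 mu (Bm m i j k).
Hypothesis dB : forall m i j k, \int[mu]_x `|B i j k x - Bm m i j k x| <= c * m.+1%:R^-1.
Hypothesis gm : forall m, weak_sol O (Bm m) (um m).
Hypothesis Sm : forall m i x, `|um m i x| <= S.
Hypothesis Cm : forall m i, int_holder O al C (um m i).
Hypothesis ulim : forall i x, um m i x @[m --> U] --> u i x.

Lemma limit_bounded i x : `|u i x| <= S.
Proof. by apply: (ultra_norm_le uU (@ulim i x)) => m. Qed.

Lemma limit_holder i : int_holder O al C (u i).
Proof.
move=> x y xy hO.
have h : um m i y - um m i x @[m --> U] --> u i y - u i x by apply: cvgB; exact: ulim.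
by apply: (ultra_norm_le uU h) => m; exact: Cm.
Qed.

(** The common Hoelder constant extends the convergence at one point to a neighbourhood, with an
    error of e / 3 for each of three terms; compactness of [K] does the rest. *)
Let limit_unif i (K : set V) (e : R) : compact K -> K `<=` O -> 0 < e ->
  \forall m \near U, K `<=` (fun x => `|um m i x - u i x| <= e).
Proof.
move=> /compact_near_coveringP cK KO e0; apply: cK => x Kx; have Ox := KO x Kx.
have [r r0 hr] := open_rV_ball oO Ox.
have h' y : `|y - x| < Num.min 1 r -> O y by rewrite lt_min => /andP[_ /hr].
have m1 : Num.min 1 r <= 1 by rewrite ge_min lexx.
have e3 : 0 < e / 3 by rewrite divr_gt0.
pose q := (e / 3 / (C + 1)) `^ al^-1.
have C1 : 0 < C + 1 by rewrite ltr_wpDl.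
have q0 : 0 < q by rewrite powR_gt0// divr_gt0.
move/cvgrPdist_lt: (@ulim i x) => /(_ _ e3) hm.
exists (ball x (Num.min (Num.min 1 r / 8) q), [set m | `|u i x - um m i x| < e / 3]) => /=.
  by split => //; apply: nbhsx_ballx; rewrite lt_min q0 divr_gt0// lt_min ltr01.
move=> [y m] [/= /ball_rVE]; rewrite lt_min => /andP[y1 y2] hxm.
have cl w : int_holder O al C w -> `|w y - w x| <= e / 3.
  move=> hw; apply: le_trans (int_holder_near C0 hw m1 h' _) _; first by rewrite mulrC -ltr_pdivlMr.
  have : `|y - x| `^ al <= e / 3 / (C + 1).
    apply: (@le_trans _ _ (q `^ al)).
      by apply: ge0_ler_powR; rewrite ?nnegrE// ?ltW.
    by rewrite -powRrM mulVf ?gt_eqF// powRr1// divr_ge0// ltW.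
  move=> h; apply: le_trans (ler_wpM2l C0 h) _.
  by rewrite mulrCA ler_piMr ?(ltW e3)// ler_pdivrMr// mul1r lerDl.
have h1 := cl _ (Cm m i); have h2 := cl _ (limit_holder i); rewrite distrC in hxm.
apply: le_trans (ler_distD (um m i x) _ _) _.
apply: le_trans (lerD h1 (ler_distD (u i x) _ _)) _; rewrite [`|u i x - _|]distrC.
by move: h2 hxm; move: `|u i y - u i x| `|um m i x - u i x| => a b; lra.
Qed.

(** The coefficients converge in L^1 only, for which the sup bound on the solutions compensates; [B]
    is only integrable, for which uniform convergence of the solutions on the support of the test
    function compensates. *)
Lemma limit_weak_sol : weak_sol O B u.
Proof.
have u0 i x : ~ O x -> u i x = 0.
  move=> nO; apply/eqP; rewrite -normr_le0; apply: (ultra_norm_le uU (@ulim i x)) => m.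
  by have [_ z _ _] := gm m; rewrite z// normr0.
have eu i : u i = ext O (u i).
  by apply/funext => x; have [Ox|nOx] := pselect (O x); [rewrite ext_in|rewrite ext_out// u0].
have mu_ i : measurable_fun setT (u i).
  rewrite eu; apply: borel_on_measurable => //; apply: continuous_borel_on => // x.
  exact: int_holder_continuous C0 (limit_holder i).
have h1 i : L1 mu (u i).
  apply: (L1_le (mu_ i) _ (L1Z S (L1_O oO bO))) => x.
  have [Ox|nOx] := pselect (O x); first by rewrite indicE mem_set// mulr1 limit_bounded.
  by rewrite u0// normr0 mulr_ge0// indicE.
have hBu i j k : L1 mu (fun x => B i j k x * u k x) by exact: L1M (hB i j k) (mu_ k) (limit_bounded k).
have h3 i j : L1 mu (grad_rhs B u i j) by apply: L1N; exact: L1_sum.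
split => // i j phi tphi.
have [sphi [K [cK [KO phi0]]]] := tphi.
have [C1 C10 hC1] := test_fun_bounded tphi; have [C2 C20 hC2] := test_fun_derive_bounded j tphi.
have mp : measurable_fun setT phi by apply: continuous_measurable_rV; exact: smooth_continuous sphi.
have mdp : measurable_fun setT ('D_(e_ j) phi).
  by apply: continuous_measurable_rV; exact: smooth_derive_continuous sphi.
pose mO := \int[mu]_x (\1_O x : R); pose Bn := \sum_k \int[mu]_x `|B i j k x|.
have mO0 : 0 <= mO by apply: Int_ge0 => x; rewrite indicE.
have Bn0 : 0 <= Bn by apply: sumr_ge0 => k _; exact: Int_ge0.
(* The total factor of e': from the derivative of [phi] over [O], from the distance of the
   coefficients weighted by [S], and from the distance of the solutions weighted by the L^1 norms of
   [B]. *)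
pose Q := C2 * mO + C1 * (n%:R * S + Bn).
have Q0 : 0 <= Q by rewrite addr_ge0 ?mulr_ge0// addr_ge0// mulr_ge0.
have La : L1 mu (fun x => u i x * 'D_(e_ j) phi x) by exact: L1M (h1 i) mdp hC2.
have Lb : L1 mu (fun x => grad_rhs B u i j x * phi x) by exact: L1M (h3 i j) mp hC1.
apply/eqP; rewrite -addr_eq0 -normr_le0; apply/ler_addgt0Pr => e e0; rewrite add0r.
pose e' := e / (Q + 1); have Q1 : 0 < Q + 1 by rewrite ltr_wpDl.
have e'0 : 0 < e' by rewrite divr_gt0.
have hn : \forall m \near U, forall k, K `<=` (fun x => `|um m k x - u k x| <= e').
  by apply: filter_forall => k; exact: limit_unif.
have hc : \forall m \near U, c * m.+1%:R^-1 < e'.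
  apply: ooU; have : c * m.+1%:R^-1 @[m --> \oo] --> (0 : R).
    by rewrite -[X in _ --> X](mulr0 c); apply: cvg_mulr; [exact: cvg_cst|exact: cvg_harmonic].
  by move/cvgr0Pnorm_lt => /(_ e' e'0); apply: filterS => m; apply: le_lt_trans; exact: ler_norm.
have [m [hm1 hm2]] := filter_ex (filterI hn hc).
have [g1 _ g3 g4] := gm m.
have Lam : L1 mu (fun x => um m i x * 'D_(e_ j) phi x) by exact: L1M (g1 i) mdp hC2.
have Lbm : L1 mu (fun x => grad_rhs (Bm m) (um m) i j x * phi x) by exact: L1M (g3 i j) mp hC1.
have Z : \int[mu]_x (um m i x * 'D_(e_ j) phi x) + \int[mu]_x (grad_rhs (Bm m) (um m) i j x * phi x) = 0.
  by rewrite (g4 i j phi tphi) addNr.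
have -> : \int[mu]_x (u i x * 'D_(e_ j) phi x) + \int[mu]_x (grad_rhs B u i j x * phi x) =
   \int[mu]_x (u i x * 'D_(e_ j) phi x - um m i x * 'D_(e_ j) phi x) +
   \int[mu]_x (grad_rhs B u i j x * phi x - grad_rhs (Bm m) (um m) i j x * phi x).
  by rewrite (IntB La Lam) (IntB Lb Lbm) addrACA -opprD Z subr0.
have LD k : L1 mu (fun x => `|B i j k x - Bm m i j k x|) by apply/L1_abs/L1B.
have hs : L1 mu (fun x => \sum_k (S * `|B i j k x - Bm m i j k x| + e' * `|B i j k x|)).
  by apply: L1_sum => k; apply: L1D; apply: L1Z => //; exact: L1_abs.
apply: (@le_trans _ _ (\int[mu]_x (e' * C2 * \1_O x) + \int[mu]_x (C1 * \sum_k (S * `|B i j k x - Bm m i j k x| + e' * `|B i j k x|)))).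
  apply: le_trans (ler_normD _ _) _; apply: lerD.
    apply: Int_abs_le; [exact: L1B|exact: L1Z (L1_O oO bO)|] => x.
    have [Kx|nKx] := pselect (K x).
      rewrite indicE (mem_set (KO x Kx)) mulr1 -mulrBl normrM; apply: ler_pM => //.
      by rewrite distrC; exact: hm1.
    by rewrite (derive_eq0_out j cK phi0 nKx) !mulr0 subrr normr0 mulr_ge0 ?indicE// mulr_ge0// ltW.
  apply: Int_abs_le; [exact: L1B|exact: L1Z|] => x.
  have [Kx|nKx] := pselect (K x); last first.
    rewrite phi0// !mulr0 subrr normr0 mulr_ge0//; apply: sumr_ge0 => k _.
    by apply: addr_ge0; apply: mulr_ge0 => //; exact: ltW.
  rewrite -mulrBl normrM mulrC; apply: ler_pM => //.
  rewrite /grad_rhs opprK addrC -sumrB; apply: le_trans (ler_norm_sum _ _ _) _; apply: ler_sum => k _.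
  have -> : Bm m i j k x * um m k x - B i j k x * u k x =
    (Bm m i j k x - B i j k x) * um m k x + B i j k x * (um m k x - u k x) by ring.
  apply: le_trans (ler_normD _ _) _; rewrite !normrM distrC mulrC; apply: lerD; first exact: ler_wpM2r.
  by rewrite mulrC; apply: ler_wpM2r => //; exact: hm1.
rewrite (IntZ _ (L1_O oO bO)) -/mO (IntZ _ hs) Int_sum; last first.
  by move=> k; apply: L1D; apply: L1Z => //; exact: L1_abs.
apply: (@le_trans _ _ (e' * Q)); last first.
  by rewrite /e' mulrAC ler_pdivrMr// ler_pM2l// lerDl.
rewrite /Q mulrDr mulrA; apply: lerD => //.
rewrite mulrCA; apply: ler_wpM2l => //; rewrite mulrDr.
apply: (@le_trans _ _ (\sum_k (S * e' + e' * \int[mu]_x `|B i j k x|))).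
  apply: ler_sum => k _; rewrite IntD; [|exact: L1Z|by apply: L1Z; exact: L1_abs].
  rewrite IntZ// (IntZ _ (L1_abs (hB i j k))); apply: lerD => //.
  by apply: ler_wpM2l => //; apply: le_trans (dB m i j k) _; exact: ltW.
rewrite big_split/= sumr_const card_ord -mulr_sumr lerD2r -mulr_natl.
by rewrite le_eqVlt; apply/orP; left; apply/eqP; ring.
Qed.

End limit.

Section classical_sol_bounded.
Variables (R : realType) (d n : nat).
Local Notation V := 'rV[R]_d.
Local Notation mu := (leb R d).
Local Notation e_ := (@evec R d).
Variables (O : set V).
Hypothesis oO : open O.
Hypothesis cO : connected O.
Hypothesis nO : O !=set0.
Hypothesis sO : smooth_boundary O.
Hypothesis bO : bounded_set_V O.
Variable B' : tfield R d n.
Implicit Types (m : V -> 'I_n -> R).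

Lemma within_closure_continuous (f : V -> R) : {within closure O, continuous f} ->
  forall x, O x -> {for x, continuous f}.
Proof.
move=> cf x Ox; have h : {within O, continuous f} by apply: continuous_subspaceW cf; exact: subset_closure.
by move: h; rewrite continuous_open_subspace// => /(_ x); apply; rewrite inE.
Qed.

Lemma within_closure_bounded (f : V -> R) : {within closure O, continuous f} ->
  exists2 C, 0 <= C & forall x, closure O x -> `|f x| <= C.
Proof.
move=> cf; have /compact_bounded [M [_ hM]] := continuous_compact cf (compact_closure bO).
exists (`|M| + 1); first by rewrite addr_ge0.
move=> x Ox; apply: (hM (`|M| + 1)); last by exists x.
by apply: le_lt_trans (ler_norm _) _; rewrite ltrDl.
Qed.

Hypothesis cB' : continuous_on_closure O B'.

Lemma cB'_in x : O x -> forall i j k, {for x, continuous (fun x => B' x i j k)}.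
Proof. by move=> Ox i j k; exact: (@within_closure_continuous (fun x => B' x i j k) (@cB' i j k) x Ox). Qed.

Lemma cB'_bounded : exists2 C, 0 <= C & forall x i j k, O x -> `|B' x i j k| <= C.
Proof.
have /choice [F hF] : forall q : 'I_n * 'I_d * 'I_n, exists C : R, 0 <= C /\
    forall x, O x -> `|B' x q.1.1 q.1.2 q.2| <= C.
  move=> q; have [C C0 hC] := within_closure_bounded (@cB' q.1.1 q.1.2 q.2).
  by exists C; split => // x Ox; apply: hC; exact: subset_closure.
exists (\sum_q F q); first by apply: sumr_ge0 => q _; have [] := hF q.
move=> x i j k Ox; apply: le_trans ((hF (i, j, k)).2 x Ox) _.
by rewrite [leRHS](bigD1 (i, j, k))//= lerDl; apply: sumr_ge0 => q _; have [] := hF q.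
Qed.

Lemma measurable_extT i j k : measurable_fun setT (extT O B' i j k).
Proof.
by apply: borel_on_measurable => //; apply: continuous_borel_on => // x Ox; exact: cB'_in.
Qed.

Lemma bounded_L1 (f : V -> R) (C : R) : (forall x, O x -> {for x, continuous f}) -> 0 <= C ->
  (forall x, O x -> `|f x| <= C) -> L1 mu (ext O f).
Proof.
move=> cf C0 hC; apply: (L1_le _ _ (L1Z C (L1_O oO bO))).
  by apply: borel_on_measurable => //; exact: continuous_borel_on.
move=> x; have [Ox|nOx] := pselect (O x); first by rewrite ext_in// indicE mem_set// mulr1 hC.
by rewrite ext_out// normr0 mulr_ge0// indicE.
Qed.

(** Nothing is known of [m] at the boundary. As [B'] is bounded, [lognorm] of [m] has bounded
    gradient, and [holder_global] with exponent 1 bounds its oscillation over all of [O]. *)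
Lemma classical_sol_bounded m : classical_sol O B' m -> exists2 S, 0 <= S & forall x i, O x -> `|m x i| <= S.
Proof.
move=> hm; have [C C0 hC] := cB'_bounded; have [x0 Ox0] := nO.
pose f x := lognorm 1 (m x).
pose f' j y := \sum_i dlognorm 1 i (m y) * (- \sum_k B' y i j k * m y k).
have df j y : O y -> is_derive y (e_ j) f (f' j y).
  move=> Oy; apply/is_derive_line.
  have D i := (@is_derive_line R V R (m^~ i) y (e_ j) _).1 ((hm y Oy).2 i j).
  have := @lognorm_chain R n 1 ltr01 (fun i t => m (y + t *: e_ j) i) _ 0 D.
  by rewrite scale0r addr0.
pose M : R := n%:R * (n%:R * C).
have M0 : 0 <= M by rewrite !mulr_ge0.
have sum_le (q : nat) (F : 'I_q -> R) c : (forall i, F i <= c) -> \sum_i F i <= q%:R * c.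
  by move=> h; rewrite -[q in q%:R]card_ord mulr_natl -sumr_const; apply: ler_sum.
have bf j y : O y -> `|f' j y| <= M.
  move=> Oy; apply: le_trans (ler_norm_sum _ _ _) _; apply: (sum_le) => i.
  rewrite mulrN normrN mulr_sumr; apply: le_trans (ler_norm_sum _ _ _) _; apply: (sum_le) => k.
  rewrite mulrCA normrM -[leRHS]mulr1; apply: ler_pM => //; first exact: hC.
  by rewrite normrM; exact: lognorm_quad.
have [K K0 hK] := @holder_global R d O 1 ltr01 oO cO nO sO bO.
have dM : 0 <= d%:R * M by rewrite mulr_ge0.
have hf := hK (d%:R * M) f dM (C1_int_holder df bf).
pose L := K * (d%:R * M).
exists (expR (2 * L) * (1 + sqnorm (m x0))); first by rewrite mulr_ge0 ?expR_ge0// addr_ge0 ?sqnorm_ge0.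
move=> x i Ox; apply: le_trans (norm_le_sqnorm i (m x)) _; apply: lognorm_le => //.
by rewrite -lerBlDl; apply: le_trans (hf x x0 Ox Ox0); exact: ler_norm.
Qed.

Lemma classical_sol_weak m : classical_sol O B' m -> weak_sol O (extT O B') (extm O m).
Proof.
move=> hm; have [S S0 hS] := classical_sol_bounded hm; have [C C0 hC] := cB'_bounded.
have h1 i : L1 mu (extm O m i).
  apply: (bounded_L1 (C := S)) => // [x Ox|x Ox]; [exact: (hm x Ox).1|exact: hS].
have cg i j x : O x -> {for x, continuous (fun y => - \sum_k B' y i j k * m y k)}.
  move=> Ox; apply: (@cvgN _ _ _ (nbhs x) (nbhs_filter x)).
  apply: (@cvg_sumr R V 'I_n (nbhs x) (nbhs_filter x)) => k.
  by apply: (@cvg_mulr R V (nbhs x) (nbhs_filter x) (fun y => B' y i j k) (m^~ k)); [exact: cB'_in|exact: (hm _ Ox).1].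
have egr i j : grad_rhs (extT O B') (extm O m) i j = ext O (fun y => - \sum_k B' y i j k * m y k).
  apply/funext => x; rewrite extN /grad_rhs ext_sum; congr (- _); apply: eq_bigr => k _.
  by rewrite extM.
have h3 i j : L1 mu (grad_rhs (extT O B') (extm O m) i j).
  rewrite egr; apply: (bounded_L1 (C := n%:R * (C * S))).
  - exact: cg.
  - by rewrite !mulr_ge0.
  - move=> x Ox; rewrite normrN; apply: le_trans (ler_norm_sum _ _ _) _.
    rewrite -[n in n%:R]card_ord mulr_natl -sumr_const; apply: ler_sum => k _.
    by rewrite normrM; apply: ler_pM => //; [exact: hC|exact: hS].
split => // [i x nOx|i j phi tphi]; first exact: ext_out.
have w := C1_weak_grad (j := j) (fun x Ox => (hm x Ox).1 i) (cg i j) (fun x Ox => (hm x Ox).2 i j) tphi.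
have [sphi [K [cK [KO phi0]]]] := tphi.
have e1 : (fun x => extm O m i x * 'D_(e_ j) phi x) = fun x => m x i * 'D_(e_ j) phi x.
  apply/funext => x; have [Ox|nOx] := pselect (O x); first by rewrite /extm ext_in.
  by rewrite (derive_eq0_out j cK phi0 (x := x)) ?mulr0// => /KO.
have e2 : (fun x => grad_rhs (extT O B') (extm O m) i j x * phi x) = fun x => (- \sum_k B' x i j k * m x k) * phi x.
  apply/funext => x; rewrite egr; have [Ox|nOx] := pselect (O x); first by rewrite ext_in.
  by rewrite phi0 ?mulr0// => /KO.
by rewrite e1 e2; exact: w.
Qed.

End classical_sol_bounded.

(** Otherwise [f] would be non-zero on a ball around x, and balls have positive measure. *)
Lemma ae_zero_continuous (R : realType) d (O : set 'rV[R]_d) (f : 'rV[R]_d -> R) x : open O -> O x ->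
  {for x, continuous f} -> {ae leb R d, forall x, O x -> f x = 0} -> f x = 0.
Proof.
move=> oO Ox cf [N [mN N0 hN]]; apply: contrapT => /eqP fx.
have fx0 : 0 < `|f x| by rewrite normr_gt0.
have [r r0 hr] := (continuous_rVP f x).1 cf _ fx0; have [r' r'0 hr'] := open_rV_ball oO Ox.
have rr : 0 < Num.min r r' by rewrite lt_min r0.
have hb : ball x (Num.min r r') `<=` N.
  move=> y /ball_rVE; rewrite lt_min => /andP[yr yr']; apply: hN => /= h.
  by have := hr y yr; rewrite h ?sub0r ?normrN ?ltxx//; exact: hr'.
have h := le_measure (leb R d) (mem_set (measurable_ball0 _ _)) (mem_set mN) hb.
have : (leb R d (ball x (Num.min r r')) <= 0)%E by rewrite -N0; exact: h.
by rewrite leb_ball// lee_fin leNgt exprn_gt0// mulr_gt0.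
Qed.

Section at_least.
Variables (R : realType) (d n : nat).
Local Notation V := 'rV[R]_d.
Local Notation mu := (leb R d).
Variables (O : set V) (p : R) (B : tfield R d n).
Hypothesis d2 : (2 <= d)%N.
Hypothesis oO : open O.
Hypothesis cO : connected O.
Hypothesis nO : O !=set0.
Hypothesis bO : bounded_set_V O.
Hypothesis sO : smooth_boundary O.
Hypothesis dp : d%:R < p.
Hypothesis hB : in_Lp O p B.

Lemma p_ge2 : 2 <= p. Proof. by apply: le_trans (ltW dp); rewrite (ler_nat _ 2). Qed.
Lemma p_ge1 : 1 <= p. Proof. by apply: le_trans p_ge2; rewrite ler1n. Qed.
Lemma al_in01 : 0 < 1 - d%:R / p < 1.
Proof.
have p0 : 0 < p by apply: lt_le_trans p_ge1.
rewrite subr_gt0 ltr_pdivrMr// mul1r dp/= gtrBl divr_gt0// ltr0n.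
exact: leq_trans d2.
Qed.
Local Notation al := (1 - d%:R / p).

Let Sm (q : nat) : R := q.+1%:R^-1.
Let Sm_gt0 q : 0 < Sm q. Proof. by rewrite invr_gt0. Qed.
Let Sm_le1 q : Sm q <= 1. Proof. by rewrite invf_le1// ler1n. Qed.

Lemma orthonormal_classical_sol k x0 (B' : tfield R d n) k' : O x0 -> continuous_on_closure O B' -> (k <= k')%N ->
  conservative_C0 O B' k' -> exists m : 'I_k -> V -> 'I_n -> R, (forall l, classical_sol O B' (m l)) /\
  forall l l', \sum_i m l x0 i * m l' x0 i = (l == l')%:R.
Proof.
move=> Ox0 cB' kk' /(_ x0 Ox0) [[v iv] _]; have cB := cB'_in oO cB'.
(* Values of global solutions take the place of [Eset], since superposition of solutions shows
   directly that they are stable under linear combinations. *)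
pose E := [set v : 'rV[R]_n | exists mm, classical_sol O B' mm /\ forall i, mm x0 i = v 0 i].
have EE v' : Eset O B' x0 v' -> E v' by move=> /(Eset_classical_sol oO cO cB Ox0).
have E_lin (a b : 'rV[R]_n) (c : R) : E a -> E b -> E (a + c *: b).
  move=> [ma [ga ea]] [mb [gb eb]].
  have h : forall l : 'I_2, classical_sol O B' (if l == ord0 then ma else mb) by move=> l; case: ifP.
  exists (fun x i => \sum_(l < 2) (if l == ord0 then 1 else c) * (if l == ord0 then ma else mb) x i); split.
    exact: (classical_sol_sum (fun l : 'I_2 => if l == ord0 then 1 else c) h).
  by move=> i; rewrite big_ord_recl big_ord1 /= mul1r ea eb !mxE.
have iE : vec_indep E v by have [h1 h2] := iv; split => // l; exact: EE.
have [W [WW EW]] := orthonormal_frame E_lin iE.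
have /choice [mm hmm] : forall l : 'I_k, exists mm, classical_sol O B' mm /\ forall i, mm x0 i = W (widen_ord kk' l) i.
  by move=> l; have [mm [g e]] := EW (widen_ord kk' l); exists mm; split => // i; rewrite e mxE.
exists mm; split=> [l|l l']; first by have [] := hmm l.
transitivity ((W *m W^T) (widen_ord kk' l) (widen_ord kk' l')); last by rewrite WW mxE.
by rewrite mxE; apply: eq_bigr => i _; rewrite (hmm l).2 (hmm l').2 mxE.
Qed.

Lemma at_least_kernel k : at_least_conservative O p B k -> exists f : 'I_k -> V -> 'I_n -> R,
  (forall l, inN O B (f l)) /\ L2_indep O f.
Proof.
move=> hk; have [x0 Ox0] := nO.
have [mB LB] := in_Lp_L1 oO p_ge2 hB.
have [_ LBijk LbB _] := tnormE_Lp oO bO p_ge2 mB LB.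
have /andP[al0 al1] := al_in01.
have [K K0 hK] := @holder_global R d O al al0 oO cO nO sO bO.
pose D (B' : tfield R d n) : tfield R d n := fun x i j k => B x i j k - B' x i j k.
have /choice [q hq] : forall r : nat, exists q : tfield R d n * ('I_k -> V -> 'I_n -> R),
    [/\ continuous_on_closure O q.1, Lp_dist_lt O p B q.1 (Sm r), forall l, classical_sol O q.1 (q.2 l) &
     forall l l', \sum_i q.2 l x0 i * q.2 l' x0 i = (l == l')%:R].
  move=> r; have [B' [cB' [[k' [kk' hk']] hd]]] := hk (Sm r) (Sm_gt0 r).
  by have [m [g o]] := orthonormal_classical_sol Ox0 cB' kk' hk'; exists (B', m).
pose mO := \int[mu]_x (\1_O x : R).
(* A bound common to all approximating fields: each is B plus an error whose L^p distance is below
   1/(r+1) <= 1; [tnorm_cst] is the price of passing from the Euclidean norm to [tnorm1]. *)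
pose J : R := 3 `^ p * (\int[mu]_x (tnorm1 (extT O B) x `^ p) + tnorm_cst R d n `^ p).
have facts r : [/\ forall i j k, L1 mu (extT O (q r).1 i j k), L1 mu (fun x => tnorm1 (extT O (q r).1) x `^ p),
    \int[mu]_x (tnorm1 (extT O (q r).1) x `^ p) <= J &
    forall i j k, \int[mu]_x `|extT O B i j k x - extT O (q r).1 i j k x| <= (mO + 1) * Sm r].
  have [cq dq _ _] := hq r; have mq := measurable_extT oO cq.
  have [mD] := Lp_dist_ltP p_ge2 (Sm r) mB mq; rewrite -/(D (q r).1) => -[/(_ dq) [LD ID] _].
  have [LN LDijk LbD IbD] := tnormE_Lp oO bO p_ge2 mD LD.
  have eD i j k' x : extT O B i j k' x - extT O (q r).1 i j k' x = extT O (D (q r).1) i j k' x.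
    by rewrite [RHS]/extT extD extN.
  have Lq i j k' : L1 mu (extT O (q r).1 i j k').
    have -> : extT O (q r).1 i j k' = fun x => extT O B i j k' x - extT O (D (q r).1) i j k' x.
      by apply/funext => x; rewrite -eD subKr.
    exact: L1B.
  have b3 x : tnorm1 (extT O (q r).1) x `^ p <= 3 `^ p * (tnorm1 (extT O B) x `^ p + tnorm1 (extT O (D (q r).1)) x `^ p).
    have h := tnorm1_triangle O B (q r).1 x; rewrite -/(D (q r).1) in h.
    have p0 : 0 <= p by apply: le_trans p_ge1.
    apply: (@le_trans _ _ ((tnorm1 (extT O B) x + tnorm1 (extT O (D (q r).1)) x + 0) `^ p)).
      by rewrite addr0; apply: ge0_ler_powR; rewrite ?nnegrE ?tnorm1_ge0// addr_ge0 ?tnorm1_ge0.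
    apply: le_trans (powR_add3 p0 (tnorm1_ge0 _ x) (tnorm1_ge0 _ x) (lexx 0)) _.
    by rewrite powR0 ?addr0// gt_eqF// (lt_le_trans _ p_ge1).
  have L3 := L1Z (3 `^ p) (L1D LbB LbD).
  have Lbq : L1 mu (fun x => tnorm1 (extT O (q r).1) x `^ p).
    apply: (L1_le _ _ L3) => [|x]; last by rewrite ger0_norm ?powR_ge0.
    by apply: measurable_powRl; do 3 (apply: measurable_sum => ?); exact: measurableT_comp.
  have Dle : \int[mu]_x (tnorm1 (extT O (D (q r).1)) x `^ p) <= tnorm_cst R d n `^ p.
    apply: le_trans IbD _; rewrite ler_piMr ?powR_ge0//; apply: le_trans (ltW ID) _.
    rewrite -[leRHS](powR_1l p); apply: ge0_ler_powR; rewrite ?nnegrE// ?ltW//.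
    by apply: lt_le_trans p_ge1.
  split => //.
    apply: le_trans (Int_le Lbq L3 b3) _; rewrite (IntZ _ (L1D LbB LbD)) (IntD LbB LbD).
    by apply: ler_wpM2l; [exact: powR_ge0|rewrite lerD2l].
  move=> i j k'; apply: (@le_trans _ _ (\int[mu]_x tnormE O (D (q r).1) x)).
    apply: Int_le => // [|x]; first by apply/L1_abs/L1B.
    by rewrite eD; exact: extT_le_tnormE.
  rewrite [leRHS]mulrC; exact: (tnormE_dist_L1 oO bO p_ge2 (Sm_gt0 r) LN LD ID).
pose um (l : 'I_k) r i := extm O ((q r).2 l) i.
have gum l r : weak_sol O (extT O (q r).1) (um l r).
  by have [cq _ gq _] := hq r; exact: classical_sol_weak.
have cum l r i z : O z -> {for z, continuous (um l r i)}.
  move=> Oz; have [_ _ gq _] := hq r; have [r' r'0 hr] := open_rV_ball oO Oz.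
  apply/continuous_rVP => e e0; have [r2 r20 hr2] := (continuous_rVP _ z).1 ((gq l z Oz).1 i) e e0.
  exists (Num.min r' r2); first by rewrite lt_min r'0.
  by move=> y; rewrite lt_min => /andP[/hr Oy /hr2]; rewrite /um /extm !ext_in.
pose E := regE d p K J; have E0 : 0 <= E by exact: expR_ge0.
(* Each solution has norm 1 at [x0], so the comparison bounds its square by [E] on [O]. *)
pose S := 1 + E; have S0 : 0 <= S by rewrite addr_ge0.
have Sum l r i x : `|um l r i x| <= S.
  have [Ox|nOx] := pselect (O x); last by rewrite /um /extm ext_out// normr0.
  have [f1 f2 f3 _] := facts r; have [_ _ _ oq] := hq r.
  apply: le_trans (norm_le_sqnorm i (fun i => um l r i x)) _; rewrite lerD2l.
  apply: le_trans (weak_sol_compare oO dp p_ge1 al_in01 hK f1 f2 f3 (gum l r) (cum l r) Ox Ox0) _.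
  rewrite -/E ler_piMr// le_eqVlt; apply/orP; left; apply/eqP.
  transitivity (\sum_i (q r).2 l x0 i * (q r).2 l x0 i); last by rewrite oq eqxx.
  apply: eq_bigr => i' _.
  by rewrite /um /extm ext_in// expr2.
have Cum l r i : int_holder O al (regC d p J S) (um l r i).
  have [f1 f2 f3 _] := facts r.
  exact: (weak_sol_holder oO dp p_ge1 al_in01 f1 f2 f3 i (gum l r) (Sum l r) S0 (cum l r)).
have C0 : 0 <= regC d p J S.
  have [_ _ f3 _] := facts 0%N.
  by rewrite mulr_ge0 ?(regC0 f3)// morreyC_ge0// al_in01.
have [U [uU ooU]] := @ultraFilterLemma nat \oo _.
have /choice [u hu] : forall t : 'I_k * 'I_n * V, exists l : R, um t.1.1 r t.1.2 t.2 @[r --> U] --> l.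
  by move=> t; exact: (ultra_lim uU (fun r => Sum t.1.1 r t.1.2 t.2)).
pose f l x i := u (l, i, x).
have fE l i x : um l r i x @[r --> U] --> f l x i by exact: hu (l, i, x).
have gf l : weak_sol O (extT O B) (fun i x => f l x i).
  apply: (@limit_weak_sol R d n O al oO bO al0 U uU ooU (extT O B) (fun r => extT O (q r).1) (um l) _ S (regC d p J S) (mO + 1)) => //.
  - by move=> r; have [] := facts r.
  - by move=> r; have [] := facts r.
have f0 l : extm O (f l) = fun i x => f l x i.
  apply/funext => i; apply/funext => x; have [Ox|nOx] := pselect (O x); first by rewrite /extm ext_in.
  by have [_ z _ _] := gf l; rewrite /extm ext_out// z.
have Sf l i x : `|f l x i| <= S by apply: (ultra_norm_le uU (@fE l i x)) => r; exact: Sum.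
have cf l i : {for x0, continuous (fun x => f l x i)}.
  apply: (int_holder_continuous oO al0 C0 _ Ox0).
  exact: (@limit_holder R d n O al U uU (um l) (fun i x => f l x i) (regC d p J S) (Cum l) (fE l) i).
(* The scalar products at [x0] are constant along the sequence; this is what prevents the limits
   from becoming dependent. *)
have ort l l' : \sum_i f l x0 i * f l' x0 i = (l == l')%:R.
  have pU : ProperFilter U := ultra_proper.
  have h1 : \sum_i um l r i x0 * um l' r i x0 @[r --> U] --> \sum_i f l x0 i * f l' x0 i.
    by apply: cvg_sumr => i; apply: cvg_mulr; exact: fE.
  have h2 : (fun r => \sum_i um l r i x0 * um l' r i x0) = fun=> (l == l')%:R.
    apply/funext => r; have [_ _ _ <-] := hq r; apply: eq_bigr => i _.
    by rewrite /um /extm !ext_in.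
  rewrite h2 in h1; exact: (cvg_unique _ h1 (cvg_cst _)).
exists f; split=> [l|c hc l'].
  apply: (@weak_sol_inN R d n O oO B (f l) S); first by rewrite f0.
  by move=> i x; rewrite f0.
have h i : \sum_l c l * f l x0 i = 0.
  have mf : measurable_fun setT (ext O (fun x => \sum_l c l * f l x i)).
    have -> : ext O (fun x => \sum_l c l * f l x i) = fun x => \sum_l c l * f l x i.
      apply/funext => x; have [Ox|nOx] := pselect (O x); first by rewrite ext_in.
      rewrite ext_out// big1// => l _; have [_ z _ _] := gf l; by rewrite z// mulr0.
    by apply: measurable_sum => l; apply: measurable_funM => //; have [g1 _ _ _] := gf l; exact: L1_meas (g1 i).
  apply: (@ae_zero_continuous R d O (fun x => \sum_l c l * f l x i) x0 oO Ox0 _ ((ae_zero_onP mf).1 (hc i))).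
  apply: (@cvg_sumr R V 'I_k (nbhs x0) (nbhs_filter x0)) => l.
  by apply: (@cvg_mulr R V (nbhs x0) (nbhs_filter x0) (fun=> c l) (fun x => f l x i)); [exact: cvg_cst|exact: cf].
(* The scalar product at [x0] with the member l' isolates its coefficient. *)
have e : \sum_i (\sum_l c l * f l x0 i) * f l' x0 i = c l'.
  transitivity (\sum_l c l * \sum_i f l x0 i * f l' x0 i).
    under eq_bigr do rewrite mulr_suml; rewrite exchange_big/=; apply: eq_bigr => l _.
    by rewrite mulr_sumr; apply: eq_bigr => i _; rewrite mulrA.
  rewrite (bigD1 l')//= ort eqxx mulr1 big1 ?addr0// => l ll'.
  by rewrite ort (negbTE ll') mulr0.
by rewrite -e big1// => i _; rewrite h mul0r.
Qed.

End at_least.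

(** * From the kernel to conservative fields *)

Section charts.
Variables (R : realType) (d : nat).
Local Notation V := 'rV[R]_d.
Local Notation mu := (leb R d).
Local Notation e_ := (@evec R d).
Variables (O : set V) (al : R).
Hypothesis oO : open O.
Hypothesis al0 : 0 < al.
Variables (A : nat) (z : 'I_A -> V) (r : 'I_A -> R) (v : 'I_A -> V) (de t0 : R).
Hypothesis de01 : 0 < de <= 1.
Hypothesis t01 : 0 < t0 <= 1.
Hypothesis r0 : forall a, 0 < r a.
Hypothesis v1 : forall a, `|v a| <= 1.
Hypothesis hc : forall a, cone O (z a) (r a) (v a) de t0.
Hypothesis cover : forall x, closure O x -> exists a, `|x - z a| < r a / 2.
Implicit Types (x y : V) (a : 'I_A) (j : 'I_d) (w g : V -> R) (t : R).

(** The radius 3/4 r lies between r / 2, within which the cover requires a positive bump, and r,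
    beyond which the cone of the chart cannot be used. *)
Let b a x : R := Bump (z a) (3 / 4 * r a) x.
Let beta x : R := \sum_a b a x.
Let db a j x : R := 'D_(e_ j) (Bump (z a) (3 / 4 * r a)) x.
Let h0 a : 0 < 3 / 4 * r a. Proof. by rewrite mulr_gt0// divr_gt0. Qed.

Definition part_unity a x : R := b a x * (beta x)^-1.
Definition dpart_unity a j x : R := db a j x * (beta x)^-1 + b a x * (- (beta x) ^- 2 * \sum_a' db a' j x).

Let beta_gt0 x : closure O x -> 0 < beta x.
Proof.
move=> /cover [a xa]; rewrite /beta (bigD1 a)//=; apply: ltr_pwDl.
  by apply: Bump_gt0 => //; apply: lt_trans xa _; have := r0 a; lra.
by apply: sumr_ge0 => a' _; exact: Bump_ge0.
Qed.

Let b_continuous a : continuous (b a). Proof. exact: smooth_continuous (smooth_Bump _ _). Qed.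
Let db_continuous a j : continuous (db a j). Proof. exact: smooth_derive_continuous (smooth_Bump _ _). Qed.

Let beta_continuous x : beta y @[y --> nbhs x] --> beta x.
Proof. by apply: (@cvg_sumr R V 'I_A (nbhs x) (nbhs_filter x)) => a; exact: b_continuous. Qed.

Let betaV x : closure O x -> (beta y)^-1 @[y --> nbhs x] --> (beta x)^-1.
Proof.
move=> /beta_gt0 b0; apply: (@cvgV R V (nbhs x) (nbhs_filter x)); first by rewrite gt_eqF.
exact: beta_continuous.
Qed.

Lemma part_unity_continuous a x : closure O x -> part_unity a y @[y --> nbhs x] --> part_unity a x.
Proof. by move=> cx; apply: (cvg_mulr (nbhs_filter x)); [exact: b_continuous|exact: betaV]. Qed.

Lemma dpart_unity_continuous a j x : closure O x -> dpart_unity a j y @[y --> nbhs x] --> dpart_unity a j x.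
Proof.
move=> cx; apply: (@cvgD _ _ _ (nbhs x) (nbhs_filter x)).
  by apply: (cvg_mulr (nbhs_filter x)); [exact: db_continuous|exact: betaV].
apply: (cvg_mulr (nbhs_filter x)); first exact: b_continuous.
apply: (cvg_mulr (nbhs_filter x)).
  apply: (@cvgN _ _ _ (nbhs x) (nbhs_filter x)).
  rewrite (_ : (fun y => (beta y) ^- 2) = fun y => (beta y)^-1 * (beta y)^-1).
    by rewrite -exprVn expr2; apply: (cvg_mulr (nbhs_filter x)); exact: betaV.
  by apply/funext => y; rewrite -exprVn expr2.
by apply: (@cvg_sumr R V 'I_A (nbhs x) (nbhs_filter x)) => a'; exact: db_continuous.
Qed.

Lemma dpart_unityP a j x : O x -> is_derive x (e_ j) (part_unity a) (dpart_unity a j x).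
Proof.
move=> Ox; have D a' : is_derive x (e_ j) (b a') (db a' j x) by exact: smooth_is_derive (smooth_Bump _ _).
have Db := df_sum (index_enum 'I_A) D.
have n0 : beta x != 0 by rewrite gt_eqF// beta_gt0//; exact: subset_closure.
exact: (dfM (D a) (dfV (f := beta) n0 Db)).
Qed.

Lemma part_unity_sum x : closure O x -> \sum_a part_unity a x = 1.
Proof. by move=> cx; rewrite -mulr_suml divff// gt_eqF// beta_gt0. Qed.

Lemma part_unity_ge0 a x : closure O x -> 0 <= part_unity a x.
Proof. by move=> cx; rewrite divr_ge0// ?Bump_ge0// ltW// beta_gt0. Qed.

Lemma part_unity_le1 a x : closure O x -> part_unity a x <= 1.
Proof.
move=> cx; rewrite -(part_unity_sum cx) (bigD1 a)//= lerDl; apply: sumr_ge0 => a' _; exact: part_unity_ge0.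
Qed.

Lemma dpart_unity_sum j x : closure O x -> \sum_a dpart_unity a j x = 0.
Proof.
move=> cx; have := beta_gt0 cx => b0; rewrite big_split/= -!mulr_suml -/(beta x).
by field; rewrite gt_eqF.
Qed.

Let far a x : r a <= `|x - z a| -> b a x = 0 /\ forall j, db a j x = 0.
Proof.
move=> h; have h1 : 3 / 4 * r a < `|x - z a| by apply: lt_le_trans h; have := r0 a; lra.
split; first by apply: Bump_eq0 => //; exact: ltW.
move=> j; apply: (@derive_eq0_out R d [set y | `|y - z a| <= 3 / 4 * r a]).
- exact: ball_closure_compact.
- by move=> y /= /negP; rewrite -ltNge => /ltW; exact: Bump_eq0.
- by rewrite /= => h2; move: h1; rewrite ltNge h2.
Qed.

Lemma part_unity_far a x : r a <= `|x - z a| -> part_unity a x = 0 /\ forall j, dpart_unity a j x = 0.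
Proof.
move=> /far [e1 e2]; rewrite /part_unity e1 mul0r; split => // j.
by rewrite /dpart_unity e1 e2 !mul0r addr0.
Qed.

(* The shift along the axis of the cone keeps the averaging ball inside [O]. *)
Definition shift_avg a t w x : R := wavg w (kern (de * t / 8)) (x + t *: v a).
Definition mollify t w x : R := \sum_a part_unity a x * shift_avg a t w x.
Definition mollify_grad t w g j x : R := \sum_a (dpart_unity a j x * shift_avg a t w x + part_unity a x * shift_avg a t g x).

Let de0 : 0 < de. Proof. by case/andP: de01. Qed.
Let eta0 t : 0 < t -> 0 < de * t / 8. Proof. by move=> tp; rewrite divr_gt0// mulr_gt0. Qed.

Lemma shift_avg_continuous a t w : L1 mu w -> 0 < t -> continuous (shift_avg a t w).
Proof.
move=> Lw tp x; apply/continuous_rVP => e e0.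
have cw := wavg_continuous Lw (kern_kernel d (eta0 tp)).
have [q q0 hq] := (continuous_rVP _ (x + t *: v a)).1 (cw (x + t *: v a)) e e0.
by exists q => // y yx; apply: hq; rewrite opprD addrACA subrr addr0.
Qed.

Lemma mollify_continuous t w x : L1 mu w -> 0 < t -> closure O x -> {for x, continuous (mollify t w)}.
Proof.
move=> Lw tp cx; apply: (@cvg_sumr R V 'I_A (nbhs x) (nbhs_filter x)) => a.
by apply: (cvg_mulr (nbhs_filter x)); [exact: part_unity_continuous|exact: shift_avg_continuous].
Qed.

Lemma mollify_grad_continuous t w g j x : L1 mu w -> L1 mu g -> 0 < t -> closure O x -> {for x, continuous (mollify_grad t w g j)}.
Proof.
move=> Lw Lg tp cx; apply: (@cvg_sumr R V 'I_A (nbhs x) (nbhs_filter x)) => a.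
apply: (@cvgD _ _ _ (nbhs x) (nbhs_filter x)); apply: (cvg_mulr (nbhs_filter x)).
- exact: dpart_unity_continuous.
- exact: shift_avg_continuous.
- exact: part_unity_continuous.
- exact: shift_avg_continuous.
Qed.

Let in_cone a t x y : O x -> `|x - z a| < r a -> 0 < t <= t0 -> `|y - (x + t *: v a)| <= de * t -> O y.
Proof.
move=> Ox xa t1 h; have := hc Ox xa t1 h.
by rewrite addrC subrK.
Qed.

Lemma mollify_gradP t w g j x : L1 mu w -> L1 mu g -> weak_grad O j w g -> 0 < t <= t0 -> O x ->
  is_derive x (e_ j) (mollify t w) (mollify_grad t w g j x).
Proof.
move=> Lw Lg wg t1 Ox; have /andP[tp tt] := t1; apply: df_sum => a.
have [xa|xa] := ltP `|x - z a| (r a).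
  have D : is_derive x (e_ j) (shift_avg a t w) (shift_avg a t g x).
    have D1 := weak_grad_wavg (x := x + t *: v a) Lw Lg wg (eta0 tp).
    have {}D1 : is_derive (x + t *: v a) (e_ j) (wavg w (kern (de * t / 8))) (shift_avg a t g x).
      apply: D1 => y yx; apply: (in_cone Ox xa t1); apply: le_trans yx _.
      by rewrite ler_pdivrMr// ler_peMr ?ler1n// mulr_ge0// ltW.
    apply/is_derive_line; have := (is_derive_line _ _ _ _).1 D1.
    by under eq_fun do rewrite addrAC.
  exact: (dfM (dpart_unityP a j Ox) D).
have [e1 e2] := part_unity_far xa; rewrite e1 e2 !mul0r addr0.
(* Here x is at distance at least r from the centre and the bump has radius 3/4 r, so the term
   vanishes for |s| < r / 4. *)
apply/is_derive_line; apply: (@is_derive_near_eq R (fun=> 0) _ 0 0 (r a / 4)); first by rewrite divr_gt0.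
  move=> s sr; rewrite add0r.
  have -> : part_unity a (x + s *: e_ j) = 0; last by rewrite mul0r.
  rewrite /part_unity /b Bump_eq0 ?mul0r//.
  have : `|x - z a| <= `|x + s *: e_ j - z a| + `|s|.
    have -> : x - z a = (x + s *: e_ j - z a) - s *: e_ j by rewrite addrAC addrK.
    by apply: le_trans (ler_normB _ _) _; rewrite lerD2l normrZ ler_piMr// norm_evec.
  by move: xa sr; move: (r a) `|x - z a| `|_ - z a| `|s| => p1 p2 p3 p4; lra.
Qed.

(** The value at x is compared with that at x + t v along the cone, and then with the average there.
    The averaging radius de t / 8 leaves room in the cone for the factor 7 of [int_holder]. *)
Lemma charts_holder : exists2 K : R, 0 <= K & forall C w, 0 <= C -> int_holder O al C w -> L1 mu w ->
  forall a t x, O x -> `|x - z a| < r a -> 0 < t <= t0 -> `|shift_avg a t w x - w x| <= K * C * t `^ al.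
Proof.
have /andP[t00 t0le] := t01.
have /choice [Kf hKf] : forall a, exists K : R, 0 <= K /\ forall C u, 0 <= C -> int_holder O al C u ->
  forall y t, O y -> `|y - z a| < r a -> 0 < t <= t0 -> `|u (y + t *: v a) - u y| <= K * C * t `^ al.
  by move=> a; have [K K0 hK] := cone_holder al0 oO (hc (a := a)) de01 t0le (v1 a); exists K.
have K0 : 0 <= \sum_a Kf a by apply: sumr_ge0 => a _; have [] := hKf a.
exists (1 + \sum_a Kf a); first by rewrite addr_ge0.
move=> C w C0 hw Lw a t x Ox xa t1; have /andP[tp tt] := t1.
apply: le_trans (ler_distD (w (x + t *: v a)) _ _) _; rewrite !mulrDl mul1r; apply: lerD.
  apply: (wavg_near Lw (kern_kernel d (eta0 tp))) => y yh.
  have dt : de * t <= 1.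
    have /andP[_ de1] := de01; have tl : t <= 1 := le_trans tt t0le.
    by rewrite -(mulr1 1); apply: ler_pM => //; exact: ltW.
  have y8 : 8 * `|y| < de * t by rewrite mulrC -ltr_pdivlMr.
  have yb : `|y| <= t.
    have := normr_ge0 y; have : de * t <= t by rewrite ler_piMl ?(ltW tp)//; case/andP: de01.
    by move: y8; move: (de * t) `|y| => p q; lra.
  apply: le_trans (hw (x + t *: v a) (x + t *: v a + y) _ _) _; rewrite [x + t *: v a + y]addrC addrK.
  - by move: y8 dt (normr_ge0 y); move: (de * t) `|y| => p q; lra.
  - move=> y' hy'; apply: (in_cone Ox xa t1); apply: le_trans hy' _.
    by move: y8 (normr_ge0 y); move: (de * t) `|y| => p q; lra.
  - by apply: ler_wpM2l => //; apply: ge0_ler_powR; rewrite ?nnegrE// ltW.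
apply: le_trans ((hKf a).2 C w C0 hw x t Ox xa t1) _.
rewrite -!mulrA; apply: ler_wpM2r; first by rewrite mulr_ge0 ?powR_ge0.
by rewrite (bigD1 a)//= lerDl; apply: sumr_ge0 => a' _; have [] := hKf a'.
Qed.

Lemma shift_avg_bounded a t w x S : L1 mu w -> 0 < t -> (forall y, `|w y| <= S) -> `|shift_avg a t w x| <= S.
Proof.
move=> Lw tp wS; have := @wavg_near R d w _ _ _ (x + t *: v a) 0 S Lw (kern_kernel d (eta0 tp)).
by rewrite subr0; apply => y _; rewrite subr0.
Qed.

Lemma mollify_bounded t w x S : closure O x -> L1 mu w -> 0 < t -> (forall y, `|w y| <= S) -> `|mollify t w x| <= S.
Proof.
move=> cx Lw tp wS; apply: le_trans (ler_norm_sum _ _ _) _.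
rewrite -[leRHS]mul1r -(part_unity_sum cx) mulr_suml; apply: ler_sum => a _.
by rewrite normrM (ger0_norm (part_unity_ge0 a cx)); apply: ler_wpM2l; [exact: part_unity_ge0|exact: shift_avg_bounded].
Qed.

Lemma mollify_dist t w x c : O x -> 0 <= c -> (forall a, `|x - z a| < r a -> `|shift_avg a t w x - w x| <= c) ->
  `|mollify t w x - w x| <= c.
Proof.
move=> Ox c0 h; have cx := subset_closure Ox.
rewrite -[w x in X in X <= _]mul1r -(part_unity_sum cx) mulr_suml -sumrB.
apply: le_trans (ler_norm_sum _ _ _) _.
rewrite -[leRHS]mul1r -(part_unity_sum cx) mulr_suml; apply: ler_sum => a _.
rewrite -mulrBr normrM (ger0_norm (part_unity_ge0 a cx)).
have [xa|xa] := ltP `|x - z a| (r a); first by apply: ler_wpM2l; [exact: part_unity_ge0|exact: h].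
by rewrite (part_unity_far xa).1 !mul0r.
Qed.

(** The derivatives of the partition of unity sum to zero, so w x may be subtracted in their sum.
    The terms in which the partition is differentiated thus become small with [c]. *)
Lemma mollify_grad_dist t w g j x c : O x -> 0 <= c -> (forall a, `|x - z a| < r a -> `|shift_avg a t w x - w x| <= c) ->
  `|mollify_grad t w g j x - g x| <= c * \sum_a `|dpart_unity a j x| + \sum_a `|shift_avg a t g x - g x|.
Proof.
move=> Ox c0 h; have cx := subset_closure Ox.
have -> : mollify_grad t w g j x - g x = \sum_a (dpart_unity a j x * (shift_avg a t w x - w x)) + \sum_a (part_unity a x * (shift_avg a t g x - g x)).
  have -> : \sum_a (dpart_unity a j x * (shift_avg a t w x - w x)) = \sum_a dpart_unity a j x * shift_avg a t w x.
    under eq_bigr do rewrite mulrBr; by rewrite sumrB -mulr_suml dpart_unity_sum// mul0r subr0.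
  have -> : \sum_a (part_unity a x * (shift_avg a t g x - g x)) = \sum_a part_unity a x * shift_avg a t g x - g x.
    by under eq_bigr do rewrite mulrBr; rewrite sumrB -mulr_suml part_unity_sum// mul1r.
  by rewrite /mollify_grad big_split/= addrA.
apply: le_trans (ler_normD _ _) _; apply: lerD; apply: le_trans (ler_norm_sum _ _ _) _.
  rewrite mulr_sumr; apply: ler_sum => a _; rewrite normrM mulrC.
  have [xa|xa] := ltP `|x - z a| (r a); first by apply: ler_wpM2r => //; exact: h.
  by rewrite (part_unity_far xa).2 !normr0 !mulr0.
apply: ler_sum => a _; rewrite normrM (ger0_norm (part_unity_ge0 a cx)) ler_piMl//; exact: part_unity_le1.
Qed.

Hypothesis bO : bounded_set_V O.

Lemma dpart_unity_bounded : exists2 D : R, 0 <= D & forall j x, O x -> \sum_a `|dpart_unity a j x| <= D.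
Proof.
have [D hD] : exists D, forall x, closure O x -> \sum_(q : 'I_d * 'I_A) `|dpart_unity q.2 q.1 x| <= D.
  apply: (@compact_local_bound R d (closure O) (fun x D => \sum_(q : 'I_d * 'I_A) `|dpart_unity q.2 q.1 x| <= D)).
  - exact: compact_closure.
  - by move=> y D1 D2 D12 h; exact: le_trans h D12.
  move=> x cx.
  have cs : {for x, continuous (fun x => \sum_(q : 'I_d * 'I_A) `|dpart_unity q.2 q.1 x|)}.
    apply: (@cvg_sumr R V _ (nbhs x) (nbhs_filter x)) => q.
    by apply: (@cvg_norm _ _ _ (nbhs x) (nbhs_filter x)); exact: dpart_unity_continuous.
  have [q q0 hq] := (continuous_rVP _ x).1 cs 1 ltr01.
  exists q, (\sum_(q : 'I_d * 'I_A) `|dpart_unity q.2 q.1 x| + 1); split => // y /hq h.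
  by rewrite -lerBlDl; apply: le_trans (ltW h); exact: ler_norm.
exists `|D| => // j x Ox; apply: le_trans (ler_norm D); apply: le_trans (hD x (subset_closure Ox)).
rewrite -(pair_big xpredT xpredT (fun j a => `|dpart_unity a j x|))/= [leRHS](bigD1 j)//= lerDl.
by do 2 (apply: sumr_ge0 => ? _).
Qed.

End charts.

Lemma powR_sum_le (R : realType) (I : finType) (f : I -> R) (p : R) : 0 < p -> (forall i, 0 <= f i) ->
  (\sum_i f i) `^ p <= #|I|%:R `^ p * \sum_i f i `^ p.
Proof.
move=> p0 f0; pose M := (\sum_i f i `^ p) `^ p^-1.
have s0 : 0 <= \sum_i f i `^ p by apply: sumr_ge0 => i _; exact: powR_ge0.
have Mp : M `^ p = \sum_i f i `^ p by rewrite -powRrM mulVf ?gt_eqF// powRr1.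
have fM i : f i <= M.
  rewrite -[f i](powRr1 (f0 i)) -(divff (lt0r_neq0 p0)) powRrM.
  apply: ge0_ler_powR; [by rewrite invr_ge0 ltW|by rewrite nnegrE powR_ge0|by rewrite nnegrE|].
  by rewrite [leRHS](bigD1 i)//= lerDl; apply: sumr_ge0 => k _; exact: powR_ge0.
rewrite -Mp -powRM ?powR_ge0//; apply: ge0_ler_powR; rewrite ?nnegrE ?mulr_ge0 ?powR_ge0 ?(ltW p0)//.
  exact: sumr_ge0.
by rewrite mulr_natl -sumr_const; apply: ler_sum => i _.
Qed.

Section det_continuity.
Variables (R : realType) (T : Type) (F : set_system T).
Hypothesis FF : Filter F.

Lemma cvg_prodr (I : Type) (s : seq I) (f : I -> T -> R) (l : I -> R) :
  (forall i, f i x @[x --> F] --> l i) -> \prod_(i <- s) f i x @[x --> F] --> \prod_(i <- s) l i.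
Proof.
move=> h; elim: s => [|i s IH].
  rewrite big_nil; under eq_fun do rewrite big_nil; exact: cvg_cst.
rewrite big_cons; under eq_fun do rewrite big_cons; exact: cvg_mulr.
Qed.

Lemma det_cvg q (f : T -> 'M[R]_q) (l : 'M[R]_q) : (forall i j, f x i j @[x --> F] --> l i j) ->
  \det (f x) @[x --> F] --> \det l.
Proof.
move=> h; apply: cvg_sumr => s; apply: cvg_mulr; first exact: cvg_cst.
by apply: cvg_prodr => i; exact: h.
Qed.

Lemma adj_cvg q (f : T -> 'M[R]_q) (l : 'M[R]_q) i j : (forall i j, f x i j @[x --> F] --> l i j) ->
  (\adj (f x)) i j @[x --> F] --> (\adj l) i j.
Proof.
move=> h; rewrite mxE; under eq_fun do rewrite mxE; apply: cvg_mulr; first exact: cvg_cst.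
apply: (det_cvg (f := fun x => row' j (col' i (f x)))) => a b.
by rewrite !mxE; under eq_fun do rewrite !mxE; exact: h.
Qed.

End det_continuity.

(** * Gram matrices, pseudo-inverses and frames of solutions *)

Section left_inverse.
Variables (R : realType) (k n : nat) (M : 'M[R]_(k, n)) (kap : R).
Hypothesis kap0 : 0 < kap.
Hypothesis hM : forall c : 'I_k -> R, kap * sqnorm c <= sqnorm (fun i => \sum_l c l * M l i).

(** The transpose of the Moore-Penrose inverse of [M]. With determinant and adjugate, its continuity
    in the entries of [M] can be read off. *)
Definition left_inv : 'M[R]_(k, n) := (\det (M *m M^T))^-1 *: (\adj (M *m M^T) *m M).

Let quad (c : 'rV[R]_k) : kap * sqnorm (fun l => c 0 l) <= (c *m (M *m M^T) *m c^T) 0 0.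
Proof.
apply: le_trans (hM _) _; rewrite mulmxA -mulmxA -trmx_mul mxE le_eqVlt; apply/orP; left; apply/eqP.
by apply: eq_bigr => i _; rewrite !mxE expr2.
Qed.

Lemma gram_det_neq0 : \det (M *m M^T) != 0.
Proof.
apply/det0P => -[c c0 cG]; have := quad c; rewrite cG mul0mx mxE pmulr_rle0// => h.
by move: c0; apply/negP; rewrite negbK; apply/eqP/rowP => l; rewrite mxE; exact: (sqnorm_eq0 h l).
Qed.

Let Ginv : 'M[R]_k := (\det (M *m M^T))^-1 *: \adj (M *m M^T).
Let GinvG : Ginv *m (M *m M^T) = 1%:M.
Proof. by rewrite -scalemxAl mul_adj_mx scale_scalar_mx mulVf// gram_det_neq0. Qed.

Lemma left_invE : left_inv *m M^T = 1%:M.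
Proof. by rewrite -GinvG /left_inv /Ginv -!scalemxAl mulmxA. Qed.

(** With G = M M^T, the row l of G^-1 M has squared norm ga = (G^-1)_ll, and the lower bound applied
    to row l of G^-1 gives kap ga^2 <= ga. Hence ga <= 1 / kap. *)
Lemma left_inv_bound l i : `|left_inv l i| <= 1 + kap^-1.
Proof.
pose c := row l Ginv; pose ga := Ginv l l.
have cG : c *m (M *m M^T) = row l 1%:M by rewrite -row_mul GinvG.
have q : (c *m (M *m M^T) *m c^T) 0 0 = ga.
  rewrite cG mxE (bigD1 l)//= big1 ?addr0; first by rewrite [row l 1%:M 0 l]mxE [1%:M l l]mxE eqxx mul1r [c^T l 0]mxE [c 0 l]mxE.
  by move=> l' ll'; rewrite !mxE eq_sym (negbTE ll') mul0r.
have h1 := quad c; rewrite q in h1.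
have h2 : ga ^+ 2 <= sqnorm (fun l => c 0 l) by have := sqnorm_ge l (fun l => c 0 l); rewrite mxE.
have ga0 : 0 <= ga by apply: le_trans h1; rewrite mulr_ge0 ?sqnorm_ge0// ltW.
have h3 : ga <= kap^-1.
  rewrite -[kap^-1]mul1r ler_pdivlMr//; have [->|gn] := eqVneq ga 0; first by rewrite mul0r.
  have gp : 0 < ga by rewrite lt_def gn.
  rewrite -(ler_pM2l gp) mulr1 mulrA -expr2 mulrC; apply: le_trans h1.
  by rewrite ler_wpM2l// ltW.
have e : left_inv l = (c *m M) 0.
  have eL : left_inv = Ginv *m M by rewrite /left_inv /Ginv -scalemxAl.
  by apply/funext => i'; rewrite eL /c -row_mul [RHS]mxE.
have h4 : sqnorm (fun i => (c *m M) 0 i) = ga.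
  rewrite -q mulmxA -mulmxA -trmx_mul [RHS]mxE; apply: eq_bigr => i' _.
  by rewrite [(c *m M)^T i' 0]mxE expr2.
rewrite e; apply: le_trans (norm_le_sqnorm i (fun i => (c *m M) 0 i)) _.
by rewrite lerD2l h4.
Qed.

End left_inverse.

Section frame_lower.
Variables (R : realType) (k n : nat).

Lemma sqnorm_orthonormal (w : 'I_k -> 'I_n -> R) (c : 'I_k -> R) :
  (forall l l', \sum_i w l i * w l' i = (l == l')%:R) -> sqnorm (fun i => \sum_l c l * w l i) = sqnorm c.
Proof.
move=> h; rewrite /sqnorm.
transitivity (\sum_l \sum_l' c l * c l' * \sum_i w l i * w l' i).
  under eq_bigr do rewrite expr2 mulr_suml; rewrite exchange_big/=; apply: eq_bigr => l _.
  under eq_bigr do rewrite mulr_sumr; rewrite exchange_big/=; apply: eq_bigr => l' _.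
  by rewrite mulr_sumr; apply: eq_bigr => i _; ring.
apply: eq_bigr => l _; rewrite (bigD1 l)//= h eqxx mulr1 big1 ?addr0 ?expr2// => l' ll'.
by rewrite h eq_sym (negbTE ll') mulr0.
Qed.

(** In |b|^2 <= 2 |a|^2 + 2 |a - b|^2 the left side is at least |c|^2 / E and the last term at most
    half of this, which leaves |c|^2 / (4 E) for |a|^2. *)
Lemma sqnorm_perturb (w m : 'I_k -> 'I_n -> R) (E tau : R) (c : 'I_k -> R) : 0 < E -> 0 <= tau <= 1 ->
  n%:R * k%:R ^+ 2 * tau <= (4 * E)^-1 -> (forall l i, `|m l i - w l i| <= tau) ->
  sqnorm c <= E * sqnorm (fun i => \sum_l c l * w l i) ->
  (4 * E)^-1 * sqnorm c <= sqnorm (fun i => \sum_l c l * m l i).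
Proof.
move=> E0 /andP[tau0 tau1] nk hm hw.
pose a i := \sum_l c l * m l i; pose b i := \sum_l c l * w l i.
have c0 := sqnorm_ge0 c.
have d2 i : (a i - b i) ^+ 2 <= k%:R ^+ 2 * tau * sqnorm c.
  have h : `|a i - b i| <= tau * \sum_l `|c l|.
    rewrite /a /b -sumrB mulr_sumr; apply: le_trans (ler_norm_sum _ _ _) _; apply: ler_sum => l _.
    by rewrite -mulrBr normrM mulrC ler_wpM2r.
  have s2 : (\sum_l `|c l|) ^+ 2 <= k%:R ^+ 2 * sqnorm c.
    rewrite expr2 mulr_suml; apply: (@le_trans _ _ (\sum_(l < k) \sum_(l' < k) sqnorm c)).
      by apply: ler_sum => l _; rewrite mulr_sumr; apply: ler_sum => l' _; exact: sqnorm_ge_prod.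
    by rewrite !sumr_const !card_ord -[_ *+ k *+ k]mulr_natr -[sqnorm c *+ k]mulr_natr le_eqVlt; apply/orP; left; apply/eqP; ring.
  rewrite -real_normK ?num_real//; apply: (@le_trans _ _ ((tau * \sum_l `|c l|) ^+ 2)).
    by rewrite ler_sqr ?nnegrE// mulr_ge0// sumr_ge0.
  rewrite exprMn; apply: (@le_trans _ _ (tau ^+ 2 * (k%:R ^+ 2 * sqnorm c))).
    by rewrite ler_wpM2l// sqr_ge0.
  have k0 : 0 <= k%:R ^+ 2 * sqnorm c by rewrite mulr_ge0 ?sqr_ge0.
  apply: (@le_trans _ _ (tau * (k%:R ^+ 2 * sqnorm c))).
    by rewrite ler_wpM2r// expr2 ler_piMl.
  by rewrite le_eqVlt; apply/orP; left; apply/eqP; ring.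
have hb : sqnorm b <= 2 * sqnorm a + 2 * (n%:R * (k%:R ^+ 2 * tau * sqnorm c)).
  move: d2; set X := _ * sqnorm c => d2.
  have -> : n%:R * X = \sum_(i < n) X by rewrite sumr_const card_ord mulr_natl.
  rewrite /(sqnorm b) /(sqnorm a) !mulr_sumr -big_split/=.
  (* The square of 2 a - b is 2 a^2 + 2 (a - b)^2 - b^2, so its sign is the inequality wanted. *)
  apply: ler_sum => i _; have := d2 i; have := sqr_ge0 (2 * a i - b i).
  have -> : (2 * a i - b i) ^+ 2 = 2 * a i ^+ 2 + 2 * (a i - b i) ^+ 2 - b i ^+ 2 by ring.
  by move: (a i ^+ 2) ((a i - b i) ^+ 2) (b i ^+ 2) => x y z' q1 q2; lra.
have h1 : E^-1 * sqnorm c <= sqnorm b by rewrite ler_pdivrMl.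
have h2 : n%:R * (k%:R ^+ 2 * tau * sqnorm c) <= (4 * E)^-1 * sqnorm c.
  by rewrite [n%:R * _]mulrA [n%:R * (_ * _)]mulrA; exact: (ler_wpM2r c0 nk).
have h3 : E^-1 * sqnorm c = 4 * ((4 * E)^-1 * sqnorm c) by field; rewrite gt_eqF.
rewrite -/a; move: hb h1 h2; rewrite h3; move: ((4 * E)^-1 * sqnorm c) (n%:R * (k%:R ^+ 2 * tau * sqnorm c)) (sqnorm b) (sqnorm a) => x y z q; lra.
Qed.

End frame_lower.

Section weak_sol_sum.
Variables (R : realType) (d n : nat).
Local Notation V := 'rV[R]_d.
Local Notation mu := (leb R d).
Local Notation e_ := (@evec R d).
Variables (O : set V) (B : 'I_n -> 'I_d -> 'I_n -> V -> R).

Lemma weak_sol_sum m (c : 'I_m -> R) (u : 'I_m -> 'I_n -> V -> R) : (forall l, weak_sol O B (u l)) ->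
  weak_sol O B (fun i x => \sum_l c l * u l i x).
Proof.
move=> hu.
have h1 i : L1 mu (fun x => \sum_l c l * u l i x).
  by apply: L1_sum => l; apply: L1Z; have [h _ _ _] := hu l; exact: h.
have egr i j x : grad_rhs B (fun i x => \sum_l c l * u l i x) i j x = \sum_l c l * grad_rhs B (u l) i j x.
  rewrite /grad_rhs; under [RHS]eq_bigr do rewrite mulrN mulr_sumr; rewrite sumrN exchange_big/=; congr (- _).
  by apply: eq_bigr => k _; rewrite mulr_sumr; apply: eq_bigr => l _; rewrite mulrCA.
have Lg l i j : L1 mu (grad_rhs B (u l) i j) by have [_ _ h _] := hu l.
split => //.
- by move=> i x nOx; rewrite big1// => l _; have [_ h _ _] := hu l; rewrite h// mulr0.
- move=> i j; rewrite (_ : grad_rhs _ _ i j = fun x => \sum_l c l * grad_rhs B (u l) i j x); last exact/funext/egr.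
  by apply: L1_sum => l; exact: L1Z.
move=> i j phi tphi.
have [C1 _ hC1] := test_fun_bounded tphi; have [C2 _ hC2] := test_fun_derive_bounded j tphi.
have mp : measurable_fun setT phi by apply: continuous_measurable_rV; exact: smooth_continuous tphi.1.
have mdp : measurable_fun setT ('D_(e_ j) phi).
  by apply: continuous_measurable_rV; exact: smooth_derive_continuous tphi.1.
have Lu l : L1 mu (fun x => u l i x * 'D_(e_ j) phi x) by have [h _ _ _] := hu l; exact: L1M (h i) mdp hC2.
have Lgp l : L1 mu (fun x => grad_rhs B (u l) i j x * phi x) by exact: L1M (Lg l i j) mp hC1.
have -> : (fun x => (\sum_l c l * u l i x) * 'D_(e_ j) phi x) = fun x => \sum_l c l * (u l i x * 'D_(e_ j) phi x).
  by apply/funext => x; rewrite mulr_suml; apply: eq_bigr => l _; rewrite mulrA.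
have -> : (fun x => grad_rhs B (fun i x => \sum_l c l * u l i x) i j x * phi x) = fun x => \sum_l c l * (grad_rhs B (u l) i j x * phi x).
  by apply/funext => x; rewrite egr mulr_suml; apply: eq_bigr => l _; rewrite mulrA.
rewrite Int_sum => [|l]; last exact: L1Z.
rewrite Int_sum => [|l]; last exact: L1Z.
rewrite -sumrN; apply: eq_bigr => l _; rewrite !IntZ// -mulrN; congr (_ * _).
by have [_ _ _ h] := hu l; exact: h.
Qed.

End weak_sol_sum.

Section kernel_frame.
Variables (R : realType) (d n : nat).
Local Notation V := 'rV[R]_d.
Local Notation mu := (leb R d).
Variables (O : set V) (p : R) (B : tfield R d n).
Hypothesis d2 : (2 <= d)%N.
Hypothesis oO : open O.
Hypothesis cO : connected O.
Hypothesis nO : O !=set0.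
Hypothesis bO : bounded_set_V O.
Hypothesis sO : smooth_boundary O.
Hypothesis dp : d%:R < p.
Hypothesis hB : in_Lp O p B.
Local Notation al := (1 - d%:R / p).

(** Comparison between points makes evaluation at [x0] injective on the kernel, so the continuous
    representatives are independent there and can be orthonormalised. Comparing [x0] with x turns
    |c|^2 into a lower bound at every x with the same [E]. *)
Lemma kernel_frame k (f : 'I_k -> V -> 'I_n -> R) x0 : O x0 -> (forall l, inN O B (f l)) -> L2_indep O f ->
  exists (w : 'I_k -> 'I_n -> V -> R) (E S C : R), [/\ forall l, weak_sol O (extT O B) (w l),
   [/\ 0 < E, 0 <= S & 0 <= C], forall l i x, `|w l i x| <= S, forall l i, int_holder O al C (w l i) &
   forall x c, O x -> sqnorm c <= E * sqnorm (fun i => \sum_l c l * w l i x)].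
Proof.
move=> Ox0 hf indep.
have p2 := p_ge2 d2 dp; have p1 := p_ge1 d2 dp; have al01 := al_in01 d2 dp.
have [avg_field LB] := in_Lp_L1 oO p2 hB.
have [_ LBijk LbB _] := tnormE_Lp oO bO p2 avg_field LB.
have /andP[al0 al1] := al01.
have [K K0 hK] := @holder_global R d O al al0 oO cO nO sO bO.
have gf l := inN_weak_sol oO bO p2 avg_field LB (hf l).
have /choice [U hU] := fun l => regularity oO bO nO dp p1 al01 hK LBijk LbB (lexx _) (gf l).
pose G := [set v : 'rV[R]_n | exists u : 'I_n -> V -> R, [/\ weak_sol O (extT O B) u,
  forall i x, O x -> {for x, continuous (u i)}, exists2 S : R, 0 <= S & forall i x, `|u i x| <= S &
  forall i, u i x0 = v 0 i]].
have csum m (c : 'I_m -> R) (u : 'I_m -> 'I_n -> V -> R) : (forall l i x, O x -> {for x, continuous (u l i)}) ->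
    forall i x, O x -> {for x, continuous (fun x => \sum_l c l * u l i x)}.
  move=> cu i x Ox; apply: (@cvg_sumr R V 'I_m (nbhs x) (nbhs_filter x)) => l.
  by apply: (@cvg_mulr R V (nbhs x) (nbhs_filter x) (fun=> c l) (u l i)); [exact: cvg_cst|exact: cu].
have G_lin (a b : 'rV[R]_n) (c : R) : G a -> G b -> G (a + c *: b).
  move=> [ua [ga ca [Sa Sa0 ba] ea]] [ub [gb cb [Sb Sb0 bb] eb]].
  pose u (l : 'I_2) := if l == ord0 then ua else ub; pose cc (l : 'I_2) := if l == ord0 then 1 else c.
  exists (fun i x => \sum_(l < 2) cc l * u l i x); split.
  - by apply: weak_sol_sum => l; rewrite /u; case: ifP.
  - by apply: csum => l i x Ox; rewrite /u; case: ifP => _; [exact: ca|exact: cb].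
  - exists (Sa + `|c| * Sb); first by rewrite addr_ge0// mulr_ge0.
    move=> i x; rewrite big_ord_recl big_ord1 /cc /u/= mul1r; apply: le_trans (ler_normD _ _) _.
    by rewrite normrM; apply: lerD => //; apply: ler_wpM2l.
  by move=> i; rewrite big_ord_recl big_ord1 /cc /u/= mul1r ea eb !mxE.
have iG : vec_indep G (fun l => \row_i U l i x0).
  split=> [l|c hc].
    by have [h1 h2 _ h4] := hU l; exists (U l); split => // i; rewrite mxE.
  have gw : weak_sol O (extT O B) (fun i x => \sum_l c l * U l i x) by apply: weak_sol_sum => l; have [] := hU l.
  have cw := csum _ c U (fun l => let: And4 _ h _ _ := hU l in h).
  have w0 i : \sum_l c l * U l i x0 = 0.
    move/rowP: hc => /(_ i); rewrite summxE [RHS]mxE => h; rewrite -[RHS]h.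
    by apply: eq_bigr => l _; rewrite !mxE.
  have wz x i : O x -> \sum_l c l * U l i x = 0.
    move=> Ox; have := weak_sol_compare oO dp p1 al01 hK LBijk LbB (lexx _) gw cw Ox Ox0.
    have -> : sqnorm (fun i => \sum_l c l * U l i x0) = 0.
      by rewrite /sqnorm big1// => i' _; rewrite w0 expr0n.
    by rewrite mulr0 => h; exact: (sqnorm_eq0 h i).
  apply: indep => i.
  have mf : measurable_fun setT (ext O (fun x => \sum_l c l * f l x i)).
    rewrite (_ : ext O _ = fun x => \sum_l c l * extm O (f l) i x); last first.
      apply/funext => x; rewrite ext_sum; apply: eq_bigr => l _.
      have [Ox|nOx] := pselect (O x); first by rewrite /extm !ext_in.
      by rewrite /extm !ext_out// mulr0.
    by apply: measurable_sum => l; apply: measurable_funM => //; have [g1 _ _ _] := gf l; exact: L1_meas (g1 i).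
  apply/(ae_zero_onP mf).
  have : {ae mu, forall x, forall l, extm O (f l) i x = U l i x}.
    by apply: filter_forall => l; have [_ _ h _] := hU l; exact: h.
  apply: filterS => x h Ox; rewrite -[RHS](wz x i Ox); apply: eq_bigr => l _.
  by rewrite -h /extm ext_in.
have [W [WW EW]] := orthonormal_frame G_lin iG.
have /choice [w hw] := EW.
have /choice [Sf hSf] : forall l, exists S : R, 0 <= S /\ forall i x, `|w l i x| <= S.
  by move=> l; have [_ _ [S S0 h] _] := hw l; exists S.
pose S := \sum_l Sf l; have S0 : 0 <= S by apply: sumr_ge0 => l _; have [] := hSf l.
have wS l i x : `|w l i x| <= S.
  apply: le_trans ((hSf l).2 i x) _; rewrite /S (bigD1 l)//= lerDl.
  by apply: sumr_ge0 => l' _; have [] := hSf l'.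
have gw l : weak_sol O (extT O B) (w l) by have [] := hw l.
have cw l i x : O x -> {for x, continuous (w l i)} by have [_ h _ _] := hw l; exact: h.
pose J := \int[mu]_x (tnorm1 (extT O B) x `^ p).
exists w, (regE d p K J), S, (regC d p J S); split => //.
- by split => //; [exact: expR_gt0|rewrite mulr_ge0 ?(regC0 (lexx _))// morreyC_ge0].
- by move=> l i; exact: (weak_sol_holder oO dp p1 al01 LBijk LbB (lexx _) i (gw l) (wS l) S0 (cw l)).
move=> x c Ox; have gc := weak_sol_sum c gw.
have := weak_sol_compare oO dp p1 al01 hK LBijk LbB (lexx _) gc (csum _ c w cw) Ox0 Ox.
rewrite (@sqnorm_orthonormal R k n (fun l i => w l i x0) c)// => l l'.
transitivity ((W *m W^T) l l'); last by rewrite WW mxE.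
rewrite mxE; apply: eq_bigr => i _.
by have [_ _ _ ->] := hw l; have [_ _ _ ->] := hw l'; rewrite !mxE.
Qed.

End kernel_frame.

(** * The corrected approximating field and its distance to [B] *)

Section approx.
Variables (R : realType) (d n k : nat).
Local Notation V := 'rV[R]_d.
Local Notation mu := (leb R d).
Local Notation e_ := (@evec R d).
Variables (O : set V) (B : tfield R d n).
Hypothesis oO : open O.
Hypothesis cO : connected O.
Hypothesis bO : bounded_set_V O.
Variables (A : nat) (z : 'I_A -> V) (r : 'I_A -> R) (v : 'I_A -> V) (de t0 : R).
Hypothesis de01 : 0 < de <= 1.
Hypothesis r0 : forall a, 0 < r a.
Hypothesis hc : forall a, cone O (z a) (r a) (v a) de t0.
Hypothesis cover : forall x, closure O x -> exists a, `|x - z a| < r a / 2.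
Variables (w : 'I_k -> 'I_n -> V -> R) (S kap tau D t h : R).
Hypothesis hB : forall i j k', L1 mu (extT O B i j k').
Hypothesis gw : forall l, weak_sol O (extT O B) (w l).
Hypothesis wS : forall l i x, `|w l i x| <= S.
Hypothesis S0 : 0 <= S.
Hypothesis t1 : 0 < t <= t0.
Hypothesis h0 : 0 < h.
Hypothesis kap0 : 0 < kap.
Hypothesis tau0 : 0 <= tau.
Local Notation shift_avg := (shift_avg v de).
Local Notation mollify := (mollify z r v de).
Local Notation mollify_grad := (mollify_grad z r v de).
Hypothesis shift_avg_dist : forall l i a x, O x -> `|x - z a| < r a -> `|shift_avg a t (w l i) x - w l i x| <= tau.
Hypothesis lower : forall x (c : 'I_k -> R), O x -> kap * sqnorm c <= sqnorm (fun i => \sum_l c l * mollify t (w l i) x).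
Hypothesis hD : forall j x, O x -> \sum_a `|dpart_unity z r a j x| <= D.
Implicit Types (x : V) (l : 'I_k) (i : 'I_n) (j : 'I_d).

Let g l i j := grad_rhs (extT O B) (w l) i j.
Let M x : 'M[R]_(k, n) := \matrix_(l, i) mollify t (w l i) x.
Definition avg_field i j k' x : R := wavg (extT O B i j k') (kern h) x.
Definition residual l i j x : R := mollify_grad t (w l i) (g l i j) j x + \sum_k' avg_field i j k' x * mollify t (w l k') x.
(* The correction turns each [mollify t (w l)] into an exact solution, as [left_inv] inverts [M]. *)
Definition approx_field : tfield R d n := fun x i j k' => avg_field i j k' x - \sum_l residual l i j x * left_inv (M x) l k'.

Let tp : 0 < t. Proof. by case/andP: t1. Qed.
Let Lw l i : L1 mu (w l i). Proof. by have [h1 _ _ _] := gw l. Qed.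
Let Lg l i j : L1 mu (g l i j). Proof. by have [_ _ h1 _] := gw l; exact: h1. Qed.

Let cmol l i x : closure O x -> {for x, continuous (mollify t (w l i))}.
Proof. by move=> cx; exact: (mollify_continuous de01 r0 cover (Lw l i) tp cx). Qed.

Let cmB i j k' x : {for x, continuous (avg_field i j k')}.
Proof. exact: (wavg_continuous (hB i j k') (kern_kernel d h0)). Qed.

(** The mollified solutions are continuous up to the boundary, so the bound passes to the closure;
    there it keeps the Gram matrix invertible and the corrected field continuous. *)
Let lower_closure x (c : 'I_k -> R) : closure O x -> kap * sqnorm c <= sqnorm (fun i => \sum_l c l * M x l i).
Proof.
move=> cx; pose F y := sqnorm (fun i => \sum_l c l * mollify t (w l i) y).
have -> : sqnorm (fun i => \sum_l c l * M x l i) = F x.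
  by congr sqnorm; apply/funext => i; apply: eq_bigr => l _; rewrite mxE.
have cF : {for x, continuous F}.
  apply: (@cvg_sumr R V 'I_n (nbhs x) (nbhs_filter x)) => i.
  rewrite (_ : (fun y => _) = fun y => (\sum_l c l * mollify t (w l i) y) * (\sum_l c l * mollify t (w l i) y)); last first.
    by apply/funext => y; rewrite expr2.
  rewrite expr2.
  have cs : \sum_l c l * mollify t (w l i) y @[y --> nbhs x] --> \sum_l c l * mollify t (w l i) x.
    apply: (@cvg_sumr R V 'I_k (nbhs x) (nbhs_filter x)) => l.
    by apply: (cvg_mulr (nbhs_filter x)); [exact: cvg_cst|exact: cmol].
  exact: (cvg_mulr (nbhs_filter x) cs cs).
apply/ler_addgt0Pr => e e0; have [q q0 hq] := (continuous_rVP F x).1 cF e e0.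
have [y Oy yx] := closure_rVP cx q0; have := hq y yx; have := lower c Oy.
rewrite -/(F y); move: (kap * _) (F y) (F x) => a1 a2 a3 h1; rewrite ltr_norml => /andP[_ h2]; lra.
Qed.

Let cM x : closure O x -> forall l i, M y l i @[y --> nbhs x] --> M x l i.
Proof. by move=> cx l i; rewrite mxE; under eq_fun do rewrite mxE; exact: cmol. Qed.

Let cinv x l k' : closure O x -> left_inv (M y) l k' @[y --> nbhs x] --> left_inv (M x) l k'.
Proof.
move=> cx.
have cG a b : (M y *m (M y)^T) a b @[y --> nbhs x] --> (M x *m (M x)^T) a b.
  rewrite mxE; under eq_fun do rewrite mxE.
  apply: (@cvg_sumr R V 'I_n (nbhs x) (nbhs_filter x)) => i.
  have -> : (M x)^T i b = M x b i by rewrite mxE.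
  have -> : (fun y => M y a i * (M y)^T i b) = fun y => M y a i * M y b i.
    by apply/funext => y; rewrite [(M y)^T i b]mxE.
  by apply: (cvg_mulr (nbhs_filter x)); exact: cM.
rewrite /left_inv mxE; under eq_fun do rewrite mxE.
apply: (cvg_mulr (nbhs_filter x)).
  apply: (@cvgV R V (nbhs x) (nbhs_filter x)); last exact: (det_cvg (nbhs_filter x) cG).
  exact: (gram_det_neq0 kap0 (fun c => lower_closure c cx)).
rewrite mxE; under eq_fun do rewrite mxE.
apply: (@cvg_sumr R V 'I_k (nbhs x) (nbhs_filter x)) => b.
by apply: (cvg_mulr (nbhs_filter x)); [exact: (@adj_cvg R V (nbhs x) (nbhs_filter x) k (fun y => M y *m (M y)^T) _ l b cG)|exact: cM].
Qed.

Let cerr l i j x : closure O x -> residual l i j y @[y --> nbhs x] --> residual l i j x.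
Proof.
move=> cx; apply: (@cvgD _ _ _ (nbhs x) (nbhs_filter x)); first exact: (mollify_grad_continuous de01 r0 cover (Lw l i) (Lg l i j) tp cx).
apply: (@cvg_sumr R V 'I_n (nbhs x) (nbhs_filter x)) => k'.
by apply: (cvg_mulr (nbhs_filter x)); [exact: cmB|exact: cmol].
Qed.

Lemma approx_field_continuous : continuous_on_closure O approx_field.
Proof.
move=> i j k'; apply: continuous_in_subspaceT => x; rewrite inE => cx.
apply: (@cvgB _ _ _ (nbhs x) (nbhs_filter x)); first exact: cmB.
apply: (@cvg_sumr R V 'I_k (nbhs x) (nbhs_filter x)) => l.
by apply: (cvg_mulr (nbhs_filter x)); [exact: cerr|exact: cinv].
Qed.

Lemma approx_field_sol l : classical_sol O approx_field (fun x i => mollify t (w l i) x).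
Proof.
move=> y Oy; have cy := subset_closure Oy; split=> [i|i j]; first exact: cmol.
have [_ _ _ wk] := gw l.
have := mollify_gradP de01 r0 hc cover (Lw l i) (Lg l i j) (wk i j) t1 Oy.
have -> // : - \sum_k' approx_field y i j k' * mollify t (w l k') y = mollify_grad t (w l i) (g l i j) j y.
have e1 : \sum_k' approx_field y i j k' * mollify t (w l k') y =
    \sum_k' avg_field i j k' y * mollify t (w l k') y - \sum_l' residual l' i j y * (left_inv (M y) *m (M y)^T) l' l.
  rewrite /approx_field; under eq_bigr do rewrite mulrBl; rewrite sumrB; congr (_ - _).
  under eq_bigr do rewrite mulr_suml; rewrite exchange_big/=; apply: eq_bigr => l' _.
  by rewrite mxE mulr_sumr; apply: eq_bigr => k' _; rewrite [(M y)^T k' l]mxE [M y l k']mxE mulrA.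
have e2 : \sum_l' residual l' i j y * (1%:M : 'M[R]_k) l' l = residual l i j y.
  rewrite (bigD1 l)//= big1 ?addr0 => [|l' ll']; first by rewrite mxE eqxx mulr1.
  by rewrite mxE (negbTE ll') mulr0.
by rewrite e1 (left_invE kap0 (fun c => lower_closure c cy)) e2 /residual opprB addrK.
Qed.

Lemma approx_field_indep x : O x -> forall c : 'I_k -> R, (forall i, \sum_l c l * mollify t (w l i) x = 0) -> forall l, c l = 0.
Proof.
move=> Ox c hc0; have := lower c Ox.
have -> : sqnorm (fun i => \sum_l c l * mollify t (w l i) x) = 0.
  by rewrite /sqnorm big1// => i _; rewrite hc0 expr0n.
by rewrite pmulr_rle0// => h1; exact: sqnorm_eq0.
Qed.

(** The three sources of error are the averaging of [B], the distance [tau] of the mollified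
    solutions from the solutions, and the averaging of the gradients. The second is multiplied by
    |B|, which is why that distance has to be uniform. *)
Definition err_field x : R := \sum_(q : 'I_n * 'I_d * 'I_n) `|avg_field q.1.1 q.1.2 q.2 x - extT O B q.1.1 q.1.2 q.2 x|.
Definition err_value x : R := tau * (D * \1_O x + tnorm1 (extT O B) x).
Definition err_grad x : R := \sum_(q : 'I_k * 'I_n * 'I_d * 'I_A)
  `|shift_avg q.2 t (g q.1.1.1 q.1.1.2 q.1.2) x - g q.1.1.1 q.1.1.2 q.1.2 x|.

Let X1_ge0 x : 0 <= err_field x. Proof. by apply: sumr_ge0 => q _; exact: normr_ge0. Qed.
Let X3_ge0 x : 0 <= err_grad x. Proof. by apply: sumr_ge0 => q _; exact: normr_ge0. Qed.

Let X1_sum i j x : \sum_k' `|avg_field i j k' x - extT O B i j k' x| <= err_field x.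
Proof.
rewrite /err_field -(pair_big xpredT xpredT (fun ij k' => `|avg_field ij.1 ij.2 k' x - extT O B ij.1 ij.2 k' x|))/=.
by rewrite [leRHS](bigD1 (i, j))//= lerDl; do 2 (apply: sumr_ge0 => ? _).
Qed.

Let X3_sum l i j x : \sum_a `|shift_avg a t (g l i j) x - g l i j x| <= err_grad x.
Proof.
rewrite /err_grad -(pair_big xpredT xpredT (fun q a => `|shift_avg a t (g q.1.1 q.1.2 q.2) x - g q.1.1 q.1.2 q.2 x|))/=.
by rewrite [leRHS](bigD1 (l, i, j))//= lerDl; do 2 (apply: sumr_ge0 => ? _).
Qed.

Let D0 x (Ox : O x) j : 0 <= D.
Proof. by apply: le_trans (hD j Ox); apply: sumr_ge0 => a _; exact: normr_ge0. Qed.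

Let err_le l i j x : O x -> `|residual l i j x| <= err_value x + err_grad x + S * err_field x.
Proof.
move=> Ox; have cx := subset_closure Ox.
(* The equation g = - B w is inserted, so that every term contains a difference that tends to 0. *)
have -> : residual l i j x = (mollify_grad t (w l i) (g l i j) j x - g l i j x) +
   \sum_k' ((avg_field i j k' x - extT O B i j k' x) * mollify t (w l k') x + extT O B i j k' x * (mollify t (w l k') x - w l k' x)).
  have -> : \sum_k' ((avg_field i j k' x - extT O B i j k' x) * mollify t (w l k') x + extT O B i j k' x * (mollify t (w l k') x - w l k' x))
      = \sum_k' avg_field i j k' x * mollify t (w l k') x + g l i j x.
    by rewrite /g /grad_rhs -sumrN -big_split/=; apply: eq_bigr => k' _; ring.
  by rewrite /residual; ring.
apply: le_trans (ler_normD _ _) _.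
have h1 := mollify_grad_dist r0 cover (g l i j) j Ox tau0 (fun a xa => @shift_avg_dist l i a x Ox xa).
have h2 : `|\sum_k' ((avg_field i j k' x - extT O B i j k' x) * mollify t (w l k') x + extT O B i j k' x * (mollify t (w l k') x - w l k' x))|
    <= S * err_field x + tau * tnorm1 (extT O B) x.
  apply: (@le_trans _ _ (\sum_k' (S * `|avg_field i j k' x - extT O B i j k' x| + tau * `|extT O B i j k' x|))).
    apply: le_trans (ler_norm_sum _ _ _) _; apply: ler_sum => k' _.
    apply: le_trans (ler_normD _ _) _; rewrite !normrM; apply: lerD.
      by rewrite mulrC; apply: ler_wpM2r => //; exact: (mollify_bounded v de01 r0 cover cx (Lw l k') tp (wS l k')).
    rewrite mulrC; apply: ler_wpM2r => //.
    exact: (mollify_dist r0 cover Ox tau0 (fun a xa => @shift_avg_dist l k' a x Ox xa)).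
  rewrite big_split/= -[X in X + _]mulr_sumr -[X in _ + X]mulr_sumr; apply: lerD.
    by apply: ler_wpM2l => //; exact: (X1_sum i j x).
  apply: ler_wpM2l => //; apply: le_trans (tnorm1_ge_slice _ j x); rewrite [leRHS](bigD1 i)//= lerDl.
  by do 2 (apply: sumr_ge0 => ? _).
have h3 : tau * \sum_a `|dpart_unity z r a j x| <= tau * D by apply: ler_wpM2l => //; exact: hD.
have h4 := X3_sum l i j x.
rewrite /err_value indicE (mem_set Ox) mulr1 mulrDr.
apply: le_trans (lerD h1 h2) _; apply: le_trans (lerD (lerD h3 h4) (lexx _)) _.
by rewrite le_eqVlt; apply/orP; left; apply/eqP; ring.
Qed.

Definition err_cst : R := 1 + (1 + kap^-1) * (k%:R * (1 + S)).

Lemma approx_field_dist i j k' x : O x -> `|B x i j k' - approx_field x i j k'| <= err_cst * (err_field x + err_value x + err_grad x).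
Proof.
move=> Ox; have cx := subset_closure Ox.
have X20 : 0 <= err_value x by rewrite mulr_ge0// addr_ge0 ?tnorm1_ge0// mulr_ge0 ?(D0 Ox j)// indicE.
have K0 : 0 <= 1 + kap^-1 by rewrite addr_ge0// invr_ge0 ltW.
have -> : B x i j k' - approx_field x i j k' = - (avg_field i j k' x - extT O B i j k' x) + \sum_l residual l i j x * left_inv (M x) l k'.
  by rewrite /approx_field /extT ext_in// !opprB addrA addrAC.
apply: le_trans (ler_normD _ _) _; rewrite normrN.
have h1 : `|avg_field i j k' x - extT O B i j k' x| <= err_field x.
  by apply: le_trans (X1_sum i j x); rewrite [leRHS](bigD1 k')//= lerDl; apply: sumr_ge0 => ? _.
have h2 : `|\sum_l residual l i j x * left_inv (M x) l k'| <= (1 + kap^-1) * (k%:R * ((1 + S) * (err_field x + err_value x + err_grad x))).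
  apply: le_trans (ler_norm_sum _ _ _) _.
  rewrite mulrCA -[k in k%:R]card_ord mulr_natl -sumr_const; apply: ler_sum => l _.
  rewrite normrM mulrC; apply: ler_pM => //.
    exact: (left_inv_bound kap0 (fun c => lower_closure c cx)).
  apply: le_trans (err_le l i j Ox) _; rewrite mulrDl mul1r.
  have := X1_ge0 x; have := X3_ge0 x; have := mulr_ge0 S0 X20; have := mulr_ge0 S0 (X3_ge0 x).
  rewrite !mulrDr; move: (S * err_field x) (S * err_value x) (S * err_grad x) (err_field x) (err_value x) (err_grad x) => *; lra.
rewrite /err_cst mulrDl mul1r; apply: lerD.
  by apply: le_trans h1 _; rewrite -addrA lerDl addr_ge0.
by apply: le_trans h2 _; rewrite -!mulrA.
Qed.

End approx.

Lemma common_lower_bound (R : realType) (I : finType) (r : I -> R) : (forall i, 0 < r i) ->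
  exists2 m : R, 0 < m & forall i, m <= r i.
Proof.
move=> r0; pose s := \sum_i (r i)^-1 + 1.
have s1 : 0 <= \sum_i (r i)^-1 by apply: sumr_ge0 => i _; rewrite invr_ge0 ltW.
have s0 : 0 < s by rewrite ltr_wpDl.
exists s^-1; first by rewrite invr_gt0.
move=> i; rewrite -[leRHS]invrK lef_pV2 ?posrE ?invr_gt0//.
rewrite /s (bigD1 i)//= -addrA lerDl addr_ge0//.
by apply: sumr_ge0 => j _; rewrite invr_ge0 ltW.
Qed.

Section sum_Lp.
Variables (R : realType) (d : nat).
Local Notation V := 'rV[R]_d.
Local Notation mu := (leb R d).

Lemma sum_Lp (I : finType) (F : I -> V -> R) (p e : R) : 0 < p -> (forall q, measurable_fun setT (F q)) ->
  (forall q, L1 mu (fun x => `|F q x| `^ p) /\ \int[mu]_x (`|F q x| `^ p) <= e) ->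
  L1 mu (fun x => (\sum_q `|F q x|) `^ p) /\
  \int[mu]_x ((\sum_q `|F q x|) `^ p) <= #|I|%:R `^ p * (#|I|%:R * e).
Proof.
move=> p0 mF hF.
have Ls : L1 mu (fun x => \sum_q `|F q x| `^ p) by apply: L1_sum => q; have [] := hF q.
have LZ := L1Z (#|I|%:R `^ p) Ls.
have le x : (\sum_q `|F q x|) `^ p <= #|I|%:R `^ p * \sum_q `|F q x| `^ p by exact: powR_sum_le.
have LX : L1 mu (fun x => (\sum_q `|F q x|) `^ p).
  apply: (L1_le _ _ LZ) => [|x]; last by rewrite ger0_norm ?powR_ge0.
  by apply: measurable_powRl; apply: measurable_sum => q; exact: measurableT_comp.
split=> //; apply: le_trans (Int_le LX LZ le) _; rewrite (IntZ _ Ls); apply: ler_wpM2l; first exact: powR_ge0.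
rewrite Int_sum => [|q]; last by have [] := hF q.
by rewrite mulr_natl -sumr_const; apply: ler_sum => q _; have [] := hF q.
Qed.

End sum_Lp.

Section converse.
Variables (R : realType) (d n : nat).
Local Notation V := 'rV[R]_d.
Local Notation mu := (leb R d).
Variables (O : set V) (p : R) (B : tfield R d n).
Hypothesis d2 : (2 <= d)%N.
Hypothesis oO : open O.
Hypothesis cO : connected O.
Hypothesis nO : O !=set0.
Hypothesis bO : bounded_set_V O.
Hypothesis sO : smooth_boundary O.
Hypothesis dp : d%:R < p.
Hypothesis hB : in_Lp O p B.
Local Notation al := (1 - d%:R / p).

Let p2 : 2 <= p := p_ge2 d2 dp.
Let p1 : 1 <= p := p_ge1 d2 dp.
Let p0 : 0 < p. Proof. exact: lt_le_trans p1. Qed.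
Let mBx : forall i j k, measurable_fun setT (extT O B i j k). Proof. by have [] := in_Lp_L1 oO p2 hB. Qed.
Let LB : forall i j k, L1 mu (extT O B i j k).
Proof. by have [m L] := in_Lp_L1 oO p2 hB; have [] := tnormE_Lp oO bO p2 m L. Qed.
Let LbB : L1 mu (fun x => tnorm1 (extT O B) x `^ p).
Proof. by have [m L] := in_Lp_L1 oO p2 hB; have [] := tnormE_Lp oO bO p2 m L. Qed.

Let extT_Lp i j k' : L1 mu (fun x => `|extT O B i j k' x| `^ p).
Proof.
apply: (L1_le _ _ LbB) => [|x]; first by apply: measurable_powRl; exact: measurableT_comp.
rewrite ger0_norm ?powR_ge0//; apply: ge0_ler_powR; rewrite ?nnegrE ?tnorm1_ge0 ?(ltW p0)//.
exact: tnorm1_ge.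
Qed.

Let gr_Lp (u : 'I_n -> V -> R) S i j : weak_sol O (extT O B) u -> 0 <= S -> (forall i x, `|u i x| <= S) ->
  L1 mu (fun x => `|grad_rhs (extT O B) u i j x| `^ p).
Proof.
move=> [_ _ Lg _] S0 uS; have LS := L1Z (S `^ p) LbB.
apply: (L1_le _ _ LS) => [|x].
  by apply: measurable_powRl; apply: measurableT_comp => //; exact: L1_meas (Lg i j).
rewrite ger0_norm ?powR_ge0// -powRM ?tnorm1_ge0//.
apply: ge0_ler_powR; rewrite ?nnegrE ?mulr_ge0 ?tnorm1_ge0 ?(ltW p0)//.
rewrite /grad_rhs normrN; apply: le_trans (ler_norm_sum _ _ _) _.
apply: (@le_trans _ _ (S * \sum_k `|extT O B i j k x|)).
  by rewrite mulr_sumr; apply: ler_sum => k _; rewrite normrM mulrC; apply: ler_wpM2r.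
apply: ler_wpM2l => //; apply: le_trans (tnorm1_ge_slice _ j x); rewrite [leRHS](bigD1 i)//= lerDl.
by do 2 (apply: sumr_ge0 => ? _).
Qed.

Lemma kernel_at_least k (f : 'I_k -> V -> 'I_n -> R) : (forall l, inN O B (f l)) -> L2_indep O f ->
  at_least_conservative O p B k.
Proof.
move=> hf indep eps eps0; have [x0 Ox0] := nO.
have [w [E [S [C [gw [E0 S0 C0] wS wC wE]]]]] := kernel_frame d2 oO cO nO bO sO dp hB Ox0 hf indep.
have [s [de [t0 [de01 t01 hs cov]]]] := cone_cover oO sO bO.
pose A := size s; pose ch (a : 'I_A) := tnth (in_tuple s) a.
pose z a := (ch a).1.1; pose r a := (ch a).1.2; pose v a := (ch a).2.
have ins a : ch a \in s by exact: mem_tnth.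
have r0 a : 0 < r a by have [] := hs _ (ins a).
have v1 a : `|v a| <= 1 by have [] := hs _ (ins a).
have hc a : cone O (z a) (r a) (v a) de t0 by have [] := hs _ (ins a).
have cover x : closure O x -> exists a, `|x - z a| < r a / 2.
  move=> /cov [q qs xq]; have /(tnthP (in_tuple s)) [a qa] : q \in in_tuple s by [].
  by exists a; rewrite /z /r /ch -qa.
have /andP[al0 al1] := al_in01 d2 dp.
have [Kc Kc0 hKc] := charts_holder oO al0 de01 t01 v1 hc.
have [D D0 hD] := dpart_unity_bounded r0 cover bO.
(* The part of the lower bound that survives in [sqnorm_perturb] when the frame is mollified. *)
pose kap : R := (4 * E)^-1; have kap0 : 0 < kap by rewrite invr_gt0 mulr_gt0.
pose I1 : finType := ('I_n * 'I_d * 'I_n)%type; pose I3 : finType := ('I_k * 'I_n * 'I_d * 'I_A)%type.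
pose N1 : R := #|I1|%:R `^ p * #|I1|%:R; pose N3 : R := #|I3|%:R `^ p * #|I3|%:R.
have N10 : 0 <= N1 by rewrite mulr_ge0 ?powR_ge0.
have N30 : 0 <= N3 by rewrite mulr_ge0 ?powR_ge0.
pose Y x := (D * \1_O x + tnorm1 (extT O B) x) `^ p.
have Db0 x : 0 <= D * \1_O x + tnorm1 (extT O B) x by rewrite addr_ge0 ?tnorm1_ge0// mulr_ge0// indicE.
have LY : L1 mu Y.
  have LD := L1Z (3 `^ p) (L1D (L1Z (D `^ p) (L1_O oO bO)) LbB).
  have mY : measurable_fun setT (fun x => D * \1_O x + tnorm1 (extT O B) x).
    apply: measurable_funD; first exact: L1_meas (L1Z D (L1_O oO bO)).
    by do 3 (apply: measurable_sum => ?); exact: measurableT_comp.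
  apply: (L1_le _ _ LD) => [|x]; first exact: measurable_powRl.
  have D1 : 0 <= D * \1_O x by rewrite mulr_ge0// indicE.
  rewrite ger0_norm ?powR_ge0//; have := powR_add3 (ltW p0) D1 (tnorm1_ge0 (extT O B) x) (lexx 0).
  rewrite addr0 powR0 ?gt_eqF// addr0 => h; apply: le_trans h _; apply: ler_wpM2l; first exact: powR_ge0.
  rewrite lerD2r indicE; case: (x \in O) => /=; first by rewrite !mulr1.
  by rewrite !mulr0 powR0 ?gt_eqF.
pose J2 := \int[mu]_x Y x; have J20 : 0 <= J2 by apply: Int_ge0 => x; exact: powR_ge0.
pose Cd : R := tnorm_cst R d n * err_cst k S kap.
have Cd0 : 0 <= Cd.
  rewrite mulr_ge0//; first by rewrite /tnorm_cst !mulr_ge0.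
  apply: addr_ge0 => //; apply: mulr_ge0; first by rewrite addr_ge0// invr_ge0 ltW.
  by apply: mulr_ge0 => //; exact: addr_ge0.
pose Q := Cd `^ p * (3 `^ p * (N1 + J2 + N3)).
have Q0 : 0 <= Q by rewrite !mulr_ge0 ?powR_ge0// !addr_ge0.
(* Each elementary error will be at most [e1] in p-th power, and [Q] collects their factors; Q e1 <
   eps^p. *)
pose e1 := eps `^ p / (Q + 1); have e10 : 0 < e1 by rewrite divr_gt0 ?powR_gt0// ltr_wpDl.
pose nk : R := n%:R * k%:R ^+ 2; have nk0 : 0 <= nk by rewrite mulr_ge0 ?sqr_ge0.
(* The first two bounds are those of [sqnorm_perturb], which keeps the mollified frame
   non-degenerate; the third gives tau^p <= e1 for [err_value]. *)
pose tau := Num.min 1 (Num.min (kap / (nk + 1)) (e1 `^ p^-1)).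
have tau0 : 0 < tau by rewrite !lt_min ltr01 divr_gt0 ?powR_gt0// ltr_wpDl.
have tau1 : tau <= 1 by rewrite ge_min lexx.
have tauk : nk * tau <= kap.
  have : tau <= kap / (nk + 1) by rewrite /tau !ge_min lexx orbT.
  rewrite ler_pdivlMr ?ltr_wpDl// mulrDr mulr1 mulrC => h; apply: le_trans h.
  by rewrite lerDl ltW.
have taup : tau `^ p <= e1.
  have -> : e1 = (e1 `^ p^-1) `^ p by rewrite -powRrM mulVf ?gt_eqF// powRr1// ltW.
  apply: ge0_ler_powR; rewrite ?nnegrE ?powR_ge0 ?(ltW p0) ?(ltW tau0)//.
  by rewrite /tau !ge_min lexx !orbT.
pose g (l : 'I_k) i j := grad_rhs (extT O B) (w l) i j.
have Lg l i j : L1 mu (g l i j) by have [_ _ h _] := gw l; exact: h.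
have Lw l i : L1 mu (w l i) by have [h _ _ _] := gw l; exact: h.
have rad (F : V -> R) : L1 mu F -> L1 mu (fun x => `|F x| `^ p) -> exists r : R, 0 < r /\
    forall (h : R) (v : V), 0 < h -> `|v| + h < r ->
    L1 mu (fun x => `|wavg F (kern h) (x + v) - F x| `^ p) /\
    \int[mu]_x (`|wavg F (kern h) (x + v) - F x| `^ p) <= e1.
  move=> L1F LpF; have [q q0 hq] := wavg_cvg_Lp p1 L1F LpF e10.
  exists q; split=> // h u h0 uh; have [h1 h2] := hq _ _ _ u (kern_kernel d h0) uh.
  by split => //; exact: ltW.
have rad0 (F : V -> R) : L1 mu F -> L1 mu (fun x => `|F x| `^ p) -> exists r : R, 0 < r /\
    forall h : R, 0 < h -> h < r ->
    L1 mu (fun x => `|wavg F (kern h) x - F x| `^ p) /\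
    \int[mu]_x (`|wavg F (kern h) x - F x| `^ p) <= e1.
  move=> L1F LpF; have [q [q0 hq]] := rad F L1F LpF; exists q; split=> // h h0 hq1.
  have := hq h 0 h0; rewrite normr0 add0r => /(_ hq1).
  by under eq_fun do rewrite addr0.
have /choice [r1 hr1] := fun q : I1 => rad0 _ (LB q.1.1 q.1.2 q.2) (extT_Lp q.1.1 q.1.2 q.2).
have /choice [r3 hr3] := fun q : I3 =>
  rad _ (Lg q.1.1.1 q.1.1.2 q.1.2) (gr_Lp q.1.1.2 q.1.2 (gw q.1.1.1) S0 (wS q.1.1.1)).
have [m1 m10 hm1] := common_lower_bound (fun q => (hr1 q).1).
have [m3 m30 hm3] := common_lower_bound (fun q => (hr3 q).1).
have /andP[t00 t0le] := t01; have /andP[de0 de1] := de01.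
(* For t <= T2 the Hoelder error Kc C t^al of the shifted averages is at most [tau]. *)
pose T2 := (tau / (Kc * C + 1)) `^ al^-1.
have KC0 : 0 < Kc * C + 1 by rewrite ltr_wpDl// mulr_ge0.
have T20 : 0 < T2 by rewrite powR_gt0// divr_gt0.
(* The same [t] is the size of the shift and the radius at which [B] is averaged. The halves leave
   room for |t v| + de t / 8, which is at most 9/8 t. *)
pose t := Num.min (Num.min t0 T2) (Num.min (m1 / 2) (m3 / 2)).
have tp : 0 < t by rewrite !lt_min t00 T20 !divr_gt0.
have tt0 : t <= t0 by rewrite !ge_min lexx.
have t1 : 0 < t <= t0 by rewrite tp.
have tT2 : t <= T2 by rewrite !ge_min lexx !orbT.
have tm1 : t <= m1 / 2 by rewrite !ge_min lexx !orbT.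
have tm3 : t <= m3 / 2 by rewrite !ge_min lexx !orbT.
have shkd l i a x : O x -> `|x - z a| < r a -> `|shift_avg v de a t (w l i) x - w l i x| <= tau.
  move=> Ox xa; apply: le_trans (hKc C (w l i) C0 (wC l i) (Lw l i) a t x Ox xa t1) _.
  have h : t `^ al <= tau / (Kc * C + 1).
    have -> : tau / (Kc * C + 1) = T2 `^ al.
      by rewrite -powRrM mulVf ?gt_eqF// powRr1// divr_ge0 ?ltW.
    by apply: ge0_ler_powR; rewrite ?nnegrE ?(ltW al0) ?(ltW tp) ?(ltW T20).
  apply: le_trans (ler_wpM2l _ h) _; first by rewrite mulr_ge0.
  by rewrite mulrCA ler_piMr ?(ltW tau0)// ler_pdivrMr// mul1r lerDl.
have lower x (c : 'I_k -> R) : O x -> kap * sqnorm c <= sqnorm (fun i => \sum_l c l * mollify z r v de t (w l i) x).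
  move=> Ox; apply: (@sqnorm_perturb R k n (fun l i => w l i x) _ E tau) => //.
  - by rewrite ltW.
  - by move=> l i; apply: (mollify_dist r0 cover Ox (ltW tau0)) => a; exact: shkd.
  - exact: wE.
pose Be := approx_field O B z r v de w t t.
have cB : continuous_on_closure O Be.
  by move=> i j k'; exact: (approx_field_continuous de01 r0 cover LB gw t1 tp kap0 lower).
have gs l : classical_sol O Be (fun x i => mollify z r v de t (w l i) x).
  by move=> y Oy; exact: (approx_field_sol de01 r0 hc cover t gw t1 kap0 lower l Oy).
exists Be; split; first exact: cB.
split.
  have iv : vec_indep (Eset O Be x0) (fun l => \row_i mollify z r v de t (w l i) x0).
    apply: (@classical_sol_indep_Eset _ _ _ O Be oO (cB'_in oO cB) k x0 (fun l x i => mollify z r v de t (w l i) x)) => // c h.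
    exact: (approx_field_indep kap0 lower Ox0 h).
  have [k' [kk' ck]] := Eset_dim_const oO cO (cB'_in oO cB) Ox0 iv.
  by exists k'.
have mBe := measurable_extT oO cB.
pose Dd : tfield R d n := fun x i j k' => B x i j k' - Be x i j k'.
have [mD] := Lp_dist_ltP p2 eps mBx mBe; rewrite -/Dd => -[_]; apply.
pose X x := err_field O B t x + err_value O B tau D x + err_grad O B v de w t x.
have X10 x : 0 <= err_field O B t x by apply: sumr_ge0.
have X20 x : 0 <= err_value O B tau D x by rewrite mulr_ge0// ltW.
have X30 x : 0 <= err_grad O B v de w t x by apply: sumr_ge0.
have [L1X I1X] : L1 mu (fun x => err_field O B t x `^ p) /\ \int[mu]_x (err_field O B t x `^ p) <= N1 * e1.
  rewrite /N1 -mulrA.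
  have H := @sum_Lp R d I1 (fun q x => avg_field O B t q.1.1 q.1.2 q.2 x - extT O B q.1.1 q.1.2 q.2 x) p e1 p0.
  apply: H => q.
    apply: measurable_funB => //; apply: continuous_measurable_rV => x.
    exact: (wavg_continuous (LB _ _ _) (kern_kernel d tp)).
  have tq : t < r1 q by have := hm1 q; move: tm1 m10; move: (r1 q) => a b c e; lra.
  exact: ((hr1 q).2 t tp tq).
have [L3X I3X] : L1 mu (fun x => err_grad O B v de w t x `^ p) /\ \int[mu]_x (err_grad O B v de w t x `^ p) <= N3 * e1.
  rewrite /N3 -mulrA.
  have H := @sum_Lp R d I3 (fun q x => shift_avg v de q.2 t (g q.1.1.1 q.1.1.2 q.1.2) x - g q.1.1.1 q.1.1.2 q.1.2 x) p e1 p0.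
  apply: H => q.
    apply: measurable_funB; last exact: L1_meas (Lg _ _ _).
    by apply: continuous_measurable_rV; exact: shift_avg_continuous.
  have et : 0 < de * t / 8 by rewrite divr_gt0// mulr_gt0.
  have [_ /(_ _ (t *: v q.2) et)] := hr3 q; apply.
    have h1 : `|t *: v q.2| <= t by rewrite normrZ gtr0_norm// ler_piMr// ltW.
    have h2 : de * t <= t by rewrite ler_piMl// ltW.
    have := hm3 q; move: h1 h2 tm3 m30 tp; move: `|t *: _| (de * t) (r3 q) => a b c; lra.
have e2 : (fun x => err_value O B tau D x `^ p) = fun x => tau `^ p * Y x.
  by apply/funext => x; rewrite /err_value powRM// ltW.
have L2X : L1 mu (fun x => err_value O B tau D x `^ p) by rewrite e2; exact: L1Z.
have I2X : \int[mu]_x (err_value O B tau D x `^ p) <= J2 * e1.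
  by rewrite e2 (IntZ _ LY) mulrC; apply: ler_wpM2l.
have NEX x : tnormE O Dd x <= Cd * X x.
  have X0 : 0 <= X x by rewrite !addr_ge0.
  have [Ox|nOx] := pselect (O x); last by rewrite tnormE_out// mulr_ge0.
  apply: le_trans (tnormE_le_tnorm1 O Dd x) _.
  have hm (m : nat) (F : 'I_m -> R) c : (forall i, F i <= c) -> \sum_i F i <= m%:R * c.
    by move=> h; rewrite -[m in m%:R]card_ord mulr_natl -sumr_const; apply: ler_sum.
  rewrite /Cd /tnorm_cst -!mulrA; apply: (hm) => i; apply: (hm) => j; apply: (hm) => k'.
  rewrite /extT ext_in//.
  exact: (approx_field_dist de01 r0 cover t gw wS S0 t1 kap0 (ltW tau0) shkd lower hD i j k' Ox).
have NEp x : tnormE O Dd x `^ p <= Cd `^ p * (3 `^ p * (err_field O B t x `^ p + err_value O B tau D x `^ p + err_grad O B v de w t x `^ p)).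
  have X0 : 0 <= X x by rewrite !addr_ge0.
  apply: (@le_trans _ _ ((Cd * X x) `^ p)).
    have NE0 : 0 <= tnormE O Dd x by exact: sqrtr_ge0.
    have CX0 : 0 <= Cd * X x by exact: mulr_ge0.
    by apply: (ge0_ler_powR (ltW p0) _ _ (NEX x)); rewrite nnegrE.
  rewrite powRM//; apply: ler_wpM2l; first exact: powR_ge0.
  by apply: powR_add3 => //; exact: ltW.
have LS := L1D (L1D L1X L2X) L3X.
have LS2 := L1Z (Cd `^ p) (L1Z (3 `^ p) LS).
have LN : L1 mu (fun x => tnormE O Dd x `^ p).
  apply: (L1_le _ _ LS2) => [|x]; last by rewrite ger0_norm ?powR_ge0.
  by apply: measurable_powRl; exact: measurable_tnormE.
split=> //; apply: le_lt_trans (Int_le LN LS2 NEp) _.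
rewrite (IntZ _ (L1Z (3 `^ p) LS)) (IntZ _ LS) (IntD (L1D L1X L2X) L3X) (IntD L1X L2X).
apply: (@le_lt_trans _ _ (Q * e1)).
  rewrite /Q -!mulrA; do 2 (apply: ler_wpM2l; first exact: powR_ge0).
  by rewrite !mulrDl; apply: lerD => //; apply: lerD.
have eQ : eps `^ p = (Q + 1) * e1 by rewrite /e1 mulrCA divff ?mulr1// gt_eqF// ltr_wpDl.
by rewrite eQ mulrDl mul1r ltrDl.
Qed.

End converse.

Theorem theorem4p2 (R : realType) (d n : nat) (O : set 'rV[R]_d) (p : R)
    (B : tfield R d n) (k : nat) :
  (2 <= d)%N ->
  open O -> connected O -> O !=set0 -> bounded_set_V O -> smooth_boundary O ->
  d%:R < p -> in_Lp O p B ->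
  (k <= n)%N ->
  (dimN_eq O B k <-> conservative O p B k).
Proof.
move=> d2 oO cO nO bO sO dp hB _.
have E m : (exists f : 'I_m -> 'rV[R]_d -> 'I_n -> R, (forall l, inN O B (f l)) /\ L2_indep O f) <->
    at_least_conservative O p B m.
  split; last exact: at_least_kernel.
  by move=> [f [hf fi]]; exact: (kernel_at_least d2 oO cO nO bO sO dp hB hf fi).
by rewrite /dimN_eq /conservative !E.
Qed.
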